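(* Let $h\in\mathbb{N}=\{1,2,3,\dots\}$. Then for every real $s>h-\frac12$, $$\mathbb{E}\left[\mathsf{X}(s)^{2h}\right]=\frac{1}{(2h)!}\sum_{k=1}^{2h}(-1)^{2h-k}\binom{2h}{k}\,\mathbb{E}_k^{(s)}\left[\left(\mathsf{x}_1^{(k)}+\dots+\mathsf{x}_k^{(k)}\right)^{2h}\right].$$ Moreover, for every $N\ge1$ the function $$s\mapsto \mathbb{E}_N^{(s)}\left[\left(\mathsf{x}_1^{(N)}+\dots+\mathsf{x}_N^{(N)}\right)^{2h}\right],\qquad s>h-\tfrac12,$$ is a rational function of $s$. Here $\mathsf{X}(s)$ is the principal-value sum of the points of the determinantal point process $\mathsf{C}^{(s)}$, and $\mathbb{E}_N^{(s)}$ is expectation when $(\mathsf{x}_1^{(N)},\dots,\mathsf{x}_N^{(N)})$ has the Hua-Pickrell law $\mathsf{M}_N^{(s)}$ (both defined in the context).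
   Context: Hua-Pickrell measures. For $N\ge1$, $s>-\frac12$, let $\mathbb{W}_N=\{\mathbf{x}\in\mathbb{R}^N:x_1\ge\cdots\ge x_N\}$ and let $\mathsf{M}_N^{(s)}$ be the probability measure on $\mathbb{W}_N$ $$\mathsf{M}_N^{(s)}(d\mathbf x)=\frac{1}{\mathsf{c}_N^{(s)}}\prod_{j=1}^N\frac{1}{(1+x_j^2)^{N+s}}\prod_{1\le i<j\le N}(x_j-x_i)^2\,dx_1\cdots dx_N,$$ with normalization constant $\mathsf{c}_N^{(s)}=(2\pi)^N2^{-N^2-2sN}G(N+1)\prod_{j=1}^N\frac{\Gamma(2s+N-j+1)}{\Gamma(s+N-j+1)^2}$, where $G$ is the Barnes $G$-function. $\mathbb{E}_N^{(s)}$ denotes expectation with respect to $\mathsf{M}_N^{(s)}$, and $(\mathsf{x}_1^{(N)},\dots,\mathsf{x}_N^{(N)})$ denotes a random vector with this law. The random variable $\mathsf{X}(s)$. Let $s>-\frac12$ and $\mathbb{R}^*=\mathbb{R}\setminus\{0\}$. $\mathsf{C}^{(s)}$ is the determinantal point process on $\mathbb{R}^*$ (with respect to Lebesgue measure) with correlation kernel $$\mathsf{K}^{(s)}(x,y)=\frac{1}{2\pi}\frac{\Gamma(s+1)^2}{\Gamma(2s+1)\Gamma(2s+2)}\,\frac{P^{(s)}(x)Q^{(s)}(y)-P^{(s)}(y)Q^{(s)}(x)}{x-y}$$ (extended to $x=y$ by continuity), where $P^{(s)}(x)=2^{2s-\frac12}\Gamma(s+\tfrac12)|x|^{-\frac12}J_{s-\frac12}(1/|x|)$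 and $Q^{(s)}(x)=\mathrm{sgn}(x)\,2^{2s+\frac32}\Gamma(s+\tfrac32)|x|^{-\frac12}J_{s+\frac12}(1/|x|)$, with $J$ the Bessel function of the first kind. That is, for all $l\ge1$ and bounded compactly supported Borel $F$ on $(\mathbb{R}^* )^l$, $\mathbb{E}\big[\sum F(x_{i_1},\dots,x_{i_l})\big]=\int_{(\mathbb{R}^* )^l}F(z_1,\dots,z_l)\det[\mathsf{K}^{(s)}(z_i,z_j)]_{i,j=1}^l\,dz_1\cdots dz_l$, the sum being over $l$-tuples of pairwise distinct points of $\mathsf{C}^{(s)}$. Denote the points of $\mathsf{C}^{(s)}$ by $-\alpha_1^-<-\alpha_2^-<\cdots<0$ and $\alpha_1^+>\alpha_2^+>\cdots>0$. Then $$\mathsf{X}(s)=\lim_{m\to\infty}\Big[\sum_{i\ge1}\alpha_i^+\mathbf 1(\alpha_i^+>m^{-2})-\sum_{i\ge1}\alpha_i^-\mathbf 1(\alpha_i^->m^{-2})\Big],$$ a limit which is known to be well defined (Qiu). *)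

(* Defs.v *)
From HB Require Import structures.
From mathcomp Require Import all_boot all_order all_algebra.
From mathcomp Require Import all_classical all_reals all_analysis.
From mathcomp Require Import measurable_realfun.

Set Implicit Arguments.
Unset Strict Implicit.
Unset Printing Implicit Defensive.
Import Order.TTheory GRing.Theory Num.Theory.
Import numFieldNormedType.Exports.
Local Open Scope classical_set_scope.
Local Open Scope ring_scope.

Section LebesgueTuple.
Context {R : realType}.

Definition cons_prod n (p : R * n.-tuple R) : n.+1.-tuple R :=
  [tuple of p.1 :: p.2].

Lemma measurable_cons_prod n : measurable_fun setT (@cons_prod n).
Proof. exact: measurable_cons. Qed.

Section ConsMeasure.
Context n (mu : {sigma_finite_measure set (n.-tuple R) -> \bar R}).

Definition cons_measure : set (n.+1.-tuple R) -> \bar R :=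
  pushforward (lebesgue_measure \x mu)%E (@cons_prod n).

HB.instance Definition _ := Measure.copy cons_measure
  (measure_function_pushforward__canonical__measure_function_Measure
     (lebesgue_measure \x mu)%E (@measurable_cons_prod n)).

Let cons_measure_sigma_finite : sigma_finite setT cons_measure.
Proof.
have /sigma_finiteP[F [TF ndF Foo]] := sigma_finiteT (@lebesgue_measure R).
have /sigma_finiteP[G [TG ndG Goo]] := sigma_finiteT mu.
pose g (t : n.+1.-tuple R) : R * n.-tuple R := (thead t, [tuple of behead t]).
have gK : cancel (@cons_prod n) g.
  by move=> [x t]; rewrite /g /cons_prod /thead; congr pair; exact: val_inj.
have mg : measurable_fun setT g.
  apply: measurable_fun_pair; first exact: measurable_tnth.
  exact: measurable_behead.
exists (fun k => g @^-1` (F k `*` G k)).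
  apply/esym; rewrite -subTset => t _.
  have [i _ Fi] : (\bigcup_k F k) (g t).1 by rewrite -TF.
  have [j _ Gj] : (\bigcup_k G k) (g t).2 by rewrite -TG.
  exists (maxn i j) => //; split => /=.
    by move: Fi; apply/subsetPset/ndF/leq_maxl.
  by move: Gj; apply/subsetPset/ndG/leq_maxr.
move=> k; have [mFk Fkoo] := Foo k; have [mGk Gkoo] := Goo k; split.
  by rewrite -[_ @^-1` _]setTI; apply: mg => //; exact: measurableX.
rewrite /cons_measure /pushforward -comp_preimage.
rewrite (_ : g \o @cons_prod n = idfun); last by apply/funext => x; exact: gK.
by rewrite preimage_id product_measure1E// lte_mul_pinfty// ge0_fin_numE.
Qed.

HB.instance Definition _ := Measure_isSigmaFinite.Build _ _ _ cons_measure
  cons_measure_sigma_finite.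

End ConsMeasure.

Fixpoint lebesgue_tuple n : {sigma_finite_measure set (n.-tuple R) -> \bar R} :=
  match n with
  | 0 => dirac [tuple]
  | m.+1 => cons_measure (lebesgue_tuple m)
  end.

End LebesgueTuple.

Section SpecialFunctions.
Context {R : realType}.

(* Euler's integral: the usual Gamma function for [0 < z], the only range in
   which it is evaluated below when [-1/2 < s]. *)
Definition Gamma (z : R) : R :=
  \int[lebesgue_measure]_(t in `]0, +oo[) (t `^ (z - 1) * expR (- t)).

(* The Barnes G-function at a positive integer, from [G 1 = 1] and
   [G (z + 1) = Gamma z * G z]. *)
Definition barnesG (n : nat) : R := \prod_(1 <= j < n) Gamma j%:R.

(* Bessel function of the first kind, for [-1 < nu] and [0 < x]. *)
Definition besselJ (nu x : R) : R :=
  limn (series (fun m : nat =>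
    (-1) ^+ m / (m`!%:R * Gamma (m%:R + nu + 1)) * (x / 2) `^ (2 * m%:R + nu))).

End SpecialFunctions.

Section HuaPickrell.
Context {R : realType}.
Implicit Types (s : R) (N : nat).

Definition weyl_chamber N : set (N.-tuple R) :=
  [set x | forall i j : 'I_N, (i <= j)%N -> tnth x j <= tnth x i].
Arguments weyl_chamber : clear implicits.

(* With this constant [hua_pickrell s N] has total mass [1] when [1 <= N] and
   [-1/2 < s]; for other [s] it is merely some measure. *)
Definition hua_pickrell_const s N : R :=
  (2 * pi) ^+ N * 2 `^ (- (N%:R ^+ 2) - 2 * s * N%:R) * barnesG N.+1 *
  \prod_(1 <= j < N.+1)
    (Gamma (2 * s + N%:R - j%:R + 1) / Gamma (s + N%:R - j%:R + 1) ^+ 2).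

Definition hua_pickrell_pdf s N (x : N.-tuple R) : R :=
  (hua_pickrell_const s N)^-1 *
  \prod_(j < N) ((1 + tnth x j ^+ 2) `^ (N%:R + s))^-1 *
  \prod_(i < N) \prod_(j < N | (i < j)%N) (tnth x j - tnth x i) ^+ 2.

Definition hua_pickrell s N (A : set (N.-tuple R)) : \bar R :=
  (\int[lebesgue_tuple N]_(x in A `&` weyl_chamber N)
     (hua_pickrell_pdf s x)%:E)%E.

Lemma Gamma_ge0 (z : R) : 0 <= Gamma z.
Proof.
by apply: Rintegral_ge0 => t _; rewrite mulr_ge0 ?powR_ge0 ?expR_ge0.
Qed.

Lemma hua_pickrell_pdf_ge0 s N (x : N.-tuple R) : 0 <= hua_pickrell_pdf s x.
Proof.
rewrite /hua_pickrell_pdf !mulr_ge0//.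
- rewrite invr_ge0 /hua_pickrell_const !mulr_ge0 ?powR_ge0//.
  + by rewrite exprn_ge0// mulr_ge0// pi_ge0.
  + by rewrite prodr_ge0// => j _; exact: Gamma_ge0.
  + by rewrite prodr_ge0// => j _; rewrite divr_ge0 ?exprn_ge0 ?Gamma_ge0.
- by rewrite prodr_ge0// => j _; rewrite invr_ge0 powR_ge0.
- by rewrite prodr_ge0// => i _; rewrite prodr_ge0// => j _; exact: sqr_ge0.
Qed.

Lemma measurable_hua_pickrell_pdf s N :
  measurable_fun setT (@hua_pickrell_pdf s N).
Proof.
apply: measurable_funM; first apply: measurable_funM => //.
- apply: measurable_prod => j _.
  have -> : (fun x : N.-tuple R => ((1 + tnth x j ^+ 2) `^ (N%:R + s))^-1) =
      (fun y => y `^ (- (N%:R + s))) \o (fun x => 1 + tnth x j ^+ 2).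
    by apply/funext => x /=; rewrite powRN.
  apply: measurableT_comp; first exact: measurable_powR.
  apply: measurable_funD => //; apply: measurable_funX.
  exact: measurable_tnth.
- apply: measurable_prod => i _.
  under eq_fun do rewrite big_mkcond.
  apply: measurable_prod => j _; case: (i < j)%N => //.
  by apply: measurable_funX; apply: measurable_funB; exact: measurable_tnth.
Qed.

Lemma measurable_weyl_chamber N : measurable (weyl_chamber N).
Proof.
rewrite (_ : weyl_chamber N = \bigcap_(p in [set p : 'I_N * 'I_N |
    (p.1 <= p.2)%N]) [set x | tnth x p.2 <= tnth x p.1]).
  apply: fin_bigcap_measurable => // -[i j] _ /=.
  rewrite -[X in measurable X]setTI; apply: measurable_fun_ler => //;
    exact: measurable_tnth.
apply/seteqP; split => [x h [i j] /= ij|x h i j ij]; first exact: h.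
exact: (h (i, j)).
Qed.

Section HuaPickrellMeasure.
Context s N.

Let hua_pickrell0 : hua_pickrell s (set0 : set (N.-tuple R)) = 0%E.
Proof. by rewrite /hua_pickrell set0I integral_set0. Qed.

Let hua_pickrell_ge0 (A : set (N.-tuple R)) : (0 <= hua_pickrell s A)%E.
Proof.
by apply: integral_ge0 => x _; rewrite lee_fin hua_pickrell_pdf_ge0.
Qed.

Let hua_pickrell_sigma_additive : semi_sigma_additive (@hua_pickrell s N).
Proof.
move=> F mF tF mU; rewrite /hua_pickrell setI_bigcupl.
have mFW i : measurable (F i `&` weyl_chamber N).
  by apply: measurableI => //; exact: measurable_weyl_chamber.
apply: (@semi_sigma_additive_nng_induced _ _ _ (lebesgue_tuple N)
  (EFin \o @hua_pickrell_pdf s N)) => //.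
- by apply/measurable_EFinP; exact: measurable_hua_pickrell_pdf.
- by move=> x; rewrite lee_fin hua_pickrell_pdf_ge0.
- exact: trivIset_setIr.
- exact: bigcup_measurable.
Qed.

HB.instance Definition _ := isMeasure.Build _ _ _ (@hua_pickrell s N)
  hua_pickrell0 hua_pickrell_ge0 hua_pickrell_sigma_additive.

End HuaPickrellMeasure.

Definition hua_pickrell_expectation s N (f : N.-tuple R -> R) : \bar R :=
  (\int[@hua_pickrell s N]_x (f x)%:E)%E.

End HuaPickrell.

Section PointProcess.
Context {R : realType}.

Definition Rstar : set R := [set x | x != 0].

(* Simple configurations that are locally finite in [Rstar]; points may
   accumulate at [0]. *)
Definition configuration (A : set R) : Prop :=
  A `<=` Rstar /\
  forall K : set R, compact K -> K `<=` Rstar -> finite_set (A `&` K).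

Section Process.
Context {d : measure_display} {T : measurableType d} (P : probability T R).

Definition point_process (C : T -> set R) : Prop :=
  (forall w, configuration (C w)) /\
  (forall B : set R, measurable B ->
     measurable_fun setT (fun w => counting (C w `&` B) : \bar R)).

Definition distinct_points {l : nat} (A : set R) : set (l.-tuple R) :=
  [set z : l.-tuple R | uniq z /\ forall i, A (tnth z i)].

(* A function on [Rstar ^ l] with compact support, extended by [0] to [R ^ l];
   a subset of [Rstar ^ l] is relatively compact there iff it is contained in
   [K ^ l] for some compact subset [K] of [Rstar]. *)
Definition compactly_supported (l : nat) (F : l.-tuple R -> R) : Prop :=
  exists K : set R, [/\ compact K, K `<=` Rstar &
    forall z, F z != 0 -> forall i, K (tnth z i)].

(* For a configuration and a compactly supported [F], the sum on the left-hand
   side has finite support. *)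
Definition determinantal (K : R -> R -> R) (C : T -> set R) : Prop :=
  forall (l : nat) (F : l.-tuple R -> R), (1 <= l)%N ->
    measurable_fun setT F -> (exists M : R, forall z, `|F z| <= M) ->
    compactly_supported F ->
    ('E_P[fun w => (\sum_(z \in distinct_points (C w)) F z)%R] =
     \int[lebesgue_tuple l]_(z in [set z : l.-tuple R | forall i, Rstar (tnth z i)])
       (F z * \det (\matrix_(i < l, j < l) K (tnth z i) (tnth z j)))%:E)%E.

End Process.
End PointProcess.

Section BesselProcess.
Context {R : realType}.
Implicit Types s x y : R.

Definition hpP s x : R :=
  2 `^ (2 * s - 1 / 2) * Gamma (s + 1 / 2) * `|x| `^ (- (1 / 2)) *
  besselJ (s - 1 / 2) (1 / `|x|).

Definition hpQ s x : R :=
  Num.sg x * 2 `^ (2 * s + 3 / 2) * Gamma (s + 3 / 2) * `|x| `^ (- (1 / 2)) *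
  besselJ (s + 1 / 2) (1 / `|x|).

Definition hp_kernel_offdiag s x y : R :=
  1 / (2 * pi) *
  (Gamma (s + 1) ^+ 2 / (Gamma (2 * s + 1) * Gamma (2 * s + 2))) *
  ((hpP s x * hpQ s y - hpP s y * hpQ s x) / (x - y)).

Definition hp_kernel s x y : R :=
  if x == y then lim (hp_kernel_offdiag s x z @[z --> x^'])
  else hp_kernel_offdiag s x y.

Definition hp_process {d} {T : measurableType d} (P : probability T R) s
    (C : T -> set R) : Prop :=
  point_process C /\ determinantal P (hp_kernel s) C.

(* [\sum_(_ \in _)] is [0] when the support is infinite; here that is the null
   event that the points accumulate at infinity. *)
Definition truncated_sum (A : set R) (m : nat) : R :=
  (\sum_(x \in A `&` [set x | m%:R ^- 2 < x]) x) -
  (\sum_(x \in A `&` [set x | m%:R ^- 2 < - x]) (- x)).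

(* The limit exists almost surely for [A] distributed as the determinantal
   process with kernel [hp_kernel s], [-1/2 < s]. *)
Definition pv_sum (A : set R) : R := lim (truncated_sum A m @[m --> \oo]).

End BesselProcess.

(* Main.v *)
(* The power sums of the N-point Hua-Pickrell ensemble have moments given by
   determinants of moments of the Cauchy weight.  Expanding these by the rows
   where the exponents are shifted, E_N[(x_1 + ... + x_N)^(2h)] is a polynomial
   in N of degree at most 2h vanishing at N = 0, with coefficients rational in s.
   Hence its 2h-th finite difference at 0, divided by (2h)!, is its coefficient of
   N^(2h), that is, the limit of N^(-2h) E_N[(x_1 + ... + x_N)^(2h)].

   It remains to identify this limit with E[X(s)^(2h)].  The ensemble rescaled by
   1/N is determinantal for the kernel of the Romanovski polynomials, which
   by Christoffel-Darboux converges to the Bessel kernel of the limit process and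
   whose diagonal is at most C / x^2 and, away from 0, at most C |x|^(-2s-2).
   Therefore the moments of the sum over the points of an annulus converge to
   those of the limit process.  The 2h-th moment of the sum over large points is
   small because of the tail of the kernel.  For small points absolute values are
   too costly: the exponential moment of their sum is a Gram determinant, which
   Hadamard's inequality bounds by the exponential of a trace, and in the trace
   the linear term cancels since the kernel is even.  The same bounds, passed to
   the limit, make the truncated sums converge to X(s) almost surely and
   in L^(2h). *)

Require Import Defs.
From HB Require Import structures.
From mathcomp Require Import all_boot all_order all_algebra fingroup perm.
From mathcomp Require Import all_classical all_reals all_analysis.
From mathcomp Require Import measurable_realfun.
From mathcomp Require Import ring lra zify.
Set Implicit Arguments.
Unset Strict Implicit.
Unset Printing Implicit Defensive.
Import Order.TTheory GRing.Theory Num.Theory.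
Import numFieldNormedType.Exports.
Local Open Scope classical_set_scope.
Local Open Scope ring_scope.

(** The condition [s > h - 1/2] reads [2h < 2s + 1]. It makes the [2h]-th power of the sum
    integrable for the [N]-point density, and [|x|^(2h)] integrable at infinity against the tail
    [|x|^(-2s-2)] of the kernel. A moment is a priori a sum over [N^(2h)] maps. Counting the shifted
    rows from the top degree, a fixed pattern of shifts contributes a product of [2h] factors linear
    in [N]; this is where the degree comes from. Small points are the obstacle: with a density of
    order [x^-2] the expected sum of [|x|] diverges logarithmically, while the expected sum of [x^2]
    over a set is at most a constant times its Lebesgue measure. Hence exponential moments are taken
    at a scale [t] with [t^2 |A| <= 1]. The shell between the cutoffs [(m+1)^-2] and [m^-2] has
    measure of order [m^-3], so its sum has mean absolute value of order [m^(-3/2)], which is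
    summable. Everything is compared through even powers: [|a^n - b^n| <= n (eta (a^n + b^n) +
    eta^(1-n) (a - b)^n)] is linear in expectations and takes the place of Minkowski's inequality,
    both in [N] and in the truncation. *)

Section RealValuedIntegrable.
Context {d : measure_display} {T : measurableType d} {R : realType}.
Variables (mu : {measure set T -> \bar R}) (D : set T) (mD : measurable D).
Implicit Types (f g : T -> R) (c : R).
Local Notation intg f := (mu.-integrable D (EFin \o f)).

Lemma integrable_EFin_measurable f : intg f -> measurable_fun D f.
Proof. by move=> /measurable_int/measurable_EFinP. Qed.

Lemma integrableZ_EFin c f : intg f -> intg (fun x => c * f x).
Proof. by move=> h; have := integrableZl mD c h; apply: eq_integrable. Qed.

Lemma integrableD_EFin f g : intg f -> intg g -> intg (fun x => f x + g x).
Proof. by move=> h1 h2; have := integrableD mD h1 h2; apply: eq_integrable. Qed.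

Lemma integrableB_EFin f g : intg f -> intg g -> intg (fun x => f x - g x).
Proof. by move=> h1 h2; have := integrableB mD h1 h2; apply: eq_integrable. Qed.

Lemma integrable_sum_EFin (I : Type) (s : seq I) (P : pred I) (f : I -> T -> R) :
  (forall i, P i -> intg (f i)) -> intg (fun x => \sum_(i <- s | P i) f i x).
Proof.
move=> h; have := @integrable_sum _ _ _ mu D mD I s P (fun i => EFin \o f i) h.
by apply: eq_integrable => // x _; rewrite /= sumEFin.
Qed.

Lemma le_integrable_EFin f g : measurable_fun D f ->
  (forall x, D x -> `|f x| <= g x) -> intg g -> intg f.
Proof.
move=> mf fg; apply: le_integrable => //; first exact/measurable_EFinP.
by move=> x Dx; rewrite lee_fin (le_trans (fg _ Dx))// ler_norm.
Qed.

Lemma Rintegral_sum (I : Type) (s : seq I) (P : pred I) (f : I -> T -> R) :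
  (forall i, P i -> intg (f i)) ->
  \int[mu]_(x in D) (\sum_(i <- s | P i) f i x) = \sum_(i <- s | P i) \int[mu]_(x in D) f i x.
Proof.
move=> h; elim: s => [|i s IH].
  under eq_Rintegral do rewrite big_nil.
  by rewrite big_nil Rintegral_cst// mul0r.
rewrite big_cons; case: ifPn => Pi.
  under eq_Rintegral do rewrite big_cons Pi.
  by rewrite RintegralD// ?IH//; [exact: h|exact: integrable_sum_EFin].
by under eq_Rintegral do rewrite big_cons (negbTE Pi).
Qed.

Lemma EFin_Rintegral f : intg f -> ((\int[mu]_(x in D) f x)%:E = \int[mu]_(x in D) (f x)%:E)%E.
Proof. by move=> h; rewrite /Rintegral fineK//; exact: integrable_fin_num. Qed.

Lemma Rintegral_ler f g : intg f -> intg g -> (forall x, D x -> f x <= g x) ->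
  \int[mu]_(x in D) f x <= \int[mu]_(x in D) g x.
Proof. by move=> h1 h2 fg; exact: le_Rintegral. Qed.

End RealValuedIntegrable.

(** * Improper integrals on the real line and the Cauchy weight *)

Section RealLineIntegrals.
Context {R : realType}.
Notation mu := (@lebesgue_measure R).
Implicit Types (f F : R -> R) (a b c : R) (p q : {poly R}).

Lemma powRN_cvgy0 (p : R) : 0 < p -> x `^ (- p) @[x --> +oo%R] --> (0 : R).
Proof.
move=> p0; apply/cvgrPdist_le => e e0; near=> x.
have x0 : 0 < x by near: x; exact: nbhs_pinfty_gt.
rewrite sub0r normrN ger0_norm ?powR_ge0// powRN.
rewrite -[leRHS]invrK lef_pV2 ?posrE ?invr_gt0 ?powR_gt0//.
have xe : e `^ (- p^-1) <= x by near: x; exact: nbhs_pinfty_ge.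
have -> : e^-1 = (e `^ (- p^-1)) `^ p.
  by rewrite -powRrM mulNr mulVf ?gt_eqF// powR_inv1// ltW.
by apply: ge0_ler_powR => //; rewrite ?nnegrE ?powR_ge0 ?(ltW p0) ?(ltW x0).
Unshelve. all: by end_near. Qed.

Lemma is_derive_powR_shift b c (x : R) : 0 < b + x ->
  is_derive x 1 (fun y => (b + y) `^ c) (c * (b + x) `^ (c - 1)).
Proof.
move=> bx.
have h : is_derive x 1 (fun y : R => b + y) 1.
  by have := is_deriveD (is_derive_cst b x 1) (is_derive_id x 1); rewrite add0r.
have := @is_derive1_comp R (@powR R ^~ c) (fun y => b + y) x _ _
  (is_derive1_powR c bx) h.
by rewrite mulr1.
Qed.

Lemma integral_powR_shift a b c : 0 < b + a -> 1 < c ->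
  (\int[mu]_(x in `[a, +oo[) ((b + x) `^ (- c))%:E =
   ((b + a) `^ (1 - c) / (c - 1))%:E)%E.
Proof.
move=> ba c1; have c10 : 0 < c - 1 by rewrite subr_gt0.
pose F x := - (c - 1)^-1 * (b + x) `^ (1 - c).
have pos x : a <= x -> 0 < b + x by move=> ax; apply: (lt_le_trans ba); rewrite lerD2l.
have dF x : a <= x -> is_derive x 1 F ((b + x) `^ (- c)).
  move=> ax; apply: (is_derive_eq (is_deriveZ (- (c - 1)^-1) (is_derive_powR_shift (1 - c) (pos _ ax)))).
  rewrite /GRing.scale/= mulrA.
  rewrite (_ : - (c - 1)^-1 * (1 - c) = 1) ?mul1r; last by field; rewrite gt_eqF.
  by congr (_ `^ _); ring.
have cF x : a <= x -> {for x, continuous F}.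
  move=> ax; apply: differentiable_continuous; apply/derivable1_diffP.
  by have [] := dF _ ax.
rewrite (@ge0_continuous_FTC2y _ _ F a 0).
- rewrite -EFinB; congr EFin; rewrite sub0r /F; by field; rewrite gt_eqF.
- by move=> x _; exact: powR_ge0.
- apply: continuous_in_subspaceT => x; rewrite inE/= in_itv/= andbT => ax.
  apply: differentiable_continuous; apply/derivable1_diffP.
  by have [] := is_derive_powR_shift (- c) (pos _ ax).
- rewrite -(mulr0 (- (c - 1)^-1)); apply: cvgM; first exact: cvg_cst.
  have -> : 1 - c = - (c - 1) by ring.
  apply: (@cvg_comp _ _ _ (fun x => b + x) (fun x => x `^ (- (c - 1)))); last exact: powRN_cvgy0.
  apply/cvgryPge => A; near=> x; rewrite -lerBlDl.
  by near: x; apply: nbhs_pinfty_ge; exact: num_real.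
- by move=> x /ltW ax; have [] := dF _ ax.
- by apply: cvg_at_right_filter; exact: cF.
- move=> x; rewrite in_itv/= andbT => /ltW ax.
  by rewrite derive1E; have [_ ->] := dF _ ax.
Unshelve. all: by end_near. Qed.

Lemma integrable_powR_norm c : 1 < c ->
  mu.-integrable setT (EFin \o (fun x => (1 + `|x|) `^ (- c))).
Proof.
move=> c1; have cf : continuous (fun x : R => (1 + `|x|) `^ (- c)).
  move=> x; apply: (@continuous_comp _ _ _ (fun x : R => 1 + `|x|) (@powR R ^~ (- c))).
    by apply: cvgD; [exact: cvg_cst|exact: norm_continuous].
  apply: differentiable_continuous; apply/derivable1_diffP.
  by apply: derivable_powR; rewrite in_itv/= andbT ltr_pwDl.
apply/integrableP; split.
  by apply/measurable_EFinP; exact: continuous_measurable_fun.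
under eq_integral => x _ do rewrite /= ger0_norm ?powR_ge0//.
rewrite ge0_symfun_integralT//; last first.
  by move=> x /=; rewrite normrN.
rewrite -set_itvcy.
have -> : (\int[mu]_(x in `[0%R, +oo[) ((1 + `|x|) `^ (- c))%:E =
    \int[mu]_(x in `[0%R, +oo[) ((1 + x) `^ (- c))%:E)%E.
  apply: eq_integral; by move=> x; rewrite inE/= in_itv/= andbT => x0; rewrite ger0_norm.
by rewrite integral_powR_shift ?addr0// -EFinM ltry.
Qed.

(** The integrand may change sign, so its integrability is assumed: the fundamental theorem on
    [[-(n+1), n+1]] passes to the limit by dominated convergence with dominating function [|f|]. *)
Lemma integral_deriveT F f (l l' : R) : continuous f ->
  (forall x : R, is_derive x 1 F (f x)) -> mu.-integrable setT (EFin \o f) ->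
  F x @[x --> +oo%R] --> l -> F x @[x --> -oo%R] --> l' ->
  (\int[mu]_x (f x)%:E = (l - l')%:E)%E.
Proof.
move=> cf dF intf Fl Fl'.
have cF : continuous F.
  move=> x; apply: differentiable_continuous; apply/derivable1_diffP.
  by have [] := dF x.
have FTC n : (\int[mu]_(x in `[(- n.+1%:R)%R, n.+1%:R%R]) (f x)%:E = (F n.+1%:R - F (- n.+1%:R))%:E)%E.
  rewrite (@continuous_FTC2 _ f F) ?EFinB//.
  - by rewrite -subr_gt0 opprK addr_gt0.
  - exact: continuous_subspaceT.
  - split.
    + by move=> x _; have [] := dF x.
    + by apply: cvg_at_right_filter; exact: cF.
    + by apply: cvg_at_left_filter; exact: cF.
  - by move=> x _; rewrite derive1E; have [_ ->] := dF x.
have h1 : (\int[mu]_x ((f \_ `[- n.+1%:R, n.+1%:R]) x)%:E)%E @[n --> \oo]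
    --> (\int[mu]_x (f x)%:E)%E.
  apply: (@dominated_cvg _ _ _ mu setT _ _ _ (fun x => (`|f x|)%:E)) => //.
  - move=> n; apply/measurable_EFinP/measurable_restrict => //.
    by rewrite setTI; apply: measurable_funTS; exact: continuous_measurable_fun.
  - move=> x _; apply: cvg_near_cst; near=> n.
    rewrite patchE ifT// inE/= in_itv/= -ler_norml.
    apply: le_trans (_ : n%:R <= _); last by rewrite ler_nat.
    by near: n; exact: nbhs_infty_ger.
  - exact: integrable_norm.
  - by move=> n x _; rewrite /= patchE; case: ifPn => _; rewrite ?normr0 lee_fin.
have h2 : (\int[mu]_x ((f \_ `[- n.+1%:R, n.+1%:R]) x)%:E)%E @[n --> \oo] --> (l - l')%:E.
  have -> : (fun n : nat => \int[mu]_x ((f \_ `[(- n.+1%:R)%R, n.+1%:R%R]) x)%:E)%E =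
      (fun n => (F n.+1%:R - F (- n.+1%:R))%:E).
    apply/funext => n; rewrite -FTC [RHS]integral_mkcond.
    by apply: eq_integral => x _; rewrite !patchE; case: ifPn.
  apply: cvg_EFin; first by near=> n.
  apply: cvgB.
    apply: (@cvg_comp _ _ _ (fun n : nat => n.+1%:R : R) F _ (@pinfty_nbhs R)) => //.
    by apply/cvgryPge => A; near=> n; apply: le_trans (_ : n%:R <= _); [near: n; exact: nbhs_infty_ger|rewrite ler_nat].
  apply: (@cvg_comp _ _ _ (fun n : nat => - n.+1%:R : R) F _ (@ninfty_nbhs R)) => //.
  apply/cvgrNyPle => A; near=> n; rewrite lerNl; apply: le_trans (_ : n%:R <= _); last by rewrite ler_nat.
  by near: n; exact: nbhs_infty_ger.
exact: (cvg_unique _ h1 h2).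
Unshelve. all: by end_near. Qed.

(** With [a = N%:R + s] this is the one-particle weight of the Hua-Pickrell density. *)
Definition cauchy_weight a (x : R) : R := (1 + x ^+ 2) `^ (- a).
Local Notation w := cauchy_weight.

Lemma onePsqr_gt0 (x : R) : 0 < 1 + x ^+ 2.
Proof. by rewrite ltr_pwDl// sqr_ge0. Qed.

Lemma cauchy_weight_gt0 a x : 0 < w a x.
Proof. by rewrite powR_gt0// onePsqr_gt0. Qed.

Lemma cauchy_weightD1 a x : (1 + x ^+ 2) * w (a + 1) x = w a x.
Proof.
have h := onePsqr_gt0 x; rewrite /w -[X in X * _]powRr1 ?ltW// -powRD.
  by congr (_ `^ _); ring.
by rewrite (gt_eqF h) implybT.
Qed.

Lemma cauchy_weightN a x : w a (- x) = w a x.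
Proof. by rewrite /w sqrrN. Qed.

Lemma is_derive_cauchy_weight a (x : R) :
  is_derive x 1 (w a) (- (2 * a) * x * w (a + 1) x).
Proof.
have h : is_derive x 1 (fun y : R => 1 + y ^+ 2) (2 * x).
  have := is_derive_poly (1 + 'X^2 : {poly R}) x.
  rewrite (_ : horner _ = fun y => 1 + y ^+ 2); last by apply/funext => y; rewrite !hornerE.
  by move=> /is_derive_eq; apply; rewrite derivD derivXn derivC add0r hornerMn hornerX mulr_natl.
have := @is_derive1_comp R (@powR R ^~ (- a)) (fun y => 1 + y ^+ 2) x _ _
  (is_derive1_powR (- a) (onePsqr_gt0 x)) h.
move=> /is_derive_eq; apply.
rewrite /w (_ : - (a + 1) = - a - 1); [ring|by ring].
Qed.

Lemma continuous_cauchy_weight a : continuous (w a).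
Proof.
move=> x; apply: differentiable_continuous; apply/derivable1_diffP.
by have [] := is_derive_cauchy_weight a x.
Qed.

Lemma continuous_poly_weight p a : continuous (fun x => p.[x] * w a x).
Proof.
by move=> x; apply: cvgM; [exact: continuous_horner|exact: continuous_cauchy_weight].
Qed.

(** From [(1 + |x|)^2 <= 2 (1 + x^2)]. Integrability and decay of polynomials times the weight
    thereby reduce to powers of [1 + |x|]. *)
Lemma cauchy_weight_le a x : 0 <= a -> w a x <= 2 `^ a * (1 + `|x|) `^ (- (2 * a)).
Proof.
move=> a0; have x0 : 0 < 1 + `|x| by rewrite ltr_pwDl.
have -> : (1 + `|x|) `^ (- (2 * a)) = ((1 + `|x|) ^+ 2) `^ (- a).
  by rewrite -powR_mulrn ?ltW// -powRrM; congr (_ `^ _); ring.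
rewrite /w !powRN -ler_pdivrMl ?powR_gt0// -invfM lef_pV2; last 2 first.
- by rewrite posrE mulr_gt0// powR_gt0// onePsqr_gt0.
- by rewrite posrE powR_gt0// exprn_gt0.
rewrite -powRM ?(ltW (onePsqr_gt0 _))//; apply: ge0_ler_powR => //.
- by rewrite nnegrE exprn_ge0// ltW.
- by rewrite nnegrE mulr_ge0// ltW// onePsqr_gt0.
rewrite -(real_normK (num_real x)) -subr_ge0.
have -> : 2 * (1 + `|x| ^+ 2) - (1 + `|x|) ^+ 2 = (1 - `|x|) ^+ 2 by ring.
exact: sqr_ge0.
Qed.

Lemma horner_growth p k : (size p <= k.+1)%N ->
  exists2 C, 0 <= C & forall x, `|p.[x]| <= C * (1 + `|x|) ^+ k.
Proof.
move=> pk; exists (\sum_(i < size p) `|p`_i|); first exact: sumr_ge0.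
move=> x; rewrite horner_coef mulr_suml; apply: le_trans (ler_norm_sum _ _ _) _.
apply: ler_sum => i _; rewrite normrM normrX; apply: ler_wpM2l => //.
have h1 : 1 <= 1 + `|x| by rewrite lerDl.
apply: (@le_trans _ _ ((1 + `|x|) ^+ i)).
  by apply: lerXn2r; rewrite ?nnegrE// ?lerDr// addr_ge0.
by rewrite ler_weXn2l// -ltnS (leq_trans (ltn_ord i)).
Qed.

Lemma poly_weight_le p a k : 0 <= a -> (size p <= k.+1)%N ->
  exists2 C, 0 <= C & forall x, `|p.[x] * w a x| <= C * (1 + `|x|) `^ (- (2 * a - k%:R)).
Proof.
move=> a0 /horner_growth[C C0 hC]; exists (C * 2 `^ a); first by rewrite mulr_ge0// powR_ge0.
move=> x; have x0 : 0 < 1 + `|x| by rewrite ltr_pwDl.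
rewrite normrM (ger0_norm (ltW (cauchy_weight_gt0 _ _))).
apply: le_trans (ler_pM _ _ (hC x) (cauchy_weight_le x a0)) _ => //.
  by rewrite ltW// cauchy_weight_gt0.
rewrite -powR_mulrn ?(ltW x0)// mulrACA -powRD; last by rewrite (gt_eqF x0) implybT.
by rewrite opprB.
Qed.

Lemma integrable_poly_weight p a : (size p)%:R < 2 * a ->
  mu.-integrable setT (EFin \o (fun x => p.[x] * w a x)).
Proof.
move=> pa.
have a0 : 0 <= a by have : 0 <= (size p)%:R :> R by []; lra.
have [|C C0 hC] := @poly_weight_le p a (size p).-1 a0.
  by case: (size p).
have [p0|p0] := eqVneq (size p) 0%N.
  rewrite (_ : EFin \o _ = cst 0%E); first exact: integrable0.
  by apply/funext => x /=; move/eqP : p0; rewrite size_poly_eq0 => /eqP ->; rewrite horner0 mul0r.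
have c1 : 1 < 2 * a - (size p).-1%:R.
  by rewrite ltrBrDr addrC natr1 prednK ?lt0n.
apply: (@le_integrable _ _ _ mu setT _ _ (fun x => (C%:E * ((1 + `|x|) `^ (- (2 * a - (size p).-1%:R)))%:E)%E)) => //.
- by apply/measurable_EFinP; exact: (continuous_measurable_fun (@continuous_poly_weight p a)).
- move=> x _; rewrite -EFinM /= lee_fin (le_trans (hC x))//.
  by rewrite ler_norm.
- by apply: integrableZl => //; exact: integrable_powR_norm.
Qed.

Lemma poly_weight_cvg0 p a (F : set_system R) : Filter F -> 0 <= a ->
  (size p)%:R < 2 * a + 1 -> `|x| @[x --> F] --> +oo%R ->
  p.[x] * w a x @[x --> F] --> (0 : R).
Proof.
move=> FF a0 pa Foo.
have [p0|p0] := eqVneq (size p) 0%N.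
  rewrite (_ : (fun x => _) = cst 0); first exact: cvg_cst.
  by apply/funext => x /=; move/eqP : p0; rewrite size_poly_eq0 => /eqP ->; rewrite horner0 mul0r.
have [|C C0 hC] := @poly_weight_le p a (size p).-1 a0; first by rewrite prednK ?lt0n.
apply/norm_cvg0P.
have d0 : 0 < 2 * a - (size p).-1%:R.
  by rewrite subr_gt0 -(ltrD2r 1) natr1 prednK ?lt0n.
apply: (@squeeze_cvgr _ _ _ _ (fun=> 0) (fun x => C * (1 + `|x|) `^ (- (2 * a - (size p).-1%:R)))).
- by near=> x; rewrite normr_ge0 hC.
- exact: cvg_cst.
- rewrite -(mulr0 C); apply: cvgM; first exact: cvg_cst.
  apply: (@cvg_comp _ _ _ (fun x => 1 + `|x|) (fun x => x `^ _)); last exact: powRN_cvgy0.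
  apply/cvgryPge => A; near=> x; rewrite -lerBlDl.
  by near: x; move/cvgryPge : Foo; exact.
Unshelve. all: by end_near. Qed.

(** The integrand is the derivative of [q] times the weight of exponent [a], and this product
    vanishes at both infinities because [q] has degree below [2a]. All recursions for masses,
    moments and orthogonal polynomials come from this identity. *)
Lemma Rintegral_poly_weight_derive q a : 0 <= a -> (size q)%:R < 2 * a + 1 ->
  \int[mu]_x ((q^`() * (1 + 'X^2) - (2 * a)%:P * 'X * q).[x] * w (a + 1) x) = 0.
Proof.
move=> a0 qa; set r := q^`() * (1 + 'X^2) - (2 * a)%:P * 'X * q.
have szr : (size r)%:R < 2 * (a + 1).
  have [q0|q0] := eqVneq q 0.
    by rewrite /r q0 deriv0 mul0r mulr0 subr0 size_poly0 mulr_gt0// ltr_wpDl.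
  have s1 : (size q > 0)%N by rewrite size_poly_gt0.
  have szX : size (1 + 'X^2 : {poly R}) = 3%N.
    by rewrite addrC size_polyDl size_polyXn// size_poly1.
  have szr' : (size r <= (size q).+1)%N.
    apply: leq_trans (size_polyD _ _) _; rewrite geq_max size_polyN; apply/andP; split.
      apply: leq_trans (size_polyMleq _ _) _; rewrite szX addn3 /=.
      by rewrite ltnS; exact: lt_size_deriv.
    rewrite -mulrA mul_polyC; apply: leq_trans (size_scale_leq _ _) _.
    by rewrite mulrC size_mulX.
  apply: le_lt_trans (_ : (size q).+1%:R < _); first by rewrite ler_nat.
  by rewrite -natr1; lra.
have dF (x : R) : is_derive x 1 (fun x => q.[x] * w a x) (r.[x] * w (a + 1) x).
  apply: (is_derive_eq (is_deriveM (is_derive_poly q x) (is_derive_cauchy_weight a x))).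
  rewrite /GRing.scale/= -[w a x](cauchy_weightD1 a x) /r.
  rewrite hornerD hornerN !hornerM !(hornerD, hornerC, hornerX, hornerXn); ring.
rewrite /Rintegral (@integral_deriveT (fun x => q.[x] * w a x) _ 0 0) ?subrr//.
- exact: continuous_poly_weight.
- exact: integrable_poly_weight.
- apply: poly_weight_cvg0 => //; apply/cvgryPge => A; near=> x.
  apply: le_trans (ler_norm _); near: x; apply: nbhs_pinfty_ge; exact: num_real.
- apply: poly_weight_cvg0 => //; apply/cvgryPge => A; near=> x.
  rewrite -normrN; apply: le_trans (ler_norm _); rewrite lerNr; near: x; apply: nbhs_ninfty_le; exact: num_real.
Unshelve. all: by end_near. Qed.

End RealLineIntegrals.

(** * The Gamma function and Cauchy weights *)

Section GammaFunction.
Context {R : realType}.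
Notation mu := (@lebesgue_measure R).
Implicit Types (f F : R -> R) (x y z : R).

(** The antiderivative is differentiable on the open half-line only, with a right limit at [0],
    since real powers are differentiated at positive arguments. *)
Lemma integral_derive0y F f (l : R) : {within `[0, +oo[, continuous f} ->
  (forall x : R, 0 < x -> is_derive x 1 F (f x)) -> F x @[x --> 0^'+] --> F 0 ->
  mu.-integrable `[0%R, +oo[ (EFin \o f) ->
  F x @[x --> +oo%R] --> l ->
  (\int[mu]_(x in `[0%R, +oo[) (f x)%:E = (l - F 0)%:E)%E.
Proof.
move=> cf dF F0 intf Fl.
have [cf1 cf2] := (continuous_within_itvcyP _ _).1 cf.
have cF x : 0 < x -> {for x, continuous F}.
  move=> x0; apply: differentiable_continuous; apply/derivable1_diffP.
  by have [] := dF x x0.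
have FTC n : (\int[mu]_(x in `[0%R, n.+1%:R%R]) (f x)%:E = (F n.+1%:R - F 0)%:E)%E.
  rewrite (@continuous_FTC2 _ f F) ?EFinB//.
  - apply/continuous_within_itvP; first by rewrite ltr0n.
    split => //.
      by move=> x; rewrite in_itv/= => /andP[x0 _]; apply: cf1; rewrite in_itv/= x0.
    by apply: cvg_at_left_filter; apply: cf1; rewrite in_itv/= andbT ltr0n.
  - split => //.
    + by move=> x; rewrite in_itv/= => /andP[x0 _]; have [] := dF x x0.
    + by apply: cvg_at_left_filter; apply: cF; rewrite ltr0n.
  - by move=> x; rewrite in_itv/= derive1E => /andP[x0 _]; have [_ ->] := dF x x0.
have h1 : (\int[mu]_(x in `[0%R, +oo[) ((f \_ `[0, n.+1%:R]) x)%:E)%E @[n --> \oo]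
    --> (\int[mu]_(x in `[0%R, +oo[) (f x)%:E)%E.
  apply: (@dominated_cvg _ _ _ mu `[0%R, +oo[%classic _ _ _ (fun x => (`|f x|)%:E)) => //.
  - move=> n; apply/measurable_EFinP/measurable_restrict => //.
    have mf := integrable_EFin_measurable intf.
    by apply: measurable_funS mf.
  - move=> x; rewrite /= in_itv/= andbT => x0; apply: cvg_near_cst; near=> n.
    rewrite patchE ifT// inE/= in_itv/= x0/=.
    apply: le_trans (_ : n%:R <= _); last by rewrite ler_nat.
    by near: n; exact: nbhs_infty_ger.
  - exact: integrable_norm.
  - by move=> n x _; rewrite /= patchE; case: ifPn => _; rewrite ?normr0 lee_fin.
have h2 : (\int[mu]_(x in `[0%R, +oo[) ((f \_ `[0, n.+1%:R]) x)%:E)%E @[n --> \oo] --> (l - F 0)%:E.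
  have -> : (fun n : nat => \int[mu]_(x in `[0%R, +oo[) ((f \_ `[0%R, n.+1%:R%R]) x)%:E)%E =
      (fun n => (F n.+1%:R - F 0)%:E).
    apply/funext => n; rewrite -FTC.
    have -> : `[0, n.+1%:R]%classic = `[0, +oo[%classic `&` `[0, n.+1%:R]%classic :> set R.
      by apply/seteqP; split => x /=; rewrite !in_itv/= andbT; [move=> /andP[-> ->]|case].
    rewrite [RHS]integral_mkcondr; apply: eq_integral => x; rewrite inE/= in_itv/= andbT => x0.
    by rewrite !patchE; rewrite in_setI (_ : x \in `[0, +oo[%classic) //= ?inE/= ?in_itv/= ?andbT//; case: ifPn.
  apply: cvg_EFin; first by near=> n.
  apply: cvgB; last exact: cvg_cst.
  apply: (@cvg_comp _ _ _ (fun n : nat => n.+1%:R : R) F _ (@pinfty_nbhs R)) => //.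
  by apply/cvgryPge => A; near=> n; apply: le_trans (_ : n%:R <= _); [near: n; exact: nbhs_infty_ger|rewrite ler_nat].
exact: (cvg_unique _ h1 h2).
Unshelve. all: by end_near. Qed.

Lemma powR_expRN_le z : 0 <= z -> exists2 C, 0 <= C &
  forall x, 0 <= x -> x `^ z * expR (- x) <= C * (1 + x) `^ (- 2).
Proof.
move=> z0; set n := (Num.bound (z + 2)).
have zn : z + 2 <= n.+1%:R by rewrite ltW// (lt_le_trans (archi_boundP _)) ?ler_nat// addr_ge0.
(* The constant comes from [(1 + x)^(n+1) / (n+1)! <= expR (1 + x)], where [n + 1] exceeds
   [z + 2]. *)
exists ((n.+1)`!%:R * expR 1); first by rewrite mulr_ge0// expR_ge0.
move=> x x0; have x10 : 0 < 1 + x by rewrite ltr_pwDl.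
rewrite powRN ler_pdivlMr ?powR_gt0//.
apply: (@le_trans _ _ ((1 + x) ^+ n.+1 * expR (- x))).
  rewrite mulrAC; apply: ler_wpM2r; first exact: expR_ge0.
  apply: (@le_trans _ _ ((1 + x) `^ z * (1 + x) `^ 2)).
    apply: ler_wpM2r; first exact: powR_ge0.
    by apply: ge0_ler_powR; rewrite ?nnegrE// ?lerDr// ltW.
  rewrite -powRD; last by rewrite (gt_eqF x10) implybT.
  by rewrite -powR_mulrn ?(ltW x10)//; apply: ler_powR => //; rewrite lerDl.
rewrite expRN ler_pdivrMr ?expR_gt0// -mulrA -expRD.
have := expR_ge1Dxn n (ltW x10).
rewrite -ler_pdivrMl ?ltr0n ?fact_gt0// mulrC => h.
by apply: le_trans h; rewrite lerDr.
Qed.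

Lemma continuous_powR z : {in `]0, +oo[, continuous (@powR R ^~ z)}.
Proof.
move=> x x0; apply: differentiable_continuous; apply/derivable1_diffP.
exact: derivable_powR.
Qed.

Lemma powR_cvg_right0 z : 0 <= z -> x `^ z @[x --> 0^'+] --> (0 : R) `^ z.
Proof.
rewrite le_eqVlt => /predU1P[<-|z0].
  by rewrite powRr0; under eq_fun do rewrite powRr0; exact: cvg_cst.
by rewrite powR0 ?gt_eqF//; exact: powR_cvg0.
Qed.

Lemma continuous_expRN : continuous (fun x : R => expR (- x)).
Proof.
move=> x; apply: (@continuous_comp _ _ _ -%R (@expR R)); last exact: continuous_expR.
exact: opp_continuous.
Qed.

Lemma within_continuous_Gamma_integrand z : 0 <= z ->
  {within `[0, +oo[, continuous (fun x => x `^ z * expR (- x))}.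
Proof.
move=> z0; apply/continuous_within_itvcyP; split.
  move=> x x0; apply: cvgM; first exact: continuous_powR.
  exact: continuous_expRN.
apply: cvgM; first exact: powR_cvg_right0.
apply: cvg_at_right_filter; exact: continuous_expRN.
Qed.

Lemma integrable_Gamma_integrand z : 0 <= z ->
  mu.-integrable `[0%R, +oo[ (EFin \o (fun x => x `^ z * expR (- x))).
Proof.
move=> z0; have [C C0 hC] := powR_expRN_le z0.
apply: (@le_integrable _ _ _ mu _ _ _ (fun x => (C%:E * ((1 + `|x|) `^ (- 2))%:E)%E)) => //.
- apply/measurable_EFinP; apply: measurable_funM.
    by apply: measurable_funTS; exact: measurable_powR.
  by apply: measurable_funTS; apply: measurableT_comp => //; exact: measurable_funN.
- move=> x; rewrite /= in_itv/= andbT => x0; rewrite -?EFinM lee_fin.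
  rewrite ger0_norm ?mulr_ge0 ?powR_ge0 ?expR_ge0//.
  by apply: le_trans (hC _ x0) _; rewrite (ger0_norm x0) ler_norm.
- apply: integrableZl => //; apply: (@integrableS _ _ _ mu setT) => //.
  by apply: integrable_powR_norm; rewrite ltr1n.
Qed.

Lemma GammaE z : 1 <= z -> Gamma z = \int[mu]_(x in `[0, +oo[) (x `^ (z - 1) * expR (- x)).
Proof.
move=> z1; rewrite /Gamma Rintegral_itv_obnd_cbnd//.
apply: (@integrableS _ _ _ mu `[0%R, +oo[%classic) => //.
  by move=> x /=; rewrite !in_itv/= !andbT => /ltW.
by apply: integrable_Gamma_integrand; rewrite subr_ge0.
Qed.

(** For [1 <= z] the integrand is continuous at [0]. This range suffices: with [s > 1/2], all Gamma
    values met below have argument at least [1]. *)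
Lemma GammaD1 z : 1 <= z -> Gamma (z + 1) = z * Gamma z.
Proof.
move=> z1; have z0 : 0 <= z - 1 by rewrite subr_ge0.
have z00 : 0 < z by rewrite (lt_le_trans ltr01).
have z1' : 1 <= z + 1 by lra.
rewrite (GammaE z1) (GammaE z1') addrK.
have i1 := integrable_Gamma_integrand z0.
have i2 := integrable_Gamma_integrand (ltW z00).
rewrite -RintegralZl//; apply/eqP; rewrite -subr_eq0; apply/eqP.
have i3 : mu.-integrable `[0%R, +oo[ (EFin \o (fun x => z * (x `^ (z - 1) * expR (- x)))).
  exact: integrableZ_EFin.
rewrite -RintegralB//.
pose F := fun x : R => - (x `^ z * expR (- x)).
have dF x : 0 < x -> is_derive x 1 F (x `^ z * expR (- x) - z * (x `^ (z - 1) * expR (- x))).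
  move=> x0; have dN : is_derive x 1 (fun x => expR (- x)) (- expR (- x)).
    have := @is_derive1_comp R (@expR R) -%R x _ _ (is_derive_expR (- x)) (is_deriveNid x 1).
    by rewrite mulrN1.
  apply: (is_derive_eq (is_deriveN (is_deriveM (is_derive1_powR z x0) dN))).
  rewrite /GRing.scale/=; ring.
rewrite /Rintegral (integral_derive0y (F := F) (l := 0)) => //=.
- by rewrite /F powR0 ?gt_eqF// mul0r oppr0 subrr.
- have h1 := within_continuous_Gamma_integrand z0.
  have h2 := within_continuous_Gamma_integrand (ltW z00).
  by move=> x; apply: cvgB; [exact: h2|apply: cvgM; [exact: cvg_cst|exact: h1]].
- have /continuous_within_itvcyP[_ h2] := within_continuous_Gamma_integrand (ltW z00).
  by apply: cvgN.
- exact: integrableB_EFin.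
- have [C C0 hC] := powR_expRN_le (ltW z00).
  rewrite -oppr0; apply: cvgN.
  apply: (@squeeze_cvgr _ _ _ _ (fun=> 0) (fun x => C * (1 + x) `^ (- 2))).
  + by near=> x; rewrite mulr_ge0 ?powR_ge0 ?expR_ge0//= hC//; near: x; apply: nbhs_pinfty_ge.
  + exact: cvg_cst.
  + rewrite -[X in _ --> X](mulr0 C); apply: cvgM; first exact: cvg_cst.
    apply: (@cvg_comp _ _ _ (fun x => 1 + x) (fun x => x `^ (- 2))); last exact: powRN_cvgy0.
    apply/cvgryPge => A; near=> x; rewrite -lerBlDl.
    by near: x; apply: nbhs_pinfty_ge; exact: num_real.
Unshelve. all: by end_near. Qed.

Lemma Gamma1 : Gamma 1 = 1 :> R.
Proof.
rewrite GammaE// subrr.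
pose F := fun x : R => - expR (- x).
have dF x : is_derive x 1 F (expR (- x)).
  have dN : is_derive x 1 (fun x => expR (- x)) (- expR (- x)).
    have := @is_derive1_comp R (@expR R) -%R x _ _ (is_derive_expR (- x)) (is_deriveNid x 1).
    by rewrite mulrN1.
  by apply: (is_derive_eq (is_deriveN dN)); rewrite opprK.
have -> : \int[mu]_(x in `[0, +oo[) (x `^ 0 * expR (- x)) = \int[mu]_(x in `[0, +oo[) (expR (- x)).
  by apply: eq_Rintegral => x _; rewrite powRr0 mul1r.
rewrite /Rintegral (ge0_continuous_FTC2y (F := F) (l := 0)) => //=.
- by rewrite /F oppr0 expR0 sub0r opprK.
- by apply: continuous_subspaceT; exact: continuous_expRN.
- rewrite -[X in _ --> X]oppr0; apply: cvgN; exact: cvgr_expR.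
- apply: cvg_at_right_filter; apply: cvgN; exact: continuous_expRN.
- by move=> x _; rewrite derive1E; have [_ ->] := dF x.
Qed.

Lemma Gamma_nat n : Gamma n.+1%:R = n`!%:R :> R.
Proof.
elim: n => [|n IH]; first by rewrite Gamma1.
by rewrite -natr1 GammaD1 ?IH ?ler1n// factS natrM.
Qed.

(** Weighted arithmetic-geometric mean inequality for [u] and [1]. The bound [ln y <= y - 1] is used
    at [u / c] with weight [x] and at [1 / c] with weight [1 - x]; the right-hand sides then add up
    to [0]. *)
Lemma powR_le_tangent x u : 0 <= x <= 1 -> 0 < u -> u `^ x <= 1 - x + x * u.
Proof.
move=> /andP[x0 x1] u0; set c := 1 - x + x * u.
have c0 : 0 < c.
  have [xe|xn1] := eqVneq x 1; first by rewrite /c xe subrr add0r mul1r.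
  have x1' : x < 1 by rewrite lt_neqAle xn1.
  by rewrite /c ltr_pwDl ?subr_gt0// mulr_ge0// ltW.
have lnle (y : R) : 0 < y -> ln y <= y - 1.
  move=> y0; rewrite -ler_expR lnK ?posrE//.
  by apply: le_trans (expR_ge1Dx _); lra.
rewrite /powR gt_eqF// -[leRHS](lnK c0) ler_expR -subr_ge0.
have := lnle (u / c) (divr_gt0 u0 c0); rewrite ln_div ?posrE// => /(ler_wpM2l x0) h1.
have x10 : 0 <= 1 - x by rewrite subr_ge0.
have := lnle (1 / c) (divr_gt0 ltr01 c0); rewrite ln_div ?posrE// ln1 sub0r => /(ler_wpM2l x10) h2.
have h3 : x * (u / c - 1) + (1 - x) * (1 / c - 1) = 0.
  have -> : x * (u / c - 1) + (1 - x) * (1 / c - 1) = (1 - x + x * u) / c - 1 by ring.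
  by rewrite divff ?subrr// gt_eqF.
by lra.
Qed.

(** Log-convexity of Gamma between [z] and [z + 1]. The tangent bound at [u = t / z] is integrated
    against the Gamma density, and the two resulting terms recombine to [Gamma z] by the functional
    equation. *)
Lemma Gamma_le_powR z x : 1 <= z -> 0 <= x <= 1 -> Gamma (z + x) <= z `^ x * Gamma z.
Proof.
move=> z1 /andP[x0 x1]; have z0 : 0 < z by lra.
have [->|xn0] := eqVneq x 0; first by rewrite addr0 powRr0 mul1r.
have zx1 : 1 <= z + x by lra.
have z10 : 0 <= z - 1 by rewrite subr_ge0.
have i1 := integrable_Gamma_integrand z10.
have i2 := integrable_Gamma_integrand (ltW z0).
have zx0 : 0 <= z + x - 1 by lra.
have i3 := integrable_Gamma_integrand zx0.
have young (t : R) : 0 <= t -> t `^ x <= z `^ x * (1 - x + x * (t / z)).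
  rewrite le_eqVlt => /predU1P[<-|t0].
    by rewrite mul0r mulr0 addr0 powR0// mulr_ge0 ?powR_ge0// subr_ge0.
  have {1}-> : t = z * (t / z) by rewrite mulrC divfK// gt_eqF.
  rewrite powRM ?(ltW z0) ?divr_ge0 ?(ltW z0) ?(ltW t0)//.
  by rewrite ler_wpM2l ?powR_ge0// powR_le_tangent ?x0// divr_gt0.
have -> : z `^ x * Gamma z = (z `^ x * (1 - x)) * Gamma z + (z `^ x * x / z) * Gamma (z + 1).
  by rewrite GammaD1//; field; rewrite gt_eqF.
rewrite !GammaE//; last by lra.
rewrite -!RintegralZl// ?addrK//; rewrite ?addrK//.
have j1 : mu.-integrable `[0%R, +oo[ (EFin \o (fun t => z `^ x * (1 - x) * (t `^ (z - 1) * expR (- t)))).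
  exact: integrableZ_EFin.
have j2 : mu.-integrable `[0%R, +oo[ (EFin \o (fun t => z `^ x * x / z * (t `^ z * expR (- t)))).
  exact: integrableZ_EFin.
rewrite -RintegralD//; apply: Rintegral_ler => //; first exact: integrableD_EFin.
move=> t; rewrite /= in_itv/= andbT => t0.
have -> : t `^ (z + x - 1) = t `^ (z - 1) * t `^ x.
  rewrite -powRD; first by congr (_ `^ _); ring.
  by apply/implyP; lra.
have -> : t `^ z = t `^ (z - 1) * t by rewrite mulrC mulr_powRB1.
rewrite mulrAC.
have -> : z `^ x * (1 - x) * (t `^ (z - 1) * expR (- t)) + z `^ x * x / z * (t `^ (z - 1) * t * expR (- t)) =
  t `^ (z - 1) * expR (- t) * (z `^ x * (1 - x + x * (t / z))) by ring.
by rewrite ler_wpM2l ?young// mulr_ge0 ?powR_ge0 ?expR_ge0.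
Qed.

(** If [Gamma z] vanished, the log-convexity bound up to the next integer would give [m! <= 0]. *)
Lemma Gamma_gt0 z : 1 <= z -> 0 < Gamma z.
Proof.
move=> z1; set m := Num.truncn z.
have /andP[m1 m2] := truncn_itv (le_trans ler01 z1).
have := @Gamma_le_powR z (m.+1%:R - z) z1.
rewrite (addrC z) subrK Gamma_nat.
rewrite -natr1 => h; have {h} := h _.
rewrite lt_neqAle Gamma_ge0 andbT eq_sym => h; apply/eqP => z0.
have : m`!%:R <= 0 :> R.
  rewrite z0 mulr0 in h; apply: h.
  by rewrite -/m -natr1 in m1 m2; apply/andP; split; lra.
by rewrite leNgt ltr0n fact_gt0.
Qed.

Lemma cvg_natD_div (c : R) : (n.+1%:R + c) / n.+1%:R @[n --> \oo] --> (1 : R).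
Proof.
have -> : (fun n : nat => (n.+1%:R + c) / n.+1%:R : R) = (fun n => 1 + c * harmonic n).
  by apply/funext => n; rewrite mulrDl divff// pnatr_eq0.
rewrite -[X in _ --> X]addr0 -(mulr0 c).
by apply: cvgD; [exact: cvg_cst|apply: cvgM; [exact: cvg_cst|exact: cvg_harmonic]].
Qed.

(* For [0 <= c <= 1] the ratio is squeezed between [n / (n + c)] and [1] by the
   log-convexity estimate; [c -> c + 1] multiplies it by [(n + c) / n]. *)
Lemma Gamma_ratio_cvg (c : R) : 0 <= c ->
  Gamma (n.+1%:R + c) / (Gamma n.+1%:R * n.+1%:R `^ c) @[n --> \oo] --> (1 : R).
Proof.
move=> c0; have /andP[m1 m2] := truncn_itv c0.
move: (Num.truncn c) m1 m2 => m m1 m2; pose c' := c - m%:R.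
have -> : c = c' + m%:R by rewrite subrK.
have c'01 : 0 <= c' <= 1 by apply/andP; rewrite /c'; split; rewrite -?natr1 in m2; lra.
move: c' c'01 => c' c'01 {c c0 m1 m2}; elim: m c' c'01 => [|m IH] c /andP[c0 c1].
  rewrite addr0; apply: (@squeeze_cvgr _ _ _ _ (fun n : nat => ((n.+1%:R + c) / n.+1%:R)^-1) (fun=> 1)).
  - near=> n; have N1 : 1 <= n.+1%:R :> R by rewrite ler1n.
    have N0 : 0 < n.+1%:R :> R by [].
    have G0 := Gamma_gt0 N1.
    have P0 : 0 < n.+1%:R `^ c :> R by rewrite powR_gt0.
    apply/andP; split; last first.
      rewrite ler_pdivrMr ?mulr_gt0// mul1r mulrC; apply: Gamma_le_powR => //.
      by rewrite c0.
    rewrite invf_div ler_pdivlMr ?mulr_gt0// mulrAC ler_pdivrMr; last by rewrite ltr_pwDl.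
    have Nc1 : 1 <= n.+1%:R + c by rewrite ler_wpDr.
    have Nc0 : 0 < n.+1%:R + c by rewrite ltr_pwDl.
    have := @Gamma_le_powR (n.+1%:R + c) (1 - c) Nc1.
    rewrite (_ : _ + c + (1 - c) = n.+1%:R + 1); last by ring.
    rewrite GammaD1// => h.
    rewrite mulrA; apply: (@le_trans _ _ ((n.+1%:R + c) `^ (1 - c) * Gamma (n.+1%:R + c) * n.+1%:R `^ c)).
      by apply: ler_wpM2r; [exact: powR_ge0|apply: h; lra].
    rewrite mulrAC [leRHS]mulrC; apply: ler_wpM2r; first exact: Gamma_ge0.
    apply: (@le_trans _ _ ((n.+1%:R + c) `^ (1 - c) * (n.+1%:R + c) `^ c)).
      apply: ler_wpM2l; first exact: powR_ge0.
      by apply: ge0_ler_powR => //; rewrite ?nnegrE ?lerDl// ltW.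
    by rewrite -powRD ?subrK ?powRr1 ?(ltW Nc0)// (gt_eqF Nc0) implybT.
  - by rewrite -[X in _ --> X]invr1; apply: cvgV; [exact: oner_neq0|exact: cvg_natD_div].
  - exact: cvg_cst.
have cm0 : 0 <= c + m%:R by rewrite addr_ge0.
have -> : (fun n : nat => Gamma (n.+1%:R + (c + m.+1%:R)) / (Gamma n.+1%:R * n.+1%:R `^ (c + m.+1%:R)) : R) =
  (fun n => (n.+1%:R + (c + m%:R)) / n.+1%:R * (Gamma (n.+1%:R + (c + m%:R)) / (Gamma n.+1%:R * n.+1%:R `^ (c + m%:R)))).
  apply/funext => n; rewrite -(natr1 m) !addrA GammaD1; last first.
    by rewrite -addrA ler_wpDr// ler1n.
  rewrite [X in Gamma _ * X]powRD ?powRr1//; last by rewrite pnatr_eq0 implybT.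
  have P0 : n.+1%:R `^ (c + m%:R) != 0 :> R by rewrite gt_eqF// powR_gt0.
  have G0 : Gamma n.+1%:R != 0 :> R by rewrite gt_eqF// Gamma_gt0// ler1n.
  by rewrite (mulrC _ n.+1%:R) mulrCA -mulf_div.
rewrite -[X in _ --> X](mulr1 1); apply: cvgM; first exact: cvg_natD_div.
by apply: IH; rewrite c0.
Unshelve. all: by end_near. Qed.

(* The mass of the Cauchy weight: both sides satisfy the same recursion in [b],
   and their ratio tends to [1] along [b + n]. *)
Definition cauchy_mass (b : R) : R := \int[mu]_x (cauchy_weight b x).

Lemma integrable_cauchy_weight b : 1 < 2 * b -> mu.-integrable setT (EFin \o cauchy_weight b).
Proof.
move=> b1; have := @integrable_poly_weight R 1 b; rewrite size_poly1 => /(_ b1).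
by apply: eq_integrable => // x _; rewrite /= hornerE mul1r.
Qed.

Lemma cauchy_massD1 b : 1 < 2 * b -> cauchy_mass (b + 1) = (2 * b - 1) / (2 * b) * cauchy_mass b.
Proof.
move=> b1; have i1 := integrable_cauchy_weight b1.
have i2 : mu.-integrable setT (EFin \o cauchy_weight (b + 1)).
  by apply: integrable_cauchy_weight; lra.
have b0 : 0 <= b by lra.
have := @Rintegral_poly_weight_derive R 'X b b0; rewrite size_polyX => h.
have {h} : _ := h _; rewrite ltrD2r => /(_ b1).
have j1 := integrableZ_EFin measurableT (1 - 2 * b) i1.
have j2 := integrableZ_EFin measurableT (2 * b) i2.
have -> : \int[mu]_x ((('X : {poly R})^`() * (1 + 'X^2) - (2 * b)%:P * 'X * 'X).[x] * cauchy_weight (b + 1) x) =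
    \int[mu]_x ((1 - 2 * b) * cauchy_weight b x + 2 * b * cauchy_weight (b + 1) x).
  apply: eq_Rintegral => x _; rewrite -(cauchy_weightD1 b x) derivX.
  rewrite hornerD hornerN !hornerM !(hornerD, hornerC, hornerX, hornerXn); ring.
rewrite RintegralD// !RintegralZl// -/(cauchy_mass _) -/(cauchy_mass _) => h.
have bn0 : b != 0 by rewrite gt_eqF//; lra.
apply: (mulfI (_ : 2 * b != 0)); first by rewrite mulf_neq0// pnatr_eq0.
rewrite mulrA mulrCA divff ?mulr1; last by rewrite mulf_neq0// pnatr_eq0.
by move: h; lra.
Qed.

Lemma cauchy_mass1 : cauchy_mass 1 = pi.
Proof.
have w1 x : cauchy_weight 1 x = (1 + x ^+ 2)^-1.
  by rewrite /cauchy_weight powR_inv1// ltW// onePsqr_gt0.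
have dF (x : R) : is_derive x 1 atan (cauchy_weight 1 x) by rewrite w1; exact: is_derive1_atan.
rewrite /cauchy_mass /Rintegral (integral_deriveT (F := atan) (l := pi / 2) (l' := - (pi / 2))) ?opprK -?splitr//.
- exact: continuous_cauchy_weight.
- by apply: integrable_cauchy_weight; rewrite mulr1 ltr1n.
- exact: cvgy_atan.
- by apply/cvgNy_compNP; under eq_fun do rewrite /= atanN; apply: cvgN; exact: cvgy_atan.
Qed.

Lemma cauchy_mass_le b b' : 1 < 2 * b -> b <= b' -> cauchy_mass b' <= cauchy_mass b.
Proof.
move=> b1 bb; apply: Rintegral_ler => //.
- by apply: integrable_cauchy_weight; lra.
- exact: integrable_cauchy_weight.
- move=> x _; apply: ler_powR; last by rewrite lerN2.
  by rewrite lerDl sqr_ge0.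
Qed.

(** A uniqueness principle in the style of Bohr and Mollerup. The quotient [M / g] has period [1]
    and equals [1] at positive integers. Monotonicity squeezes [M (n + 1 + b)] between values at
    integers, where [M] agrees with [g], and [g] hardly varies over bounded shifts, so the periodic
    quotient is [1] at [b] too. *)
Lemma eq_from_asymptotic_ratio (M g r : R -> R) :
  (forall b, 1 <= b -> 0 < g b) -> (forall b, 1 <= b -> r b != 0) ->
  (forall b, 1 <= b -> M (b + 1) = r b * M b) ->
  (forall b, 1 <= b -> g (b + 1) = r b * g b) ->
  (forall b b', 1 <= b -> b <= b' -> M b' <= M b) ->
  (forall c, 0 <= c -> g (n.+1%:R + c) / g n.+1%:R @[n --> \oo] --> (1 : R)) ->
  M 1 = g 1 -> forall b, 1 <= b -> M b = g b.
Proof.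
move=> g_gt0 r0 MD1 gD1 M_le g_cvg M1.
have ratioD b n : 1 <= b -> M (b + n%:R) / g (b + n%:R) = M b / g b.
  move=> b1; elim: n => [|n IH]; first by rewrite addr0.
  have bn1 : 1 <= b + n%:R by rewrite ler_wpDr.
  by rewrite -natr1 addrA MD1// gD1// -mulf_div divff ?mul1r ?r0.
have M_nat n : M n.+1%:R = g n.+1%:R.
  have g1 := lt0r_neq0 (g_gt0 _ (lexx 1)).
  have := ratioD 1 n (lexx _); rewrite nat1r M1 divff// => h.
  have g0 : g n.+1%:R != 0 by rewrite lt0r_neq0// g_gt0// ler1n.
  by rewrite -[LHS](divfK g0) h mul1r.
move=> b b1; set m := Num.bound b.
have bm : b <= m%:R by rewrite ltW// archi_boundP// (le_trans ler01).
have gb0 := g_gt0 _ b1.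
suff h : M b / g b = 1 by rewrite -[LHS](divfK (lt0r_neq0 gb0)) h mul1r.
apply: (@cvg_unique _ _ ((fun _ : nat => M b / g b) @ \oo)) => //; first exact: cvg_cst.
have b0 : 0 <= b by rewrite (le_trans ler01).
apply: (@squeeze_cvgr _ _ _ _ (fun n : nat => (g (n.+1%:R + m%:R) / g n.+1%:R) / (g (n.+1%:R + b) / g n.+1%:R))
  (fun n : nat => (g (n.+1%:R + b) / g n.+1%:R)^-1)).
- near=> n; have n1 : 1 <= n.+1%:R :> R by rewrite ler1n.
  have g0 := g_gt0 _ n1.
  have nb1 : 1 <= n.+1%:R + b by rewrite ler_wpDr.
  have gb := g_gt0 _ nb1.
  rewrite -(ratioD b n.+1 b1) (addrC b) invf_div.
  have -> : g (n.+1%:R + m%:R) / g n.+1%:R * (g n.+1%:R / g (n.+1%:R + b)) =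
      g (n.+1%:R + m%:R) / g (n.+1%:R + b) by rewrite mulrA divfK// lt0r_neq0.
  rewrite !ler_pM2r ?invr_gt0// -M_nat -natrD addSn -M_nat -addSn natrD.
  by apply/andP; split; apply: M_le; rewrite ?lerD2l ?lerDl//; lra.
- rewrite -[X in _ --> X](mulr1 1) -[X in 1 * X]invr1; apply: cvgM; first exact: g_cvg.
  by apply: cvgV; [exact: oner_neq0|exact: g_cvg].
- by rewrite -[X in _ --> X]invr1; apply: cvgV; [exact: oner_neq0|exact: g_cvg].
Unshelve. all: by end_near. Qed.

Lemma powR_div x y r : 0 <= x -> 0 < y -> (x / y) `^ r = x `^ r / y `^ r.
Proof.
move=> x0 y0; rewrite powRM ?invr_ge0 ?(ltW y0)//; congr (_ * _).
by rewrite -[X in X `^ _](powR_inv1 (ltW y0)) -powRrM mulN1r powRN.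
Qed.

Lemma powR_cvg1 (u : nat -> R) c : u n @[n --> \oo] --> (1 : R) ->
  u n `^ c @[n --> \oo] --> (1 : R).
Proof.
move=> u1; have -> : (1 : R) = 1 `^ c by rewrite powR1.
apply: (@cvg_comp _ _ _ u (@powR R ^~ c)); first exact: u1.
by apply: continuous_powR; rewrite in_itv/= andbT.
Qed.

Let gamma_field_identity (p a b N M G1 G2 G3 G4 : R) : p != 0 -> a != 0 -> b != 0 -> M != 0 ->
  N != 0 -> G2 != 0 -> G3 != 0 -> G4 != 0 ->
  2 * p * (a / b) * G1 / G2 ^+ 2 / (2 * p * a * G3 / G4 ^+ 2) =
  G1 / (G3 * M) / (G2 / (G4 * N)) ^+ 2 * (M / (b * N ^+ 2)).
Proof. by move=> p0 a0 b0 M0 N0 h1 h2 h3; field; rewrite p0 a0 b0 M0 N0 h1 h2 h3. Qed.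

Lemma cauchy_massE b : 1 <= b ->
  cauchy_mass b = 2 * pi * 2 `^ (1 - 2 * b) * Gamma (2 * b - 1) / Gamma b ^+ 2.
Proof.
move: b; pose g b : R := 2 * pi * 2 `^ (1 - 2 * b) * Gamma (2 * b - 1) / Gamma b ^+ 2.
apply: (@eq_from_asymptotic_ratio cauchy_mass g (fun b => (2 * b - 1) / (2 * b))).
- move=> b b1; rewrite /g !mulr_gt0 ?powR_gt0 ?pi_gt0 ?invr_gt0 ?exprn_gt0 ?Gamma_gt0//.
  by lra.
- by move=> b b1; rewrite mulf_neq0 ?invr_neq0// lt0r_neq0//; lra.
- by move=> b b1; apply: cauchy_massD1; lra.
- move=> b b1; rewrite /g.
  rewrite (_ : 2 * (b + 1) - 1 = 2 * b - 1 + 1 + 1); last by ring.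
  rewrite !GammaD1; [|lra..].
  rewrite (_ : 1 - 2 * (b + 1) = 1 - 2 * b - 2%:R); last by ring.
  rewrite powRB; last by rewrite pnatr_eq0 implybT.
  rewrite powR_mulrn//; have G0 : Gamma b != 0 by rewrite gt_eqF// Gamma_gt0.
  have bn0 : b != 0 by rewrite gt_eqF//; lra.
  move: (Gamma b) (Gamma (2 * b - 1)) (2 `^ _) G0 => x y z x0.
  by field; rewrite x0 bn0.
- by move=> b b' b1 bb; apply: cauchy_mass_le => //; lra.
- move=> c c0; have c20 : 0 <= 2 * c by rewrite mulr_ge0.
  (* At [b = n + 1] the argument [2b - 1] equals [2n + 1], so the Gamma ratio limit is needed along
     the subsequence [2n]. *)
  have r1 : Gamma (n.*2.+1%:R + 2 * c) / (Gamma n.*2.+1%:R * n.*2.+1%:R `^ (2 * c)) @[n --> \oo] --> (1 : R).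
    apply: (@cvg_comp _ _ _ (fun n => n.*2)%N _ _ \oo _ _ (Gamma_ratio_cvg c20)).
    apply/cvgnyPge => A; near=> n; rewrite -addnn; apply: leq_trans (leq_addr _ _); near: n; exact: nbhs_infty_ge.
  have r2 := Gamma_ratio_cvg c0.
  (* Accounts for the difference between [(2n+1)^(2c)], produced by the Gamma ratio, and
     [2^(2c) (n+1)^(2c)], produced by the other factors. *)
  have r3 : (n.*2.+1%:R / (2 * n.+1%:R)) `^ (2 * c) @[n --> \oo] --> (1 : R).
    apply: powR_cvg1.
    have -> : (fun n : nat => n.*2.+1%:R / (2 * n.+1%:R)) = (fun n => 1 - 2^-1 * harmonic n) :> (nat -> R).
      apply/funext => n; rewrite /harmonic/= -(natr1 n.*2) -addnn natrD -(natr1 n).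
      by field; rewrite natr1 pnatr_eq0.
    rewrite -[X in _ --> X]subr0 -[X in 1 - X](mulr0 2^-1).
    by apply: cvgB; [exact: cvg_cst|apply: cvgM; [exact: cvg_cst|exact: cvg_harmonic]].
  have -> : (fun n : nat => g (n.+1%:R + c) / g n.+1%:R) = (fun n =>
     Gamma (n.*2.+1%:R + 2 * c) / (Gamma n.*2.+1%:R * n.*2.+1%:R `^ (2 * c)) *
     (Gamma (n.+1%:R + c) / (Gamma n.+1%:R * n.+1%:R `^ c)) ^- 2 *
     (n.*2.+1%:R / (2 * n.+1%:R)) `^ (2 * c)).
    apply/funext => n; rewrite /g.
    rewrite (_ : 2 * (n.+1%:R + c) - 1 = n.*2.+1%:R + 2 * c); last by rewrite -(natr1 n.*2) -addnn natrD -(natr1 n); ring.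
    rewrite (_ : 2 * n.+1%:R - 1 = n.*2.+1%:R); last by rewrite -(natr1 n.*2) -addnn natrD -(natr1 n); ring.
    rewrite (_ : 1 - 2 * (n.+1%:R + c) = (1 - 2 * n.+1%:R) - 2 * c); last by ring.
    rewrite powRB; last by rewrite pnatr_eq0 implybT.
    rewrite powR_div ?mulr_gt0// powRM//.
    rewrite [n.+1%:R `^ (2 * c)](_ : _ = (n.+1%:R `^ c) ^+ 2); last first.
      by rewrite -powR_mulrn ?powR_ge0// -powRrM mulrC.
    have n1 : 1 <= n.+1%:R :> R by rewrite ler1n.
    have m1 : 1 <= n.*2.+1%:R :> R by rewrite ler1n.
    have := lt0r_neq0 (Gamma_gt0 n1); have := lt0r_neq0 (Gamma_gt0 m1).
    have := lt0r_neq0 (@Gamma_gt0 (n.+1%:R + c) (ler_wpDr c0 n1)).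
    have N0 : 0 < n.+1%:R :> R by [].
    have M0 : 0 < n.*2.+1%:R :> R by [].
    have := lt0r_neq0 (powR_gt0 c N0); have := lt0r_neq0 (powR_gt0 (2 * c) M0).
    have := lt0r_neq0 (@powR_gt0 R 2 (2 * c) (ltr0Sn _ _)).
    have := lt0r_neq0 (@powR_gt0 R 2 (1 - 2 * n.+1%:R) (ltr0Sn _ _)).
    have := lt0r_neq0 (@pi_gt0 R).
    exact: gamma_field_identity.
  rewrite -[X in _ --> X]mulr1 -[X in X * 1]mulr1; apply: cvgM; last exact: r3.
  apply: cvgM; first exact: r1.
  have r22 := cvgM r2 r2; rewrite mulr1 in r22.
  have -> : (fun n : nat => (Gamma (n.+1%:R + c) / (Gamma n.+1%:R * n.+1%:R `^ c)) ^- 2) =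
     (fun n => ((Gamma (n.+1%:R + c) / (Gamma n.+1%:R * n.+1%:R `^ c)) *
        (Gamma (n.+1%:R + c) / (Gamma n.+1%:R * n.+1%:R `^ c)))^-1) :> (nat -> R).
    by apply/funext => n; rewrite expr2.
  rewrite -[X in _ --> X]invr1; apply: cvgV; [exact: oner_neq0|exact: r22].
- rewrite cauchy_mass1 /g.
  rewrite (_ : 2 * 1 - 1 = 1); last by ring.
  rewrite (_ : 1 - 2 * 1 = -1); last by ring.
  rewrite powR_inv1// Gamma1 expr1n invr1 !mulr1 mulrAC divff ?pnatr_eq0// mul1r//.
Unshelve. all: by end_near. Qed.

End GammaFunction.

(** * Determinantal ensembles *)

Section LebesgueTupleTheory.
Context {R : realType}.
Notation mu := (@lebesgue_measure R).
Notation leb n := (@lebesgue_tuple R n).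

Definition box n (A : 'I_n -> set R) : set (n.-tuple R) :=
  [set x | forall i, A i (tnth x i)].

Lemma measurable_box n (A : 'I_n -> set R) : (forall i, measurable (A i)) ->
  measurable (box A).
Proof.
move=> mA; rewrite (_ : box A = \bigcap_(i in [set: 'I_n]) (fun x => tnth x i) @^-1` A i).
  apply: fin_bigcap_measurable => // i _; rewrite -[X in measurable X]setTI.
  exact: measurable_tnth.
by apply/seteqP; split => [x h i _|x h i]; exact: h.
Qed.

Lemma lebesgue_tuple_box n (A : 'I_n -> set R) : (forall i, measurable (A i)) ->
  (leb n (box A) = \prod_(i < n) mu (A i))%E.
Proof.
elim: n A => [|n IH] A mA.
  rewrite big_ord0 /= diracE mem_set// => i; by case: i.
rewrite big_ord_recl -IH// /= /cons_measure /pushforward.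
rewrite (_ : _ @^-1` _ = A ord0 `*` box (fun i => A (lift ord0 i))); last first.
  apply/seteqP; split => [[x t] h|[x t] [/= h1 h2] i].
    split => /=; first exact: (h ord0).
    by move=> i; have := h (lift ord0 i); rewrite /cons_prod tnthS.
  by case: (unliftP ord0 i) => [j ->|->]; rewrite /cons_prod ?tnthS//; exact: h2.
have mB : measurable (box (fun i : 'I_n => A (lift ord0 i))) by exact: measurable_box.
exact: (@product_measure1E _ _ _ _ _ mu (leb n) _ _ (mA ord0) mB).
Qed.

Definition permt n (s : 'S_n) (x : n.-tuple R) : n.-tuple R := [tuple tnth x (s i) | i < n].

Lemma tnth_permt n (s : 'S_n) (x : n.-tuple R) i : tnth (permt s x) i = tnth x (s i).
Proof. by rewrite tnth_mktuple. Qed.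

Lemma measurable_permt n (s : 'S_n) : measurable_fun setT (@permt n s).
Proof.
apply/measurable_fun_tnthP => i; rewrite (_ : _ \o _ = fun x => tnth x (s i)).
  exact: measurable_tnth.
by apply/funext => x; rewrite /= tnth_permt.
Qed.

Definition boxes n : set (set (n.-tuple R)) :=
  [set X | exists2 A : 'I_n -> set R, (forall i, measurable (A i)) & X = box A].

Lemma measurable_tuple_boxes n : @measurable _ (n.-tuple R) = <<s @boxes n >>.
Proof.
apply/seteqP; split.
  apply: smallest_sub; first exact: (@smallest_sigma_algebra _ setT (@boxes n)).
  case: n => [|n]; first by rewrite big_ord0.
  rewrite -bigcup_mkord_ord; apply: bigcup_sub => i Ii X [A mA <-].
  apply: sub_sigma_algebra; rewrite setTI.
  exists (fun j => if j == inord i then A else setT).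
    by move=> j; case: ifP.
  apply/seteqP; split => [x h j|x h]; first by case: eqP => // ->.
  by have := h (inord i); rewrite eqxx.
apply: smallest_sub; first exact: sigma_algebra_measurable.
by move=> X [A mA ->]; exact: measurable_box.
Qed.

(** Boxes form a generating pi-system, a permutation sends a box to a box with the same side
    lengths, and cubes exhaust the space; uniqueness of measures concludes. *)
Lemma lebesgue_tuple_permt n (s : 'S_n) (X : set (n.-tuple R)) : measurable X ->
  pushforward (leb n) (permt s) X = leb n X.
Proof.
move=> mX.
pose m1 := measure_function_pushforward__canonical__measure_function_Measure
  (leb n) (measurable_permt s).
apply: (@measure_unique _ R _ (@boxes n) (fun k => box (fun=> `[(- k%:R)%R, k%:R%R]%classic))
  _ _ _ _ m1 (leb n) _ _ X mX).
- exact: measurable_tuple_boxes.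
- move=> _ _ [A mA ->] [B mB ->]; exists (fun i => A i `&` B i).
    by move=> i; exact: measurableI.
  by apply/seteqP; split => [x [h1 h2] i|x h]; [split|split => i; have [] := h i].
- by move=> k; exists (fun=> `[(- k%:R)%R, k%:R%R]%classic).
- apply/seteqP; split => // x _.
  pose M := Num.bound (\sum_i `|tnth x i|).
  exists M => // i; rewrite /= in_itv/= -ler_norml ltW// (le_lt_trans _ (archi_boundP _))//.
    by rewrite (bigD1 i)//= lerDl sumr_ge0.
  exact: sumr_ge0.
- move=> _ [A mA ->]; rewrite /m1 /= /pushforward.
  rewrite (_ : _ @^-1` _ = box (fun i => A (s^-1%g i))).
    rewrite !lebesgue_tuple_box// (reindex_inj (@perm_inj _ s)).
    by apply: eq_bigr => i _; rewrite permK.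
  apply/seteqP; split => x h i; last by rewrite tnth_permt; have := h (s i); rewrite permK.
  by have := h (s^-1%g i); rewrite tnth_permt permKV.
- move=> k; rewrite /m1 /= /pushforward.
  rewrite (_ : _ @^-1` _ = box (fun=> `[(- k%:R)%R, k%:R%R]%classic)); last first.
    apply/seteqP; split => x h i; last by rewrite tnth_permt; exact: h.
    by have := h (s^-1%g i); rewrite tnth_permt permKV.
  rewrite lebesgue_tuple_box// -ge0_fin_numE; last exact: prode_ge0.
  apply: prode_fin_num => i _; rewrite lebesgue_measure_itv/=; case: ifP => // _.
Qed.

Lemma ge0_integral_permt n (s : 'S_n) (f : n.-tuple R -> \bar R) :
  measurable_fun setT f -> (forall x, 0 <= f x)%E ->
  (\int[leb n]_x f (permt s x) = \int[leb n]_x f x)%E.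
Proof.
move=> mf f0; pose m1 := measure_function_pushforward__canonical__measure_function_Measure
  (leb n) (measurable_permt s).
have /= <- := @ge0_integral_pushforward _ _ _ _ R (permt s) (measurable_permt s) (leb n) setT f measurableT mf (fun x _ => f0 x).
apply: (@eq_measure_integral _ _ _ setT (leb n) m1) => A mA _; exact: lebesgue_tuple_permt.
Qed.

Lemma integrable_permt n (s : 'S_n) (f : n.-tuple R -> R) :
  (leb n).-integrable setT (EFin \o f) -> (leb n).-integrable setT (EFin \o (f \o permt s)).
Proof.
move=> /integrableP[mf foo]; apply/integrableP; split.
  by apply: (measurableT_comp mf); exact: measurable_permt.
rewrite (ge0_integral_permt s (f := fun x => `|(f x)%:E|%E))//.
exact: measurableT_comp.
Qed.

Lemma integral_permt n (s : 'S_n) (f : n.-tuple R -> R) :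
  (leb n).-integrable setT (EFin \o f) ->
  \int[leb n]_x f (permt s x) = \int[leb n]_x f x.
Proof.
move=> intf; have intf' := integrable_permt s intf.
pose m1 := measure_function_pushforward__canonical__measure_function_Measure
  (leb n) (measurable_permt s).
rewrite /Rintegral; congr fine.
have /= <- := @integral_pushforward _ _ _ _ R (permt s) (measurable_permt s) (leb n) setT (EFin \o f) (measurable_int (leb n) intf) intf' measurableT.
apply: (@eq_measure_integral _ _ _ setT (leb n) m1) => A mA _; exact: lebesgue_tuple_permt.
Qed.

Lemma card_weyl_permt n (x : n.-tuple R) : uniq x ->
  #|[pred s : 'S_n | `[< @weyl_chamber R n (permt s x) >]]| = 1%N.
Proof.
(* The Weyl chamber is decreasing, so tuples are sorted for the reversed order. *)
move=> ux; pose r : rel R := fun a b => b <= a.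
have rtot : total r by move=> a b; rewrite /r orbC le_total.
have rtr : transitive r by move=> a b c ab bc; exact: (le_trans bc ab).
have rasym : antisymmetric r by move=> a b /andP[h1 h2]; apply/eqP; rewrite eq_le -/(r b a) -/(r a b) h1 h2.
have weylE (y : n.-tuple R) : @weyl_chamber R n y <-> sorted r y.
  split => [h|h i j ij].
    apply/(sortedP 0) => i; rewrite size_tuple => i1.
    have i0 : (i < n)%N by exact: ltn_trans i1.
    by have := h (Ordinal i0) (Ordinal i1) (leqnSn _); rewrite !(tnth_nth 0).
  rewrite !(tnth_nth 0); apply: (sorted_leq_nth rtr _ 0 h) => //; rewrite ?inE ?size_tuple//.
  by move=> a; rewrite /r.
have /tuple_permP[s sE] : perm_eq (sort_tuple r x) x by rewrite /= perm_sort.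
have sE' : permt s x = sort r x :> seq R by rewrite sE.
rewrite -(card1 s); apply: eq_card => t; rewrite !inE/=; apply/asboolP/eqP.
  move=> /weylE h; apply/permP => i.
  have e : permt t x = permt s x.
    apply/val_inj/(sorted_eq rtr rasym h); first by move: (sort_sorted rtot x); rewrite -sE'.
    apply: (@perm_trans _ x).
      by apply/tuple_permP; exists t.
    by rewrite [X in perm_eq _ X]sE' perm_sym perm_sort.
  have /(congr1 (fun y => tnth y i)) := e; rewrite !tnth_permt => /eqP.
  by rewrite !(tnth_nth 0) nth_uniq ?size_tuple// => /eqP/val_inj.
by move=> ->; apply/weylE; rewrite sE'; exact: sort_sorted.
Qed.

(* Exactly one permutation sorts a tuple without repetition, and the integrand
   vanishes on the other ones. *)
Lemma integral_weyl_chamber n (f : n.-tuple R -> R) :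
  (leb n).-integrable setT (EFin \o f) -> (forall s x, f (permt s x) = f x) ->
  (forall x : n.-tuple R, ~~ uniq x -> f x = 0) ->
  \int[leb n]_(x in @weyl_chamber R n) f x = n`!%:R^-1 * \int[leb n]_x f x.
Proof.
move=> intf fs f0; pose W : set (n.-tuple R) := @weyl_chamber R n.
have mW : measurable W by exact: measurable_weyl_chamber.
pose g x := \1_W x * f x.
have mg : measurable_fun setT g.
  by apply: measurable_funM; [exact: measurable_indic|exact: integrable_EFin_measurable intf].
have ig : (leb n).-integrable setT (EFin \o g).
  apply: (le_integrable_EFin measurableT (g := fun x => `|f x|)) => //.
    move=> x _; rewrite /g normrM indicE; case: (_ \in _); rewrite ?normr1 ?mul1r//.
    by rewrite normr0 mul0r.
  exact: integrable_norm.
have -> : \int[leb n]_(x in W) f x = \int[leb n]_x g x.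
  rewrite Rintegral_mkcond; apply: eq_Rintegral => x _.
  by rewrite patchE /g indicE; case: (_ \in _); rewrite ?mul1r ?mul0r.
have nf0 : n`!%:R != 0 :> R by rewrite pnatr_eq0 -lt0n fact_gt0.
apply: (mulfI nf0); rewrite mulVKf//.
have -> : n`!%:R * \int[leb n]_x g x = \sum_(s : 'S_n) \int[leb n]_x g (permt s x).
  under eq_bigr => s _ do rewrite (integral_permt s ig).
  by rewrite sumr_const card_Sn mulr_natl.
rewrite -Rintegral_sum//; last first.
  by move=> s _; exact: (integrable_permt s ig).
apply: eq_Rintegral => x _; rewrite /g.
under eq_bigr => s _ do rewrite fs.
rewrite -mulr_suml; have [ux|/f0 ->] := boolP (uniq x); last by rewrite mulr0.
rewrite (_ : \sum_(s : 'S_n) _ = 1) ?mul1r//.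
rewrite (eq_bigr (fun s : 'S_n => if s \in [pred s : 'S_n | `[< W (permt s x) >]] then 1 else 0)).
  by rewrite -big_mkcond/= sumr_const card_weyl_permt.
move=> s _; rewrite indicE [in RHS]inE/=.
by have [h|h] := pselect (W (permt s x)); [rewrite mem_set// asboolT|rewrite memNset// asboolF].
Qed.

Lemma measurable_tuple0 (f : 0.-tuple R -> R) : measurable_fun setT f.
Proof.
move=> _ Y mY; rewrite setTI.
have [h|h] := pselect (Y (f [tuple])).
  rewrite (_ : f @^-1` Y = setT); first exact: measurableT.
  by apply/seteqP; split => // x _; rewrite /= (tuple0 x).
rewrite (_ : f @^-1` Y = set0); first exact: measurable0.
by apply/seteqP; split => // x; rewrite /= (tuple0 x).
Qed.

Lemma lebesgue_tuple0 (f : 0.-tuple R -> R) :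
  (\int[leb 0]_x (f x)%:E = (f [tuple])%:E)%E.
Proof.
rewrite /= integral_dirac//; last by apply/measurable_EFinP; exact: measurable_tuple0.
by rewrite diracT mul1e.
Qed.

Lemma integrable_lebesgue_tuple0 (f : 0.-tuple R -> R) : (leb 0).-integrable setT (EFin \o f).
Proof.
apply/integrableP; split; first by apply/measurable_EFinP; exact: measurable_tuple0.
by rewrite (lebesgue_tuple0 (fun x => `|f x|)) ltry.
Qed.

Lemma ge0_integral_cons_tuple n (f : n.+1.-tuple R -> \bar R) :
  measurable_fun setT f -> (forall x, 0 <= f x)%E ->
  (\int[leb n.+1]_x f x = \int[mu \x leb n]_p f (cons_prod p))%E.
Proof.
move=> mf f0.
have := @ge0_integral_pushforward _ _ (measurableTypeR R * n.-tuple R)%type _ R (@cons_prod R n) (@measurable_cons_prod R n)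
  (mu \x leb n)%E setT f measurableT mf (fun x _ => f0 x).
by rewrite preimage_setT => <-.
Qed.

Lemma integral_cons_tuple n (f : n.+1.-tuple R -> \bar R) :
  measurable_fun setT f -> (mu \x leb n)%E.-integrable setT (f \o @cons_prod R n) ->
  (\int[leb n.+1]_x f x = \int[mu \x leb n]_p f (cons_prod p))%E.
Proof.
move=> mf intf; rewrite -(preimage_setT (@cons_prod R n)) in intf.
have := @integral_pushforward _ _ (measurableTypeR R * n.-tuple R)%type _ R (@cons_prod R n) (@measurable_cons_prod R n)
  (mu \x leb n)%E setT f mf intf measurableT.
by rewrite preimage_setT => <-.
Qed.

Lemma prod_tuple_integral n (f : 'I_n -> R -> R) :
  (forall i, mu.-integrable setT (EFin \o f i)) ->
  (leb n).-integrable setT (EFin \o (fun x => \prod_i f i (tnth x i))) /\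
  \int[leb n]_x (\prod_i f i (tnth x i)) = \prod_i \int[mu]_x f i x.
Proof.
elim: n f => [|n IH] f intf.
  split; first exact: integrable_lebesgue_tuple0.
  by rewrite /Rintegral lebesgue_tuple0 !big_ord0.
have [i1 e1] := IH (fun i => f (lift ord0 i)) (fun i => intf (lift ord0 i)).
pose G (t : n.-tuple R) : R := \prod_i f (lift ord0 i) (tnth t i).
have mf0 := integrable_EFin_measurable (intf ord0).
have mG : measurable_fun setT G := integrable_EFin_measurable i1.
pose F (p : R * n.-tuple R) : R := f ord0 p.1 * G p.2.
have mF : measurable_fun setT F.
  apply: measurable_funM.
    by apply: (measurableT_comp mf0); exact: measurable_fst.
  by apply: (measurableT_comp mG); exact: measurable_snd.
have intF : (mu \x leb n)%E.-integrable setT (EFin \o F).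
  apply/(integrable12ltyP mu (leb n) _).2; first exact/measurable_EFinP.
  have h x : (\int[leb n]_y `|(EFin \o F) (x, y)| = `|f ord0 x|%:E * \int[leb n]_y `|G y|%:E)%E.
    rewrite -ge0_integralZl_EFin//; last by apply/measurable_EFinP; exact: measurableT_comp.
    by apply: eq_integral => y _; rewrite /F /= normrM EFinM.
  under eq_integral do rewrite h.
  rewrite ge0_integralZr//; last 2 first.
  - by apply/measurable_EFinP; exact: measurableT_comp.
  - exact: integral_ge0.
  apply: lte_mul_pinfty.
  - exact: integral_ge0.
  - by rewrite ge0_fin_numE ?integral_ge0//; have /integrableP[] := intf ord0.
  - by have /integrableP[] := i1.
have FE : (fun p => \prod_i f i (tnth (cons_prod p) i)) = F.
  apply/funext => p; rewrite big_ord_recl /F /G; congr (_ * _).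
  by apply: eq_bigr => i _; rewrite /cons_prod tnthS.
have mP : measurable_fun setT (fun x : n.+1.-tuple R => \prod_i f i (tnth x i)).
  apply: measurable_prod => i _.
  apply: (measurableT_comp (integrable_EFin_measurable (intf i))); exact: measurable_tnth.
have mP' := (measurable_EFinP _ _).2 mP.
have intF' : (mu \x leb n)%E.-integrable (@cons_prod R n @^-1` setT)
    ((EFin \o (fun x => \prod_i f i (tnth x i))) \o @cons_prod R n).
  by rewrite preimage_setT; move: intF; rewrite -FE.
split.
  apply/integrableP; split => //.
  rewrite (ge0_integral_cons_tuple (f := fun x => `|(\prod_i f i (tnth x i))%:E|%E))//; first by have /integrableP[] := intF'.
  exact: measurableT_comp.
rewrite big_ord_recl -e1 {1}/Rintegral.
have -> : (\int[leb n.+1]_x (\prod_i f i (tnth x i))%:E = \int[mu \x leb n]_p (F p)%:E)%E.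
  rewrite (integral_cons_tuple (f := EFin \o (fun x => \prod_i f i (tnth x i)))) ?preimage_setT//.
  by apply: eq_integral => p _; rewrite -FE.
rewrite -(integral12_prod_meas1 intF) /fubini_F.
have h x : (\int[leb n]_y (EFin \o F) (x, y) = (f ord0 x)%:E * (\int[leb n]_y G y)%:E)%E.
  by rewrite EFin_Rintegral// -integralZl//.
under eq_integral do rewrite h.
have i0 := intf ord0.
transitivity (fine (\int[mu]_x ((f ord0 x)%:E * (\int[leb n]_y G y)%R%:E))%E); first by [].
rewrite (integralZr measurableT i0) fineM ?integrable_fin_num//.
Qed.

End LebesgueTupleTheory.

(** * Integrals of products of determinants and correlation functions *)

Section DeterminantalAlgebra.
Context {R : realType}.
Notation mu := (@lebesgue_measure R).
Notation leb n := (@lebesgue_tuple R n).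
Local Notation intg f := (mu.-integrable setT (EFin \o f)).

Definition evalmx n m (f : 'I_m -> R -> R) (x : n.-tuple R) : 'M[R]_(n, m) :=
  \matrix_(j, a) f a (tnth x j).

(** The factor [G j] may depend on the coordinate [j]. This freedom allows test functions to be
    inserted at chosen coordinates when correlation sums are computed. *)
Lemma integral_two_dets n (G f g : 'I_n -> R -> R) :
  (forall j a b, intg (fun x => G j x * f a x * g b x)) ->
  (leb n).-integrable setT (EFin \o (fun x =>
     \prod_j G j (tnth x j) * \det (evalmx f x) * \det (evalmx g x))) /\
  \int[leb n]_x (\prod_j G j (tnth x j) * \det (evalmx f x) * \det (evalmx g x)) =
  \sum_(s : 'S_n) \sum_(t : 'S_n) (-1) ^+ s * (-1) ^+ t *
    \prod_j \int[mu]_x (G j x * f (s j) x * g (t j) x).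
Proof.
move=> intG.
have E x : \prod_j G j (tnth x j) * \det (evalmx f x) * \det (evalmx g x) =
   \sum_(s : 'S_n) \sum_(t : 'S_n) (-1) ^+ s * (-1) ^+ t *
    \prod_j (G j (tnth x j) * f (s j) (tnth x j) * g (t j) (tnth x j)).
  have detE (u : 'I_n -> R -> R) : \det (evalmx u x) = \sum_(s : 'S_n) (-1) ^+ s * \prod_j u (s j) (tnth x j).
    by apply: eq_bigr => s _; congr (_ * _); apply: eq_bigr => j _; rewrite mxE.
  rewrite !detE [X in X * _]mulr_sumr mulr_suml; apply: eq_bigr => s _.
  rewrite mulr_sumr; apply: eq_bigr => t _; rewrite !big_split/=.
  have aux (u v b c d : R) : u * (v * b) * (c * d) = v * c * (u * b * d) by ring.
  exact: aux.
pose h (s t : 'S_n) j x := G j x * f (s j) x * g (t j) x.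
have hi s t j : intg (h s t j) by exact: intG.
have P s t := @prod_tuple_integral R n (h s t) (hi s t).
have mT : measurable [set: n.-tuple R] by [].
have Ist (s t : 'S_n) : (leb n).-integrable setT (EFin \o (fun x => (-1) ^+ s * (-1) ^+ t *
    \prod_j (G j (tnth x j) * f (s j) (tnth x j) * g (t j) (tnth x j)))).
  by apply: integrableZ_EFin => //; have [] := P s t.
split.
  rewrite (_ : EFin \o _ = EFin \o (fun x => \sum_(s : 'S_n) \sum_(t : 'S_n) (-1) ^+ s * (-1) ^+ t *
    \prod_j (G j (tnth x j) * f (s j) (tnth x j) * g (t j) (tnth x j)))).
    by apply: integrable_sum_EFin => // s _; exact: integrable_sum_EFin.
  by apply/funext => x /=; rewrite E.
under eq_Rintegral do rewrite E.
rewrite Rintegral_sum//; last by move=> s _; exact: integrable_sum_EFin.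
apply: eq_bigr => s _; rewrite Rintegral_sum//; apply: eq_bigr => t _.
rewrite RintegralZl//; last by have [] := P s t.
by congr (_ * _); have [_ ->] := P s t.
Qed.

(** Andréief's identity. In the double sum over [s] and [t], the substitution of [s * t] for [t]
    cancels the sign of [s], so each of the [n!] permutations [s] contributes the same
    determinant. *)
Lemma andreief n (f g : 'I_n -> R -> R) : (forall a b, intg (fun x => f a x * g b x)) ->
  (leb n).-integrable setT (EFin \o (fun x => \det (evalmx f x) * \det (evalmx g x))) /\
  \int[leb n]_x (\det (evalmx f x) * \det (evalmx g x)) =
  n`!%:R * \det (\matrix_(a, b) \int[mu]_x (f a x * g b x)).
Proof.
move=> intfg; have := @integral_two_dets n (fun=> cst 1) f g.
have G1 (x : n.-tuple R) : \prod_(j < n) (cst 1 (tnth x j) : R) = 1 by rewrite big1.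
case; first by move=> j a b; under eq_fun do rewrite mul1r; exact: intfg.
under eq_fun do rewrite G1 mul1r.
move=> i1 ->; split => //.
under eq_bigr do under eq_bigr do under eq_bigr do under eq_Rintegral do rewrite mul1r.
rewrite (eq_bigr (fun=> \det (\matrix_(a, b) \int[mu]_x (f a x * g b x)))).
  by rewrite sumr_const card_Sn mulr_natl.
move=> s _; rewrite (reindex_inj (mulgI s))/=; apply: eq_bigr => t _.
rewrite odd_permM signr_addb mulrA -signr_addb addbb mul1r; congr (_ * _).
rewrite [RHS](reindex_inj (@perm_inj _ s))/=; apply: eq_bigr => j _.
by rewrite mxE permM.
Qed.

(** Rows outside the image of [s] are rows of the identity, and expansion along them deletes one
    index at a time. When none is left, [s] is a bijection, which permutes rows and columns
    alike. *)
Lemma det_identity_rows n l (M : 'M[R]_n) (s : 'I_l -> 'I_n) : injective s ->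
  (forall j k, (forall i, s i != j) -> M j k = (j == k)%:R) ->
  \det M = \det (\matrix_(i < l, j < l) M (s i) (s j)).
Proof.
elim: n => [|n IH] in l M s * => sI hM.
  have l0 : l = 0%N by case: l s sI hM => // l s; case: (s ord0).
  by subst l; rewrite !det_mx00.
have [/existsP[j0 /forallP hj0]|] := boolP [exists j, [forall i, s i != j]].
  rewrite (expand_det_row _ j0) (bigD1 j0)//= big1 ?addr0; last first.
    by move=> k kj; rewrite hM// eq_sym (negbTE kj) mul0r.
  rewrite hM// eqxx mul1r /cofactor -signr_odd addnn odd_double mul1r.
  have s'E i : {k | s i = lift j0 k}.
    by case: (unliftP j0 (s i)) => [k e|e]; [exists k|have := hj0 i; rewrite e eqxx].
  pose s' i := sval (s'E i).
  have es i : s i = lift j0 (s' i) by exact: (svalP (s'E i)).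
  rewrite (IH l _ s').
  - by congr (\det _); apply/matrixP => i j; rewrite !mxE !es.
  - by move=> i j e; apply: sI; rewrite !es e.
  - move=> j k h; rewrite !mxE hM ?(inj_eq lift_inj)// => i.
    by rewrite es (inj_eq lift_inj).
rewrite negb_exists => /forallP hs.
have ls : l = n.+1.
  apply/eqP; rewrite eqn_leq; apply/andP; split.
    by have := leq_card s sI; rewrite !card_ord.
  rewrite -[leqLHS](card_ord) -[leqRHS](card_ord l) -(card_codom sI); apply/subset_leq_card/fintype.subsetP => j _.
  by have := hs j; rewrite negb_forall => /existsP[i]; rewrite negbK => /eqP <-; exact: codom_f.
subst l; pose t := perm sI.
rewrite (_ : (\matrix_(i, j) _) = row_perm t (col_perm t M)); last first.
  by apply/matrixP => i j; rewrite !mxE !permE.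
rewrite row_permE col_permE !det_mulmx !det_perm odd_permV.
by rewrite mulrC -mulrA -signr_addb addbb mulr1.
Qed.

Section Orthonormal.
Variables (n : nat) (phi : 'I_n -> R -> R).
Hypothesis phi_on : forall a b, intg (fun x => phi a x * phi b x) /\
  \int[mu]_x (phi a x * phi b x) = (a == b)%:R.

Definition gram (f : R -> R) : 'M[R]_n := \matrix_(a, b) \int[mu]_x (f x * phi a x * phi b x).

Definition admissible (f : R -> R) := forall a b, intg (fun x => f x * phi a x * phi b x).

(* Expectation of a symmetric function in the determinantal ensemble of
   [phi_0, ..., phi_(n-1)]. *)
Definition ensembleE (g : n.-tuple R -> R) : R :=
  n`!%:R^-1 * \int[leb n]_x (g x * \det (evalmx phi x) ^+ 2).

Definition corr_kernel (x y : R) : R := \sum_a phi a x * phi a y.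

Let nf0 : n`!%:R != 0 :> R. Proof. by rewrite pnatr_eq0 -lt0n fact_gt0. Qed.

Lemma det_evalmx_scale (G : R -> R) (x : n.-tuple R) :
  \det (evalmx (fun a x => G x * phi a x) x) = (\prod_j G (tnth x j)) * \det (evalmx phi x).
Proof.
rewrite (_ : evalmx _ _ = diag_mx (\row_j G (tnth x j)) *m evalmx phi x); last first.
  by apply/matrixP => i j; rewrite mul_diag_mx !mxE.
rewrite det_mulmx det_diag; congr (_ * _).
by apply: eq_bigr => j _; rewrite mxE.
Qed.

Lemma ensembleE_prod (G : R -> R) : admissible G ->
  (leb n).-integrable setT (EFin \o (fun x => \prod_j G (tnth x j) * \det (evalmx phi x) ^+ 2)) /\
  ensembleE (fun x => \prod_j G (tnth x j)) = \det (gram G).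
Proof.
move=> aG; have [i1 e1] := @andreief n (fun a x => G x * phi a x) phi aG.
have E x : \det (evalmx (fun a x => G x * phi a x) x) * \det (evalmx phi x) =
    (\prod_j G (tnth x j)) * \det (evalmx phi x) ^+ 2.
  by rewrite det_evalmx_scale expr2 mulrA.
split; first by move: i1; under eq_fun do rewrite E.
rewrite /ensembleE; under eq_Rintegral do rewrite -E.
by rewrite e1 mulKf.
Qed.

Lemma admissible1 : admissible (cst 1).
Proof. by move=> a b; under eq_fun do rewrite mul1r; have [] := phi_on a b. Qed.

Lemma ensembleE1 : ensembleE (fun=> 1) = 1.
Proof.
have [_] := ensembleE_prod admissible1.
rewrite (_ : (fun x => _) = fun=> 1); last by apply/funext => x; rewrite big1.
move=> ->; rewrite (_ : gram _ = 1%:M) ?det1//.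
apply/matrixP => a b; rewrite !mxE; under eq_Rintegral do rewrite mul1r.
by have [_ ->] := phi_on a b.
Qed.

(** The statistic over ordered [l]-tuples of distinct particles; its expectation is the integral of
    the test functions against the [l]-point correlation function. *)
Definition inj_sum l (f : 'I_l -> R -> R) (x : n.-tuple R) : R :=
  \sum_(s : {ffun 'I_l -> 'I_n} | injectiveb s) \prod_i f i (tnth x (s i)).

(** By orthonormality a coordinate without test function yields an identity row, so each [n] by [n]
    determinant collapses to an [l] by [l] one. Averaging over the row permutations makes all
    injections equivalent, and maps [a] that are not injective may be added because they repeat a
    column. *)
Lemma ensembleE_inj_sum l (f : 'I_l -> R -> R) : (forall i, admissible (f i)) ->
  (leb n).-integrable setT (EFin \o (fun x => inj_sum f x * \det (evalmx phi x) ^+ 2)) /\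
  ensembleE (inj_sum f) =
  \sum_(a : {ffun 'I_l -> 'I_n}) \det (\matrix_(i, j) gram (f i) (a i) (a j)).
Proof.
move=> af.
(* The product of the test functions sitting at particle [j]: a single [f i], or [1] if [j] is not
   in the image of the injection [s]. *)
pose G (s : {ffun 'I_l -> 'I_n}) (j : 'I_n) : R -> R :=
  fun x => \prod_(i | s i == j) f i x.
have GE (s : {ffun 'I_l -> 'I_n}) j : injectiveb s ->
    (exists2 i, s i = j & G s j = f i) \/ ((forall i, s i != j) /\ G s j = cst 1).
  move=> /injectiveP sI; have [/existsP[i /eqP e]|] := boolP [exists i, s i == j].
    left; exists i => //; apply/funext => x; rewrite /G (bigD1 i) ?e ?eqxx//= big1 ?mulr1//.
    by move=> k /andP[/eqP h1]; rewrite -e in h1; rewrite (sI _ _ h1) eqxx.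
  rewrite negb_exists => /forallP h; right; split => //.
  by apply/funext => x; rewrite /G big1// => i; rewrite (negbTE (h i)).
have aG (s : {ffun 'I_l -> 'I_n}) j : injectiveb s -> admissible (G s j).
  by move=> sI; have [[i _ ->]|[_ ->]] := GE s j sI; [exact: af|exact: admissible1].
have prodG (s : {ffun 'I_l -> 'I_n}) (x : n.-tuple R) : \prod_i f i (tnth x (s i)) = \prod_j G s j (tnth x j).
  rewrite (partition_big s predT)//=; apply: eq_bigr => j _.
  by apply: eq_bigr => i /eqP ->.
pose T s x := \prod_j G s j (tnth x j) * \det (evalmx phi x) * \det (evalmx phi x).
have P (s : {ffun 'I_l -> 'I_n}) (sI : injectiveb s) :=
  @integral_two_dets n (G s) phi phi (fun j a b => aG s j sI a b).
have E x : inj_sum f x * \det (evalmx phi x) ^+ 2 = \sum_(s : {ffun 'I_l -> 'I_n} | injectiveb s) T s x.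
  rewrite /inj_sum mulr_suml; apply: eq_bigr => s _.
  by rewrite prodG expr2 mulrA.
have mT : measurable [set: n.-tuple R] by [].
split.
  under eq_fun do rewrite E.
  by apply: integrable_sum_EFin => // s sI; have [] := P s sI.
rewrite /ensembleE; under eq_Rintegral do rewrite E.
rewrite Rintegral_sum//; last by move=> s sI; have [] := P s sI.
have key (s : {ffun 'I_l -> 'I_n}) : injectiveb s -> \int[leb n]_x T s x =
    \sum_(r : 'S_n) \det (\matrix_(i, j) gram (f i) (r (s i)) (r (s j))).
  move=> sI; have [_ ->] := P s sI; apply: eq_bigr => r _.
  have sI' : injective s by exact/injectiveP.
  have := @det_identity_rows n l (\matrix_(j, k) gram (G s j) (r j) (r k)) s sI'.
  have -> : \matrix_(i, j) (\matrix_(j0, k) gram (G s j0) (r j0) (r k)) (s i) (s j) =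
      \matrix_(i, j) gram (f i) (r (s i)) (r (s j)) :> 'M[R]_l.
    apply/matrixP => i j; rewrite mxE [LHS]mxE [RHS]mxE.
    have [[i' e ->]|[h _]] := GE s (s i) sI; first by rewrite (sI' _ _ e).
    by have := h i; rewrite eqxx.
  move=> <-.
    rewrite (reindex_inj (mulIg r))/=; apply: eq_bigr => t _.
    rewrite odd_permM [_ (+) _]addbC signr_addb mulrA -signr_addb addbb mul1r; congr (_ * _).
    by apply: eq_bigr => j _; rewrite !mxE permM.
  move=> j k h; rewrite !mxE.
  have [[i e _]|[_ ->]] := GE s j sI; first by have := h i; rewrite e eqxx.
  under eq_Rintegral do rewrite mul1r.
  by have [_ ->] := phi_on (r j) (r k); rewrite (inj_eq perm_inj).
rewrite (eq_bigr _ key) exchange_big/=.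
rewrite (eq_bigr (fun=> \sum_(a : {ffun 'I_l -> 'I_n} | injectiveb a) \det (\matrix_(i, j) gram (f i) (a i) (a j)))).
  rewrite sumr_const card_Sn -[X in _ * X]mulr_natl mulKf//.
  rewrite big_mkcond; apply: eq_bigr => a _; case: ifPn => // /injectivePn[i [j ij e]].
  by rewrite -det_tr (@determinant_alternate _ _ _ i j ij)// => k; rewrite !mxE e.
move=> r _; pose h (a : {ffun 'I_l -> 'I_n}) := [ffun i => r (a i)].
pose h' (a : {ffun 'I_l -> 'I_n}) := [ffun i => (r^-1)%g (a i)].
have hK : cancel h h' by move=> a; apply/ffunP => i; rewrite !ffunE permK.
rewrite [RHS](reindex_inj (can_inj hK))/=; apply: eq_big => a.
  apply/injectiveP/injectiveP => aI i j; first by rewrite !ffunE => /perm_inj/aI.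
  by move=> e; apply: aI; rewrite !ffunE e.
by move=> _; congr (\det _); apply/matrixP => i j; rewrite !mxE !ffunE.
Qed.

(** Expanding each kernel entry over the index [a] and integrating coordinate by coordinate gives
    the sum already found for [inj_sum]. Comparing the two shows that the kernel determinants are
    the correlation functions. *)
Lemma integral_corr_kernel l (f : 'I_l -> R -> R) : (forall i, admissible (f i)) ->
  (leb l).-integrable setT (EFin \o (fun z =>
    (\prod_i f i (tnth z i)) * \det (\matrix_(i, j) corr_kernel (tnth z i) (tnth z j)))) /\
  \int[leb l]_z ((\prod_i f i (tnth z i)) * \det (\matrix_(i, j) corr_kernel (tnth z i) (tnth z j))) =
  \sum_(a : {ffun 'I_l -> 'I_n}) \det (\matrix_(i, j) gram (f i) (a i) (a j)).
Proof.
move=> af.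
pose T (a : {ffun 'I_l -> 'I_n}) (s : 'S_l) i x := f i x * phi (a i) x * phi (a (s i)) x.
have P a s := @prod_tuple_integral R l (T a s) (fun i => af i (a i) (a (s i))).
have E z : (\prod_i f i (tnth z i)) * \det (\matrix_(i, j) corr_kernel (tnth z i) (tnth z j)) =
  \sum_(a : {ffun 'I_l -> 'I_n}) \sum_(s : 'S_l) (-1) ^+ s * \prod_i T a s i (tnth z i).
  rewrite exchange_big/= (reindex_inj invg_inj)/= /determinant mulr_sumr; apply: eq_bigr => s _.
  rewrite mulrCA odd_permV -mulr_sumr; congr (_ * _).
  rewrite [X in _ * X](eq_bigr (fun i => \sum_a phi a (tnth z i) * phi a (tnth z (s i)))); last by move=> i _; rewrite mxE.
  rewrite bigA_distr_bigA mulr_sumr; apply: eq_bigr => a _.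
  rewrite !big_split/= mulrA; congr (_ * _).
  rewrite [RHS](reindex_inj (@perm_inj _ s)); apply: eq_bigr => i _.
  by rewrite permK.
have mT : measurable [set: l.-tuple R] by [].
have I1 a (s : 'S_l) : (leb l).-integrable setT (EFin \o (fun z => (-1) ^+ s * \prod_i T a s i (tnth z i))).
  by apply: integrableZ_EFin => //; have [] := P a s.
split.
  under eq_fun do rewrite E.
  by apply: integrable_sum_EFin => // a _; exact: integrable_sum_EFin.
under eq_Rintegral do rewrite E.
rewrite Rintegral_sum//; last by move=> a _; exact: integrable_sum_EFin.
apply: eq_bigr => a _; rewrite Rintegral_sum//; apply: eq_bigr => s _.
rewrite RintegralZl//; last by have [] := P a s.
congr (_ * _); have [_ ->] := P a s; apply: eq_bigr => i _; rewrite !mxE//.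
Qed.

End Orthonormal.
End DeterminantalAlgebra.

(** * Hadamard's inequality for positive semidefinite matrices *)

Section Hadamard.
Context {R : realType}.
Implicit Types (n : nat).

Definition psd n (A : 'M[R]_n) : Prop :=
  A^T = A /\ forall v : 'rV[R]_n, 0 <= (v *m A *m v^T) 0 0.

(** With [y = v A], the quadratic form at [t v + y] is affine in [t] once it vanishes at [v].
    Nonnegativity forces the slope, twice the squared norm of [y], to be [0]. *)
Lemma psd_null n (A : 'M[R]_n) (v : 'rV[R]_n) : psd A ->
  (v *m A *m v^T) 0 0 = 0 -> v *m A = 0.
Proof.
move=> [sA pA] v0; set y := v *m A.
have yyE : (v *m A *m y^T) 0 0 = \sum_j y 0 j ^+ 2.
  by rewrite -/y mxE; apply: eq_bigr => j _; rewrite [y^T j 0]mxE expr2.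
have [c0|c0] := eqVneq ((v *m A *m y^T) 0 0) 0.
  apply/rowP => j; rewrite [RHS]mxE; apply/eqP; rewrite -sqrf_eq0.
  move: c0; rewrite yyE => /eqP; rewrite psumr_eq0; last by move=> i _; exact: sqr_ge0.
  by move=> /allP/(_ j); rewrite mem_index_enum => /(_ isT).
set c := (v *m A *m y^T) 0 0 in c0 *; set q := (y *m A *m y^T) 0 0.
(* With this [t] the form would take the value [-1]. *)
pose t := - (q + 1) / (2 * c).
have := pA (t *: v + y).
have -> : ((t *: v + y) *m A *m (t *: v + y)^T) 0 0 = t * (2 * c) + q.
  have D (X Y : 'M[R]_1) : (X + Y) 0 0 = X 0 0 + Y 0 0 by rewrite mxE.
  have Z (k : R) (X : 'M[R]_1) : (k *: X) 0 0 = k * X 0 0 by rewrite mxE.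
  rewrite linearD linearZ/= !mulmxDl !mulmxDr -!scalemxAl -!scalemxAr !(D, Z).
  have -> : (y *m A *m v^T) 0 0 = c.
    have T (X : 'M[R]_1) : X^T 0 0 = X 0 0 by rewrite mxE.
    by rewrite -T trmx_mul trmxK [(y *m A)^T]trmx_mul sA mulmxA.
  by rewrite -/c -/q v0; ring.
rewrite /t divfK ?mulf_neq0 ?pnatr_eq0//.
by rewrite opprD addrAC addNr add0r oppr_ge0 leNgt ltr01.
Qed.

(** Schur complement: [\det A] is [\det B] times [c = a - b B^-1 b^T]. Here [c] is a value of the
    quadratic form, hence nonnegative, and it is at most the corner entry because [b B^-1 b^T] is
    itself nonnegative. *)
Lemma hadamard_psd n (A : 'M[R]_n) : psd A ->
  0 <= \det A <= \prod_i A i i.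
Proof.
elim: n A => [|n IH] A pA; first by rewrite det_mx00 big_ord0 lexx ler01.
have diag_ge0 m (M : 'M[R]_m) i : psd M -> 0 <= M i i.
  move=> [_ /(_ (delta_mx 0 i))]; rewrite -rowE trmx_delta -colE !mxE//.
have [->|dA] := eqVneq (\det A) 0.
  by rewrite lexx prodr_ge0// => i _; exact: diag_ge0.
pose A' : 'M[R]_(1 + n) := A.
pose a := ulsubmx A'; pose b := ursubmx A'; pose B := drsubmx A'.
have [sA qA0] := pA.
have qA (v : 'rV[R]_(1 + n)) : 0 <= (v *m A' *m v^T) 0 0 by exact: qA0.
have AE : A' = block_mx a b b^T B.
  rewrite -[LHS]submxK; congr block_mx.
  by rewrite /b trmx_ursub /A' sA.
have pB : psd B.
  split; first by rewrite /B trmx_drsub /A' sA.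
  move=> v; have := qA (row_mx 0 v : 'rV_(1 + n)).
  by rewrite AE mul_row_block !mul0mx !add0r tr_row_mx mul_row_col trmx0 mulmx0 add0r.
have [sB qB] := pB.
(* A null vector of [B] padded with [0] annihilates the quadratic form of [A], hence is a null
   vector of [A], contrary to [\det A != 0]. *)
have uB : B \in unitmx.
  rewrite unitmxE unitfE; apply/negP => /det0P[v vn0 vB].
  have : (row_mx 0 v : 'rV_(1 + n)) *m A' = 0.
    apply: psd_null => //.
    rewrite AE mul_row_block !mul0mx !add0r tr_row_mx mul_row_col trmx0 mulmx0 add0r vB.
    by rewrite mul0mx mxE.
  move=> h; move/eqP: dA; apply; apply/eqP/det0P; exists (row_mx 0 v : 'rV_(1 + n)) => //.
  apply: contra vn0 => /eqP /(congr1 (@rsubmx _ 1 1 n)); rewrite row_mxKr => ->.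
  by rewrite linear0.
pose u := b *m invmx B.
have uBE : u *m B = b by rewrite /u mulmxKV.
have BuT : B *m u^T = b^T by have := congr1 trmx uBE; rewrite (trmx_mul u B) sB.
pose c := a - u *m b^T.
have dE : \det A = \det B * c 0 0.
  rewrite -[\det A]/(\det A') AE.
  have -> : block_mx a b b^T B = block_mx 1%:M u 0 1%:M *m block_mx c 0 b^T B.
    by rewrite mulmx_block !mul1mx !mul0mx !add0r /c subrK uBE.
  by rewrite det_mulmx det_ublock !det1 !mul1r det_lblock det_mx11 mulrC.
have /andP[dB0 dBle] := IH B pB.
have c0 : 0 <= c 0 0.
  have := qA (row_mx 1%:M (- u) : 'rV_(1 + n)).
  rewrite AE mul_row_block !mul1mx !mulNmx uBE subrr tr_row_mx mul_row_col.
  by rewrite trmx1 mulmx1 mul0mx addr0.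
have cle : c 0 0 <= A ord0 ord0.
  have -> : A ord0 ord0 = a 0 0 by rewrite !mxE; congr (A _ _); apply/val_inj.
  rewrite /c [in leLHS]mxE [X in _ + X]mxE lerBlDr lerDl.
  by have := qB u; rewrite -mulmxA BuT.
rewrite dE mulr_ge0//= big_ord_recl mulrC; apply: ler_pM => //.
apply: le_trans dBle _; rewrite le_eqVlt; apply/orP; left; apply/eqP.
by apply: eq_bigr => i _; rewrite !mxE; congr (A _ _); apply/val_inj.
Qed.

Lemma psd_gram_mx n m (Phi : 'M[R]_(n, m)) : psd (Phi *m Phi^T).
Proof.
split; first by rewrite trmx_mul trmxK.
move=> v; rewrite mulmxA -mulmxA -trmx_mul mxE sumr_ge0// => j _.
by rewrite [X in _ * X]mxE -expr2 sqr_ge0.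
Qed.

End Hadamard.

(** * Moments of the Hua-Pickrell measures *)

Section DensityIntegral.
Context d (T : measurableType d) (R : realType) (nu mu : {measure set T -> \bar R}).
Variables (D : set T) (f : T -> R).
Hypothesis mD : measurable D.
Hypothesis mf : measurable_fun setT f.
Hypothesis f0 : forall x, 0 <= f x.
Hypothesis nuE : forall A, measurable A -> (nu A = \int[mu]_(x in A `&` D) (f x)%:E)%E.
Import HBNNSimple.

Let density_indic (r : R) A : measurable A -> (0 <= r)%R ->
  (\int[nu]_x (r * \1_A x)%:E = \int[mu]_(x in D) ((r * \1_A x)%:E * (f x)%:E))%E.
Proof.
move=> mA r0.
have mfD : measurable_fun D (EFin \o f) by apply: measurable_funTS; exact/measurable_EFinP.
under eq_integral do rewrite EFinM.
rewrite ge0_integralZl_EFin//=; last first.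
  by apply/measurable_EFinP; exact: measurable_indic.
under [RHS]eq_integral do rewrite EFinM -muleA.
have m1 : measurable_fun D (fun x => (\1_A x)%:E * (f x)%:E)%E.
  by apply: emeasurable_funM => //; apply/measurable_EFinP; exact: measurable_indic.
rewrite [RHS]ge0_integralZl_EFin//=; last by move=> x _; rewrite mule_ge0// lee_fin.
congr (_ * _)%E; rewrite integral_indic// setIT nuE// setIC integral_mkcondr.
apply: eq_integral => x _; rewrite /patch indicE.
by case: (x \in A); rewrite ?mul1e ?mul0e.
Qed.

Let density_nnsfun (h : {nnsfun T >-> R}) :
  (\int[nu]_x (h x)%:E = \int[mu]_(x in D) ((h x)%:E * (f x)%:E))%E.
Proof.
have m1 r : measurable_fun setT (fun x => (r * \1_(h @^-1` [set r]) x)%:E).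
  by apply/measurable_EFinP; exact: measurable_funM.
under eq_integral do rewrite fimfunE -fsumEFin//.
rewrite ge0_integral_fsum//; last by move=> r x _; rewrite nnfun_muleindic_ge0.
under [RHS]eq_integral.
  move=> x _; rewrite fimfunE -fsumEFin// muleC ge0_mule_fsumr; last first.
    by move=> r; rewrite nnfun_muleindic_ge0.
  over.
rewrite [RHS]ge0_integral_fsum//; last 2 first.
- by move=> r; apply: emeasurable_funM; apply: measurable_funTS => //; exact/measurable_EFinP.
- move=> r x _; apply: mule_ge0; first by rewrite lee_fin.
  by rewrite EFinM; exact: nnfun_muleindic_ge0.
apply: eq_fsbigr => r _; have [r0|r0] := leP 0 r.
  by rewrite density_indic//; apply: eq_integral => x _; rewrite muleC.
rewrite preimage_nnfun0//; under eq_integral do rewrite indic0 mulr0.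
by under [RHS]eq_integral do rewrite indic0 mulr0 mule0; rewrite !integral0.
Qed.

(** The measure is given by its values on sets only; the formula is carried from indicators to
    simple functions and then through increasing limits. *)
Lemma integral_density (g : T -> \bar R) : measurable_fun setT g -> (forall x, 0 <= g x)%E ->
  (\int[nu]_x g x = \int[mu]_(x in D) (g x * (f x)%:E))%E.
Proof.
move=> mg g0; pose g_ := nnsfun_approx measurableT mg.
transitivity (limn (fun n => \int[nu]_x (g_ n x)%:E)%E).
  rewrite -monotone_convergence//.
  - apply: eq_integral => y _; apply/esym/cvg_lim => //.
    by apply: cvg_nnsfun_approx.
  - by move=> n; exact/measurable_EFinP/measurable_funP.
  - by move=> n y _; rewrite lee_fin.
  - by move=> y _ m n mn; rewrite lee_fin; exact/lefP/nd_nnsfun_approx.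
rewrite [X in limn X](_ : _ = (fun n => \int[mu]_(x in D) ((g_ n x)%:E * (f x)%:E)))%E; last first.
  by apply/funext => n; rewrite density_nnsfun.
rewrite -monotone_convergence//.
- apply: eq_integral => y _; apply/cvg_lim => //.
  rewrite muleC; under eq_fun do rewrite muleC.
  by apply: cvgeZl => //; exact: cvg_nnsfun_approx.
- move=> n; apply: emeasurable_funM; last by apply: measurable_funTS; exact/measurable_EFinP.
  by apply: measurable_funTS; exact/measurable_EFinP/measurable_funP.
- by move=> n y _; rewrite mule_ge0// lee_fin.
- by move=> y _ m n mn; rewrite lee_wpmul2r// lee_fin//; exact/lefP/nd_nnsfun_approx.
Qed.

End DensityIntegral.

Lemma pred_ltnS (j N : nat) : (j < N)%N -> (j.-1 < N.+1)%N.
Proof. by case: j => // j /ltnW/ltnW. Qed.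

Lemma sum_pick (A : pzSemiRingType) n (F : 'I_n -> A) c i0 (P : pred 'I_n) :
  (forall i, P i = (i == i0)) -> \sum_i F i * (c * (P i)%:R) = F i0 * c.
Proof.
move=> PE; rewrite (bigD1 i0)//= big1 ?addr0 => [|i ii0]; rewrite PE ?eqxx ?mulr1//.
by rewrite (negbTE ii0) !mulr0.
Qed.

Lemma prod_nat_rev (A : comPzSemiRingType) (F : nat -> A) n :
  \prod_(1 <= j < n.+1) F (n - j)%N = \prod_(i < n) F i.
Proof.
rewrite big_add1/= big_nat_rev/= big_mkord; apply: eq_bigr => i _; rewrite add0n subnSK// subKn//.
exact: ltnW.
Qed.

#[local] Opaque Gamma cauchy_weight.

(** * Moment determinants of the Cauchy weight and the normalization constant *)

Section CauchyMoments.
Context {R : realType}.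
Notation mu := (@lebesgue_measure R).
Variable s : R.
Hypothesis s0 : 1 < 2 * s.

Definition cauchy_moment (N p : nat) : R := \int[mu]_x (x ^+ p * cauchy_weight (N%:R + s) x).
Local Notation m := cauchy_moment.

Lemma integrable_cauchy_moment N p : p.+1%:R < 2 * (N%:R + s) ->
  mu.-integrable setT (EFin \o (fun x => x ^+ p * cauchy_weight (N%:R + s) x)).
Proof.
move=> h; have := @integrable_poly_weight R 'X^p (N%:R + s); rewrite size_polyXn => /(_ h).
by apply: eq_integrable => // x _; rewrite /= hornerXn.
Qed.

(** The weight of level [N] is [1 + x^2] times that of level [N + 1]. Together with integration by
    parts this links the moments of the two levels. *)
Lemma cauchy_moment_split N p : p.+1%:R < 2 * (N%:R + s) ->
  m N p = m N.+1 p + m N.+1 p.+2.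
Proof.
move=> h; rewrite -RintegralD//; last 2 first.
- by apply: integrable_cauchy_moment; rewrite -natr1; lra.
- by apply: integrable_cauchy_moment; rewrite -!natr1 in h *; lra.
apply: eq_Rintegral => x _; rewrite -(cauchy_weightD1 (N%:R + s) x) !exprS.
by rewrite (_ : N.+1%:R + s = N%:R + s + 1); [ring|rewrite -natr1; ring].
Qed.

Lemma cauchy_moment_ibp N p : p%:R < 2 * (N%:R + s) ->
  p%:R * m N p.-1 = 2 * (N%:R + s) * m N.+1 p.+1.
Proof.
have s1 := s0; have s00 : 0 <= s by lra.
move=> h; have a0 : 0 <= N%:R + s by rewrite addr_ge0.
have := @Rintegral_poly_weight_derive R 'X^p (N%:R + s) a0; rewrite size_polyXn => h'.
have {}h' : _ := h' _; rewrite -natr1 ltrD2r in h'; have {h'} := h' h.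
have e : N.+1%:R + s = N%:R + s + 1 by rewrite -natr1; ring.
have i1 : mu.-integrable setT (EFin \o (fun x => p%:R * (x ^+ p.-1 * cauchy_weight (N%:R + s) x))).
  case: p h => [|p] h; last by apply: integrableZ_EFin => //; exact: integrable_cauchy_moment.
  by under eq_fun do rewrite mul0r; exact: integrable0.
have i2 : mu.-integrable setT (EFin \o (fun x => 2 * (N%:R + s) * (x ^+ p.+1 * cauchy_weight (N.+1%:R + s) x))).
  by apply: integrableZ_EFin => //; apply: integrable_cauchy_moment; rewrite -!natr1; lra.
have -> : \int[mu]_x ((('X^p : {poly R})^`() * (1 + 'X^2) - (2 * (N%:R + s))%:P * 'X * 'X^p).[x] * cauchy_weight (N%:R + s + 1) x) =
  \int[mu]_x (p%:R * (x ^+ p.-1 * cauchy_weight (N%:R + s) x) - 2 * (N%:R + s) * (x ^+ p.+1 * cauchy_weight (N.+1%:R + s) x)).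
  apply: eq_Rintegral => x _; rewrite -(cauchy_weightD1 (N%:R + s) x) e derivXn -scaler_nat.
  rewrite !(hornerD, hornerN, hornerM, hornerZ, hornerC, hornerX, hornerXn).
  by have aux (y A B W c d : R) : (c * A * (1 + y ^+ 2) + - (d * y * B)) * W =
    c * (A * ((1 + y ^+ 2) * W)) - d * (y * B * W) by [ring]; rewrite [x ^+ p.+1]exprS; exact: aux.
have e2 : \int[mu]_x (2 * (N%:R + s) * (x ^+ p.+1 * cauchy_weight (N.+1%:R + s) x)) =
    2 * (N%:R + s) * m N.+1 p.+1.
  by rewrite RintegralZl//; apply: integrable_cauchy_moment; rewrite -!natr1; lra.
rewrite (RintegralB measurableT i1 i2) e2 => /eqP; rewrite subr_eq0 => /eqP <-.
case: p h {i1 i2 e2} => [|p] h; last by rewrite RintegralZl//; exact: integrable_cauchy_moment.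
by rewrite mul0r; under eq_Rintegral do rewrite mul0r; rewrite Rintegral_cst// mul0r.
Qed.

Lemma cauchy_moment0 N : m N 0 = cauchy_mass (N%:R + s).
Proof. by apply: eq_Rintegral => x _; rewrite mul1r. Qed.

Definition moment_det N (l : 'I_N -> nat) : R := \det (\matrix_(k, j) m N (j + l k)).

(** A triangular column operation [C] turns the rows of level [N + 1] into multiples of rows of
    level [N]. The unshifted bottom row becomes zero outside its corner, so one expansion lowers [N]
    by one, and the factors [l k + 1] are the exponents brought down by differentiation. *)
Lemma moment_detS N (l : 'I_N -> nat) (l' : 'I_N.+1 -> nat) :
  l' ord0 = 0%N -> (forall k, l' (lift ord0 k) = (l k).+1) ->
  (forall k j : 'I_N, (j + l k).+1%:R < 2 * (N%:R + s)) ->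
  (\prod_(j < N) (2 * (N%:R + s) - j%:R)) * moment_det l' =
  m N.+1 0 * (\prod_(k < N) (l k).+1%:R) * moment_det l.
Proof.
move=> l0 lS hl; set a := N%:R + s.
(* Column [j + 1] holds the coefficients of [- (x^j w)' / w1], with [w] and [w1] the weights of
   levels [N] and [N + 1]. Integrated by parts against [x^(l' k)] it gives [l' k] times a moment of
   level [N]. *)
pose C : 'M[R]_N.+1 := \matrix_(i, c) (if c == ord0 then (i == ord0)%:R else
   (2 * a - c.-1%:R) * (i == c)%:R - c.-1%:R * (i.+2 == c)%:R).
pose M : 'M[R]_N.+1 := \matrix_(k, j) m N.+1 (j + l' k).
have detC : \det C = \prod_(j < N) (2 * a - j%:R).
  rewrite -det_tr det_trig; last first.
    apply/is_trig_mxP => i j ij; rewrite !mxE.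
    case: eqP => [i0|_]; first by rewrite -val_eqE/= gtn_eqF// (leq_trans _ ij).
    by rewrite -!val_eqE/= gtn_eqF// (gtn_eqF (leq_trans ij _))// ?mulr0 ?subr0// ltnW.
  rewrite big_ord_recl !mxE eqxx mul1r; apply: eq_bigr => j _.
  rewrite !mxE -[lift _ _ == _]val_eqE/= eqxx.
  have -> : ((bump 0 j).+2 == bump 0 j) = false by apply/negbTE; rewrite neq_ltn; apply/orP; right; rewrite !ltnS leqnSn.
  by rewrite mulr1 mulr0 subr0 add0n.
have CE i c : C i c = if c == ord0 then (i == ord0)%:R else
   (2 * a - c.-1%:R) * (i == c)%:R - c.-1%:R * (i.+2 == c)%:R by rewrite mxE.
have ME k j : M k j = m N.+1 (j + l' k) by rewrite mxE.
rewrite [moment_det l'](_ : _ = \det M)//.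
clearbody M C.
have MC k (j : 'I_N) : (M *m C) k (lift ord0 j) = (l' k)%:R * m N (j + l' k).-1.
  have hk : (j + l' k)%:R < 2 * a.
    have [i ->|->] := unliftP ord0 k; first by rewrite lS addnS.
    rewrite l0 addn0; have : j%:R <= N%:R :> R by rewrite ler_nat ltnW.
    by have s1 := s0; have : 0 <= N%:R :> R by []; rewrite /a; lra.
  have E1 := cauchy_moment_ibp hk.
  have E2 : \sum_i M k i * ((2 * a - j%:R) * (i == lift ord0 j)%:R) = (2 * a - j%:R) * m N.+1 (j + l' k).+1.
    rewrite (bigD1 (lift ord0 j))//= big1 => [|i ij]; last by rewrite (negbTE ij) !mulr0.
    by rewrite eqxx mulr1 addr0 mulrC ME lift0 addSn.
  rewrite mxE (eq_bigr (fun i => M k i * ((2 * a - j%:R) * (i == lift ord0 j)%:R) - M k i * (j%:R * (i.+2 == j.+1)%:R))); last first.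
    by move=> i _; rewrite CE lift0 mulrBr.
  rewrite big_split/= E2 sumrN.
  have [j0|j0] := posnP (j : nat).
    rewrite j0 add0n in E1 *; rewrite big1 ?subr0 => [|i _]; last by rewrite mul0r mulr0.
    by rewrite E1.
  have j1N := pred_ltnS (ltn_ord j).
  rewrite (@sum_pick _ _ (fun i => M k i) _ (Ordinal j1N)); last first.
    by move=> i; rewrite -val_eqE [nat_of_ord _]/= eqSS -{1}(prednK j0) eqSS.
  rewrite ME [nat_of_ord _]/=.
  have E3 : m N (j + l' k).-1 = m N.+1 (j.-1 + l' k) + m N.+1 (j + l' k).+1.
    have -> : (j + l' k).-1 = (j.-1 + l' k)%N by rewrite -[in LHS](prednK j0).
    rewrite cauchy_moment_split; first by rewrite -!addSn prednK.
    by rewrite -addSn prednK.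
  rewrite mulrBl -E1 natrD mulrDl.
  have -> : m N.+1 (j.-1 + l' k) = m N (j + l' k).-1 - m N.+1 (j + l' k).+1 by rewrite E3 addrK.
  by ring.
have MC0 k : (M *m C) k ord0 = M k ord0.
  rewrite mxE (bigD1 ord0)//= big1 ?addr0 => [|i i0]; rewrite CE ?eqxx ?mulr1//.
  by rewrite (negbTE i0) mulr0.
rewrite -detC mulrC -det_mulmx (expand_det_row _ ord0) (bigD1 ord0)//= big1 ?addr0; last first.
  move=> j j0; have [k ->|e] := unliftP ord0 j; last by rewrite e eqxx in j0.
  by rewrite MC l0 mul0r mul0r.
rewrite MC0 ME l0 addn0 /cofactor addn0 expr0 mul1r -mulrA; congr (_ * _).
rewrite (_ : row' ord0 (col' ord0 (M *m C)) = diag_mx (\row_(k < N) (l k).+1%:R) *m (\matrix_(k < N, j < N) m N (j + l k))); last first.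
  apply/matrixP => k j; rewrite mul_diag_mx [LHS]mxE [LHS]mxE MC lS !mxE.
  by rewrite addnS.
rewrite det_mulmx det_diag; congr (_ * _).
by apply: eq_bigr => k _; rewrite mxE.
Qed.

Definition moment_det0 N : R := moment_det (fun k : 'I_N => k : nat).

Let a_gt0 N (j : 'I_N) : 0 < 2 * (N%:R + s) - j%:R.
Proof.
have : j%:R <= N%:R :> R by rewrite ler_nat ltnW.
by have s1 := s0; have : 0 <= N%:R :> R by []; lra.
Qed.

Lemma moment_det0S N :
  (\prod_(j < N) (2 * (N%:R + s) - j%:R)) * moment_det0 N.+1 = m N.+1 0 * N`!%:R * moment_det0 N.
Proof.
rewrite (@moment_detS N (fun k => k) (fun k => k)) => //; last first.
  move=> k j; have : (j + k).+1%:R <= 2 * N%:R :> R.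
    rewrite -natrM ler_nat mul2n -addnn -addSn leq_add//; exact: ltnW.
  by have s1 := s0; lra.
by congr (_ * _ * _); rewrite fact_prod big_add1/= big_mkord natr_prod.
Qed.

(** [Gamma (2s + 2N + 1)], which enters through the mass of the Cauchy weight, is [N] functional
    equations away from [Gamma (2s + N + 1)]; these steps produce the product on the left. *)
Lemma hua_pickrell_constS N :
  (\prod_(j < N) (2 * (N%:R + s) - j%:R)) * hua_pickrell_const s N.+1 =
  cauchy_mass (N.+1%:R + s) * N`!%:R * hua_pickrell_const s N.
Proof.
have s1 := s0.
have GE n : \prod_(1 <= j < n.+1) (Gamma (2 * s + n%:R - j%:R + 1) / Gamma (s + n%:R - j%:R + 1) ^+ 2) =
   \prod_(i < n) (Gamma (2 * s + i%:R + 1) / Gamma (s + i%:R + 1) ^+ 2).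
  rewrite -(prod_nat_rev (fun i => Gamma (2 * s + i%:R + 1) / Gamma (s + i%:R + 1) ^+ 2)).
  apply: eq_big_nat => j /andP[_ jn].
  by rewrite natrB ?addrA//; exact: jn.
have GN : Gamma (2 * s + (2 * N)%:R + 1) =
    (\prod_(j < N) (2 * (N%:R + s) - j%:R)) * Gamma (2 * s + N%:R + 1).
  have K k : Gamma (2 * s + (N + k)%:R + 1) = (\prod_(j < k) (2 * s + (N + k)%:R - j%:R)) * Gamma (2 * s + N%:R + 1).
    elim: k => [|k IH]; first by rewrite big_ord0 mul1r addn0.
    rewrite GammaD1; last by clear -s1; rewrite addnS -natr1; have : 0 <= (N + k)%:R :> R by []; lra.
    rewrite big_ord_recl subr0 -mulrA; congr (_ * _).
    have -> : 2 * s + (N + k.+1)%:R = 2 * s + (N + k)%:R + 1 by rewrite addnS -natr1; ring.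
    rewrite IH; congr (_ * _); apply: eq_bigr => j _.
    by rewrite /= /bump add1n -[j.+1%:R]natr1; ring.
  rewrite mul2n -addnn K; congr (_ * _); apply: eq_bigr => j _; rewrite natrD; ring.
have N0 : 0 <= N%:R :> R by [].
rewrite cauchy_massE; last by clear -s1 N0; rewrite -natr1; lra.
rewrite /hua_pickrell_const !GE big_ord_recr/= /barnesG big_nat_recr//= Gamma_nat -/(barnesG _).
have -> : 2 * (N.+1%:R + s) - 1 = 2 * s + (2 * N)%:R + 1 by rewrite -natr1 natrM; ring.
rewrite GN.
have -> : N.+1%:R + s = s + N%:R + 1 by rewrite -natr1; ring.
have -> : - (N.+1%:R ^+ 2) - 2 * s * N.+1%:R = (1 - 2 * (s + N%:R + 1)) + (- (N%:R ^+ 2) - 2 * s * N%:R) :> R.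
  by rewrite -natr1; ring.
rewrite powRD ?pnatr_eq0 ?implybT//.
have aux (A B C D E F G H K L I : R) : A * (B * C * (D * E) * (F * L) * (G * (H / I))) =
  B * D * (A * H) / I * L * (C * E * F * G) by ring.
by rewrite exprS; exact: aux.
Qed.

(** Both sides equal [1] for [N = 0] and obey the same recursion. There is no factor [N!] because
    the Hua-Pickrell density lives on the ordered chamber. *)
Lemma moment_det0E N : moment_det0 N = hua_pickrell_const s N.
Proof.
have s1 := s0; have P0 n : 0 < \prod_(j < n) (2 * (n%:R + s) - j%:R) by exact: prodr_gt0.
elim: N => [|N IH].
  rewrite /moment_det0 /moment_det det_mx00 /hua_pickrell_const expr0 big_nil /barnesG big_nil.
  by rewrite expr0n/= oppr0 sub0r mulr0 oppr0 powRr0 !mulr1.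
by apply: (mulfI (lt0r_neq0 (P0 N))); rewrite moment_det0S hua_pickrell_constS IH cauchy_moment0.
Qed.

Lemma moment_det0_gt0 N : 0 < moment_det0 N.
Proof.
have s1 := s0; elim: N => [|N IH]; first by rewrite /moment_det0 /moment_det det_mx00.
have P0 : 0 < \prod_(j < N) (2 * (N%:R + s) - j%:R) by exact: prodr_gt0.
have N0 : 0 <= N%:R :> R by [].
rewrite -(pmulr_rgt0 _ P0) moment_det0S !mulr_gt0 ?ltr0n ?fact_gt0//.
rewrite cauchy_moment0 cauchy_massE; last by rewrite -natr1; lra.
rewrite !mulr_gt0 ?invr_gt0 ?exprn_gt0 ?powR_gt0 ?pi_gt0//; apply: Gamma_gt0; rewrite -natr1; lra.
Qed.

End CauchyMoments.

(** * Finite differences and leading coefficients *)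

Section PolynomialFacts.
Context {R : numFieldType}.

(** Induction through the forward difference [q(x) = p(x + 1) - p(x)], which lowers the degree and
    multiplies the top coefficient by [n + 1]; Pascal's rule matches the alternating sums. *)
Lemma finite_difference n (p : {poly R}) : (size p <= n.+1)%N ->
  \sum_(k < n.+1) (-1) ^+ (n - k) * 'C(n, k)%:R * p.[k%:R] = n`!%:R * p`_n.
Proof.
elim: n p => [|n IH] p sp.
  rewrite big_ord1 subnn expr0 bin0 !mul1r [in LHS](size1_polyC sp) hornerC.
  by [].
(* By Taylor's formula this is [p(x + 1) - p(x)], written so that its size and its top coefficient
   can be read off. *)
pose q := \sum_(i < size p | i != 0 :> nat) p^`N(i).
have qE x : q.[x] = p.[x + 1] - p.[x].
  have [p0|p0] := posnP (size p).
    move/eqP: p0; rewrite size_poly_eq0 => /eqP p0.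
    rewrite /q p0 !horner0 subr0 big1 ?horner0// => i _.
    by apply/polyP => j; rewrite coef_nderivn !coef0 mul0rn.
  rewrite nderiv_taylor ?/GRing.comm ?mulr1 ?mul1r// (bigD1 (Ordinal p0))//=.
  rewrite nderivn0 expr0 mulr1 addrAC subrr add0r horner_sum; apply: eq_big => // i _.
  by rewrite expr1n mulr1.
have cq j : q`_j = \sum_(i < size p | i != 0 :> nat) p`_(i + j) *+ 'C(i + j, i).
  by rewrite coef_sum; apply: eq_bigr => i _; rewrite coef_nderivn.
have sq : (size q <= n.+1)%N.
  apply/leq_sizeP => j nj; rewrite cq big1// => i i0.
  by rewrite nth_default ?mul0rn// (leq_trans sp)//; move: i0 nj; rewrite -lt0n; lia.
have qn : q`_n = p`_n.+1 *+ n.+1.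
  rewrite cq; have [|sp2] := leqP 2 (size p); last first.
    rewrite big1 ?nth_default ?mul0rn// => [|i].
    - by rewrite (leq_trans _ (ltn0Sn n))//; move: sp2; lia.
    - by move=> i0; have := ltn_ord i; move: i0 sp2; rewrite -lt0n; lia.
  move=> s2; rewrite (bigD1 (Ordinal s2))//= big1 ?addr0 => [|i /andP[i0 i1]].
    by rewrite add1n bin1.
  rewrite nth_default ?mul0rn// (leq_trans sp)// -addn2 addnC leq_add2r.
  by move: i0 i1; rewrite -val_eqE/=; case: (i : nat) => [|[|]].
have -> : (n.+1)`!%:R * p`_n.+1 = n`!%:R * q`_n by
  rewrite qn factS natrM -[p`_n.+1 *+ _]mulr_natl mulrA [n`!%:R * _]mulrC.
rewrite -(IH q sq).
under [RHS]eq_bigr do rewrite qE mulrBr -[_ + 1]/(_ + 1%:R) -natrD addn1.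
rewrite sumrB big_ord_recl [X in _ + X](_ : _ = 
  \sum_(i < n.+1) (-1) ^+ (n - i) * ('C(n, i.+1) + 'C(n, i))%:R * p.[i.+1%:R]); last first.
  by apply: eq_bigr => i _; rewrite lift0 binS subSS.
under [X in _ + X]eq_bigr do rewrite natrD mulrDr mulrDl.
rewrite big_split/= addrA addrC; congr (_ + _).
rewrite [in RHS]big_ord_recl opprD -!sumrN; congr (_ + _).
  by rewrite /= !bin0 !subn0 exprS mulN1r !mulNr.
rewrite big_ord_recr/= bin_small// mulr0 mul0r addr0; apply: eq_bigr => i _.
by rewrite [bump 0 i]/bump/= add1n -(subnSK (ltn_ord i)) exprS mulN1r !mulNr.
Qed.

Lemma poly_eq_nat n (p q : {poly R}) : (size p <= n.+1)%N -> (size q <= n.+1)%N ->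
  (forall k, (k <= n)%N -> p.[k%:R] = q.[k%:R]) -> p = q.
Proof.
move=> sp sq h; apply/eqP; rewrite -subr_eq0; apply/eqP.
apply: (@roots_geq_poly_eq0 _ _ [seq k%:R | k <- iota 0 n.+1]).
- apply/allP => x /mapP[k]; rewrite mem_iota => /andP[_ kn] ->.
  by rewrite rootE hornerD hornerN h// subrr.
- rewrite map_inj_uniq ?iota_uniq//; exact: mulrIn (oner_neq0 _).
- by rewrite size_map size_iota (leq_trans (size_polyD _ _))// size_polyN geq_max sp.
Qed.

End PolynomialFacts.

Lemma poly_lead_cvg (R : realType) n (p : {poly R}) : (size p <= n.+1)%N ->
  p.[N%:R] / N%:R ^+ n @[N --> \oo] --> p`_n.
Proof.
move=> sp; rewrite -(cvg_shiftS (fun N => p.[N%:R] / N%:R ^+ n)).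
(* The reciprocal polynomial: [p(N) / N^n = q(1/N)], and [q(0)] is the coefficient sought. *)
pose q := \poly_(i < n.+1) p`_(n - i).
have -> : (fun N => p.[N.+1%:R] / N.+1%:R ^+ n) = fun N => q.[harmonic N] :> R.
  apply/funext => N; rewrite (horner_coef_wide _ sp) mulr_suml horner_poly (reindex_inj rev_ord_inj).
  apply: eq_bigr => i _; rewrite -mulrA /= subSS; congr (_ * _); rewrite /harmonic exprVn.
  have e : (n - i + i)%N = n by rewrite subnK// leq_ord.
  by rewrite -[in X in _ / X]e exprD invfM mulrA mulfV ?mul1r// expf_neq0// pnatr_eq0.
have -> : p`_n = q.[0] by rewrite horner_coef0 coef_poly subn0.
by apply: (@cvg_comp _ _ _ harmonic (horner q)); [exact: cvg_harmonic|exact: continuous_horner].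
Qed.

Section PowerSums.
Context {R : realType}.

Definition monomials N (l : 'I_N -> nat) (k : 'I_N) (x : R) : R := x ^+ l k.

Definition content n N (g : 'I_n -> 'I_N) (t : 'I_N) : nat := #|[pred i | g i == t]|.

Lemma prod_content n N (g : 'I_n -> 'I_N) (y : 'I_N -> R) :
  \prod_i y (g i) = \prod_t y t ^+ content g t.
Proof.
rewrite (partition_big g xpredT)//=; apply: eq_bigr => t _.
rewrite (eq_bigr (fun=> y t)) => [|i /eqP -> //].
by rewrite prodr_const.
Qed.

(** The sum over all maps [g] is stable under relabelling by a permutation. In the Leibniz term of
    [s], the extra powers can thus be attached to the exponents of the monomials instead of to the
    variables. *)
Lemma power_sum_monomials n N (l : 'I_N -> nat) (x : N.-tuple R) :
  (\sum_i tnth x i) ^+ n * \det (evalmx (monomials l) x) =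
  \sum_(g : {ffun 'I_n -> 'I_N}) \det (evalmx (monomials (fun t => l t + content g t)%N) x).
Proof.
have -> : (\sum_i tnth x i) ^+ n = \sum_(g : {ffun 'I_n -> 'I_N}) \prod_i tnth x (g i).
  by rewrite -[in LHS](card_ord n) -prodr_const bigA_distr_bigA.
rewrite mulr_sumr exchange_big; apply: eq_bigr => s _.
rewrite mulrCA mulr_suml [in RHS](eq_bigr (fun g : {ffun 'I_n -> 'I_N} => (-1) ^+ s *
  \prod_j (evalmx (monomials (fun t => l t + content g t)%N) x) j (s j)))// -mulr_sumr.
congr (_ * _).
rewrite [RHS](reindex (fun g : {ffun 'I_n -> 'I_N} => [ffun i => s (g i)])); last first.
  exists (fun g : {ffun 'I_n -> 'I_N} => [ffun i => (s^-1)%g (g i)]) => g _; apply/ffunP => i;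
    by rewrite !ffunE ?permK ?permKV.
apply: eq_bigr => g _.
rewrite (prod_content g) -big_split/=; apply: eq_bigr => j _.
rewrite !mxE /monomials exprD mulrC; congr (_ * _ ^+ _).
by apply: eq_card => i; rewrite !inE ffunE (inj_eq perm_inj).
Qed.

Lemma det_evalmx_Vandermonde N (x : N.-tuple R) :
  \det (evalmx (monomials (fun k => k)) x) =
  \prod_(i < N) \prod_(j < N | (i < j)%N) (tnth x j - tnth x i).
Proof.
rewrite -det_tr (_ : _^T = Vandermonde N (\row_j tnth x j)).
  by rewrite det_Vandermonde; apply: eq_bigr => i _; apply: eq_bigr => j _; rewrite !mxE.
by apply/matrixP => i j; rewrite !mxE.
Qed.

Lemma det_evalmx_eq0 n (f : 'I_n -> R -> R) (x : n.-tuple R) : ~~ uniq x -> \det (evalmx f x) = 0.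
Proof.
move=> nu; have [i [j [ij e]]] : exists i j : 'I_n, i != j /\ tnth x i = tnth x j.
  apply: contrapT => h; move/negP: nu; apply; apply/tuple_uniqP => i j e.
  by apply: contrapT => /eqP ij; apply: h; exists i, j.
by apply: (determinant_alternate ij) => a; rewrite !mxE e.
Qed.

Lemma evalmx_permt n (f : 'I_n -> R -> R) (s : 'S_n) (x : n.-tuple R) :
  \det (evalmx f (permt s x)) = (-1) ^+ s * \det (evalmx f x).
Proof.
rewrite (_ : evalmx f (permt s x) = row_perm s (evalmx f x)).
  by rewrite row_permE det_mulmx det_perm.
by apply/matrixP => i j; rewrite !mxE tnth_permt.
Qed.

End PowerSums.

Section HuaPickrellMoments.
Context {R : realType}.
Notation mu := (@lebesgue_measure R).
Notation leb n := (@lebesgue_tuple R n).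

(** The [n]-th moment of the sum of the particles as a purely algebraic expression, which also makes
    sense for [N = 0] and can be studied as a function of [N] and of [s]. *)
Definition power_moment (s : R) n N : R :=
  \sum_(g : {ffun 'I_n -> 'I_N}) moment_det s (fun k => k + content g k)%N / moment_det0 s N.

Lemma content_le n N (g : 'I_n -> 'I_N) t : (content g t <= n)%N.
Proof. by rewrite -[leqRHS](card_ord n); exact: max_card. Qed.

Lemma integral_power_monomials (s : R) n N : 1 < 2 * s -> n%:R < 2 * s + 1 ->
  (leb N).-integrable setT (EFin \o (fun x : N.-tuple R => (\sum_i tnth x i) ^+ n *
     (\prod_j cauchy_weight (N%:R + s) (tnth x j) * \det (evalmx (monomials (fun k => k)) x) ^+ 2))) /\
  \int[leb N]_x ((\sum_i tnth x i) ^+ n *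
     (\prod_j cauchy_weight (N%:R + s) (tnth x j) * \det (evalmx (monomials (fun k => k)) x) ^+ 2)) =
  N`!%:R * \sum_(g : {ffun 'I_n -> 'I_N}) moment_det s (fun k => k + content g k)%N.
Proof.
move=> s1 ns.
pose F (g : {ffun 'I_n -> 'I_N}) (k : 'I_N) x : R :=
  monomials (fun t => t + content g t)%N k x * cauchy_weight (N%:R + s) x.
have E (x : N.-tuple R) : (\sum_i tnth x i) ^+ n *
     (\prod_j cauchy_weight (N%:R + s) (tnth x j) * \det (evalmx (monomials (fun k => k)) x) ^+ 2) =
   \sum_(g : {ffun 'I_n -> 'I_N}) \det (evalmx (F g) x) * \det (evalmx (monomials (fun k => k)) x).
  rewrite mulrCA expr2 (mulrA (_ ^+ _)) power_sum_monomials mulr_suml mulr_sumr.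
  apply: eq_bigr => g _; rewrite mulrA; congr (_ * _); rewrite -det_evalmx_scale.
  by congr (\det _); apply/matrixP => i j; rewrite !mxE mulrC.
have i1 g a b : mu.-integrable setT (EFin \o (fun x => F g a x * monomials (fun k : 'I_N => k) b x)).
  (* The largest exponent is [2 (N - 1) + n], so integrability amounts to [n < 2s + 1]. *)
  have : (b + (a + content g a)).+1%:R < 2 * (N%:R + s).
    apply: (@le_lt_trans _ _ (2 * N%:R + n%:R - 1)); last by lra.
    have h : ((b + (a + content g a)).+1.+1 <= 2 * N + n)%N.
      by have := content_le g a; have := ltn_ord a; have := ltn_ord b; lia.
    by rewrite lerBrDr -natrM -natrD natr1 ler_nat.
  move=> /integrable_cauchy_moment; apply: eq_integrable => // x _.
  by rewrite /F /monomials /= exprD; congr EFin; ring.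
have A g := andreief (i1 g).
split.
  apply: (@eq_integrable _ _ _ _ _ _ (EFin \o (fun x : N.-tuple R => \sum_(g : {ffun 'I_n -> 'I_N})
    \det (evalmx (F g) x) * \det (evalmx (monomials (fun k => k)) x)))) => //.
    by move=> x _; rewrite /= E.
  by apply: integrable_sum_EFin => // g _; exact: (A g).1.
under eq_Rintegral do rewrite E.
rewrite Rintegral_sum//; last by move=> g _; exact: (A g).1.
rewrite mulr_sumr; apply: eq_bigr => g _; rewrite (A g).2; congr (_ * \det _).
apply/matrixP => a b; rewrite !mxE; apply: eq_Rintegral => x _.
by rewrite /F /monomials [x ^+ (b + _)]exprD mulrAC; congr (_ * _); rewrite mulrC.
Qed.

Lemma hua_pickrell_pdfE (s : R) N (x : N.-tuple R) : 1 < 2 * s ->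
  hua_pickrell_pdf s x = (moment_det0 s N)^-1 *
  (\prod_j cauchy_weight (N%:R + s) (tnth x j) * \det (evalmx (monomials (fun k => k)) x) ^+ 2).
Proof.
move=> s1; rewrite /hua_pickrell_pdf moment_det0E// -mulrA; congr (_ * (_ * _)).
  by apply: eq_bigr => j _; rewrite -powRN.
by rewrite det_evalmx_Vandermonde -prodrXl; apply: eq_bigr => i _; rewrite prodrXl.
Qed.

(** An even [n] makes the integrand nonnegative, as [integral_density] demands. The [1/N!] from
    restricting to the chamber cancels the [N!] of Andréief's identity. *)
Lemma hua_pickrell_power_moment (s : R) n N : 1 < 2 * s -> n%:R < 2 * s + 1 -> ~~ odd n ->
  hua_pickrell_expectation s (fun x : N.-tuple R => (\sum_i tnth x i) ^+ n) =
  (power_moment s n N)%:E.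
Proof.
move=> s1 ns en.
pose W (x : N.-tuple R) := \prod_j cauchy_weight (N%:R + s) (tnth x j) *
  \det (evalmx (monomials (fun k => k)) x) ^+ 2.
have [iW eW] := integral_power_monomials N s1 ns.
have p0 (x : N.-tuple R) : 0 <= (\sum_i tnth x i) ^+ n by exact: exprn_even_ge0.
rewrite /hua_pickrell_expectation (@integral_density _ _ _ _ (leb N) (@weyl_chamber R N) (@hua_pickrell_pdf R s N)) //.
- under eq_integral do rewrite hua_pickrell_pdfE// -EFinM mulrCA.
  have mW := @measurable_weyl_chamber R N.
  have iW' := integrableS measurableT mW (@subsetT _ _) iW.
  rewrite -EFin_Rintegral//; last exact: integrableZ_EFin.
  rewrite (RintegralZl _ mW iW').
  rewrite integral_weyl_chamber//.
  + rewrite eW mulKf ?pnatr_eq0 -?lt0n ?fact_gt0// /power_moment mulr_sumr.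
    by congr EFin; apply: eq_bigr => g _; rewrite mulrC.
  + move=> t x; congr (_ ^+ _ * (_ * _)).
    * rewrite [RHS](reindex_inj (@perm_inj _ t)); apply: eq_bigr => i _; exact: tnth_permt.
    * rewrite [RHS](reindex_inj (@perm_inj _ t)); apply: eq_bigr => i _; congr cauchy_weight; exact: tnth_permt.
    * by rewrite evalmx_permt exprMn sqrr_sign mul1r.
  + by move=> x /det_evalmx_eq0 ->; rewrite expr0n/= !mulr0.
- exact: measurable_weyl_chamber.
- exact: measurable_hua_pickrell_pdf.
- exact: hua_pickrell_pdf_ge0.
- apply/measurable_EFinP; apply: measurable_funX; apply: measurable_sum => i; exact: measurable_tnth.
Qed.

(** * Polynomial dependence of the moments on the number of particles *)

Section Polynomiality.
Variable (s : R) (n : nat).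
Hypothesis s1 : 1 < 2 * s.
Hypothesis ns : n%:R < 2 * s + 1.
Implicit Types (c : nat -> nat) (N L T : nat).

(* Row shifts are indexed from the top degree downwards, so that for a fixed [c]
   the ratio is a polynomial in [N]. *)
Definition top_moment N c : R :=
  moment_det s (fun k : 'I_N => k + c (N - k.+1))%N / moment_det0 s N.

(** Quotient of the recursion [moment_detS] for the shifted and for the unshifted rows. Passing to
    [N + 1] adds a row of degree [0], which has index [N] from the top; [c N = 0] says that it is
    not shifted. *)
Lemma top_momentS N c : c N = 0%N -> (forall t, c t <= n)%N ->
  top_moment N.+1 c = top_moment N c * \prod_(t < N) ((N%:R - t%:R + (c t)%:R) / (N%:R - t%:R)).
Proof.
move=> cN cn; have s2 := s1; have n2 := ns.
have := @moment_detS R s s1 N (fun k : 'I_N => k + c (N - k.+1))%N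
  (fun k : 'I_N.+1 => k + c (N.+1 - k.+1))%N.
rewrite /= subSS subn0 cN => /(_ erefl (fun=> erefl)) h.
have hc (k j : 'I_N) : (j + (k + c (N - k.+1)%N)).+1%:R < 2 * (N%:R + s).
  apply: (@le_lt_trans _ _ (2 * N%:R + n%:R - 1)); last by lra.
  by rewrite lerBrDr -natrM -natrD natr1 ler_nat; have := cn (N - k.+1)%N;
    have := ltn_ord k; have := ltn_ord j; lia.
  have hb := h hc; have e0 := moment_det0S s1 N.
  have P0 : 0 < \prod_(j < N) (2 * (N%:R + s) - j%:R).
    apply: prodr_gt0 => j _; have : j%:R <= N%:R :> R by rewrite ler_nat ltnW.
    by have : 0 <= N%:R :> R by []; lra.
  have M0 := moment_det0_gt0 s1 N; have M1 := moment_det0_gt0 s1 N.+1.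
  have -> : \prod_(t < N) ((N%:R - t%:R + (c t)%:R) / (N%:R - t%:R)) =
      (\prod_(k < N) (k + c (N - k.+1)%N).+1%:R) / N`!%:R :> R.
    rewrite fact_prod big_add1/= big_mkord natr_prod -prodf_div.
    rewrite (reindex_inj rev_ord_inj); apply: eq_bigr => k _ /=.
    rewrite natrB// -!natr1 natrD; congr (_ / _); ring.
  rewrite /top_moment.
  have Nf : N`!%:R != 0 :> R by rewrite pnatr_eq0 -lt0n fact_gt0.
  have m0 : cauchy_moment s N.+1 0 != 0.
    apply/eqP => m0; move: e0; rewrite m0 !mul0r => /eqP; rewrite mulf_eq0 !gt_eqF//.
  move: e0 hb (lt0r_neq0 P0) (lt0r_neq0 M0) (lt0r_neq0 M1) m0 Nf.
  move: (cauchy_moment _ _ _) (N`!%:R) (moment_det0 _ _) (moment_det0 _ _) (\prod_(j < N) (_ - _)).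
  move: (\prod_(k < N) _) (moment_det _ _) (moment_det _ _) => A B C m F X Y P e1 e2 P0' X0 Y0 m0 F0.
  have -> : C = m * A * B / P by rewrite -e2 mulrC mulKf.
  have -> : Y = m * F * X / P by rewrite -e1 mulrC mulKf.
  by field; rewrite P0' X0 F0 m0.
Qed.

Lemma prod_rising (y : R) k :
  y * \prod_(m < k) (y + 1 + m%:R) = \prod_(m < k) (y + m%:R) * (y + k%:R).
Proof.
elim: k => [|k IH]; first by rewrite !big_ord0; ring.
by rewrite !big_ord_recr/= mulrA IH -natr1; ring.
Qed.

(** The solution in [N] of the recursion [top_momentS], normalized to be [1] at [N = T]. Its degree
    is at most the total shift. *)
Definition growth_poly T c : {poly R} :=
  \prod_(t < T) \prod_(m < c t) ((T%:R - t%:R + m%:R)^-1 *: ('X - (t%:R - m%:R)%:P)).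

Lemma growth_polyE T c x : (growth_poly T c).[x] =
  \prod_(t < T) \prod_(m < c t) ((x - t%:R + m%:R) / (T%:R - t%:R + m%:R)).
Proof.
rewrite horner_prod; apply: eq_bigr => t _; rewrite horner_prod; apply: eq_bigr => m _.
by rewrite hornerZ hornerXsubC mulrC; congr (_ / _); ring.
Qed.

Lemma size_prod_le (I : Type) (r : seq I) (P : pred I) (F : I -> {poly R}) (e : I -> nat) :
  (forall i, P i -> size (F i) <= (e i).+1)%N ->
  (size (\prod_(i <- r | P i) F i)%R <= (\sum_(i <- r | P i) e i).+1)%N.
Proof.
move=> h; apply: (big_ind2 (fun (p : {poly R}) k => size p <= k.+1)%N) => //; first by rewrite size_poly1.
by move=> p k q l hp hq; rewrite (leq_trans (size_polyMleq _ _))//; lia.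
Qed.

Lemma size_growth_poly T c : (size (growth_poly T c) <= (\sum_(t < T) c t).+1)%N.
Proof.
apply: size_prod_le => t _; rewrite -[X in (_ <= X.+1)%N](card_ord (c t)) -sum1_card.
apply: size_prod_le => m _; rewrite (leq_trans (size_scale_leq _ _))//.
by rewrite size_XsubC.
Qed.

Lemma top_moment_grow T N c : (forall t, T <= t -> c t = 0)%N -> (forall t, c t <= n)%N ->
  (T <= N)%N -> top_moment N c = top_moment T c * (growth_poly T c).[N%:R].
Proof.
move=> cT cn /subnKC <-; elim: (N - T)%N => [|e IH].
  rewrite addn0 growth_polyE big1 ?mulr1// => t _; rewrite big1// => m _; rewrite divff//.
  have : t.+1%:R <= T%:R :> R by rewrite ler_nat.
  by rewrite -natr1; have : 0 <= m%:R :> R by []; move=> a b; rewrite gt_eqF//; lra.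
rewrite addnS top_momentS ?IH ?cT ?leq_addr// -mulrA; congr (_ * _); rewrite !growth_polyE.
rewrite big_split_ord/= [X in _ * (_ * X)]big1 ?mulr1 => [|t _]; last first.
  rewrite cT ?leq_addr// addr0 divff//.
  have : (T + t)%:R < (T + e)%:R :> R by rewrite ltr_nat ltn_add2l.
  by move=> ?; rewrite gt_eqF//; lra.
rewrite -big_split/=; apply: eq_bigr => t _.
have tT : t.+1%:R <= T%:R :> R by rewrite ler_nat.
have y0 : 0 < (T + e)%:R - t%:R :> R.
  by rewrite natrD; move: tT; rewrite -natr1; have : 0 <= e%:R :> R by []; lra.
rewrite !prodf_div -mulrA [_^-1 * _]mulrC mulrA; congr (_ / _).
have eS : (T + e).+1%:R - t%:R = (T + e)%:R - t%:R + 1 :> R by rewrite -natr1; ring.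
under [in RHS]eq_bigr do rewrite eS.
by rewrite mulrA -prod_rising mulrC mulKf// gt_eqF.
Qed.

Definition count_at L (g : 'I_n -> 'I_L) (t : nat) : nat := #|[pred i | g i == t :> nat]|.

Lemma count_at_le L (g : 'I_n -> 'I_L) t : (count_at g t <= n)%N.
Proof. by rewrite -[leqRHS](card_ord n); exact: max_card. Qed.

Lemma count_at_eq0 L (g : 'I_n -> 'I_L) t : (forall i, g i != t :> nat) -> count_at g t = 0%N.
Proof. by move=> h; apply: eq_card0 => i; rewrite !inE; exact/negbTE. Qed.

Lemma power_moment_top N :
  power_moment s n N = \sum_(g : {ffun 'I_n -> 'I_N}) top_moment N (count_at g).
Proof.
rewrite /power_moment (reindex (fun g : {ffun 'I_n -> 'I_N} => [ffun i => rev_ord (g i)])); last first.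
  by exists (fun g : {ffun 'I_n -> 'I_N} => [ffun i => rev_ord (g i)]) => g _; apply/ffunP => i;
    rewrite !ffunE rev_ordK.
apply: eq_bigr => g _; rewrite /top_moment; congr (moment_det _ _ / _); apply/funext => k.
congr (_ + _)%N; apply: eq_card => i; rewrite !inE ffunE -val_eqE /=.
move: (g i) => gi; have := ltn_ord gi; have := ltn_ord k.
by move: (nat_of_ord gi) (nat_of_ord k) => a b; clear; lia.
Qed.

(* If all columns shift within the bottom block, that shift is a permutation
   of the block, hence trivial. *)
Lemma top_moment_eq0 L N c : (forall t, N <= t < L -> c t <= t - N)%N ->
  (exists2 t, (N <= t < L)%N & (0 < c t)%N) -> top_moment L c = 0.
Proof.
move=> hc [t0 /andP[Nt0 t0L] ct0]; have [K KE] : exists K, K = (L - N)%N by exists (L - N)%N.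
have fK (k : 'I_K) : (k + c (L - k.+1) < K)%N.
  have kK := ltn_ord k.
  have h1 : (N <= L - k.+1 < L)%N by lia.
  by have := hc _ h1; lia.
pose f k := Ordinal (fK k).
have [/injectiveP fI|/injectivePn[k1 [k2 k12 e]]] := boolP (injectiveb f).
  have : (\sum_(k < K) k = \sum_(k < K) f k)%N by exact: (reindex_inj fI).
  rewrite /= big_split/= -[LHS]addn0 => /addnI/esym/eqP; rewrite sum_nat_eq0 => /forallP/=.
  have hk : (L - t0.+1 < K)%N by lia.
  move=> /(_ (Ordinal hk)) /=; have -> : (L - (L - t0.+1).+1 = t0)%N by lia.
  by rewrite gtn_eqF.
have KL : (K <= L)%N by rewrite KE leq_subr.
rewrite /top_moment /moment_det (@determinant_alternate _ _ _ (widen_ord KL k1) (widen_ord KL k2)).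
- by rewrite mul0r.
- by rewrite -val_eqE.
- by move=> j; rewrite !mxE /=; congr (cauchy_moment _ _ (_ + _)%N); move/(congr1 val): e.
Qed.

(** The factor of index [m = t - N] is zero at [N]. *)
Lemma growth_poly_eq0 L N c t : (N <= t < L)%N -> (t - N < c t)%N -> (growth_poly L c).[N%:R] = 0.
Proof.
move=> /andP[Nt tL] h; rewrite growth_polyE (bigD1 (Ordinal tL))//= (bigD1 (Ordinal h))//=.
by rewrite natrB// (_ : _ - _ + _ = 0) ?mul0r ?mul0r//; ring.
Qed.

Lemma growth_poly_inv T L c : (T <= L)%N -> (forall t, T <= t -> c t = 0)%N ->
  (growth_poly T c).[L%:R] * (growth_poly L c).[T%:R] = 1.
Proof.
move=> /subnKC <- cT; rewrite !growth_polyE big_split_ord/=.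
rewrite [X in _ * (_ * X)]big1 ?mulr1 => [|t _]; last by rewrite cT ?leq_addr// big_ord0.
rewrite -big_split/=; apply: big1 => t _; rewrite -big_split/=; apply: big1 => m _.
rewrite mulrA divfK ?divff//; last first.
  have : t.+1%:R <= T%:R :> R by rewrite ler_nat.
  by rewrite -natr1; have : 0 <= m%:R :> R by []; move=> a b; rewrite gt_eqF//; lra.
have : t.+1%:R <= (T + (L - T))%:R :> R by rewrite ler_nat (leq_trans (ltn_ord t))// leq_addr.
by rewrite -natr1; have : 0 <= m%:R :> R by []; move=> a b; rewrite gt_eqF//; lra.
Qed.

(** Enlarges the range of the maps from [N] to [L] values without changing the sum. For a map that
    leaves the first [N] values, either some shift exceeds [t - N] and the growth polynomial
    vanishes at [N], or all shifts are at most [t - N] and the determinant of level [L] vanishes.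
    The right-hand side is thus one polynomial in [N], valid for all [N <= L]. *)
Lemma power_moment_growth N L : (0 < n)%N -> (N <= L)%N ->
  power_moment s n N = \sum_(g : {ffun 'I_n -> 'I_L})
    top_moment L (count_at g) * (growth_poly L (count_at g)).[N%:R].
Proof.
move=> n0 NL; rewrite power_moment_top (bigID (fun g : {ffun 'I_n -> 'I_L} => [forall i, g i < N]%N))/=.
rewrite [X in _ + X]big1 ?addr0 => [|g]; last first.
  rewrite negb_forall => /existsP[i]; rewrite -leqNgt => Ni.
  have [[t tNL ht]|h] := pselect (exists2 t, (N <= t < L)%N & (t - N < count_at g t)%N).
    by rewrite (growth_poly_eq0 tNL) ?mulr0.
  rewrite (@top_moment_eq0 L N) ?mul0r// => [t tNL|].
    by rewrite leqNgt; apply/negP => ?; apply: h; exists t.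
  exists (g i); first by rewrite Ni ltn_ord.
  by apply/card_gt0P; exists i; rewrite !inE.
case: N NL => [|N] NL.
  rewrite [RHS]big1 => [|g /forallP/(_ (Ordinal n0))//].
  by apply: big1 => g; case: (g (Ordinal n0)).
pose wd (g : {ffun 'I_n -> 'I_N.+1}) : {ffun 'I_n -> 'I_L} := [ffun i => widen_ord NL (g i)].
pose wd' (g : {ffun 'I_n -> 'I_L}) : {ffun 'I_n -> 'I_N.+1} := [ffun i => inord (g i)].
rewrite [RHS](reindex_onto wd wd') => [|g /forallP gN]; last first.
  by apply/ffunP => i; rewrite !ffunE; apply: val_inj; rewrite /= inordK.
apply: eq_big => [g|g _].
  have -> : [forall i, wd g i < N.+1]%N by apply/forallP => i; rewrite ffunE /= ltn_ord.
  by apply/esym/eqP/ffunP => i; rewrite !ffunE /= inord_val.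
have ce : count_at (wd g) = count_at g.
  by apply/funext => t; apply: eq_card => i; rewrite !inE ffunE.
have c0 t : (N < t)%N -> count_at g t = 0%N.
  by move=> Nt; apply: count_at_eq0 => i; rewrite neq_ltn (leq_trans (ltn_ord (g i))).
rewrite ce (top_moment_grow c0 (count_at_le g) NL) -mulrA growth_poly_inv ?mulr1//.
Qed.

Lemma sum_count_at L (g : 'I_n -> 'I_L) : (\sum_(t < L) count_at g t)%N = n.
Proof.
rewrite -[RHS](card_ord n) -sum1_card (partition_big g xpredT)//=; apply: eq_bigr => t _.
by rewrite /count_at -sum1_card; apply: eq_bigl => i; rewrite !inE.
Qed.

Lemma power_moment_poly : (0 < n)%N ->
  exists2 Q : {poly R}, (size Q <= n.+1)%N & forall N, power_moment s n N = Q.[N%:R].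
Proof.
move=> n0; pose Q L := \sum_(g : {ffun 'I_n -> 'I_L})
  top_moment L (count_at g) *: growth_poly L (count_at g).
have sQ L : (size (Q L) <= n.+1)%N.
  apply: (big_ind (fun q : {poly R} => (size q <= n.+1)%N)) => [|p q sp sq|g _].
  - by rewrite size_poly0.
  - by rewrite (leq_trans (size_polyD _ _))// geq_max sp.
  - by rewrite (leq_trans (size_scale_leq _ _))// (leq_trans (size_growth_poly _ _))// sum_count_at.
have QE L N : (N <= L)%N -> power_moment s n N = (Q L).[N%:R].
  move=> NL; rewrite (power_moment_growth n0 NL) horner_sum; apply: eq_bigr => g _.
  by rewrite hornerZ.
(* [Q n] and [Q (n + N)] have degree at most [n] and agree at [0, ..., n], so they coincide, and
   [Q n] is valid for every [N]. *)
exists (Q n) => // N; rewrite (QE (n + N)%N) ?leq_addl//; congr (_.[_]).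
apply: (poly_eq_nat (sQ _) (sQ _)) => k kn; rewrite -!QE//.
exact: leq_trans (leq_addr _ _).
Qed.

Lemma power_moment_cvg : (0 < n)%N ->
  power_moment s n N / N%:R ^+ n @[N --> \oo] -->
  n`!%:R^-1 * \sum_(1 <= k < n.+1) (-1) ^+ (n - k) * 'C(n, k)%:R * power_moment s n k.
Proof.
move=> n0; have [Q sQ QE] := power_moment_poly n0.
(* There is no map from a nonempty set to the empty one, so the term [k = 0] of the finite
   difference disappears. *)
have M0 : power_moment s n 0 = 0.
  by rewrite /power_moment big1// => g; case: (g (Ordinal n0)).
have := finite_difference sQ; rewrite -(big_mkord xpredT (fun k => (-1) ^+ (n - k) * 'C(n, k)%:R * Q.[k%:R])).
rewrite big_ltn// -QE M0 mulr0 add0r => fd.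
under eq_bigr do rewrite QE.
rewrite fd mulKf ?pnatr_eq0 -?lt0n ?fact_gt0//.
under eq_fun do rewrite QE.
exact: poly_lead_cvg.
Qed.

End Polynomiality.

Lemma cauchy_moment_rec (s : R) N p : 1 < 2 * s -> p.+1%:R < 2 * (N%:R + s) ->
  (2 * (N%:R + s) - p.+1%:R) * cauchy_moment s N.+1 p.+2 = p.+1%:R * cauchy_moment s N.+1 p.
Proof.
move=> s1 h; have := cauchy_moment_ibp s1 h; rewrite /= (cauchy_moment_split h).
move=> e; rewrite mulrBl -e; ring.
Qed.

(** * Rational dependence of the moments on the parameter [s] *)

Section Rationality.
Variables (N h : nat).
Let K := (N + h)%N.

Definition cauchy_denom (j : nat) : {poly R} := 2%:P * 'X + (2 * N%:R - (2 * j).+1%:R)%:P.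

Lemma cauchy_denomE j s : (cauchy_denom j).[s] = 2 * (N%:R + s) - (2 * j).+1%:R.
Proof.
rewrite /cauchy_denom hornerD hornerM !hornerC hornerX.
by move: (_.+1%:R) => u; ring.
Qed.

(** Numerator, as a polynomial in [s], of the moment of order [p] divided by the mass, over the
    common denominator formed by all [cauchy_denom j] with [j < K]. Odd moments vanish by
    symmetry. *)
Definition moment_num (p : nat) : {poly R} := if odd p then 0 else
  (\prod_(j < p./2) (2 * j).+1%:R)%:P * \prod_(j < K | (p./2 <= j)%N) cauchy_denom j.

Lemma moment_numS i : (i < K)%N -> moment_num (2 * i).+2 * cauchy_denom i =
  moment_num (2 * i) * (2 * i).+1%:R%:P.
Proof.
move=> iK; rewrite /moment_num /= negbK mul2n odd_double doubleK big_ord_recr/= polyCM.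
rewrite [in RHS](bigD1 (Ordinal iK))//= (eq_bigl (fun j : 'I_K => (i <= j)%N && (j != Ordinal iK))) => [|j].
  by rewrite mul2n; ring.
by rewrite -val_eqE /=; lia.
Qed.

Lemma moment_numE s p : h%:R - 1 / 2 < s -> 1 < 2 * s -> (p <= 2 * K)%N ->
  cauchy_moment s N.+1 p * \prod_(j < K) (cauchy_denom j).[s] =
  cauchy_moment s N.+1 0 * (moment_num p).[s].
Proof.
move=> hs s1.
have hK p' : (p'.+2 <= 2 * K)%N -> p'.+1%:R < 2 * (N%:R + s).
  move=> pK; have : p'.+2%:R <= 2 * (N%:R + h%:R) :> R by rewrite -natrD -natrM ler_nat.
  by rewrite -natr1; lra.
elim/ltn_ind: p => -[|[|p]] IH pK.
- by rewrite /moment_num big_ord0 mul1r horner_prod; congr (_ * _); apply: eq_bigl => j; rewrite leq0n.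
- rewrite /moment_num/= horner0 mulr0.
  have h0 : 0%:R < 2 * (N%:R + s) by have : 0 <= N%:R :> R by []; lra.
  have := cauchy_moment_ibp s1 h0; rewrite mul0r => /esym/eqP; rewrite mulf_eq0 gt_eqF//=.
  by move=> /eqP ->; rewrite mul0r.
have dn0 : 2 * (N%:R + s) - p.+1%:R != 0.
  by rewrite gt_eqF// subr_gt0 hK.
apply: (mulfI dn0); rewrite mulrA cauchy_moment_rec ?hK// -mulrA IH//; last lia.
have [po|pe] := boolP (odd p).
  by rewrite /moment_num /= negbK po horner0 !mulr0.
have pE : p = (2 * p./2)%N by rewrite mul2n even_halfK.
have pK2 : (p./2 < K)%N by lia.
have := moment_numS pK2; rewrite -pE => /(congr1 (fun q => q.[s])).
rewrite !hornerM hornerC cauchy_denomE -pE => e.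
by rewrite mulrCA [RHS]mulrCA; congr (_ * _); rewrite mulrC -e mulrC.
Qed.

Definition moment_det_num (l : 'I_N.+1 -> nat) : {poly R} :=
  \det (\matrix_(k, j) moment_num (j + l k)).

Lemma moment_det_numE s l : h%:R - 1 / 2 < s -> 1 < 2 * s ->
  (forall j k : 'I_N.+1, j + l k <= 2 * K)%N ->
  moment_det s l * (\prod_(j < K) (cauchy_denom j).[s]) ^+ N.+1 =
  cauchy_moment s N.+1 0 ^+ N.+1 * (moment_det_num l).[s].
Proof.
move=> hs s1 hl; rewrite mulrC -detZ -horner_evalE -det_map_mx -detZ; congr (\det _).
apply/matrixP => k j; rewrite !mxE mulrC moment_numE//.
Qed.

Lemma power_moment_rational : (0 < h)%N -> exists p q : {poly R}, forall s : R, h%:R - 1 / 2 < s ->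
  q.[s] != 0 /\ power_moment s (2 * h) N.+1 = p.[s] / q.[s].
Proof.
(* The transcendental mass and the common denominator enter numerator and denominator with the same
   power [N + 1], so determinants of the polynomial numerators suffice. *)
move=> h0; exists (\sum_(g : {ffun 'I_(2 * h) -> 'I_N.+1}) moment_det_num (fun k => k + content g k)%N).
exists (moment_det_num (fun k => k)) => s hs.
have h1 : 1 <= h%:R :> R by rewrite ler1n.
have s1 : 1 < 2 * s by lra.
have hK (j : nat) (k : 'I_N.+1) c : (j < N.+1)%N -> (c <= 2 * h)%N -> (j + (k + c) <= 2 * K)%N.
  by have := ltn_ord k; rewrite /K; lia.
(* For [j <= N + h - 1] the factor [2 (N + s) - (2j + 1)] is positive as soon as [s > h - 1/2]. *)
have Q0 : \prod_(j < K) (cauchy_denom j).[s] != 0.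
  apply/prodf_neq0 => j _; rewrite cauchy_denomE gt_eqF// subr_gt0.
  have : (2 * j).+2%:R <= 2 * (N%:R + h%:R) :> R.
    by rewrite -natrD -natrM ler_nat; have := ltn_ord j; rewrite /K; lia.
  by rewrite -natr1; lra.
have M0 := moment_det0_gt0 s1 N.+1.
have hK0 (j k : 'I_N.+1) : (j + k <= 2 * K)%N by have := hK j k 0%N (ltn_ord j) isT; rewrite addn0.
have E0 := @moment_det_numE s (fun k => k) hs s1 hK0.
have m0 : cauchy_moment s N.+1 0 != 0.
  apply/eqP => m0; move: E0; rewrite m0 expr0n mul0r => /eqP.
  by rewrite mulf_eq0 expf_eq0 (negbTE Q0) andbF orbF (gt_eqF M0).
have D0 : (moment_det_num (fun k => k)).[s] != 0.
  apply/eqP => d0; move: E0; rewrite d0 mulr0 => /eqP.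
  by rewrite mulf_eq0 expf_eq0 (negbTE Q0) andbF orbF (gt_eqF M0).
split=> //; rewrite horner_sum mulr_suml; apply: eq_bigr => g _.
have E1 := @moment_det_numE s (fun k => k + content g k)%N hs s1
  (fun j k => hK j k _ (ltn_ord j) (content_le g k)).
apply/eqP; rewrite eqr_div ?(gt_eqF M0)//; apply/eqP.
have QN := expf_neq0 N.+1 Q0; apply: (mulIf QN).
by rewrite mulrAC E1 -[RHS]mulrA [moment_det0 s N.+1 * _]E0; ring.
Qed.

End Rationality.

End HuaPickrellMoments.

(** * Romanovski polynomials *)

Section RomanovskiPolynomials.
Context {R : realType}.
Notation mu := (@lebesgue_measure R).
Implicit Types (a b x : R) (m k j : nat).

(** These are [(-1)^k / (4^k k! (b + 1/2)_k)], the coefficients of the hypergeometric series 0F1 of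
    parameter [b + 1/2] at [- v / 4], that is, of a normalized Bessel function of order [b - 1/2].
    They occur both in the orthogonal polynomials and in the limit kernel, so that the scaling limit
    can be taken coefficient by coefficient. *)
Definition bessel_coef b k : R :=
  (-1) ^+ k / \prod_(i < k) (2 * i.+1%:R * (2 * b + 1 + 2 * i%:R)).
Local Notation g := bessel_coef.

Lemma bessel_coef0 b : g b 0 = 1.
Proof. by rewrite /g expr0 big_ord0 divr1. Qed.

Lemma bessel_coefS b k : 0 < 2 * b + 1 ->
  2 * k.+1%:R * (2 * b + 1 + 2 * k%:R) * g b k.+1 = - g b k.
Proof.
move=> b0; have n0 : 2 * k.+1%:R * (2 * b + 1 + 2 * k%:R) != 0.
  have : 0 <= k%:R :> R by []; move=> k0; rewrite !mulf_neq0 ?pnatr_eq0//.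
  by rewrite gt_eqF//; lra.
rewrite /g big_ord_recr/= invfM; move: n0; set D := 2 * _ * _ => n0.
by clearbody D; rewrite mulrC mulrA mulfVK// exprS mulN1r mulNr.
Qed.

Lemma bessel_coef_shift b k : 0 < 2 * b + 1 ->
  (2 * b + 1) * g b k = (2 * b + 1 + 2 * k%:R) * g (b + 1) k.
Proof.
move=> b0; elim: k => [|k IH]; first by rewrite !bessel_coef0; ring.
have k0 : 0 <= k%:R :> R by [].
have b1 : 0 < 2 * (b + 1) + 1 by lra.
have e1 := bessel_coefS k b0; have e2 := bessel_coefS k b1.
have n0 : 2 * k.+1%:R * (2 * b + 1 + 2 * k%:R) != 0.
  by rewrite !mulf_neq0 ?pnatr_eq0// gt_eqF//; lra.
apply: (mulfI n0); rewrite mulrCA e1 mulrN IH.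
have -> : 2 * b + 1 + 2 * k.+1%:R = 2 * (b + 1) + 1 + 2 * k%:R by rewrite -natr1; ring.
rewrite -mulrN -e2; ring.
Qed.

Lemma bessel_coefS_shift b k : 0 < 2 * b + 1 ->
  2 * k.+1%:R * (2 * b + 1) * g b k.+1 = - g (b + 1) k.
Proof.
move=> b0; have k0 : 0 <= k%:R :> R by [].
have n0 : 2 * b + 1 + 2 * k%:R != 0 by rewrite gt_eqF//; lra.
apply: (mulfI n0); rewrite [RHS]mulrN -(bessel_coef_shift k b0) -mulrN -(bessel_coefS k b0); ring.
Qed.

(* Monic, and orthogonal to lower degrees for the weight [cauchy_weight (b + m)]. *)
Definition romanovski b m : {poly R} :=
  \sum_(k < m.+1) (g b k * (m ^_ (2 * k))%:R) *: 'X^(m - 2 * k).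
Local Notation P := romanovski.

Lemma romanovski_widen b m K : (m < K)%N ->
  P b m = \sum_(k < K) (g b k * (m ^_ (2 * k))%:R) *: 'X^(m - 2 * k).
Proof.
move=> mK; rewrite /P (big_ord_widen _ (fun k => (g b k * (m ^_ (2 * k))%:R) *: 'X^(m - 2 * k)) mK).
rewrite [RHS](bigID (fun k : 'I_K => k < m.+1)%N)/= [X in _ + X]big1 ?addr0// => k.
by rewrite -leqNgt => mk; rewrite ffact_small ?mulr0 ?scale0r//; lia.
Qed.

Lemma horner_romanovski b m K x : (m < K)%N ->
  (P b m).[x] = \sum_(k < K) g b k * (m ^_ (2 * k))%:R * x ^+ (m - 2 * k).
Proof.
move=> /(romanovski_widen b) ->; rewrite horner_sum; apply: eq_bigr => k _.
by rewrite hornerZ hornerXn.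
Qed.

Lemma romanovski0 b : P b 0 = 1.
Proof. by rewrite /P big_ord1 bessel_coef0 mul1r scale1r. Qed.

Lemma romanovski1 b : P b 1 = 'X.
Proof.
rewrite /P big_ord_recl big_ord1 (_ : 1 ^_ _ = 1)%N// (_ : 1 ^_ (2 * lift _ _) = 0)%N//.
by rewrite bessel_coef0 mulr0 scale0r addr0 mul1r scale1r.
Qed.

Lemma romanovskiN b m x : (P b m).[- x] = (-1) ^+ m * (P b m).[x].
Proof.
rewrite !(@horner_romanovski _ _ m.+1)// mulr_sumr; apply: eq_bigr => k _.
have [km|mk] := leqP (2 * k) m; last by rewrite ffact_small// mulr0 !mul0r mulr0.
have -> : (-1) ^+ m = (-1) ^+ (m - 2 * k) :> R.
  by rewrite -[in LHS](subnK km) exprD mulnC exprM sqrr_sign mulr1.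
by rewrite [(- x) ^+ _]exprNn mulrCA.
Qed.

(** Read off coefficientwise from the two shift relations of [bessel_coef] in [b]. The two ladder
    relations generate the recurrences and differential relations that follow. *)
Lemma romanovski_ladder_down b m x : 0 < 2 * b + 1 ->
  (2 * b + 1) * (x * (P b m.+1).[x] - (P b m.+2).[x]) = m.+1%:R * (P (b + 1) m).[x].
Proof.
move=> b0; rewrite !(@horner_romanovski b _ m.+3)// (@horner_romanovski (b + 1) _ m.+2)//.
rewrite [x * _]mulr_sumr -sumrB big_ord_recl [X in _ * (X + _)](_ : _ = 0) ?add0r; last first.
  by rewrite /= !muln0 !ffactn0 !subn0 mulrCA -exprS subrr.
rewrite !mulr_sumr; apply: eq_bigr => k _.
rewrite !lift0 mulnS !add2n; move: (nat_of_ord k) => {}k.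
have [km|mk] := leqP (2 * k) m; last first.
  by rewrite !ffact_small ?ltnS// ?mulr0 ?mul0r ?mulr0 ?subr0 ?mulr0//; lia.
have e1 : (m.+2 ^_ (2 * k).+2)%N = (m.+2 * (m.+1 ^_ (2 * k).+1))%N by rewrite ffactnS.
have e2 : (m.+1 ^_ (2 * k).+2)%N = (m.+1 ^_ (2 * k).+1 * (m.+1 - (2 * k).+1))%N by rewrite ffactnSr.
have e3 : (m.+1 ^_ (2 * k).+1)%N = (m.+1 * (m ^_ (2 * k)))%N by rewrite ffactnS.
rewrite subnE -!subnE !subSS e1 e2 e3 subSS.
have [->|mk] := eqVneq m (2 * k)%N.
  rewrite subnn muln0 mulr0 mul0r mulr0 sub0r !expr0 !mulr1 !natrM.
  have := bessel_coefS_shift k b0.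
  have -> : (2 * k).+2%:R = 2 * k.+1%:R :> R by rewrite -natrM mulnS add2n.
  move: (g b k.+1) (g (b + 1) k) => u v e.
  have -> : v = - (2 * k.+1%:R * (2 * b + 1) * u) by rewrite e opprK.
  by move: (k.+1%:R) ((2 * k).+1%:R) (_%:R) => A B C; ring.
have lt : (2 * k < m)%N by lia.
have -> : x * (g b k.+1 * (m.+1 * m ^_ (2 * k) * (m - 2 * k))%:R * x ^+ (m - (2 * k).+1)) =
  g b k.+1 * (m.+1 * m ^_ (2 * k) * (m - 2 * k))%:R * x ^+ (m - 2 * k).
  by rewrite mulrCA -exprS subnSK.
have := bessel_coefS_shift k b0.
rewrite !natrM natrB// -[m.+2%:R]natr1 -[m.+1%:R]natr1 -[k.+1%:R]natr1 natrM.
move: (g b k.+1) (g (b + 1) k) => u v e.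
have -> : v = - (2 * (k%:R + 1) * (2 * b + 1) * u) by rewrite e opprK.
by move: (_ ^_ _)%:R (x ^+ _) => F X; ring.
Qed.

Lemma romanovski_ladder_up b m x : 0 < 2 * b + 1 ->
  (2 * b + 1) * (P b m).[x] =
  (2 * b + 1 + m%:R) * (P (b + 1) m).[x] - m%:R * x * (P (b + 1) m.-1).[x].
Proof.
move=> b0; rewrite !(@horner_romanovski _ _ m.+1) ?ltnS ?leq_pred// !mulr_sumr -sumrB.
apply: eq_bigr => k _.
move: (nat_of_ord k) => {}k; rewrite [in LHS]mulrA [in LHS]mulrA (bessel_coef_shift k b0).
have [km|mk] := leqP (2 * k) m; last first.
  by rewrite !ffact_small// ?mulr0 ?mul0r ?mulr0 ?subr0 ?mulr0//; lia.
have -> : m%:R * x * (g (b + 1) k * (m.-1 ^_ (2 * k))%:R * x ^+ (m.-1 - 2 * k)) =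
   g (b + 1) k * (m * m.-1 ^_ (2 * k))%:R * (x * x ^+ (m.-1 - 2 * k)).
  by rewrite natrM; ring.
rewrite -ffactnS ffactnSr natrM natrB//.
have [e|lt] := eqVneq (2 * k)%N m.
  rewrite -e subrr !mulr0 mul0r subr0 natrM.
  by move: (_ ^_ _)%:R (x ^+ _) => F X; ring.
have -> : x * x ^+ (m.-1 - 2 * k) = x ^+ (m - 2 * k) by rewrite -exprS; congr (_ ^+ _); lia.
rewrite natrM; ring.
Qed.

Lemma romanovski_rec b m x : 1 < 2 * b ->
  (2 * b + m%:R) * (P b m.+1).[x] =
  2 * (b + m%:R) * x * (P b m).[x] - m%:R * (1 + x ^+ 2) * (P b m.-1).[x].
Proof.
move=> b1; have b0 : 0 < 2 * (b - 1) + 1 by lra.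
have eb : b - 1 + 1 = b by rewrite subrK.
have := @romanovski_ladder_up (b - 1) m.+1 x b0; rewrite eb /=.
case: m => [|m].
  by rewrite !romanovski0 !romanovski1 hornerC hornerX => _; ring.
have := @romanovski_ladder_up (b - 1) m.+1 x b0; rewrite eb /=.
have := @romanovski_ladder_down (b - 1) m x b0; rewrite eb.
rewrite -[m.+2%:R]natr1 -[m.+1%:R]natr1.
move: (P (b - 1) m.+2).[x] (P (b - 1) m.+1).[x] (P b m.+2).[x] (P b m.+1).[x] (P b m).[x] => p2 p1 q2 q1 q0.
move=> e1 e2 e3; apply/eqP; rewrite -subr_eq0.
have -> : (2 * b + (m%:R + 1)) * q2 - (2 * (b + (m%:R + 1)) * x * q1 - (m%:R + 1) * (1 + x ^+ 2) * q0) =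
  ((m%:R + 1) * q0 - (2 * (b - 1) + 1) * (x * p1 - p2)) +
  x * ((2 * (b - 1) + 1) * p1 - ((2 * (b - 1) + 1 + (m%:R + 1)) * q1 - (m%:R + 1) * x * q0))
  - ((2 * (b - 1) + 1) * p2 - ((2 * (b - 1) + 1 + (m%:R + 1 + 1)) * q2 - (m%:R + 1 + 1) * x * q1)) by ring.
by rewrite e1 e2 e3 !subrr mulr0 subr0 addr0.
Qed.

(** The three polynomials share the value of parameter plus degree, hence the same weight: this is
    the recurrence of one orthogonal family. *)
Lemma romanovski_three_term b m x : 1 < 2 * b ->
  (P (b - 1) m.+1).[x] = x * (P b m).[x] -
    m%:R * (m%:R + 2 * b) / ((2 * b + 1) * (2 * b - 1)) * (P (b + 1) m.-1).[x].
Proof.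
move=> b1; have b0 : 0 < 2 * (b - 1) + 1 by lra.
have b0' : 0 < 2 * b + 1 by lra.
have eb : b - 1 + 1 = b by rewrite subrK.
have n0 : 2 * b - 1 != 0 by rewrite gt_eqF//; lra.
apply: (mulfI n0).
have := @romanovski_ladder_up (b - 1) m.+1 x b0; rewrite eb /=.
have -> : 2 * (b - 1) + 1 = 2 * b - 1 by ring.
move=> ->; case: m => [|m].
  by rewrite !romanovski0 !romanovski1 hornerC hornerX !mul0r; ring.
have := @romanovski_ladder_down b m x b0'; rewrite -[m.+2%:R]natr1 -[m.+1%:R]natr1 /=.
move: (P b m.+2).[x] (P b m.+1).[x] (P (b + 1) m).[x] => p2 p1 q0 e.
have n1 : 2 * b + 1 != 0 by rewrite gt_eqF.
have -> : p2 = x * p1 - (m%:R + 1) * q0 / (2 * b + 1) by rewrite -e mulrAC mulfV//; ring.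
by field; rewrite n0 n1.
Qed.

(** For a fixed parameter the family is an Appell sequence. *)
Lemma deriv_romanovski b m : (P b m)^`() = m%:R *: P b m.-1.
Proof.
rewrite (@romanovski_widen b m m.+1)// (@romanovski_widen b m.-1 m.+1) ?ltnS ?leq_pred//.
rewrite raddf_sum scaler_sumr; apply: eq_bigr => k _ /=.
move: (nat_of_ord k) => {}k; rewrite derivZ derivXn -[X in _ *: X]scaler_nat !scalerA.
have -> : (m - 2 * k).-1 = (m.-1 - 2 * k)%N by lia.
congr (_ *: _); rewrite -mulrA -natrM -ffactnSr ffactnS natrM; ring.
Qed.

Lemma size_romanovskiB b m : (size (P b m - 'X^m)%R <= m)%N.
Proof.
rewrite /P big_ord_recl bessel_coef0 ffactn0 mulr1 scale1r muln0 subn0 addrAC subrr add0r.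
apply: (big_ind (fun q : {poly R} => (size q <= m)%N)) => [|p q sp sq|k _].
- by rewrite size_poly0.
- by rewrite (leq_trans (size_polyD _ _))// geq_max sp.
- rewrite lift0; have [km|mk] := leqP (2 * k.+1) m; last by rewrite ffact_small// mulr0 scale0r size_poly0.
  by rewrite (leq_trans (size_scale_leq _ _))// size_polyXn; lia.
Qed.

Lemma size_romanovski b m : size (P b m) = m.+1.
Proof.
rewrite -[P b m](subrK 'X^m) addrC size_polyDl ?size_polyXn// ltnS; exact: size_romanovskiB.
Qed.

End RomanovskiPolynomials.

Section RomanovskiOrthogonality.
Context {R : realType}.
Notation mu := (@lebesgue_measure R).
Local Notation P := (@romanovski R).
Implicit Types (a b x : R) (m k j : nat).

(** By [romanovski_rec], the derivative of [x^j P_m] times its weight is [j x^(j-1) (1 + x^2) P_m -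
    (2b + m) x^j P_(m+1)] times the next weight. Iteration lowers [j] and the degree together,
    giving [0] when [j] runs out first and the norm when both reach [0]. *)
Lemma romanovski_ibp b m j : 1 < 2 * b -> (j <= m.+1)%N ->
  (2 * b + m%:R) * \int[mu]_x (('X^j * P b m.+1).[x] * cauchy_weight (b + m.+1%:R) x) =
  j%:R * \int[mu]_x (('X^(j.-1) * P b m).[x] * cauchy_weight (b + m%:R) x).
Proof.
move=> b1 jm; have m0 : 0 <= m%:R :> R by [].
have a0 : 0 <= b + m%:R by lra.
have szX i n : size ('X^i * P b n) = (i + n.+1)%N.
  rewrite size_proper_mul ?size_polyXn ?size_romanovski//.
  by rewrite lead_coefXn mul1r lead_coef_eq0 -size_poly_eq0 size_romanovski.
have h : (size ('X^j * P b m))%:R < 2 * (b + m%:R) + 1.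
  rewrite szX natrD; have : j%:R <= m.+1%:R :> R by rewrite ler_nat.
  by rewrite -natr1; lra.
have := Rintegral_poly_weight_derive a0 h.
have i1 : mu.-integrable setT (EFin \o (fun x => (2 * b + m%:R) * (('X^j * P b m.+1).[x] * cauchy_weight (b + m.+1%:R) x))).
  apply: integrableZ_EFin => //; apply: integrable_poly_weight.
  rewrite szX natrD; have : j%:R <= m.+1%:R :> R by rewrite ler_nat.
  by clear -b1 m0; rewrite -!natr1; lra.
have i2 : mu.-integrable setT (EFin \o (fun x => j%:R * (('X^(j.-1) * P b m).[x] * cauchy_weight (b + m%:R) x))).
  apply: integrableZ_EFin => //; apply: integrable_poly_weight.
  rewrite szX natrD; have : j.-1%:R <= m%:R :> R by rewrite ler_nat; lia.
  by clear -b1 m0; rewrite -!natr1; lra.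
have -> : \int[mu]_x ((('X^j * P b m)^`() * (1 + 'X^2) - (2 * (b + m%:R))%:P * 'X * ('X^j * P b m)).[x] *
   cauchy_weight (b + m%:R + 1) x) =
  \int[mu]_x (j%:R * (('X^(j.-1) * P b m).[x] * cauchy_weight (b + m%:R) x) -
     (2 * b + m%:R) * (('X^j * P b m.+1).[x] * cauchy_weight (b + m.+1%:R) x)).
  apply: eq_Rintegral => x _; rewrite -(cauchy_weightD1 (b + m%:R) x).
  have -> : b + m.+1%:R = b + m%:R + 1 by rewrite -natr1 addrA.
  move: (cauchy_weight _ x) => w.
  rewrite derivM derivXn deriv_romanovski -scaler_nat.
  rewrite !(hornerD, hornerN, hornerM, hornerZ, hornerC, hornerX, hornerXn).
  have := romanovski_rec m x b1.
  move: (P b m.+1).[x] (P b m).[x] (P b m.-1).[x] => p2 p1 p0 e.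
  have aux (y A B w' j' m' : R) : (2 * b + m') * p2 = 2 * (b + m') * y * p1 - m' * (1 + y ^+ 2) * p0 ->
     ((j' * A * p1 + B * (m' * p0)) * (1 + y ^+ 2) - 2 * (b + m') * y * (B * p1)) * w' =
     j' * (A * p1 * ((1 + y ^+ 2) * w')) - (2 * b + m') * (B * p2 * w').
    move=> e'; have -> : (2 * b + m') * (B * p2 * w') = B * w' * ((2 * b + m') * p2) by ring.
    by rewrite e'; ring.
  exact: aux.
rewrite (RintegralB measurableT i2 i1) => /eqP; rewrite subr_eq0 => /eqP e.
have c2 : mu.-integrable setT (EFin \o (fun x => (('X^(j.-1) * P b m).[x] * cauchy_weight (b + m%:R) x))).
  apply: integrable_poly_weight; rewrite szX natrD; have : j.-1%:R <= m%:R :> R by rewrite ler_nat; lia.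
  by clear -b1 m0; rewrite -!natr1; lra.
have c1 : mu.-integrable setT (EFin \o (fun x => (('X^j * P b m.+1).[x] * cauchy_weight (b + m.+1%:R) x))).
  apply: integrable_poly_weight; rewrite szX natrD; have : j%:R <= m.+1%:R :> R by rewrite ler_nat.
  by clear -b1 m0; rewrite -!natr1; lra.
by rewrite -(RintegralZl _ measurableT c1) -(RintegralZl _ measurableT c2) e.
Qed.

Lemma romanovski_orthogonal b m j : 1 < 2 * b -> (j < m)%N ->
  \int[mu]_x (('X^j * P b m).[x] * cauchy_weight (b + m%:R) x) = 0.
Proof.
move=> b1; elim: m j => // m IH j jm.
have n0 : 2 * b + m%:R != 0 by have : 0 <= m%:R :> R by []; move=> ?; rewrite gt_eqF//; lra.
apply: (mulfI n0); rewrite romanovski_ibp ?(ltnW jm)// mulr0.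
case: j jm => [|j] jm; first by rewrite mul0r.
by rewrite IH// mulr0.
Qed.

Definition romanovski_norm b m : R := m`!%:R / \prod_(i < m) (2 * b + i%:R) * cauchy_mass b.

Lemma romanovski_norm_gt0 b m : 1 < 2 * b -> 0 < romanovski_norm b m.
Proof.
move=> b1; rewrite /romanovski_norm !mulr_gt0 ?ltr0n ?fact_gt0// ?invr_gt0.
  by apply: prodr_gt0 => i _; have : 0 <= i%:R :> R by []; lra.
have h : 0 < (2 * b - 1) / (2 * b) by rewrite divr_gt0//; lra.
rewrite -(pmulr_rgt0 _ h) -cauchy_massD1// cauchy_massE; last by lra.
rewrite !mulr_gt0 ?invr_gt0 ?exprn_gt0 ?powR_gt0 ?pi_gt0//; apply: Gamma_gt0; lra.
Qed.

Lemma romanovski_normE b m : 1 < 2 * b ->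
  \int[mu]_x (('X^m * P b m).[x] * cauchy_weight (b + m%:R) x) = romanovski_norm b m.
Proof.
move=> b1; rewrite /romanovski_norm; elim: m => [|m IH].
  rewrite big_ord0 divr1 (_ : 0`!%:R = 1)// mul1r; apply: eq_Rintegral => x _.
  by rewrite romanovski0 mulr1 hornerXn expr0 mul1r addr0.
have n0 : 2 * b + m%:R != 0 by have : 0 <= m%:R :> R by []; move=> ?; rewrite gt_eqF//; lra.
apply: (mulfI n0); rewrite romanovski_ibp//= IH big_ord_recr/= factS natrM invfM.
have p0 : \prod_(i < m) (2 * b + i%:R) != 0.
  by apply/prodf_neq0 => i _; have : 0 <= i%:R :> R by []; move=> ?; rewrite gt_eqF//; lra.
by field; rewrite n0 p0.
Qed.

End RomanovskiOrthogonality.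

Section RomanovskiEnsemble.
Context {R : realType}.
Notation mu := (@lebesgue_measure R).
Notation leb n := (@lebesgue_tuple R n).
Local Notation P := (@romanovski R).
Local Notation intg f := (mu.-integrable setT (EFin \o f)).
Variables (s : R).
Hypothesis s1 : 1 < 2 * s.
Implicit Types (N m k j : nat) (x y : R).

(* Degree [m] orthogonal polynomial for the weight of the [N]-point ensemble. *)
Definition hp_poly N m : {poly R} := P (N%:R + s - m%:R) m.
Definition hp_norm N m : R := romanovski_norm (N%:R + s - m%:R) m.

Let b1 N m : (m <= N)%N -> 1 < 2 * (N%:R + s - m%:R).
Proof. by rewrite -(ler_nat R) => h; have s2 := s1; lra. Qed.

Lemma size_hp_poly N m : size (hp_poly N m) = m.+1.
Proof. exact: size_romanovski. Qed.

Lemma hp_norm_gt0 N m : (m <= N)%N -> 0 < hp_norm N m.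
Proof. by move=> /b1; exact: romanovski_norm_gt0. Qed.

Lemma integrable_cauchy_weight_poly N (q : {poly R}) : (size q <= 2 * N)%N ->
  intg (fun x => q.[x] * cauchy_weight (N%:R + s) x).
Proof.
move=> h; apply: integrable_poly_weight.
by have : (size q)%:R <= 2 * N%:R :> R; [rewrite -natrM ler_nat|have s2 := s1; lra].
Qed.

Lemma hp_poly_orthogonal N m (q : {poly R}) : (m <= N)%N -> (size q <= m)%N ->
  \int[mu]_x ((q * hp_poly N m).[x] * cauchy_weight (N%:R + s) x) = 0.
Proof.
move=> mN sq.
have -> : \int[mu]_x ((q * hp_poly N m).[x] * cauchy_weight (N%:R + s) x) =
  \int[mu]_x (\sum_(j < m) q`_j * (('X^j * hp_poly N m).[x] * cauchy_weight (N%:R + s) x)).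
  apply: eq_Rintegral => x _; rewrite hornerM (horner_coef_wide _ sq) mulr_suml mulr_suml.
  by apply: eq_bigr => j _; rewrite hornerM hornerXn !mulrA.
have i1 j : (j < m)%N -> intg (fun x => ('X^j * hp_poly N m).[x] * cauchy_weight (N%:R + s) x).
  move=> jm; apply: integrable_cauchy_weight_poly; rewrite (leq_trans (size_polyMleq _ _))//.
  by rewrite size_polyXn size_hp_poly; lia.
rewrite Rintegral_sum// => [|j _]; last by apply: integrableZ_EFin => //; exact: i1.
apply: big1 => j _; rewrite (RintegralZl _ measurableT (i1 _ (ltn_ord j))).
have := romanovski_orthogonal (b1 mN) (ltn_ord j); rewrite subrK -/(hp_poly N m) => ->.
by rewrite mulr0.
Qed.

Lemma hp_poly_orthonormal N m m' : (m < N)%N -> (m' < N)%N ->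
  intg (fun x => (hp_poly N m * hp_poly N m').[x] * cauchy_weight (N%:R + s) x) /\
  \int[mu]_x ((hp_poly N m * hp_poly N m').[x] * cauchy_weight (N%:R + s) x) =
  hp_norm N m * (m == m')%:R.
Proof.
move=> mN mN'; split.
  apply: integrable_cauchy_weight_poly; rewrite (leq_trans (size_polyMleq _ _))//.
  by rewrite !size_hp_poly; lia.
have [mm|mm|<-] := ltngtP m m'.
- by rewrite hp_poly_orthogonal ?mulr0 ?size_hp_poly// ltnW.
- by rewrite mulrC hp_poly_orthogonal ?mulr0 ?size_hp_poly// ltnW.
have e : hp_poly N m * hp_poly N m = 'X^m * hp_poly N m + (hp_poly N m - 'X^m) * hp_poly N m.
  by rewrite -mulrDl addrC subrK.
have sz : (size (hp_poly N m - 'X^m)%R <= m)%N by exact: size_romanovskiB.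
rewrite e mulr1; under eq_Rintegral do rewrite hornerD mulrDl.
rewrite RintegralD//; last 2 first.
- apply: integrable_cauchy_weight_poly; rewrite (leq_trans (size_polyMleq _ _))//.
  by rewrite size_polyXn size_hp_poly; lia.
- apply: integrable_cauchy_weight_poly; rewrite (leq_trans (size_polyMleq _ _))//.
  by rewrite size_hp_poly; move: sz; lia.
rewrite (hp_poly_orthogonal (ltnW mN) sz) addr0.
by have := romanovski_normE m (b1 (ltnW mN)); rewrite subrK.
Qed.

Definition hp_fun N (m : 'I_N) x : R :=
  (hp_poly N m).[x] * Num.sqrt (cauchy_weight (N%:R + s) x) / Num.sqrt (hp_norm N m).

Let sqrt_sqr (u : R) : 0 < u -> Num.sqrt u * Num.sqrt u = u.
Proof. by move=> u0; rewrite -expr2 sqr_sqrtr// ltW. Qed.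

Lemma hp_funM N (a b : 'I_N) x : hp_fun a x * hp_fun b x =
  (Num.sqrt (hp_norm N a) * Num.sqrt (hp_norm N b))^-1 *
  ((hp_poly N a * hp_poly N b).[x] * cauchy_weight (N%:R + s) x).
Proof.
have aux (p q W A B : R) : p * W * A * (q * W * B) = A * B * (p * q * (W * W)) by ring.
by rewrite /hp_fun aux -invfM hornerM (sqrt_sqr (cauchy_weight_gt0 _ _)).
Qed.

Lemma hp_fun_orthonormal N (a b : 'I_N) : intg (fun x => hp_fun a x * hp_fun b x) /\
  \int[mu]_x (hp_fun a x * hp_fun b x) = (a == b)%:R.
Proof.
have [i e] := hp_poly_orthonormal (ltn_ord a) (ltn_ord b).
split; first by under eq_fun do rewrite hp_funM; exact: integrableZ_EFin.
under eq_Rintegral do rewrite hp_funM.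
rewrite RintegralZl// e; have [->|ab] := eqVneq a b.
  by rewrite eqxx sqrt_sqr ?hp_norm_gt0 ?(ltnW (ltn_ord b))// mulr1 mulVf// gt_eqF// hp_norm_gt0// ltnW.
by rewrite (_ : (a == b :> nat) = false) ?mulr0//; exact/negbTE.
Qed.

(** The usual telescoping sum. What has to be verified is that the coefficient of the explicit
    three-term recurrence is the quotient of consecutive norms. *)
Lemma hp_poly_christoffel_darboux N n x y : (n < N)%N ->
  (x - y) * \sum_(m < n.+1) (hp_poly N m).[x] * (hp_poly N m).[y] / hp_norm N m =
  ((hp_poly N n.+1).[x] * (hp_poly N n).[y] - (hp_poly N n.+1).[y] * (hp_poly N n).[x]) / hp_norm N n.
Proof.
have rec m z : (m < N)%N -> (hp_poly N m.+1).[z] = z * (hp_poly N m).[z] -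
   (if m is m'.+1 then hp_norm N m / hp_norm N m' * (hp_poly N m').[z] else 0).
  move=> mN; have s2 := s1; have mN' : m.+1%:R <= N%:R :> R by rewrite ler_nat.
  have h1 := b1 (ltnW mN).
  have := romanovski_three_term m z h1.
  have -> : N%:R + s - m%:R - 1 = N%:R + s - m.+1%:R by rewrite -natr1; ring.
  rewrite -/(hp_poly N m.+1) -/(hp_poly N m) => ->; congr (_ - _).
  case: m mN mN' h1 => [|m] mN mN' h1; first by rewrite !mul0r.
  have -> : N%:R + s - m.+1%:R + 1 = N%:R + s - m%:R by rewrite -natr1; ring.
  rewrite -/(hp_poly N m); congr (_ * _).
  rewrite /hp_norm /romanovski_norm.
  have -> : N%:R + s - m%:R = N%:R + s - m.+1%:R + 1 by rewrite -natr1; ring.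
  move: h1; move: (N%:R + s - m.+1%:R) => b h1.
  rewrite cauchy_massD1// factS natrM.
  have m0 : 0 <= m%:R :> R by [].
  have c0 : cauchy_mass b != 0.
    apply/eqP => c0; have := romanovski_norm_gt0 0 h1.
    by rewrite /romanovski_norm c0 mulr0 ltxx.
  have p0 : \prod_(i < m) (2 * (b + 1) + i%:R) != 0.
    by apply/prodf_neq0 => i _; have : 0 <= i%:R :> R by []; move=> ?; rewrite gt_eqF//; lra.
  have f0 : m`!%:R != 0 :> R by rewrite pnatr_eq0 -lt0n fact_gt0.
  have d0 : 2 * b + m.+1%:R != 0 by rewrite -natr1 gt_eqF//; lra.
  have e : \prod_(i < m.+1) (2 * b + i%:R) =
      2 * b * (2 * b + 1) * \prod_(i < m) (2 * (b + 1) + i%:R) / (2 * b + m.+1%:R).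
    apply: (canRL (mulfK d0)).
    transitivity (\prod_(i < m.+2) (2 * b + i%:R)); first by rewrite [RHS]big_ord_recr.
    rewrite 2!big_ord_recl addr0 mulrA; congr (_ * _).
    by apply: eq_bigr => i _; rewrite !lift0 -!natr1; ring.
  rewrite e; move: d0 p0 f0 c0; rewrite -[m.+1%:R]natr1.
  move: (m`!%:R) (m%:R) (\prod_(i < m) _) (cauchy_mass b) => F u X M d0 p0 f0 c0.
  have q1 : 2 * b + 1 != 0 by rewrite gt_eqF//; lra.
  have q2 : 2 * b - 1 != 0 by rewrite gt_eqF//; lra.
  have q3 : b != 0 by rewrite gt_eqF//; lra.
  by field; rewrite ?c0 ?p0 ?f0 ?d0 ?q1 ?q2 ?q3 ?pnatr_eq0.
elim: n => [|n IH] nN.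
  rewrite big_ord1 !rec// /hp_poly !romanovski0 !hornerC; ring.
have h0 := lt0r_neq0 (hp_norm_gt0 (ltnW nN)); have h1 := lt0r_neq0 (hp_norm_gt0 (ltnW (ltnW nN))).
rewrite big_ord_recr/= mulrDr IH ?(ltnW nN)// (rec n.+1 x nN) (rec n.+1 y nN).
move: h0 h1 (hp_poly N n.+1).[x] (hp_poly N n.+1).[y] (hp_poly N n).[x] (hp_poly N n).[y].
move: (hp_norm N n.+1) (hp_norm N n) => A B A0 B0 p q r t; field; exact/andP.
Qed.

End RomanovskiEnsemble.

(** * Scaling limit of the correlation kernel *)

Section Tannery.
Context {R : realType}.

Lemma series_tail_le (M : nat -> R) K n : (forall k, 0 <= M k) -> cvgn (series M) -> (K <= n)%N ->
  \sum_(K <= k < n) M k <= limn (series M) - series M K.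
Proof.
move=> M0 cM Kn; rewrite lerBrDl.
have -> : series M K + \sum_(K <= k < n) M k = series M n by rewrite /series/= -big_cat_nat.
apply: nondecreasing_cvgn_le => //; apply: nondecreasing_series => k _ _; exact: M0.
Qed.

(** Tannery's theorem: the sum is cut at [K], where the tail of the dominating series is below
    [e / 3], and the remaining finite sum converges term by term. *)
Lemma tannery (a : nat -> nat -> R) (a0 M : nat -> R) :
  (forall k, a N k @[N --> \oo] --> a0 k) -> (forall N k, `|a N k| <= M k) ->
  cvgn (series M) ->
  \sum_(k < N.+1) a N k @[N --> \oo] --> limn (series a0).
Proof.
move=> aa0 aM cM.
have M0 k : 0 <= M k by apply: le_trans (aM 0%N k).
have a0M k : `|a0 k| <= M k.
  have h : `|a N k| @[N --> \oo] --> `|a0 k| by exact: cvg_norm.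
  have <- := cvg_lim (@Rhausdorff R) h.
  by apply: limr_le; [apply: cvgP h|near=> N; exact: aM].
have ca0 : cvgn (series a0).
  apply: normed_cvg; apply: (series_le_cvg _ _ _ cM) => // k; exact: normr_ge0.
have tail0 K : `|limn (series a0) - series a0 K| <= limn (series M) - series M K.
  have h : `|series a0 n - series a0 K| @[n --> \oo] --> `|limn (series a0) - series a0 K|.
    by apply: cvg_norm; apply: cvgB => //; exact: cvg_cst.
  have <- := cvg_lim (@Rhausdorff R) h.
  apply: limr_le; first by apply: cvgP h.
  near=> n; have Kn : (K <= n)%N by near: n; exact: nbhs_infty_ge.
  rewrite sub_series_geq// (le_trans (ler_norm_sum _ _ _))//.
  by apply: le_trans (series_tail_le M0 cM Kn); apply: ler_sum => k _.
apply/cvgrPdist_le => e e0; have e3 : 0 < e / 3 by rewrite divr_gt0.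
have /cvgrPdist_le/(_ _ e3)[K _ hK] := cM.
have tK : limn (series M) - series M K <= e / 3 by apply: le_trans (ler_norm _) (hK K (leqnn K)).
have cK : \sum_(k < K) a N k @[N --> \oo] --> \sum_(k < K) a0 k.
  by apply: cvg_big => //; first [exact: add_continuous|move=> k _; exact: aa0].
have /cvgrPdist_le/(_ _ e3) [N0 _ hN0] := cK.
near=> N; have NK : (K <= N.+1)%N by rewrite ltnW// ltnS; near: N; exact: nbhs_infty_ge.
have NN0 : (N0 <= N)%N by near: N; exact: nbhs_infty_ge.
have hN := hN0 _ NN0; rewrite -(big_mkord xpredT (a N)) (big_cat_nat (leq0n K) NK)//= big_mkord.
have := tail0 K; rewrite {2}/series/= big_mkord => t0.
have t1 : `|\sum_(K <= k < N.+1) a N k| <= e / 3.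
  apply: le_trans (ler_norm_sum _ _ _) _; apply: le_trans tK.
  by apply: le_trans (series_tail_le M0 cM NK); apply: ler_sum => k _.
have {}t0 := le_trans t0 tK.
have -> : limn (series a0) - (\sum_(k < K) a N k + \sum_(K <= k < N.+1) a N k) =
  (limn (series a0) - \sum_(k < K) a0 k) + (\sum_(k < K) a0 k - \sum_(k < K) a N k) - \sum_(K <= k < N.+1) a N k by ring.
rewrite (le_trans (ler_normB _ _))// (le_trans (lerD (ler_normD _ _) (lexx _)))//.
rewrite (splitr e) /=; have : e = e / 3 + e / 3 + e / 3 by field.
by lra.
Unshelve. all: by end_near. Qed.

End Tannery.

Section BesselSeries.
Context {R : realType}.
Implicit Types (b v x : R).
Local Notation g := (@bessel_coef R).

Lemma bessel_coef_le b k : 1 <= 2 * b + 1 -> `|g b k| <= k`!%:R^-1.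
Proof.
move=> b1; elim: k => [|k IH]; first by rewrite bessel_coef0 normr1 invr1.
have k0 : 0 <= k%:R :> R by [].
have e := @bessel_coefS R b k (lt_le_trans ltr01 b1).
have d0 : 0 < 2 * k.+1%:R * (2 * b + 1 + 2 * k%:R) by rewrite !mulr_gt0//; lra.
have -> : g b k.+1 = - g b k / (2 * k.+1%:R * (2 * b + 1 + 2 * k%:R)).
  by rewrite -e [RHS]mulrC mulKf// gt_eqF.
rewrite normrM normrN normfV (gtr0_norm d0) factS natrM [leRHS]invfM [leRHS]mulrC.
apply: ler_pM => //; rewrite ?invr_ge0 ?(ltW d0)//.
rewrite lef_pV2 ?posrE//; move: (k.+1%:R) (ltr0Sn R k) => K K0.
have : 0 <= 2 * K * (2 * b + 2 * k%:R) by rewrite !mulr_ge0//; lra.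
by lra.
Qed.

(** The Bessel function of order [b - 1/2] at [z], stripped of [(z / 2)^(b - 1/2) / Gamma (b + 1/2)]
    and written in [v = z^2]; it is an entire function of [v]. *)
Definition bessel_psi b v : R := limn (pseries (g b) v).

Lemma bessel_term_le b v k : 1 <= 2 * b + 1 -> `|g b k * v ^+ k| <= exp_coeff `|v| k.
Proof.
move=> b1; rewrite normrM normrX /exp_coeff /= mulrC; apply: ler_wpM2l; first exact: exprn_ge0.
exact: bessel_coef_le.
Qed.

Lemma is_cvg_bessel_psi b v : 1 <= 2 * b + 1 -> cvgn (pseries (g b) v).
Proof.
move=> b1; apply: normed_cvg.
apply: (series_le_cvg _ _ _ (is_cvg_series_exp_coeff `|v|)) => k; first exact: normr_ge0.
- by rewrite exp_coeff_ge0.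
- exact: bessel_term_le.
Qed.

Lemma bessel_coef_diffs b : 1 <= 2 * b + 1 ->
  pseries_diffs (g b) = (fun k => - (2 * (2 * b + 1))^-1 * g (b + 1) k).
Proof.
move=> b1; apply/funext => k; have b0 := lt_le_trans ltr01 b1.
have n0 : 2 * (2 * b + 1) != 0 by rewrite gt_eqF//; lra.
by apply: (mulfI n0); rewrite mulNr mulrN mulVKf// -(bessel_coefS_shift k b0) /pseries_diffs; ring.
Qed.

Lemma pseriesZ (c : R) (f : nat -> R) v : cvgn (pseries f v) ->
  limn (pseries (fun k => c * f k) v) = c * limn (pseries f v).
Proof.
move=> cf; have -> : pseries (fun k => c * f k) v = (fun n => c * pseries f v n).
  by apply/funext => n; rewrite /pseries /series/= mulr_sumr; apply: eq_bigr => k _; rewrite mulrA.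
by apply/cvg_lim => //; apply: cvgZr.
Qed.

Lemma is_cvg_pseriesZ (c : R) (f : nat -> R) v : cvgn (pseries f v) ->
  cvgn (pseries (fun k => c * f k) v).
Proof.
move=> cf; have -> : pseries (fun k => c * f k) v = (fun n => c * pseries f v n).
  by apply/funext => n; rewrite /pseries /series/= mulr_sumr; apply: eq_bigr => k _; rewrite mulrA.
by apply: cvgP; apply: cvgZr; exact: cf.
Qed.

Lemma is_derive_bessel_psi b v : 1 <= 2 * b + 1 ->
  is_derive v (1 : R) (bessel_psi b) (- (2 * (2 * b + 1))^-1 * bessel_psi (b + 1) v).
Proof.
move=> b1; have b2 : 1 <= 2 * (b + 1) + 1 by lra.
have b3 : 1 <= 2 * (b + 1 + 1) + 1 by lra.
have := @pseries_snd_diffs R (g b) (`|v| + 1) v.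
rewrite bessel_coef_diffs// => h.
have -> : - (2 * (2 * b + 1))^-1 * bessel_psi (b + 1) v =
    limn (pseries (fun k => - (2 * (2 * b + 1))^-1 * g (b + 1) k) v).
  by rewrite pseriesZ//; exact: is_cvg_bessel_psi.
apply: h.
- exact: is_cvg_bessel_psi.
- by apply: is_cvg_pseriesZ; exact: is_cvg_bessel_psi.
- have -> : pseries_diffs (fun k => - (2 * (2 * b + 1))^-1 * g (b + 1) k) =
      fun k => - (2 * (2 * b + 1))^-1 * pseries_diffs (g (b + 1)) k.
    by apply/funext => k; rewrite /pseries_diffs mulrCA.
  apply: is_cvg_pseriesZ; rewrite bessel_coef_diffs//.
  by apply: is_cvg_pseriesZ; exact: is_cvg_bessel_psi.
- by rewrite [ltRHS]ger0_norm ?addr_ge0// ltrDl.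
Qed.

(** The three-term recurrence of the Bessel functions of orders [b - 1/2], [b + 1/2] and [b + 3/2].
    The constant terms cancel, so partial sums of length [n + 1] on the left match those of length
    [n] on the right. *)
Lemma bessel_psi_shift b v : 1 <= 2 * b + 1 ->
  (2 * b + 1) * (bessel_psi b v - bessel_psi (b + 1) v) =
  - v / (2 * b + 3) * bessel_psi (b + 1 + 1) v.
Proof.
move=> b1; have b2 : 1 <= 2 * (b + 1) + 1 by lra.
have b3 : 1 <= 2 * (b + 1 + 1) + 1 by lra.
have b0 := lt_le_trans ltr01 b1.
have e k : (2 * b + 1) * (g b k - g (b + 1) k) = 2 * k%:R * g (b + 1) k.
  by rewrite mulrBr (bessel_coef_shift k b0); ring.
have L : (2 * b + 1) * (pseries (g b) v n.+1 - pseries (g (b + 1)) v n.+1) @[n --> \oo] -->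
    (2 * b + 1) * (bessel_psi b v - bessel_psi (b + 1) v).
  apply: cvgMr; apply: cvgB; rewrite (cvg_shiftS (pseries _ v)); exact: is_cvg_bessel_psi.
have RR : - v / (2 * b + 3) * pseries (g (b + 1 + 1)) v n @[n --> \oo] -->
    - v / (2 * b + 3) * bessel_psi (b + 1 + 1) v.
  by apply: cvgMr; exact: is_cvg_bessel_psi.
suff E : (fun n => (2 * b + 1) * (pseries (g b) v n.+1 - pseries (g (b + 1)) v n.+1)) =
    (fun n => - v / (2 * b + 3) * pseries (g (b + 1 + 1)) v n).
  by rewrite E in L; exact: (cvg_unique (@Rhausdorff R) L RR).
apply/funext => n; rewrite /pseries /series/= -sumrB mulr_sumr big_nat_recl//=.
rewrite !bessel_coef0 subrr mulr0 add0r mulr_sumr; apply: eq_bigr => k _.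
rewrite -mulrBl mulrA e.
have b20 : 0 < 2 * (b + 1) + 1 by lra.
have := bessel_coefS_shift k b20.
have -> : 2 * (b + 1) + 1 = 2 * b + 3 by ring.
move: (g (b + 1) k.+1) (g (b + 1 + 1) k) => u u2 h.
have n0 : 2 * b + 3 != 0 by rewrite gt_eqF//; lra.
have -> : u2 = - (2 * k.+1%:R * (2 * b + 3) * u) by rewrite h opprK.
rewrite exprS; move: (k.+1%:R) (v ^+ k) => A B; field; exact: n0.
Qed.

End BesselSeries.

Lemma cauchy_mass_gt0 (R : realType) (b : R) : 1 < 2 * b -> 0 < cauchy_mass b.
Proof. by move=> /(@romanovski_norm_gt0 R b 0); rewrite /romanovski_norm big_ord0 divr1 mul1r. Qed.

Section ScaledKernel.
Context {R : realType}.
Notation mu := (@lebesgue_measure R).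
Local Notation P := (@romanovski R).
Local Notation g := (@bessel_coef R).
Variables (s : R).
Hypothesis s1 : 1 < 2 * s.
Implicit Types (N m k j : nat) (x y : R).

(** [hp_A N.+1] and [hp_B N] are the polynomials of degrees [N + 1] and [N] of the ensemble of
    [N + 1] points, taken at [(N + 1) x] and divided by their leading monomials. As functions of
    [x^-2] their coefficients tend to Bessel coefficients. *)
Definition hp_A N x : R := \sum_(k < N.+1) g s k * ((N ^_ (2 * k))%:R / N%:R ^+ (2 * k)) * (x ^- 2) ^+ k.
Definition hp_B N x : R :=
  \sum_(k < N.+1) g (s + 1) k * ((N ^_ (2 * k))%:R / N.+1%:R ^+ (2 * k)) * (x ^- 2) ^+ k.

Lemma romanovski_scale b m x (t : R) K : (m < K)%N -> t != 0 -> x != 0 ->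
  (P b m).[t * x] = (t * x) ^+ m * \sum_(k < K) g b k * ((m ^_ (2 * k))%:R / t ^+ (2 * k)) * (x ^- 2) ^+ k.
Proof.
move=> mK t0 x0; rewrite (horner_romanovski _ _ mK) mulr_sumr; apply: eq_bigr => k _.
have [km|mk] := leqP (2 * k) m; last by rewrite ffact_small// mulr0 !mul0r mulr0 mul0r mulr0.
have -> : (t * x) ^+ m = (t * x) ^+ (m - 2 * k) * (t ^+ (2 * k) * x ^+ (2 * k)).
  by rewrite -exprMn -exprD subnK.
have -> : (x ^- 2) ^+ k = (x ^+ (2 * k))^-1 by rewrite exprVn exprM.
have : t ^+ (2 * k) != 0 by rewrite expf_neq0.
have : x ^+ (2 * k) != 0 by rewrite expf_neq0.
move: (x ^+ (2 * k)) (t ^+ (2 * k)) ((t * x) ^+ _) (g b k) (_%:R) => X T Y G F X0 T0.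
by field; rewrite X0 T0.
Qed.

Lemma hp_poly_topE N x : x != 0 ->
  (hp_poly s N.+1 N.+1).[N.+1%:R * x] = (N.+1%:R * x) ^+ N.+1 * hp_A N.+1 x.
Proof. by move=> x0; rewrite /hp_poly addrC addKr (@romanovski_scale _ _ _ _ N.+2)// pnatr_eq0. Qed.

Lemma hp_poly_subtopE N x : x != 0 ->
  (hp_poly s N.+1 N).[N.+1%:R * x] = (N.+1%:R * x) ^+ N * hp_B N x.
Proof.
move=> x0; rewrite /hp_poly (_ : N.+1%:R + s - N%:R = s + 1); last by rewrite -natr1; ring.
by rewrite (@romanovski_scale _ _ _ _ N.+1)// pnatr_eq0.
Qed.

(** The degree [u N] may be [N] or [N + 1], which serves [hp_B] and [hp_A] alike; each of the [k]
    factors tends to [1]. *)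
Lemma ffact_ratio_cvg c (u v : nat -> nat) k :
  (forall N, (u N <= N.+1)%N) -> (forall N, (N <= u N)%N) -> v = (fun N => N.+1) ->
  c = 1 -> (u N ^_ k)%:R / (v N)%:R ^+ k @[N --> \oo] --> (c : R).
Proof.
move=> u1 u0 -> ->; elim: k => [|k IH].
  under eq_fun do rewrite ffactn0 expr0 divr1; exact: cvg_cst.
under eq_fun do rewrite ffactnSr exprSr natrM -mulf_div.
suff h : (u N - k)%:R / N.+1%:R @[N --> \oo] --> (1 : R).
  by apply: cvg_trans (cvgM IH h) _; rewrite mulr1; exact: cvg_id.
apply: (@squeeze_cvgr _ _ _ _ (fun N => 1 - k.+1%:R * harmonic N) (cst 1)); last 2 first.
- rewrite -[X in _ --> X]subr0; apply: cvgB; first exact: cvg_cst.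
  by rewrite -(mulr0 k.+1%:R); apply: cvgMr; exact: cvg_harmonic.
- exact: cvg_cst.
near=> N; rewrite /harmonic /= ler_pdivrMr// ler_pdivlMr// mul1r mulrBl mul1r mulfVK ?pnatr_eq0//.
have kN : (k.+1 <= N.+1)%N by near: N; exists k.
rewrite -natrB// !ler_nat; have := u1 N; have := u0 N; lia.
Unshelve. all: by end_near. Qed.

Lemma ffact_ratio_le n k : `|(n ^_ k)%:R / n.+1%:R ^+ k| <= 1 :> R.
Proof.
rewrite ger0_norm ?divr_ge0// ler_pdivrMr ?exprn_gt0// mul1r -natrX ler_nat.
elim: k => [|k IH]; first by rewrite ffactn0 expn0.
rewrite ffactnSr expnSr leq_mul//; lia.
Qed.

Lemma ffact_ratio_le' n k : `|(n.+1 ^_ k)%:R / n.+1%:R ^+ k| <= 1 :> R.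
Proof.
rewrite ger0_norm ?divr_ge0// ler_pdivrMr ?exprn_gt0// mul1r -natrX ler_nat.
elim: k => [|k IH]; first by rewrite ffactn0 expn0.
rewrite ffactnSr expnSr leq_mul//; lia.
Qed.

Lemma hp_A_cvg x : hp_A N.+1 x @[N --> \oo] --> bessel_psi s (x ^- 2).
Proof.
have s2 := s1; have b1 : 1 <= 2 * s + 1 by lra.
rewrite /hp_A.
rewrite (cvg_shiftS (fun n => \sum_(k < n.+1) g s k * ((n ^_ (2 * k))%:R / n%:R ^+ (2 * k)) * (x ^- 2) ^+ k)).
apply: (@tannery R (fun N k => g s k * ((N ^_ (2 * k))%:R / N%:R ^+ (2 * k)) * (x ^- 2) ^+ k) _ (exp_coeff `|x ^- 2|)).
- move=> k; apply: cvgMl; rewrite -[X in _ --> X]mulr1; apply: cvgMr.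
  rewrite -(cvg_shiftS (fun N => (N ^_ (2 * k))%:R / N%:R ^+ (2 * k) : R)).
  exact: (@ffact_ratio_cvg 1 (fun N => N.+1) (fun N => N.+1)).
- move=> [|N] k.
    case: k => [|k]; last by rewrite ffact_small ?muln_gt0// mul0r mulr0 mul0r normr0 exp_coeff_ge0.
    rewrite muln0 ffactn0 expr0 divr1 mulr1; exact: bessel_term_le.
  rewrite mulrAC normrM; apply: le_trans (bessel_term_le _ _ b1).
  by rewrite ler_piMr// ffact_ratio_le'.
- exact: is_cvg_series_exp_coeff.
Qed.

Lemma hp_B_cvg x : hp_B N x @[N --> \oo] --> bessel_psi (s + 1) (x ^- 2).
Proof.
have s2 := s1; have b1 : 1 <= 2 * (s + 1) + 1 by lra.
apply: (@tannery R (fun N k => g (s + 1) k * ((N ^_ (2 * k))%:R / N.+1%:R ^+ (2 * k)) * (x ^- 2) ^+ k) _ (exp_coeff `|x ^- 2|)).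
- move=> k; apply: cvgMl; rewrite -[X in _ --> X]mulr1; apply: cvgMr.
  exact: (@ffact_ratio_cvg 1 (fun N => N) (fun N => N.+1)).
- move=> N k; rewrite mulrAC normrM; apply: le_trans (bessel_term_le _ _ b1).
  by rewrite ler_piMr// ffact_ratio_le.
- exact: is_cvg_series_exp_coeff.
Qed.

Lemma exp_coeff_sum_le x r n : 0 < r -> r <= `|x| -> \sum_(k < n) exp_coeff `|x ^- 2| k <= expR (r ^- 2).
Proof.
move=> r0 rx; have x0 : 0 < `|x| by exact: lt_le_trans rx.
have h : `|x ^- 2| <= r ^- 2.
  rewrite normfV normrX lef_pV2 ?posrE ?exprn_gt0//; apply: lerXn2r => //; rewrite nnegrE; exact: ltW.
apply: le_trans (_ : expR `|x ^- 2| <= _); last by rewrite ler_expR.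
rewrite -(big_mkord xpredT (exp_coeff `|x ^- 2|)).
apply: (@nondecreasing_cvgn_le R (series (exp_coeff `|x ^- 2|))); last exact: is_cvg_series_exp_coeff.
by apply: nondecreasing_series => k _ _; rewrite exp_coeff_ge0.
Qed.

Lemma hp_A_le N x r : 0 < r -> r <= `|x| -> `|hp_A N.+1 x| <= expR (r ^- 2).
Proof.
move=> r0 rx; apply: le_trans (exp_coeff_sum_le N.+2 r0 rx).
rewrite (le_trans (ler_norm_sum _ _ _))//; apply: ler_sum => k _.
have s2 := s1; have b1 : 1 <= 2 * s + 1 by lra.
rewrite mulrAC normrM; apply: le_trans (bessel_term_le _ _ b1).
by rewrite ler_piMr// ffact_ratio_le'.
Qed.

Lemma hp_B_le N x r : 0 < r -> r <= `|x| -> `|hp_B N x| <= expR (r ^- 2).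
Proof.
move=> r0 rx; apply: le_trans (exp_coeff_sum_le N.+1 r0 rx).
rewrite (le_trans (ler_norm_sum _ _ _))//; apply: ler_sum => k _.
have s2 := s1; have b1 : 1 <= 2 * (s + 1) + 1 by lra.
rewrite mulrAC normrM; apply: le_trans (bessel_term_le _ _ b1).
by rewrite ler_piMr// ffact_ratio_le.
Qed.

(** The constant in front of the rescaled kernel. The norm being a quotient of Gamma values, this is
    a Gamma ratio with increment [2s + 1] divided by the matching power. *)
Definition hp_kappa N : R := (hp_norm s N.+1 N)^-1 * N.+1%:R `^ (- (2 * s + 1)).

Definition hp_kappa_lim : R := (Gamma (2 * s + 2) * cauchy_mass (s + 1))^-1.

Lemma hp_norm_subtopE N : hp_norm s N.+1 N =
  Gamma N.+1%:R * Gamma (2 * s + 2) / Gamma (N.+1%:R + (2 * s + 1)) * cauchy_mass (s + 1).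
Proof.
have s2 := s1.
rewrite /hp_norm (_ : N.+1%:R + s - N%:R = s + 1); last by rewrite -natr1; ring.
rewrite /romanovski_norm Gamma_nat; congr (_ * _).
suff -> : Gamma (N.+1%:R + (2 * s + 1)) = \prod_(i < N) (2 * (s + 1) + i%:R) * Gamma (2 * s + 2).
  have G0 : Gamma (2 * s + 2) != 0 by rewrite gt_eqF// Gamma_gt0//; lra.
  by rewrite -mulf_div divff// mulr1.
elim: N => [|N IH]; first by rewrite big_ord0 mul1r; congr Gamma; ring.
have -> : N.+2%:R + (2 * s + 1) = N.+1%:R + (2 * s + 1) + 1 by rewrite -[N.+2%:R]natr1; ring.
rewrite (@GammaD1 _ (N.+1%:R + (2 * s + 1))); last by clear -s2; have : 0 <= N.+1%:R :> R by []; lra.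
by rewrite IH big_ord_recr/= mulrA [_ * \prod_(i < N) _]mulrC -natr1; congr (_ * _ * _); ring.
Qed.

Lemma hp_kappa_gt0 N : 0 < hp_kappa N.
Proof. by rewrite /hp_kappa mulr_gt0 ?powR_gt0// invr_gt0; exact: hp_norm_gt0. Qed.

Lemma hp_kappa_cvg : hp_kappa N @[N --> \oo] --> hp_kappa_lim.
Proof.
have s2 := s1; have c0 : 0 <= 2 * s + 1 by lra.
suff -> : hp_kappa = (fun N => Gamma (N.+1%:R + (2 * s + 1)) / (Gamma N.+1%:R * N.+1%:R `^ (2 * s + 1)) * hp_kappa_lim).
  by rewrite -[X in _ @ _ --> X]mul1r; apply: cvgMl; exact: Gamma_ratio_cvg.
apply/funext => N; rewrite /hp_kappa hp_norm_subtopE /hp_kappa_lim powRN.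
have N0 : (0 : R) < N.+1%:R by [].
have G0 : Gamma (2 * s + 2) != 0 by rewrite gt_eqF// Gamma_gt0//; lra.
have G1 : Gamma N.+1%:R != 0 :> R by rewrite gt_eqF// Gamma_gt0// ler1n.
have G2 : Gamma (N.+1%:R + (2 * s + 1)) != 0 by rewrite gt_eqF// Gamma_gt0//; clear -s2 N0; lra.
have M0 : cauchy_mass (s + 1) != 0.
  by clear -s2; apply: lt0r_neq0; apply: cauchy_mass_gt0; lra.
have P0 : N.+1%:R `^ (2 * s + 1) != 0 by rewrite gt_eqF// powR_gt0.
move: (Gamma _) (Gamma _) (Gamma _) (cauchy_mass _) (_ `^ _) G0 G1 G2 M0 P0 => A B C D E A0 B0 C0 D0 E0.
by field; rewrite ?A0 ?B0 ?C0 ?D0 ?E0.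
Qed.

(** What separates the Cauchy weight at [y = (N + 1) x] from the pure power of [|y|]: it is at most
    [1] and tends to [1]. *)
Definition hp_omega N x : R := (1 + (N.+1%:R * x) ^- 2) `^ (- (N.+1%:R + s)).

Lemma hp_omega_gt0 N x : 0 < hp_omega N x.
Proof. by rewrite powR_gt0// ltr_wpDr// invr_ge0 sqr_ge0. Qed.

Lemma hp_omega_le1 N x : hp_omega N x <= 1.
Proof.
have s2 := s1; have u0 : 1 <= 1 + (N.+1%:R * x) ^- 2 by rewrite lerDl invr_ge0 sqr_ge0.
have N0 : 0 <= N.+1%:R :> R by [].
by apply: (@le_trans _ _ ((1 + (N.+1%:R * x) ^- 2) `^ 0)); [apply: ler_powR => //; lra|rewrite powRr0].
Qed.

Lemma hp_omega_cvg x : x != 0 -> hp_omega N x @[N --> \oo] --> (1 : R).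
Proof.
move=> x0; have s2 := s1.
pose c := (1 + s) / x ^+ 2.
apply: (@squeeze_cvgr _ _ _ _ (fun N => 1 - c * harmonic N) (cst 1)); last 2 first.
- rewrite -[X in _ @ _ --> X]subr0; apply: cvgB; first exact: cvg_cst.
  by rewrite -(mulr0 c); apply: cvgMr; exact: cvg_harmonic.
- exact: cvg_cst.
apply: nearW => N; rewrite hp_omega_le1 andbT.
have x20 : 0 < x ^+ 2 by rewrite exprn_even_gt0.
have N0 : 0 < N.+1%:R :> R by [].
have N1 : 1 <= N.+1%:R :> R by rewrite ler1n.
have u0 : 0 < (N.+1%:R * x) ^- 2 by rewrite invr_gt0 exprMn mulr_gt0// exprn_gt0.
set u := (N.+1%:R * x) ^- 2 in u0 *.
have w0 : 0 < 1 + u by lra.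
have ln_le : ln (1 + u) <= u by apply: le_ln1Dx; lra.
rewrite /hp_omega /powR -/u (gt_eqF w0).
apply: le_trans (expR_ge1Dx _); rewrite lerD2l mulNr lerN2.
apply: (@le_trans _ _ ((N.+1%:R + s) * u)); first by apply: ler_wpM2l => //; lra.
rewrite /u /harmonic /c exprMn /=.
have aux (t X : R) : 1 <= t -> 0 < X -> (t + s) * (t ^+ 2 * X)^-1 <= (1 + s) / X / t.
  move=> t1 X0; have t0 : 0 < t by lra.
  have -> : (1 + s) / X / t = (1 + s) * t * (t ^+ 2 * X)^-1 by field; rewrite !gt_eqF.
  by apply: ler_wpM2r; [rewrite invr_ge0 mulr_ge0 ?sqr_ge0// ltW|nra].
exact: aux.
Qed.

Lemma cauchy_weight_scale N x : x != 0 ->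
  cauchy_weight (N.+1%:R + s) (N.+1%:R * x) =
  (N.+1%:R * x) ^- (2 * N.+1) * (N.+1%:R `^ (- s) * `|x| `^ (- s)) ^+ 2 * hp_omega N x.
Proof.
move=> x0; have N0 : N.+1%:R != 0 :> R by rewrite pnatr_eq0.
have y0 : N.+1%:R * x != 0 by rewrite mulf_neq0.
set y := N.+1%:R * x in y0 *.
have y2 : 0 < y ^+ 2 by rewrite exprn_even_gt0.
have e : 1 + y ^+ 2 = y ^+ 2 * (1 + y ^- 2) by rewrite mulrDr mulr1 mulfV ?gt_eqF// addrC.
transitivity ((y ^+ 2 * (1 + y ^- 2)) `^ (- (N.+1%:R + s))); first by rewrite -e.
rewrite powRM ?(ltW y2)//; last by rewrite addr_ge0// invr_ge0 ltW.
congr (_ * _); rewrite opprD powRD; last by rewrite (gt_eqF y2) implybT.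
congr (_ * _); first by rewrite powRN powR_mulrn ?(ltW y2)// -exprM.
rewrite -powRM// -(real_normK (num_real y)) /y normrM (ger0_norm (ler0n _ _)).
by rewrite [RHS]expr2 -powRM ?mulr_ge0// expr2.
Qed.

Definition hp_theta N x : R := `|x| `^ (- s) * Num.sqrt (hp_omega N x).

Lemma hp_theta_sqr N x : hp_theta N x ^+ 2 = `|x| `^ (- s) ^+ 2 * hp_omega N x.
Proof. by rewrite exprMn sqr_sqrtr// ltW// hp_omega_gt0. Qed.

Lemma hp_theta_cvg x : x != 0 -> hp_theta N x @[N --> \oo] --> `|x| `^ (- s).
Proof.
move=> x0; rewrite -[X in _ @ _ --> X]mulr1; apply: cvgMr; rewrite -[X in _ @ _ --> X]sqrtr1.
apply: (@cvg_comp _ _ _ (hp_omega ^~ x) Num.sqrt); first exact: hp_omega_cvg.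
exact: sqrt_continuous.
Qed.

Lemma sqrt_cauchy_weight_scale N x : x != 0 ->
  Num.sqrt (cauchy_weight (N.+1%:R + s) (N.+1%:R * x)) =
  `|N.+1%:R * x| ^- N.+1 * N.+1%:R `^ (- s) * hp_theta N x.
Proof.
move=> x0; apply/eqP; rewrite -(@eqrXn2 _ 2)//; last first.
  by rewrite !mulr_ge0 ?invr_ge0 ?exprn_ge0 ?powR_ge0 ?sqrtr_ge0.
rewrite sqr_sqrtr ?(ltW (cauchy_weight_gt0 _ _))// cauchy_weight_scale//.
have := hp_theta_sqr N x; move: (hp_theta N x) => T hT.
set y := N.+1%:R * x; clearbody y.
rewrite !exprMn hT exprVn -exprM [(N.+1 * 2)%N]mulnC !exprM (real_normK (num_real y)).
by apply/eqP; rewrite !mulrA.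
Qed.

Definition hp_sfun N (m : 'I_N.+1) x : R := Num.sqrt N.+1%:R * hp_fun s m (N.+1%:R * x).
Definition hp_skernel N x y : R := corr_kernel (@hp_sfun N) x y.

Lemma hp_skernelE N x y : hp_skernel N x y =
  N.+1%:R * (Num.sqrt (cauchy_weight (N.+1%:R + s) (N.+1%:R * x)) *
    Num.sqrt (cauchy_weight (N.+1%:R + s) (N.+1%:R * y)) *
    \sum_(m < N.+1) (hp_poly s N.+1 m).[N.+1%:R * x] * (hp_poly s N.+1 m).[N.+1%:R * y] / hp_norm s N.+1 m).
Proof.
rewrite /hp_skernel /corr_kernel !mulr_sumr; apply: eq_bigr => m _; rewrite /hp_sfun /hp_fun.
have h0 : 0 < hp_norm s N.+1 m by rewrite hp_norm_gt0// ltnW.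
have aux (t p w p' w' r h : R) : t * t = N.+1%:R -> r * r = h ->
   t * (p * w * r) * (t * (p' * w' * r)) = N.+1%:R * (w * w' * (p * p' * h)).
  by move=> <- <-; ring.
by apply: aux; rewrite -expr2 ?exprVn sqr_sqrtr// ltW.
Qed.

(** The square roots of the weights supply powers of [|x|] and [|y|] where the polynomials supply
    powers of [x] and [y], and the signs in between alternate with [N]. Only the sign-conjugated
    kernel converges; the conjugation does not affect determinants. *)
Lemma hp_skernel_offdiag N x y : x != 0 -> y != 0 -> x != y ->
  (Num.sg x * Num.sg y) ^+ N.+1 * hp_skernel N x y =
  hp_kappa N * hp_theta N x * hp_theta N y *
  ((hp_A N.+1 x * (hp_B N y / y) - hp_A N.+1 y * (hp_B N x / x)) / (x - y)).
Proof.
move=> x0 y0 xy; rewrite hp_skernelE !sqrt_cauchy_weight_scale//.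
have N0 : N.+1%:R != 0 :> R by rewrite pnatr_eq0.
have N0' : 0 < N.+1%:R :> R by [].
have xy0 : x - y != 0 by rewrite subr_eq0.
have := @hp_poly_christoffel_darboux R s s1 N.+1 N (N.+1%:R * x) (N.+1%:R * y) (ltnSn N).
rewrite !hp_poly_topE// !hp_poly_subtopE// -mulrBr.
set S := \sum_(m < N.+1) _ => e.
have {}e : S = ((N.+1%:R * x) ^+ N.+1 * hp_A N.+1 x * ((N.+1%:R * y) ^+ N * hp_B N y) -
      (N.+1%:R * y) ^+ N.+1 * hp_A N.+1 y * ((N.+1%:R * x) ^+ N * hp_B N x)) / hp_norm s N.+1 N /
      (N.+1%:R * (x - y)).
  by rewrite -e mulrAC mulfV ?mul1r// mulf_neq0.
rewrite e.
have pS (z : R) : z != 0 -> (N.+1%:R * z) ^+ N = (N.+1%:R * z) ^+ N.+1 / (N.+1%:R * z).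
  by move=> z0; rewrite exprSr mulfK// mulf_neq0.
rewrite (pS y)// (pS x)// !normrM (ger0_norm (ler0n _ _)) !exprMn.
have sgE (z : R) : z != 0 -> Num.sg z ^+ N.+1 * `|z| ^- N.+1 * z ^+ N.+1 = 1.
  move=> z0; rewrite -exprVn -!exprMn.
  have -> : Num.sg z * `|z|^-1 * z = 1 by rewrite mulrAC -normrEsg mulfV// normr_eq0.
  exact: expr1n.
have h0 : hp_norm s N.+1 N != 0 by rewrite gt_eqF// hp_norm_gt0// leqnSn.
rewrite /hp_kappa (_ : N.+1%:R `^ (- (2 * s + 1)) = (N.+1%:R `^ (- s)) ^+ 2 / N.+1%:R); last first.
  rewrite -[X in _ / X]powRr1// -powRN -powR_mulrn ?powR_ge0// -powRrM -powRD; last by rewrite N0 implybT.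
  by congr (_ `^ _); ring.
have t0 : N.+1%:R ^+ N.+1 != 0 :> R by rewrite expf_neq0.
have nx0 : `|x| ^+ N.+1 != 0 by rewrite expf_neq0// normr_eq0.
have ny0 : `|y| ^+ N.+1 != 0 by rewrite expf_neq0// normr_eq0.
have aux (T t h X Y sx sy nx ny p tx ty Ax Ay Bx By u v : R) :
  sx / nx * X = 1 -> sy / ny * Y = 1 -> u != 0 -> v != 0 -> u - v != 0 -> h != 0 -> T != 0 ->
  nx != 0 -> ny != 0 -> t != 0 ->
  sx * sy * (t * ((T * nx)^-1 * p * tx * ((T * ny)^-1 * p * ty) *
    ((T * X * Ax * (T * Y / (t * v) * By) - T * Y * Ay * (T * X / (t * u) * Bx)) / h / (t * (u - v))))) =
  h^-1 * (p ^+ 2 / t) * tx * ty * ((Ax * (By / v) - Ay * (Bx / u)) / (u - v)).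
  move=> ex ey x0' y0' xy0' h0' T0 nx0' ny0' t0'.
  have X0 : X != 0 by apply/eqP => X0; move/eqP: ex; rewrite X0 mulr0 eq_sym oner_eq0.
  have Y0 : Y != 0 by apply/eqP => Y0; move/eqP: ey; rewrite Y0 mulr0 eq_sym oner_eq0.
  have -> : sx = nx / X by rewrite -[RHS]mul1r -ex; field; rewrite X0.
  have -> : sy = ny / Y by rewrite -[RHS]mul1r -ey; field; rewrite Y0.
  by field; rewrite ?X0 ?Y0 ?nx0' ?ny0' ?T0 ?t0' ?h0' ?x0' ?y0' ?xy0'.
exact: (aux _ _ _ _ _ _ _ _ _ _ _ _ _ _ _ _ _ _ (sgE x x0) (sgE y y0) x0 y0 xy0 h0 t0 nx0 ny0 N0).
Qed.

End ScaledKernel.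

Lemma diff_quotient_cvg (R : realType) (f : R -> R) (x df : R) : is_derive x (1 : R) f df ->
  (f z - f x) / (z - x) @[z --> x^'] --> df.
Proof.
move=> [fd <-].
have sh : (z - x) @[z --> x^'] --> (0 : R)^'.
  move=> A [e e0 hA]; exists e => // z /= xz zx; apply: hA; last by rewrite /= subr_eq0.
  by rewrite /= sub0r normrN distrC.
have := @cvg_comp _ _ _ _ _ _ _ _ sh fd.
apply: cvg_trans; apply: near_eq_cvg; near=> z.
by rewrite /= [_%:A]mulr1 subrK [in RHS]mulrC.
Unshelve. all: by end_near. Qed.

Lemma poly_ext (R : numFieldType) (p q : {poly R}) : (forall x, p.[x] = q.[x]) -> p = q.
Proof.
move=> pq; apply: (@poly_eq_nat _ (maxn (size p) (size q))).
- by rewrite leqW// leq_max leqnn.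
- by rewrite leqW// leq_max leqnn orbT.
- by move=> k _.
Qed.

Section KernelLimit.
Context {R : realType}.
Notation mu := (@lebesgue_measure R).
Local Notation P := (@romanovski R).
Local Notation g := (@bessel_coef R).
Variables (s : R).
Hypothesis s1 : 1 < 2 * s.
Implicit Types (N m k j : nat) (x y : R).

Lemma romanovski_ladder_down' b m x : 0 < 2 * b + 1 ->
  (2 * b + 1) * (x * (P b m).[x] - (P b m.+1).[x]) = m%:R * (P (b + 1) m.-1).[x].
Proof.
move=> b0; case: m => [|m]; last exact: romanovski_ladder_down.
by rewrite romanovski0 romanovski1 hornerC hornerX mulr1 subrr mulr0 mul0r.
Qed.

(** The first-order differential system of the two top polynomials, from the Appell property and the
    ladder relations. *)
Lemma hp_poly_deriv N y :
  (2 * s + 1) * (1 + y ^+ 2) * (hp_poly s N.+1 N.+1)^`().[y] =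
    N.+1%:R * ((N.+1%:R + 2 * s) * (hp_poly s N.+1 N).[y] + (2 * s + 1) * y * (hp_poly s N.+1 N.+1).[y]) /\
  (1 + y ^+ 2) * (hp_poly s N.+1 N)^`().[y] =
    (N.+1%:R + 2 * s) * y * (hp_poly s N.+1 N).[y] - (2 * s + 1) * (hp_poly s N.+1 N.+1).[y].
Proof.
have s2 := s1; have b0 : 0 < 2 * s + 1 by lra.
have -> : hp_poly s N.+1 N.+1 = P s N.+1 by rewrite /hp_poly addrC addKr.
have -> : hp_poly s N.+1 N = P (s + 1) N.
  by rewrite /hp_poly (_ : N.+1%:R + s - N%:R = s + 1)//; rewrite -natr1; ring.
rewrite !deriv_romanovski !hornerZ [_.+1.-1]/=.
have e1 := romanovski_ladder_up N y b0; have e2 := romanovski_ladder_down' N y b0.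
rewrite -[N.+1%:R]natr1.
move: (P s N.+1).[y] (P s N).[y] (P (s + 1) N).[y] (P (s + 1) N.-1).[y] e1 e2 => p1 p0 q1 q0 e1 e2.
move: (N%:R : R) e1 e2 => n e1 e2; split.
  have -> : (2 * s + 1) * (1 + y ^+ 2) * ((n + 1) * p0) =
    (n + 1) * ((2 * s + 1) * p0 + y * ((2 * s + 1) * (y * p0 - p1)) + (2 * s + 1) * y * p1) by ring.
  by rewrite e1 e2; ring.
have -> : (1 + y ^+ 2) * (n * q0) = n * q0 - y * ((2 * s + 1 + n) * q1 - n * y * q0) + (n + 1 + 2 * s) * y * q1 by ring.
by rewrite -e1 -e2; ring.
Qed.

(** Differentiating the Christoffel-Darboux identity in the first variable on the diagonal gives a
    Wronskian; the first-order system then removes the derivatives. *)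
Lemma hp_poly_diag N y :
  (2 * s + 1) * (1 + y ^+ 2) * hp_norm s N.+1 N *
    \sum_(m < N.+1) (hp_poly s N.+1 m).[y] * (hp_poly s N.+1 m).[y] / hp_norm s N.+1 m =
  N.+1%:R * (N.+1%:R + 2 * s) * (hp_poly s N.+1 N).[y] ^+ 2 +
  (2 * s + 1) ^+ 2 * (hp_poly s N.+1 N.+1).[y] ^+ 2 -
  2 * s * (2 * s + 1) * y * (hp_poly s N.+1 N.+1).[y] * (hp_poly s N.+1 N).[y].
Proof.
have s2 := s1; have b0 : 0 < 2 * s + 1 by lra.
(* The kernel sum as a polynomial in its first variable, so that Christoffel-Darboux becomes an
   identity of polynomials that can be differentiated at [y]. *)
pose S := \sum_(m < N.+1) ((hp_poly s N.+1 m).[y] / hp_norm s N.+1 m) *: hp_poly s N.+1 m.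
have SE u : S.[u] = \sum_(m < N.+1) (hp_poly s N.+1 m).[u] * (hp_poly s N.+1 m).[y] / hp_norm s N.+1 m.
  by rewrite horner_sum; apply: eq_bigr => m _; rewrite hornerZ mulrC mulrA.
rewrite -SE; set p := hp_poly s N.+1 N.+1; set q := hp_poly s N.+1 N; set h := hp_norm s N.+1 N.
have h0 : h != 0 by rewrite gt_eqF// hp_norm_gt0// leqnSn.
have CD : ('X - y%:P) * S = (q.[y] / h) *: p - (p.[y] / h) *: q.
  apply: poly_ext => u; rewrite hornerM hornerXsubC SE (hp_poly_christoffel_darboux s1 _ _ (ltnSn N)).
  by rewrite !(hornerD, hornerN, hornerZ) -/p -/q -/h; ring.
have := congr1 (fun r : {poly R} => r^`().[y]) CD.
rewrite derivM derivB derivX derivC subr0 mul1r hornerD hornerM hornerXsubC subrr mul0r addr0.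
rewrite derivB !derivZ !(hornerD, hornerN, hornerZ) => ->.
have [d1 d2] := hp_poly_deriv N y; rewrite -/p -/q in d1 d2.
transitivity (q.[y] * ((2 * s + 1) * (1 + y ^+ 2) * p^`().[y]) - (2 * s + 1) * p.[y] * ((1 + y ^+ 2) * q^`().[y])).
  by field; exact: h0.
by rewrite d1 d2; ring.
Qed.

Definition hp_bracket N x : R :=
  ((1 + 2 * s / N.+1%:R) * (hp_B s N x / x) ^+ 2 + (2 * s + 1) ^+ 2 * hp_A s N.+1 x ^+ 2 -
   2 * s * (2 * s + 1) * hp_A s N.+1 x * hp_B s N x) / (2 * s + 1).

Lemma hp_skernel_diag N x : x != 0 ->
  hp_skernel s N x x = hp_kappa s N * hp_theta s N x ^+ 2 *
    (N.+1%:R ^+ 2 / (1 + (N.+1%:R * x) ^+ 2)) * hp_bracket N x.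
Proof.
move=> x0; have s2 := s1; rewrite hp_skernelE// sqrt_cauchy_weight_scale//.
have N0 : N.+1%:R != 0 :> R by rewrite pnatr_eq0.
have h0 : hp_norm s N.+1 N != 0 by rewrite gt_eqF// hp_norm_gt0// leqnSn.
have := hp_poly_diag N (N.+1%:R * x).
rewrite hp_poly_topE// hp_poly_subtopE//.
set S := \sum_(m < N.+1) _.
have -> : (N.+1%:R * x) ^+ N = (N.+1%:R * x) ^+ N.+1 / (N.+1%:R * x).
  by rewrite exprSr mulfK// mulf_neq0.
have q0 : 1 + (N.+1%:R * x) ^+ 2 != 0 by rewrite gt_eqF// onePsqr_gt0.
have d0 : 2 * s + 1 != 0 by rewrite gt_eqF//; lra.
have XX : `|N.+1%:R * x| ^- N.+1 ^+ 2 * ((N.+1%:R * x) ^+ N.+1) ^+ 2 = 1.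
  rewrite -exprMn -exprVn -exprMn -exprM mulnC exprM exprMn exprVn (real_normK (num_real _)).
  by rewrite mulVf ?expr1n// expf_neq0// mulf_neq0.
rewrite /hp_kappa (_ : N.+1%:R `^ (- (2 * s + 1)) = (N.+1%:R `^ (- s)) ^+ 2 / N.+1%:R); last first.
  rewrite -[X in _ / X]powRr1// -powRN -powR_mulrn ?powR_ge0// -powRrM -powRD; last by rewrite N0 implybT.
  by congr (_ `^ _); ring.
rewrite /hp_bracket.
have aux (t X Y h p th A B q d : R) : Y ^+ 2 * X ^+ 2 = 1 -> t != 0 -> h != 0 -> d != 0 -> q != 0 ->
  d * q * h * S = t * (t + 2 * s) * (X / (t * x) * B) ^+ 2 + d ^+ 2 * (X * A) ^+ 2 -
      2 * s * d * (t * x) * (X * A) * (X / (t * x) * B) ->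
  t * (Y * p * th * (Y * p * th) * S) = h^-1 * (p ^+ 2 / t) * th ^+ 2 * (t ^+ 2 / q) *
   (((1 + 2 * s / t) * (B / x) ^+ 2 + d ^+ 2 * A ^+ 2 - 2 * s * d * A * B) / d).
  move=> YX t0 h0' d0' q0' e.
  have -> : S = (t * (t + 2 * s) * (X / (t * x) * B) ^+ 2 + d ^+ 2 * (X * A) ^+ 2 -
      2 * s * d * (t * x) * (X * A) * (X / (t * x) * B)) / (d * q * h).
    by rewrite -e [RHS]mulrC mulKf// !mulf_neq0.
  transitivity (Y ^+ 2 * X ^+ 2 * (h^-1 * (p ^+ 2 / t) * th ^+ 2 * (t ^+ 2 / q) *
   (((1 + 2 * s / t) * (B / x) ^+ 2 + d ^+ 2 * A ^+ 2 - 2 * s * d * A * B) / d))).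
    by field; rewrite ?t0 ?h0' ?d0' ?q0' ?x0.
  by rewrite YX mul1r.
exact: aux.
Qed.

Definition hp_bracket_lim x : R :=
  ((bessel_psi (s + 1) (x ^- 2) / x) ^+ 2 + (2 * s + 1) ^+ 2 * bessel_psi s (x ^- 2) ^+ 2 -
   2 * s * (2 * s + 1) * bessel_psi s (x ^- 2) * bessel_psi (s + 1) (x ^- 2)) / (2 * s + 1).

Lemma hp_skernel_diag_cvg x : x != 0 -> hp_skernel s N x x @[N --> \oo] -->
  hp_kappa_lim s * (`|x| `^ (- s)) ^+ 2 * x ^- 2 * hp_bracket_lim x.
Proof.
move=> x0; under eq_fun do rewrite hp_skernel_diag//.
have cA := @hp_A_cvg R s s1 x; have cB := @hp_B_cvg R s s1 x.
have ct : (2 * s) / N.+1%:R @[N --> \oo] --> (0 : R).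
  rewrite -(mulr0 (2 * s)); apply: cvgMr; exact: cvg_harmonic.
apply: cvgM; first apply: cvgM; first apply: cvgM.
- exact: hp_kappa_cvg.
- under eq_fun do rewrite expr2; rewrite expr2; apply: cvgM; exact: hp_theta_cvg.
- have -> : (fun N => N.+1%:R ^+ 2 / (1 + (N.+1%:R * x) ^+ 2)) = fun N => (harmonic N ^+ 2 + x ^+ 2)^-1.
    apply/funext => N; rewrite /harmonic /=.
    have N0 : N.+1%:R != 0 :> R by rewrite pnatr_eq0.
    have q0 : 1 + (N.+1%:R * x) ^+ 2 != 0 by rewrite gt_eqF// onePsqr_gt0.
    move: (N.+1%:R) N0 q0 => t t0 q0; apply: invr_inj; rewrite invrK invf_div.
    by field.
  apply: cvgV; first by rewrite expf_neq0.
  rewrite -[X in _ @ _ --> X]add0r; apply: cvgD; last exact: cvg_cst.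
  rewrite -(mulr0 0); under eq_fun do rewrite expr2; apply: cvgM; exact: cvg_harmonic.
- apply: cvgMl; apply: cvgB; first apply: cvgD.
  + rewrite -[X in _ @ _ --> X]mul1r; apply: cvgM.
      by rewrite -[X in _ @ _ --> X]addr0; apply: cvgD => //; exact: cvg_cst.
    under eq_fun do rewrite expr2; rewrite expr2; apply: cvgM; apply: cvgMl => //.
  + apply: cvgMr; under eq_fun do rewrite expr2; rewrite expr2; exact: cvgM.
  + by apply: cvgM => //; apply: cvgMr.
Qed.

Definition hp_offdiag_lim x y : R := hp_kappa_lim s * `|x| `^ (- s) * `|y| `^ (- s) *
  ((bessel_psi s (x ^- 2) * (bessel_psi (s + 1) (y ^- 2) / y) -
    bessel_psi s (y ^- 2) * (bessel_psi (s + 1) (x ^- 2) / x)) / (x - y)).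

Lemma hp_skernel_offdiag_cvg x y : x != 0 -> y != 0 -> x != y ->
  (Num.sg x * Num.sg y) ^+ N.+1 * hp_skernel s N x y @[N --> \oo] --> hp_offdiag_lim x y.
Proof.
move=> x0 y0 xy; under eq_fun do rewrite hp_skernel_offdiag//.
have cA z := @hp_A_cvg R s s1 z; have cB z := @hp_B_cvg R s s1 z.
apply: cvgM; first apply: cvgM; first apply: cvgM.
- exact: hp_kappa_cvg.
- exact: hp_theta_cvg.
- exact: hp_theta_cvg.
- by apply: cvgMl; apply: cvgB; apply: cvgM => //; apply: cvgMl.
Qed.

Lemma besselJE (b z : R) : 1 / 2 <= b -> 0 < z ->
  besselJ (b - 1 / 2) z = (z / 2) `^ (b - 1 / 2) / Gamma (b + 1 / 2) * bessel_psi b (z ^+ 2).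
Proof.
move=> b1 z0; have b2 : 1 <= 2 * b + 1 by lra.
rewrite /bessel_psi -pseriesZ; last exact: is_cvg_bessel_psi.
rewrite /besselJ /pseries; congr (limn (series _)); apply/funext => m.
have G0 : Gamma (b + 1 / 2) != 0 by rewrite gt_eqF// Gamma_gt0//; lra.
have z2 : 0 < z / 2 by lra.
have -> : (z / 2) `^ (2 * m%:R + (b - 1 / 2)) = (z / 2) `^ (b - 1 / 2) * (z / 2) ^+ (2 * m).
  rewrite addrC (@powRD R _ (b - 1 / 2)); last by rewrite (gt_eqF z2) implybT.
  by rewrite -natrM powR_mulrn// ltW.
have GE : Gamma (m%:R + (b - 1 / 2) + 1) = \prod_(i < m) (b + 1 / 2 + i%:R) * Gamma (b + 1 / 2).
  elim: m => [|m IH]; first by rewrite big_ord0 [RHS]mul1r; congr (Gamma _); field.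
  rewrite big_ord_recr/= mulrAC -IH -natr1.
  have -> : m%:R + 1 + (b - 1 / 2) + 1 = (m%:R + (b - 1 / 2) + 1) + 1 by ring.
  rewrite GammaD1; last by clear -b1; have : 0 <= m%:R :> R by []; lra.
  by rewrite mulrC; congr (_ * _); field.
rewrite GE /bessel_coef /=.
have -> : \prod_(i < m) (2 * i.+1%:R * (2 * b + 1 + 2 * i%:R)) =
   4 ^+ m * m`!%:R * \prod_(i < m) (b + 1 / 2 + i%:R) :> R.
  elim: m {GE} => [|m IH]; first by rewrite !big_ord0 expr0 !mul1r.
  rewrite !big_ord_recr/= IH exprS factS natrM.
  by move: (\prod_(i < m) _) (4 ^+ m) (m`!%:R) => A B C; field.
have p0 : \prod_(i < m) (b + 1 / 2 + i%:R) != 0.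
  by apply/prodf_neq0 => i _; clear -b1; have : 0 <= i%:R :> R by []; move=> ?; rewrite gt_eqF//; lra.
have f0 : m`!%:R != 0 :> R by rewrite pnatr_eq0 -lt0n fact_gt0.
have -> : (z / 2) ^+ (2 * m) = z ^+ 2 ^+ m / 4 ^+ m.
  by rewrite exprM -expr_div_n; congr (_ ^+ _); field.
have q0 : 4 ^+ m != 0 :> R by rewrite expf_neq0// pnatr_eq0.
have aux (A B C D E F W : R) : A != 0 -> B != 0 -> C != 0 -> D != 0 ->
   F / (C * (A * D)) * (W * (E / B)) = W / D * (F / (B * C * A)) * E.
  by move=> A0 B0 C0 D0; field; rewrite ?A0 ?B0 ?C0 ?D0.
exact: aux.
Qed.

Lemma hpPE x : x != 0 -> hpP s x = 2 `^ s * `|x| `^ (- s) * bessel_psi s (x ^- 2).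
Proof.
move=> x0; have s2 := s1; have ax : 0 < `|x| by rewrite normr_gt0.
rewrite /hpP besselJE; [|lra|by rewrite divr_gt0].
have -> : (1 / `|x|) ^+ 2 = x ^- 2 by rewrite div1r exprVn (real_normK (num_real _)).
have -> : 1 / `|x| / 2 = (2 * `|x|) ^-1 by rewrite div1r invfM mulrC.
have G0 : Gamma (s + 1 / 2) != 0 by rewrite gt_eqF// Gamma_gt0//; lra.
rewrite mulrA; congr (_ * _).
have -> : (2 * `|x|)^-1 `^ (s - 1 / 2) = 2 `^ (1 / 2 - s) * `|x| `^ (1 / 2 - s).
  rewrite -powRM// -(powR_inv1 (mulr_ge0 _ (ltW ax)))// -powRrM; congr (_ `^ _); lra.
have -> : 2 `^ s = 2 `^ (2 * s - 1 / 2) * 2 `^ (1 / 2 - s) :> R.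
  by rewrite -powRD; [congr (_ `^ _); lra|rewrite pnatr_eq0 implybT].
have -> : `|x| `^ (- s) = `|x| `^ (- (1 / 2)) * `|x| `^ (1 / 2 - s).
  by rewrite -powRD; [congr (_ `^ _); lra|rewrite (gt_eqF ax) implybT].
have aux (A B C D G : R) : G != 0 -> A * G * C * (B * D / G) = A * B * (C * D) by move=> ?; field.
exact: aux.
Qed.

Lemma hpQE x : x != 0 -> hpQ s x = 2 `^ (s + 1) * `|x| `^ (- s) * (bessel_psi (s + 1) (x ^- 2) / x).
Proof.
move=> x0; have s2 := s1; have ax : 0 < `|x| by rewrite normr_gt0.
have e1 : s + 1 / 2 = s + 1 - 1 / 2 by lra.
have e2 : s + 3 / 2 = s + 1 + 1 / 2 by lra.
rewrite /hpQ e1 e2 besselJE; [|lra|by rewrite divr_gt0].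
have -> : (1 / `|x|) ^+ 2 = x ^- 2 by rewrite div1r exprVn (real_normK (num_real _)).
have -> : 1 / `|x| / 2 = (2 * `|x|) ^-1 by rewrite div1r invfM mulrC.
have G0 : Gamma (s + 1 + 1 / 2) != 0 by rewrite gt_eqF// Gamma_gt0//; lra.
have -> : (2 * `|x|)^-1 `^ (s + 1 - 1 / 2) = 2 `^ (- (s + 1 / 2)) * (`|x| `^ (1 / 2 - s) / `|x|).
  have -> : `|x| `^ (1 / 2 - s) / `|x| = `|x| `^ (- (s + 1 / 2)).
    have -> : `|x|^-1 = `|x| `^ (- 1) by rewrite powRN powRr1// ltW.
    rewrite -powRD; last by rewrite (gt_eqF ax) implybT.
    by congr (_ `^ _); lra.
  rewrite -powRM// -(powR_inv1 (mulr_ge0 _ (ltW ax)))// -powRrM; congr (_ `^ _); lra.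
have -> : 2 `^ (s + 1) = 2 `^ (2 * s + 3 / 2) * 2 `^ (- (s + 1 / 2)) :> R.
  by rewrite -powRD; [congr (_ `^ _); lra|rewrite pnatr_eq0 implybT].
have -> : `|x| `^ (- s) = `|x| `^ (- (1 / 2)) * `|x| `^ (1 / 2 - s).
  by rewrite -powRD; [congr (_ `^ _); lra|rewrite (gt_eqF ax) implybT].
have sx : Num.sg x = `|x| / x by rewrite normrEsg mulfK.
rewrite sx; have ax0 := lt0r_neq0 ax.
have aux (A B C D G psi X y : R) : G != 0 -> X != 0 -> y != 0 ->
    X / y * A * G * C * (B * (D / X) / G * psi) = A * B * (C * D) * (psi / y).
  by move=> g0 X0 y0; field; rewrite ?g0 ?X0 ?y0.
exact: aux.
Qed.

Lemma hp_kernel_offdiagE x y : x != 0 -> y != 0 -> hp_kernel_offdiag s x y = hp_offdiag_lim x y.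
Proof.
move=> x0 y0; have s2 := s1; rewrite /hp_kernel_offdiag !hpPE// !hpQE// /hp_offdiag_lim /hp_kappa_lim.
rewrite cauchy_massE; last by lra.
have -> : 2 * (s + 1) - 1 = 2 * s + 1 by ring.
have e : 2 `^ (1 - 2 * (s + 1)) * (2 `^ s * 2 `^ (s + 1)) = 1 :> R.
  rewrite -!powRD ?pnatr_eq0 ?implybT//.
  have -> : 1 - 2 * (s + 1) + (s + (s + 1)) = 0 by ring.
  by rewrite powRr0.
have G1 : Gamma (2 * s + 1) != 0 by clear -s2; rewrite gt_eqF// Gamma_gt0//; lra.
have G2 : Gamma (2 * s + 2) != 0 by clear -s2; rewrite gt_eqF// Gamma_gt0//; lra.
have G3 : Gamma (s + 1) != 0 by clear -s2; rewrite gt_eqF// Gamma_gt0//; lra.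
have p0 : pi != 0 :> R by rewrite gt_eqF// pi_gt0.
have t0 : 2 `^ (1 - 2 * (s + 1)) != 0 :> R by rewrite gt_eqF// powR_gt0.
have aux (F G H T U V W Z A B C D p Q : R) : T * (U * V) = 1 -> G != 0 -> H != 0 -> F != 0 -> p != 0 -> T != 0 ->
   1 / (2 * p) * (F ^+ 2 / (G * H)) * ((U * W * A * (V * Z * B) - U * Z * C * (V * W * D)) / Q) =
   (H * (2 * p * T * G / F ^+ 2))^-1 * W * Z * ((A * B - C * D) / Q).
  move=> e' G0 H0 F0 p0' T0.
  have -> : T = (U * V)^-1.
    by apply/(mulIf (x := U * V)); [apply/eqP => u0; move/eqP: e'; rewrite u0 mulr0 eq_sym oner_eq0|rewrite e' mulVf//; apply/eqP => u0; move/eqP: e'; rewrite u0 mulr0 eq_sym oner_eq0].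
  have UV : U * V != 0 by apply/eqP => u0; move/eqP: e'; rewrite u0 mulr0 eq_sym oner_eq0.
  move: UV; rewrite mulf_eq0 negb_or => /andP[U0 V0].
  have [->|Q0] := eqVneq Q 0; first by rewrite invr0 !mulr0.
  by field; rewrite ?G0 ?H0 ?F0 ?p0' ?U0 ?V0 ?Q0.
exact: aux.
Qed.

Lemma is_derive_invr x : x != 0 -> is_derive x (1 : R) (fun z : R => z^-1) (- x ^- 2).
Proof.
move=> x0; apply: (is_derive_eq (is_deriveV x0 (is_derive_id x (1 : R)))).
by rewrite /= [_ *: _]mulr1.
Qed.

Lemma is_derive_bessel_inv b x : 1 <= 2 * b + 1 -> x != 0 ->
  is_derive x (1 : R) (fun z => bessel_psi b (z ^- 2)) (bessel_psi (b + 1) (x ^- 2) / (2 * b + 1) / x ^+ 3).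
Proof.
move=> b1 x0.
have hX (u : R) : is_derive u (1 : R) (fun u : R => u ^+ 2) (2 * u).
  have := is_derive_poly ('X^2 : {poly R}) u; rewrite derivXn expr1 hornerMn hornerX -mulr_natl.
  by congr is_derive; apply/funext => v; rewrite hornerXn.
have h1 : is_derive x (1 : R) (fun z : R => (z^-1) ^+ 2) (2 * x^-1 * (- x ^- 2)).
  exact: (@is_derive1_comp R (fun u => u ^+ 2) (fun z => z^-1) x _ _ (hX _) (is_derive_invr x0)).
have h2 := @is_derive1_comp R (bessel_psi b) (fun z : R => (z^-1) ^+ 2) x _ _ (is_derive_bessel_psi (x^-1 ^+ 2) b1) h1.
have -> : (fun z => bessel_psi b (z ^- 2)) = (fun z => bessel_psi b ((z^-1) ^+ 2)).
  by apply/funext => z; rewrite exprVn.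
apply: (is_derive_eq h2); rewrite exprVn.
have d0 : 2 * b + 1 != 0 by rewrite gt_eqF//; lra.
by move: (bessel_psi _ _) => A; field; rewrite ?d0 ?x0.
Qed.

(** The diagonal value is defined by a limit. Written with difference quotients it becomes a
    Wronskian of two Bessel series, which the contiguity relation brings to the form reached by the
    finite kernels. *)
Lemma hp_kernel_diagE x : x != 0 ->
  hp_kernel s x x = hp_kappa_lim s * (`|x| `^ (- s)) ^+ 2 * x ^- 2 * hp_bracket_lim x.
Proof.
move=> x0; have s2 := s1; rewrite /hp_kernel eqxx; apply/cvg_lim => //.
have b1 : 1 <= 2 * s + 1 by lra.
have b2 : 1 <= 2 * (s + 1) + 1 by lra.
have d1 := is_derive_bessel_inv b1 x0.
have d2 := is_derive_bessel_inv b2 x0.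
(* The part of [hpQ] that remains after the powers common to [hpP] and [hpQ] are removed; [bd] is
   its derivative at [x], simplified by [bessel_psi_shift]. *)
pose beta z := bessel_psi (s + 1) (z ^- 2) * z^-1.
pose bd := - x ^- 2 * ((2 * s + 1) * bessel_psi s (x ^- 2) - 2 * s * bessel_psi (s + 1) (x ^- 2)).
have d3 : is_derive x (1 : R) beta bd.
  apply: (is_derive_eq (is_deriveM d2 (is_derive_invr x0))); rewrite /bd.
  have := bessel_psi_shift (x ^- 2) b1.
  rewrite -[X in _ -> X = _]/(_ * _ + _ * _).
  have -> : 2 * (s + 1) + 1 = 2 * s + 3 by ring.
  move: (bessel_psi s _) (bessel_psi (s + 1) _) (bessel_psi (s + 1 + 1) _) => A B C e.
  have d0 : 2 * s + 3 != 0 by rewrite gt_eqF//; lra.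
  have -> : (2 * s + 1) * A - 2 * s * B = (2 * s + 1) * (A - B) + B by ring.
  by rewrite e; field; rewrite ?d0 ?x0.
have q1 := diff_quotient_cvg d1; have q3 := diff_quotient_cvg d3.
pose a' := bessel_psi (s + 1) (x ^- 2) / (2 * s + 1) / x ^+ 3.
have L : hp_kappa_lim s * `|x| `^ (- s) * `|z| `^ (- s) *
    ((bessel_psi s (z ^- 2) - bessel_psi s (x ^- 2)) / (z - x) * beta x -
     bessel_psi s (x ^- 2) * ((beta z - beta x) / (z - x))) @[z --> x^'] -->
    hp_kappa_lim s * `|x| `^ (- s) * `|x| `^ (- s) * (a' * beta x - bessel_psi s (x ^- 2) * bd).
  apply: cvgM; last by apply: cvgB; [apply: cvgMl|apply: cvgMr].
  apply: cvgMr.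
  have c : `|z| `^ (- s) @[z --> x] --> `|x| `^ (- s).
    apply: (@cvg_comp _ _ _ (fun z : R => `|z|) (fun u => u `^ (- s)) _ (nbhs `|x|)).
      by apply: cvg_norm; exact: cvg_id.
    by apply: continuous_powR; rewrite in_itv/= andbT normr_gt0.
  exact: cvg_trans (cvg_app _ (@nbhs_dnbhs _ x)) c.
apply: cvg_trans (_ : _ --> (hp_kappa_lim s * `|x| `^ (- s) * `|x| `^ (- s) * (a' * beta x - bessel_psi s (x ^- 2) * bd))) _.
  apply: cvg_trans L; apply: near_eq_cvg; near=> z.
  have z0 : z != 0 by near: z; apply: nbhs_dnbhs; exact: (cvgr_neq0 _ cvg_id x0).
  have zx : z != x by near: z; exact: nbhs_dnbhs_neq.
  rewrite hp_kernel_offdiagE// /hp_offdiag_lim; congr (_ * _); rewrite -/(beta z) -/(beta x).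
  have d : z - x != 0 by rewrite subr_eq0.
  have d' : x - z != 0 by rewrite subr_eq0 eq_sym.
  by field; rewrite d d'.
rewrite /a' /bd /beta /hp_bracket_lim.
have d0 : 2 * s + 1 != 0 by rewrite gt_eqF//; lra.
have -> : hp_kappa_lim s * `|x| `^ (- s) * `|x| `^ (- s) *
   (bessel_psi (s + 1) (x ^- 2) / (2 * s + 1) / x ^+ 3 * (bessel_psi (s + 1) (x ^- 2) / x) -
    bessel_psi s (x ^- 2) * (- x ^- 2 *
     ((2 * s + 1) * bessel_psi s (x ^- 2) - 2 * s * bessel_psi (s + 1) (x ^- 2)))) =
  hp_kappa_lim s * (`|x| `^ (- s)) ^+ 2 * x ^- 2 *
   (((bessel_psi (s + 1) (x ^- 2) / x) ^+ 2 + (2 * s + 1) ^+ 2 * bessel_psi s (x ^- 2) ^+ 2 -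
   2 * s * (2 * s + 1) * bessel_psi s (x ^- 2) * bessel_psi (s + 1) (x ^- 2)) / (2 * s + 1)).
  move: (hp_kappa_lim s) (`|x| `^ _) (bessel_psi s _) (bessel_psi (s + 1) _) => k t A B.
  by field; rewrite ?d0 ?x0.
exact: cvg_id.
Unshelve. all: by end_near. Qed.

Lemma hp_skernel_cvg x y : x != 0 -> y != 0 ->
  (Num.sg x * Num.sg y) ^+ N.+1 * hp_skernel s N x y @[N --> \oo] --> hp_kernel s x y.
Proof.
move=> x0 y0; have [<-|xy] := eqVneq x y.
  rewrite hp_kernel_diagE// -expr2 sqr_sg x0.
  by under eq_fun do rewrite expr1n mul1r; exact: hp_skernel_diag_cvg.
rewrite /hp_kernel (negbTE xy) hp_kernel_offdiagE//; exact: hp_skernel_offdiag_cvg.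
Qed.

End KernelLimit.

Lemma cvg_bounded (R : realType) (u : nat -> R) (l : R) : u n @[n --> \oo] --> l -> exists2 C, 0 <= C & forall n, `|u n| <= C.
Proof.
move=> ul; have [M [_ hM]] := @cvg_seq_bounded R R u (cvgP _ ul).
exists (`|M| + 1); first by rewrite addr_ge0.
by move=> n; apply: hM => //; rewrite (le_lt_trans (ler_norm M))// ltrDl.
Qed.

(** * Bounds on the diagonal of the rescaled kernel, uniform in the number of points *)

Section KernelBounds.
Context {R : realType}.
Notation mu := (@lebesgue_measure R).
Variables (s : R).
Hypothesis s1 : 1 < 2 * s.
Implicit Types (N m k j : nat) (x y : R).

(** For [|x| >= r] the two series are at most [expR (r^-2)]. The decay comes from the weight, which
    gives [|x|^(-2s)], and from the factor [1 / (1 + y^2)], which gives [x^-2]. *)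
Lemma hp_skernel_far (r : R) : 0 < r -> exists2 C, 0 <= C &
  forall N x, r <= `|x| -> hp_skernel s N x x <= C * `|x| `^ (- (2 * s + 2)).
Proof.
move=> r0; have s2 := s1; have [K K0 hK] := cvg_bounded (hp_kappa_cvg s1).
pose E := expR (r ^- 2); have E0 : 0 < E by exact: expR_gt0.
pose B := ((1 + 2 * s) * (E / r) ^+ 2 + (2 * s + 1) ^+ 2 * E ^+ 2 + 2 * s * (2 * s + 1) * (E * E)) / (2 * s + 1).
have B0 : 0 <= B.
  have p1 : 0 <= 2 * s by lra.
  have p2 : 0 <= 2 * s + 1 by lra.
  have p3 : 0 <= 1 + 2 * s by lra.
  apply: divr_ge0 => //; apply: addr_ge0; first (apply: addr_ge0; apply: mulr_ge0; rewrite ?sqr_ge0//).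
  by apply: mulr_ge0; apply: mulr_ge0 => //; exact: ltW.
exists (K * B); first exact: mulr_ge0.
move=> N x rx; have x0 : x != 0 by rewrite -normr_gt0; exact: lt_le_trans rx.
have ax := lt_le_trans r0 rx.
rewrite hp_skernel_diag//.
have t1 : 1 <= N.+1%:R :> R by rewrite ler1n.
have hA := hp_A_le s1 N r0 rx; have hB := hp_B_le s1 N r0 rx.
have bB : hp_bracket s N x <= B.
  rewrite /hp_bracket /B ler_pM2r ?invr_gt0; last by lra.
  have sq (u v : R) : `|u| <= v -> u ^+ 2 <= v ^+ 2.
    by move=> uv; rewrite -(real_normK (num_real u)); apply: lerXn2r; rewrite ?nnegrE// (le_trans _ uv).
  have a1 := sq _ _ hA.
  have a2 : (hp_B s N x / x) ^+ 2 <= (E / r) ^+ 2.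
    by apply: sq; rewrite normrM normfV; apply: ler_pM => //; rewrite lef_pV2.
  have a3 : `|hp_A s N.+1 x * hp_B s N x| <= E * E by rewrite normrM; exact: ler_pM.
  have a4 : 1 + 2 * s / N.+1%:R <= 1 + 2 * s by rewrite lerD2l ler_pdivrMr ?ler_peMr//; lra.
  have a5 : - (hp_A s N.+1 x * hp_B s N x) <= E * E by apply: le_trans a3; rewrite -normrN ler_norm.
  apply: lerD; first apply: lerD.
  - by apply: ler_pM => //; rewrite ?sqr_ge0// addr_ge0// divr_ge0//; lra.
  - by apply: ler_wpM2l => //; exact: sqr_ge0.
  - by rewrite -mulrA -mulrN; apply: ler_wpM2l => //; rewrite mulr_ge0//; lra.
have th : hp_theta s N x ^+ 2 <= `|x| `^ (- s) ^+ 2.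
  by rewrite hp_theta_sqr ler_piMr ?sqr_ge0// hp_omega_le1.
have q : N.+1%:R ^+ 2 / (1 + (N.+1%:R * x) ^+ 2) <= x ^- 2.
  rewrite ler_pdivrMr ?onePsqr_gt0// mulrDr mulr1 exprMn mulrCA mulVf ?expf_neq0// mulr1 lerDr.
  by rewrite invr_ge0 sqr_ge0.
have xE : `|x| `^ (- (2 * s + 2)) = `|x| `^ (- s) ^+ 2 * x ^- 2.
  rewrite -(real_normK (num_real x)) -(powR_mulrn 2 (ltW ax)) -powRN -powR_mulrn ?powR_ge0// -powRrM.
  by rewrite -powRD ?(gt_eqF ax) ?implybT//; congr (_ `^ _); ring.
have kK : hp_kappa s N <= K by apply: le_trans (hK N); exact: ler_norm.
have k0 := ltW (hp_kappa_gt0 s1 N).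
have q0 : 0 <= N.+1%:R ^+ 2 / (1 + (N.+1%:R * x) ^+ 2).
  by apply: divr_ge0; [exact: sqr_ge0|exact: ltW (onePsqr_gt0 _)].
have kt0 : 0 <= hp_kappa s N * hp_theta s N x ^+ 2 by apply: mulr_ge0 => //; exact: sqr_ge0.
have [b0|b0] := leP 0 (hp_bracket s N x).
  rewrite xE; have -> : K * B * (`|x| `^ (- s) ^+ 2 * x ^- 2) = K * `|x| `^ (- s) ^+ 2 * x ^- 2 * B by ring.
  apply: ler_pM => //.
    exact: mulr_ge0.
  apply: ler_pM => //; apply: ler_pM => //; exact: sqr_ge0.
apply: (@le_trans _ _ 0); last by apply: mulr_ge0; [exact: mulr_ge0|exact: powR_ge0].
by apply: mulr_ge0_le0; [exact: mulr_ge0|exact: ltW].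
Qed.

(* Up to the factor [hp_norm * (1 + y ^ 2)], the kernel on the diagonal; its
   derivative is [- 2 s p q w]. *)
Definition hp_energy_poly N : {poly R} :=
  (N.+1%:R * (N.+1%:R + 2 * s) / (2 * s + 1)) *: (hp_poly s N.+1 N * hp_poly s N.+1 N) +
  (2 * s + 1) *: (hp_poly s N.+1 N.+1 * hp_poly s N.+1 N.+1) - (2 * s) *: ('X * hp_poly s N.+1 N.+1 * hp_poly s N.+1 N).

Definition hp_energy N y : R := (hp_energy_poly N).[y] * cauchy_weight (N.+1%:R + s) y.

Lemma is_derive_hp_energy N y : is_derive y (1 : R) (hp_energy N)
  (- (2 * s) * ((hp_poly s N.+1 N.+1).[y] * (hp_poly s N.+1 N).[y]) * cauchy_weight (N.+1%:R + s) y).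
Proof.
have s2 := s1; have d0 : 2 * s + 1 != 0 by rewrite gt_eqF//; lra.
apply: (is_derive_eq (is_deriveM (is_derive_poly (hp_energy_poly N) y) (is_derive_cauchy_weight (N.+1%:R + s) y))).
rewrite -[LHS]/(_ * _ + _ * _) -(cauchy_weightD1 (N.+1%:R + s) y).
have [d1 d2] := hp_poly_deriv s1 N y.
rewrite /hp_energy_poly derivB derivD !derivZ !derivM derivX !(hornerD, hornerN, hornerZ, hornerM, hornerX, hornerC).
move: d1 d2; move: (hp_poly s N.+1 N.+1)^`().[y] (hp_poly s N.+1 N)^`().[y].
move: (hp_poly s N.+1 N.+1).[y] (hp_poly s N.+1 N).[y] (cauchy_weight _ _) => p q W p' q' d1 d2.
set t : R := N.+1%:R in d1 d2 *; clearbody t.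
have y0 : 1 + y ^+ 2 != 0 by rewrite gt_eqF// onePsqr_gt0.
have -> : p' = t * ((t + 2 * s) * q + (2 * s + 1) * y * p) / ((2 * s + 1) * (1 + y ^+ 2)).
  by rewrite -d1 [RHS]mulrC mulKf// mulf_neq0.
have -> : q' = ((t + 2 * s) * y * q - (2 * s + 1) * p) / (1 + y ^+ 2).
  by rewrite -d2 [RHS]mulrC mulKf.
by field; rewrite d0 y0.
Qed.

(** Let [t = N + 1]. The squares in the energy dominate [2 t |p q|], and for [|y| <= t / (2s)] the
    mixed term is at most [t |p q|]. So the energy dominates [t |p q| w], and its derivative is at
    most [2s / t] times the energy. *)
Lemma hp_energy_derive_le N y : `|y| <= N.+1%:R / (2 * s) ->
  0 <= hp_energy N y /\
  `|- (2 * s) * ((hp_poly s N.+1 N.+1).[y] * (hp_poly s N.+1 N).[y]) * cauchy_weight (N.+1%:R + s) y| <=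
  2 * s / N.+1%:R * hp_energy N y.
Proof.
move=> yt; have s2 := s1; have w0 := cauchy_weight_gt0 (N.+1%:R + s) y.
have t0 : 0 < N.+1%:R :> R by [].
rewrite /hp_energy /hp_energy_poly !(hornerD, hornerN, hornerZ, hornerM, hornerX, hornerC).
move: (hp_poly s N.+1 N.+1).[y] (hp_poly s N.+1 N).[y] (cauchy_weight _ _) w0 => p q W W0.
set t : R := N.+1%:R in yt t0 *; clearbody t.
set c := t * (t + 2 * s) / (2 * s + 1).
have d0 : 0 < 2 * s + 1 by lra.
have cE : c * (2 * s + 1) = t * (t + 2 * s) by rewrite /c mulfVK// gt_eqF.
have c0 : 0 < c by rewrite /c divr_gt0// mulr_gt0//; lra.
clearbody c.
have pq : 2 * t * `|p * q| <= c * (q * q) + (2 * s + 1) * (p * p).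
  suff h : 2 * t * `|p * q| <= c * (`|q| * `|q|) + (2 * s + 1) * (`|p| * `|p|).
    by move: h; rewrite -!expr2 !(real_normK (num_real _)).
  rewrite normrM; move: (`|p|) (`|q|) (normr_ge0 p) (normr_ge0 q) => u v u0 v0.
  rewrite -(ler_pM2l c0) -subr_ge0.
  have -> : c * (c * (v * v) + (2 * s + 1) * (u * u)) - c * (2 * t * (u * v)) =
    (c * v - t * u) ^+ 2 + (c * (2 * s + 1) - t ^+ 2) * u ^+ 2 by ring.
  rewrite cE addr_ge0 ?sqr_ge0// mulr_ge0 ?sqr_ge0// mulrDr -expr2 addrAC subrr add0r.
  by rewrite !mulr_ge0//; lra.
have yy : 2 * s * `|y| <= t.
  by move: yt; rewrite ler_pdivlMr; [rewrite mulrC|lra].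
have ypq : `|2 * s * (y * p * q)| <= t * `|p * q|.
  rewrite -mulrA !normrM (ger0_norm (_ : 0 <= 2)) ?(ger0_norm (_ : 0 <= s))//; last by lra.
  have -> : 2 * (s * (`|y| * `|p| * `|q|)) = 2 * s * `|y| * (`|p| * `|q|) by ring.
  by apply: ler_wpM2r => //; rewrite mulr_ge0.
have lo : t * `|p * q| <= c * (q * q) + (2 * s + 1) * (p * p) - 2 * s * (y * p * q).
  have := ler_norm (2 * s * (y * p * q)); lra.
split; first by rewrite mulr_ge0 ?(ltW W0)// (le_trans _ lo)// mulr_ge0// ltW.
rewrite normrM (gtr0_norm W0) normrM normrN (ger0_norm (_ : 0 <= 2 * s)); last by lra.
rewrite mulrA; apply: ler_wpM2r; first exact: ltW.
rewrite -mulrA; apply: ler_wpM2l; first by lra.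
by rewrite ler_pdivlMl.
Qed.

(** Gronwall: the energy times [expR (k y)] is nondecreasing on [[-y0, y0]]. Since [k y0 = 1], the
    exponential varies by at most a factor [expR 2] there. *)
Lemma hp_energy_le N y : `|y| <= N.+1%:R / (2 * s) ->
  hp_energy N y <= hp_energy N (N.+1%:R / (2 * s)) * expR 2.
Proof.
move=> yt; have s2 := s1; have t0 : 0 < N.+1%:R :> R by [].
set y0 := N.+1%:R / (2 * s) in yt *.
have y00 : 0 < y0 by rewrite /y0 divr_gt0//; lra.
pose k := 2 * s / N.+1%:R.
have k0 : 0 < k by rewrite /k divr_gt0//; lra.
pose f y := hp_energy N y * expR (k * y).
pose f' y := (- (2 * s) * ((hp_poly s N.+1 N.+1).[y] * (hp_poly s N.+1 N).[y]) * cauchy_weight (N.+1%:R + s) y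
   + k * hp_energy N y) * expR (k * y).
have df (z : R) : is_derive z (1 : R) f (f' z).
  have dk : is_derive z (1 : R) (fun y => k * y) k.
    have := is_derive_poly (k *: 'X) z; rewrite derivZ derivX hornerZ hornerC mulr1.
    by congr is_derive; apply/funext => v; rewrite hornerZ hornerX.
  have de : is_derive z (1 : R) (fun y => expR (k * y)) (expR (k * z) * k).
    exact: (@is_derive1_comp R expR (fun y => k * y) z _ _ (is_derive_expR _) dk).
  apply: (is_derive_eq (is_deriveM (is_derive_hp_energy N z) de)).
  by rewrite /f' -[LHS]/(_ * _ + _ * _); ring.
have ky0 : k * y0 = 1 by rewrite /k -invf_div -/y0 mulVf// gt_eqF.
have fle : f y <= f y0.
  have [yl yr] : (- y0 <= y) /\ (y <= y0) by apply/andP; rewrite -ler_norml.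
  apply: (@ger0_derive1_ndecr R f (- y0) y0) => //.
  - move=> z; rewrite in_itv/= => /andP[zl zr]; rewrite derive1E (@derive_val _ _ _ _ _ _ _ (df z)).
    have zy : `|z| <= y0 by rewrite ler_norml !ltW.
    have [h0 h] := hp_energy_derive_le zy.
    rewrite mulr_ge0 ?expR_ge0// -lerBlDl sub0r lerNl.
    exact: lerNnormlW h.
  - apply: continuous_subspaceT => z; apply: differentiable_continuous.
    by apply/derivable1_diffP; have [] := df z.
have : hp_energy N y <= f y0 * expR (- (k * y)).
  by rewrite -ler_pdivrMr ?expR_gt0// -expRN opprK.
move/le_trans; apply; rewrite /f -mulrA -expRD ky0.
have yy0 : `|y0| <= y0 by rewrite gtr0_norm.
have [h _] := hp_energy_derive_le yy0.
apply: ler_wpM2l => //; rewrite ler_expR.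
have : k * `|y| <= 1 by rewrite -ky0 ler_pM2l.
have : - (k * y) <= k * `|y| by rewrite -mulrN ler_pM2l// -normrN ler_norm.
by lra.
Qed.

Lemma hp_skernel_energy N x :
  hp_skernel s N x x = N.+1%:R / hp_norm s N.+1 N / (1 + (N.+1%:R * x) ^+ 2) * hp_energy N (N.+1%:R * x).
Proof.
have s2 := s1; rewrite hp_skernelE// -expr2 sqr_sqrtr ?(ltW (cauchy_weight_gt0 _ _))//.
have := hp_poly_diag s1 N (N.+1%:R * x); set S := \sum_(m < N.+1) _.
rewrite /hp_energy /hp_energy_poly !(hornerD, hornerN, hornerZ, hornerM, hornerX, hornerC).
have h0 : hp_norm s N.+1 N != 0 by rewrite gt_eqF// hp_norm_gt0// leqnSn.
have y0 : 1 + (N.+1%:R * x) ^+ 2 != 0 by rewrite gt_eqF// onePsqr_gt0.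
have d0 : 2 * s + 1 != 0 by rewrite gt_eqF//; lra.
move: S (hp_norm s N.+1 N) (cauchy_weight _ _) (hp_poly s N.+1 N).[_] (hp_poly s N.+1 N.+1).[_] h0 => S h W q p h0.
move: (1 + (N.+1%:R * x) ^+ 2) y0 => Y y0 e.
have -> : S = (N.+1%:R * (N.+1%:R + 2 * s) * q ^+ 2 + (2 * s + 1) ^+ 2 * p ^+ 2 -
   2 * s * (2 * s + 1) * (N.+1%:R * x) * p * q) / ((2 * s + 1) * Y * h).
  by rewrite -e [RHS]mulrC mulKf// !mulf_neq0.
by field; rewrite ?d0 ?y0 ?h0.
Qed.

Lemma hp_skernel_ge0 N x : 0 <= hp_skernel s N x x.
Proof. by apply: sumr_ge0 => m _; rewrite -expr2 sqr_ge0. Qed.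

(** The constant of [hp_skernel_far] blows up near [0], so for small [x] the energy is compared with
    its value at a fixed point [x0], where that bound applies. The factor [1 / (1 + ((N + 1) x)^2)]
    then supplies [x^-2]. *)
Lemma hp_skernel_le : exists2 C, 0 <= C & forall N x, x != 0 -> hp_skernel s N x x <= C * x ^- 2.
Proof.
(* In the rescaled variable this is the end of the interval on which the energy is controlled. *)
have s2 := s1; pose x0 := (2 * s)^-1; have x00 : 0 < x0 by rewrite invr_gt0; lra.
have [C C0 hC] := hp_skernel_far x00.
pose C1 := C * x0 `^ (- (2 * s + 2)); pose C2 := C * x0 `^ (- (2 * s)).
have C10 : 0 <= C1 by rewrite mulr_ge0// powR_ge0.
have C20 : 0 <= C2 by rewrite mulr_ge0// powR_ge0.
have u0 : 0 <= 1 + x0 ^+ 2 := ltW (onePsqr_gt0 x0).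
have e2 := expR_ge0 (2 : R).
exists (C2 + C1 * (1 + x0 ^+ 2) * expR 2).
  by apply: addr_ge0 => //; apply: mulr_ge0 => //; exact: mulr_ge0.
move=> N x xn0; have ax : 0 < `|x| by rewrite normr_gt0.
have x2 : 0 <= x ^- 2 by rewrite invr_ge0 sqr_ge0.
have [xx|xx] := leP x0 `|x|.
  apply: le_trans (hC N x xx) _; apply: (@le_trans _ _ (C2 * x ^- 2)); last first.
    rewrite mulrDl lerDl; apply: mulr_ge0 => //; apply: mulr_ge0 => //; exact: mulr_ge0.
  have -> : `|x| `^ (- (2 * s + 2)) = `|x| `^ (- (2 * s)) * x ^- 2.
    rewrite -(real_normK (num_real x)) -(powR_mulrn 2 (ltW ax)) -powRN.
    by rewrite -powRD ?(gt_eqF ax) ?implybT//; congr (_ `^ _); ring.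
  rewrite [leLHS]mulrA; apply: ler_wpM2r => //; apply: ler_wpM2l => //.
  rewrite !powRN lef_pV2 ?posrE ?powR_gt0//; apply: ge0_ler_powR; rewrite ?nnegrE//; lra.
have t1 : 1 <= N.+1%:R :> R by rewrite ler1n.
have t0 : 0 < N.+1%:R :> R by [].
have hy : `|N.+1%:R * x| <= N.+1%:R / (2 * s).
  by rewrite normrM (ger0_norm (ler0n _ _)) ler_pM2l// ltW.
have := hp_energy_le hy; have h0 : 0 < hp_norm s N.+1 N by rewrite hp_norm_gt0// leqnSn.
have := hC N x0; rewrite (gtr0_norm x00) => /(_ (lexx _)); rewrite -/C1.
rewrite !hp_skernel_energy -/x0.
have p0 := onePsqr_gt0 (N.+1%:R * x0); have px := onePsqr_gt0 (N.+1%:R * x).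
move=> b1 b2.
have k0 : 0 < N.+1%:R / hp_norm s N.+1 N by rewrite divr_gt0.
have {}b1 : N.+1%:R / hp_norm s N.+1 N * hp_energy N (N.+1%:R * x0) <= C1 * (1 + (N.+1%:R * x0) ^+ 2).
  by move: b1; rewrite mulrAC ler_pdivrMr.
rewrite mulrAC ler_pdivrMr//.
apply: (@le_trans _ _ (C1 * (1 + (N.+1%:R * x0) ^+ 2) * expR 2)).
  apply: le_trans (ler_wpM2l (ltW k0) b2) _; rewrite mulrA; apply: ler_wpM2r => //; exact: expR_ge0.
apply: (@le_trans _ _ (C1 * ((1 + x0 ^+ 2) * N.+1%:R ^+ 2) * expR 2)).
  apply: ler_wpM2r => //; apply: ler_wpM2l => //; rewrite exprMn mulrDl mul1r.
  by rewrite [x0 ^+ 2 * _]mulrC lerD2r exprn_ege1.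
have -> : (C2 + C1 * (1 + x0 ^+ 2) * expR 2) * x ^- 2 * (1 + (N.+1%:R * x) ^+ 2) =
  C1 * ((1 + x0 ^+ 2) * N.+1%:R ^+ 2) * expR 2 +
  (C2 * (x ^- 2 * (1 + (N.+1%:R * x) ^+ 2)) + C1 * (1 + x0 ^+ 2) * expR 2 * x ^- 2).
  by move: (expR 2) => e; field.
rewrite lerDl; apply: addr_ge0; first by apply: mulr_ge0 => //; apply: mulr_ge0 => //; exact: ltW.
by apply: mulr_ge0 => //; apply: mulr_ge0 => //; exact: mulr_ge0.
Qed.

End KernelBounds.

(** * Powers of a sum as sums over distinct indices *)

Section DistinctSums.
Context {R : comNzRingType}.

Definition distinct_sum (I : finType) (y : I -> R) l (e : nat -> nat) : R :=
  \sum_(s : {ffun 'I_l -> I} | injectiveb s) \prod_i y (s i) ^+ e i.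

Definition ncons_fun a (e : nat -> nat) i := if i is i'.+1 then e i' else a.

(** The new index either avoids all chosen ones or equals exactly one of them, whose exponent then
    grows by [a]. *)
Lemma sum_distinct_sum (I : finType) (y : I -> R) a l e :
  (\sum_i y i ^+ a) * distinct_sum y l e =
  distinct_sum y l.+1 (ncons_fun a e) +
  \sum_(j < l) distinct_sum y l (fun i => e i + (i == j) * a)%N.
Proof.
pose cs (p : I * {ffun 'I_l -> I}) : {ffun 'I_l.+1 -> I} :=
  [ffun i => if unlift ord0 i is Some j then p.2 j else p.1].
pose uc (s : {ffun 'I_l.+1 -> I}) : I * {ffun 'I_l -> I} :=
  (s ord0, [ffun i => s (lift ord0 i)]).
have csK : cancel cs uc.
  move=> [i s]; rewrite /uc /cs !ffunE unlift_none; congr pair.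
  by apply/ffunP => j; rewrite !ffunE liftK.
have ucK : cancel uc cs.
  move=> s; apply/ffunP => i; rewrite !ffunE /=.
  by case: unliftP => [j ->|->]; rewrite ?ffunE.
have csI p : injectiveb (cs p) = injectiveb p.2 && [forall j, p.2 j != p.1].
  apply/injectiveP/andP => [h|[/injectiveP h /forallP h'] i k].
    split; first by apply/injectiveP => i j e1; apply: (@lift_inj _ ord0); apply: h; rewrite !ffunE !liftK.
    apply/forallP => j; apply/eqP => e1; have /eqP : ord0 = lift ord0 j.
      by apply: h; rewrite !ffunE unlift_none liftK.
    by rewrite (negbTE (neq_lift _ _)).
  rewrite !ffunE; case: (unliftP ord0 i) => [i' ->|->]; case: (unliftP ord0 k) => [k' ->|->] //.
  - by move/h ->.
  - by move=> e1; have := h' i'; rewrite e1 eqxx.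
  - by move=> e1; have := h' k'; rewrite e1 eqxx.
rewrite {1}/distinct_sum mulr_suml; under eq_bigr do rewrite mulr_sumr.
rewrite pair_big_dep/= (bigID (fun p : I * {ffun 'I_l -> I} => [forall j, p.2 j != p.1]))/=; congr (_ + _).
  rewrite /distinct_sum [RHS](reindex_onto cs uc)/=; last by move=> s _; rewrite ucK.
  apply: eq_big => p; first by rewrite csI csK eqxx andbT.
  move=> _; rewrite big_ord_recl/= ffunE unlift_none; congr (_ * _).
  by apply: eq_bigr => i _; rewrite ffunE liftK.
rewrite /distinct_sum [RHS]exchange_big/=.
rewrite -(pair_big_dep predT (fun i (s : {ffun 'I_l -> I}) => injectiveb s && ~~ [forall j, s j != i])
  (fun i (s : {ffun 'I_l -> I}) => y i ^+ a * \prod_(i0 < l) y (s i0) ^+ e i0))/=.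
rewrite (exchange_big_dep (fun s : {ffun 'I_l -> I} => injectiveb s))//=; last by move=> p s _ /andP[].
apply: eq_bigr => s sI.
rewrite (eq_bigl (fun i => (i \in codom s))); last first.
  move=> i; rewrite sI/= negb_forall; apply/existsP/codomP => -[j].
    by rewrite negbK => /eqP <-; exists j.
  by move=> ->; exists j; rewrite negbK.
rewrite (reindex_omap s (fun i => [pick j | s j == i]))/=; last first.
  by move=> i /codomP[j ->]; case: pickP => [j' /eqP/= ->//|/(_ j)]; rewrite eqxx.
apply: eq_big => j.
  rewrite codom_f; case: pickP => [j' /eqP e1|/(_ j)]; last by rewrite eqxx.
  by apply/eqP; congr Some; exact: (injectiveP _ sI).
move=> _; rewrite (bigD1 j)//= [RHS](bigD1 j)//= eqxx mul1n addnC exprD -!mulrA; congr (_ * _).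
congr (_ * _); apply: eq_bigr => i ij.
by rewrite (_ : (i == j :> nat) = false) ?mul0n ?addn0//; exact/negbTE.
Qed.

Lemma distinct_sum_ext (I : finType) (y : I -> R) l e e' :
  (forall i, (i < l)%N -> e i = e' i) -> distinct_sum y l e = distinct_sum y l e'.
Proof.
by move=> h; apply: eq_bigr => s _; apply: eq_bigr => i _; rewrite h.
Qed.

(** The block sizes of the set partitions of [n] elements, listed with multiplicity: a further
    element opens a block or joins an existing one. *)
Fixpoint patterns n : seq (seq nat) :=
  if n is n'.+1 then
    flatten [seq (1%N :: e) :: [seq incr_nth e j | j <- iota 0 (size e)] | e <- patterns n']
  else [:: [::]].

Lemma patternsS n e' : e' \in patterns n.+1 -> exists2 e, e \in patterns n &
  e' = 1%N :: e \/ exists2 j, (j < size e)%N & e' = incr_nth e j.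
Proof.
move=> /flattenP[s /mapP[e he ->]]; rewrite inE => /orP[/eqP ->|]; first by exists e => //; left.
by move=> /mapP[j]; rewrite mem_iota => hj ->; exists e => //; right; exists j.
Qed.

Lemma patterns_gt0 n e i : e \in patterns n -> (i < size e)%N -> (0 < nth 0 e i)%N.
Proof.
elim: n => [|n IH] in e i *; first by rewrite inE => /eqP ->.
move=> /patternsS[e' he' [->|[j hj ->]]]; first by case: i => //= i; exact: IH.
by rewrite size_incr_nth hj nth_incr_nth => hi; rewrite ltn_addl// IH.
Qed.

Lemma patterns_le n e i : e \in patterns n -> (nth 0 e i <= n)%N.
Proof.
elim: n => [|n IH] in e i *; first by rewrite inE => /eqP ->; rewrite nth_nil.
move=> /patternsS[e' he' [->|[j hj ->]]]; first by case: i => //= i; rewrite leqW// IH.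
by rewrite nth_incr_nth -addn1 addnC leq_add ?IH//; case: (_ == _).
Qed.

Lemma patterns_size n e : e \in patterns n.+1 -> (0 < size e)%N.
Proof.
elim: n => [|n IH] in e *.
  by move=> /patternsS[e'] _ [->|[j hj ->]]//; rewrite size_incr_nth hj; case: (size e') hj.
by move=> /patternsS[e'] he' [->|[j hj ->]]//; rewrite size_incr_nth hj; exact: IH.
Qed.

Lemma power_sum_distinct (I : finType) (y : I -> R) n :
  (\sum_i y i) ^+ n = \sum_(e <- patterns n) distinct_sum y (size e) (nth 0%N e).
Proof.
elim: n => [|n IH].
  rewrite expr0 big_seq1 /distinct_sum (big_pred1 (ffun0 (card_ord 0))) ?big_ord0// => s /=.
  have -> : s = ffun0 (card_ord 0) by apply/ffunP => -[].
  by rewrite eqxx; apply/injectiveP => -[].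
rewrite exprS IH mulr_sumr /= big_flatten/= big_map; apply: eq_bigr => e _.
under eq_bigr do rewrite -[y _]expr1.
rewrite sum_distinct_sum big_cons big_map -[size e in RHS]subn0 -/(index_iota _ _) big_mkord; congr (_ + _).
  by apply: distinct_sum_ext => -[].
apply: eq_bigr => j _; rewrite size_incr_nth ltn_ord.
by apply: distinct_sum_ext => i _; rewrite nth_incr_nth muln1 eq_sym addnC.
Qed.

End DistinctSums.

(** * Truncated sums of the rescaled ensemble *)

Section LebesgueScaling.
Context {R : realType}.
Notation mu := (@lebesgue_measure R).
Local Notation intg f := (mu.-integrable setT (EFin \o f)).

Lemma lebesgue_measure_scale (c : R) (c0 : 0 < c) (A : set R) : measurable A ->
  pushforward mu ( *%R c : _ -> measurableTypeR R) A = (c^-1%:E * mu A)%E.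
Proof.
have mc : measurable_fun setT ( *%R c : measurableTypeR R -> measurableTypeR R) by apply: measurable_funM.
have ci0 : 0 <= c^-1 by rewrite invr_ge0 ltW.
pose nu : {measure set (measurableTypeR R) -> \bar R} :=
  mscale (NngNum (ltW c0)) (measure_function_pushforward__canonical__measure_function_Measure mu mc).
move=> mA; have : mu A = nu A.
  apply: lebesgue_measure_unique => // _ [[a b]] _ <-.
  rewrite /nu /= /mscale /= /pushforward.
  have -> : *%R c @^-1` [set` `]a, b]] = [set` `](a / c), (b / c)]] :> set R.
    by apply/seteqP; split => x /=; rewrite !in_itv/= ltr_pdivrMr// ler_pdivlMr// ![_ * c]mulrC.
  rewrite !lebesgue_measure_itv/= !lte_fin ltr_pM2r ?invr_gt0//; case: ifPn => _; last by rewrite mule0.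
  by rewrite -EFinM; congr EFin; field; rewrite gt_eqF.
by move=> ->; rewrite /nu /= /mscale/= muleA -EFinM mulVf ?gt_eqF// mul1e.
Qed.

Lemma ge0_integral_scale (c : R) (f : R -> \bar R) : 0 < c -> measurable_fun [set: R] f ->
  (forall x, 0 <= f x)%E -> (\int[mu]_x f (c * x)%R = c^-1%:E * \int[mu]_x f x)%E.
Proof.
move=> c0 mf f0.
have mc : measurable_fun setT ( *%R c : measurableTypeR R -> measurableTypeR R) by apply: measurable_funM.
have ci0 : 0 <= c^-1 by rewrite invr_ge0 ltW.
rewrite -(ge0_integral_mscale _ _ (NngNum ci0))//=.
transitivity (\int[pushforward mu ( *%R c : _ -> measurableTypeR R)]_x f x)%E.
  by rewrite ge0_integral_pushforward.
by apply: eq_measure_integral => A mA _; exact: lebesgue_measure_scale.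
Qed.

Lemma ge0_integral_opp (f : R -> \bar R) : measurable_fun [set: R] f ->
  (forall x, 0 <= f x)%E -> (\int[mu]_x f (- x)%R = \int[mu]_x f x)%E.
Proof.
move=> mf f0.
have mc : measurable_fun setT (-%R : measurableTypeR R -> measurableTypeR R) by exact: oppr_measurable.
transitivity (\int[pushforward mu (-%R : _ -> measurableTypeR R)]_x f x)%E.
  by rewrite ge0_integral_pushforward.
by apply: eq_measure_integral => A mA _; exact: lebesgue_measureN.
Qed.

Lemma integral_comp_proportional (k : R) (phi : R -> R) : 0 <= k -> measurable_fun setT phi ->
  (forall f : R -> \bar R, measurable_fun [set: R] f -> (forall x, 0 <= f x)%E ->
    (\int[mu]_x f (phi x) = k%:E * \int[mu]_x f x)%E) ->
  forall f : R -> R, intg f -> intg (f \o phi) /\ \int[mu]_x f (phi x) = k * \int[mu]_x f x.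
Proof.
move=> k0 mphi H f intf.
have mf := integrable_EFin_measurable intf.
have mfe : measurable_fun [set: R] (EFin \o f) by exact/measurable_EFinP.
have [/integrableP[_ foo]] := intf.
split.
  apply/integrableP; split; first by apply/measurable_EFinP; exact: measurableT_comp.
  rewrite (H (fun x => `|(f x)%:E|)%E)//; last exact: measurableT_comp.
  by rewrite lte_mul_pinfty.
rewrite /Rintegral integralE [in RHS]integralE.
under eq_integral do rewrite (_ : (fun x => (f (phi x))%:E) = (EFin \o f) \o phi)// funepos_comp.
under [X in (_ - X)%E]eq_integral do rewrite (_ : (fun x => (f (phi x))%:E) = (EFin \o f) \o phi)// funeneg_comp.
rewrite (H ((EFin \o f)^\+)%E)//; last exact: measurable_funepos.
rewrite (H ((EFin \o f)^\-)%E)//; last exact: measurable_funeneg.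
have p1 := integrable_fin_num measurableT (integrable_funepos measurableT intf).
have p2 := integrable_fin_num measurableT (integrable_funeneg measurableT intf).
by rewrite -(fineK p1) -(fineK p2) -!EFinM -!EFinB/= mulrBr.
Qed.

Lemma integral_scale (c : R) (f : R -> R) : 0 < c -> intg f ->
  intg (fun x => f (c * x)) /\ \int[mu]_x f (c * x) = c^-1 * \int[mu]_x f x.
Proof.
move=> c0; apply: integral_comp_proportional; first by rewrite invr_ge0 ltW.
- exact: measurable_funM.
- by move=> g mg g0; exact: ge0_integral_scale.
Qed.

Lemma integral_opp (f : R -> R) : intg f ->
  intg (fun x => f (- x)) /\ \int[mu]_x f (- x) = \int[mu]_x f x.
Proof.
move=> intf.
have [] := @integral_comp_proportional 1 -%R ler01 (@oppr_measurable R setT) _ f intf; last by rewrite mul1r.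
by move=> g mg g0; rewrite mul1e; exact: ge0_integral_opp.
Qed.

End LebesgueScaling.

Section EnsemblePowerSums.
Context {R : realType} (n : nat) (phi : 'I_n -> R -> R).
Notation mu := (@lebesgue_measure R).
Notation leb n := (@lebesgue_tuple R n).
Local Notation intg f := (mu.-integrable setT (EFin \o f)).
Hypothesis phi_on : forall a b, intg (fun x => phi a x * phi b x) /\
  \int[mu]_x (phi a x * phi b x) = (a == b)%:R.

Lemma ensembleE_power_sum (f : R -> R) p : (forall e, (e <= p)%N -> admissible phi (fun x => f x ^+ e)) ->
  [/\ (leb n).-integrable setT (EFin \o (fun x => (\sum_i f (tnth x i)) ^+ p * \det (evalmx phi x) ^+ 2)),
   ensembleE phi (fun x => (\sum_i f (tnth x i)) ^+ p) =
     \sum_(e <- patterns p) \sum_(a : {ffun 'I_(size e) -> 'I_n})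
       \det (\matrix_(i, j) gram phi (fun x => f x ^+ nth 0%N e i) (a i) (a j)) &
   ensembleE phi (fun x => (\sum_i f (tnth x i)) ^+ p) =
     \sum_(e <- patterns p) \int[leb (size e)]_z ((\prod_i f (tnth z i) ^+ nth 0%N e i) *
        \det (\matrix_(i, j) corr_kernel phi (tnth z i) (tnth z j)))].
Proof.
move=> af.
have E (x : n.-tuple R) : (\sum_i f (tnth x i)) ^+ p = \sum_(e <- patterns p)
    inj_sum (fun (i : 'I_(size e)) x => f x ^+ nth 0%N e i) x.
  exact: power_sum_distinct.
have P e (he : e \in patterns p) := @ensembleE_inj_sum R n phi phi_on (size e)
  (fun i x => f x ^+ nth 0%N e i) (fun i => af _ (patterns_le _ he)).
have E2 x : (\sum_i f (tnth x i)) ^+ p * \det (evalmx phi x) ^+ 2 = \sum_(e <- patterns p | e \in patterns p)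
    inj_sum (fun (i : 'I_(size e)) x => f x ^+ nth 0%N e i) x * \det (evalmx phi x) ^+ 2.
  by rewrite E mulr_suml [LHS]big_seq_cond; apply: eq_bigl => e; rewrite andbT.
have EE : ensembleE phi (fun x => (\sum_i f (tnth x i)) ^+ p) = \sum_(e <- patterns p) \sum_(a : {ffun 'I_(size e) -> 'I_n})
       \det (\matrix_(i, j) gram phi (fun x => f x ^+ nth 0%N e i) (a i) (a j)).
  rewrite /ensembleE; under eq_Rintegral do rewrite E2.
  rewrite Rintegral_sum//; last by move=> e he; have [] := P e he.
  rewrite mulr_sumr [RHS]big_seq; apply: eq_bigr => e he; have [_ <-] := P e he.
  by [].
split => //.
- under eq_fun do rewrite E2.
  by apply: integrable_sum_EFin => // e he; have [] := P e he.
- rewrite EE !big_seq; apply: eq_bigr => e he.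
  by have [_ ->] := @integral_corr_kernel R n phi (size e)
    (fun i x => f x ^+ nth 0%N e i) (fun i => af _ (patterns_le _ he)).
Qed.

Lemma ensembleE_ge0 g : (forall x, 0 <= g x) -> 0 <= ensembleE phi g.
Proof.
move=> g0; rewrite /ensembleE mulr_ge0//.
by apply: Rintegral_ge0 => x _; rewrite mulr_ge0// sqr_ge0.
Qed.

Lemma ensembleE_le g1 g2 : (forall x, g1 x <= g2 x) ->
  (leb n).-integrable setT (EFin \o (fun x => g1 x * \det (evalmx phi x) ^+ 2)) ->
  (leb n).-integrable setT (EFin \o (fun x => g2 x * \det (evalmx phi x) ^+ 2)) ->
  ensembleE phi g1 <= ensembleE phi g2.
Proof.
move=> g12 i1 i2; rewrite /ensembleE ler_wpM2l//.
by apply: Rintegral_ler => // x _; rewrite ler_wpM2r// sqr_ge0.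
Qed.

Lemma ensembleED g1 g2 :
  (leb n).-integrable setT (EFin \o (fun x => g1 x * \det (evalmx phi x) ^+ 2)) ->
  (leb n).-integrable setT (EFin \o (fun x => g2 x * \det (evalmx phi x) ^+ 2)) ->
  (leb n).-integrable setT (EFin \o (fun x => (g1 x + g2 x) * \det (evalmx phi x) ^+ 2)) /\
  ensembleE phi (fun x => g1 x + g2 x) = ensembleE phi g1 + ensembleE phi g2.
Proof.
move=> i1 i2; split; first by under eq_fun do rewrite mulrDl; exact: integrableD_EFin.
rewrite /ensembleE; under eq_Rintegral do rewrite mulrDl.
by rewrite RintegralD// mulrDr.
Qed.

Lemma ensembleEZ c g :
  (leb n).-integrable setT (EFin \o (fun x => g x * \det (evalmx phi x) ^+ 2)) ->
  (leb n).-integrable setT (EFin \o (fun x => (c * g x) * \det (evalmx phi x) ^+ 2)) /\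
  ensembleE phi (fun x => c * g x) = c * ensembleE phi g.
Proof.
move=> i1; split; first by under eq_fun do rewrite -mulrA; exact: integrableZ_EFin.
rewrite /ensembleE; under eq_Rintegral do rewrite -mulrA.
by rewrite RintegralZl// mulrCA.
Qed.

End EnsemblePowerSums.

Section HuaPickrellEnsemble.
Context {R : realType}.
Notation mu := (@lebesgue_measure R).
Notation leb n := (@lebesgue_tuple R n).
Local Notation intg f := (mu.-integrable setT (EFin \o f)).
Variables (s : R).
Hypothesis s1 : 1 < 2 * s.

(** The two sides differ by a constant factor involving [(\det M)^2], which is determined by
    comparing total masses: both integrate to [N!]. *)
Lemma det_hp_fun N (x : N.-tuple R) : \det (evalmx (@hp_fun R s N) x) ^+ 2 =
  (moment_det0 s N)^-1 * (\prod_j cauchy_weight (N%:R + s) (tnth x j) *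
    \det (evalmx (monomials (fun k => k)) x) ^+ 2).
Proof.
pose M : 'M[R]_N := \matrix_(k, a) ((hp_poly s N a)`_k / Num.sqrt (hp_norm s N a)).
have E y : \det (evalmx (@hp_fun R s N) y) ^+ 2 = \det M ^+ 2 *
   (\prod_j cauchy_weight (N%:R + s) (tnth y j) * \det (evalmx (monomials (fun k => k)) y) ^+ 2).
  pose q (a : 'I_N) x := (hp_poly s N a).[x] / Num.sqrt (hp_norm s N a).
  have -> : evalmx (@hp_fun R s N) y =
      evalmx (fun a x => Num.sqrt (cauchy_weight (N%:R + s) x) * q a x) y.
    by apply/matrixP => i a; rewrite !mxE /hp_fun /q mulrA [Num.sqrt (cauchy_weight _ _) * _]mulrC.
  rewrite det_evalmx_scale (_ : evalmx q y = evalmx (monomials (fun k => k)) y *m M); last first.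
    apply/matrixP => i a; rewrite !mxE /q (@horner_coef_wide _ N); last by rewrite size_hp_poly.
    by rewrite mulr_suml; apply: eq_bigr => k _; rewrite !mxE /monomials mulrCA mulrA.
  rewrite det_mulmx !exprMn -prodrXl mulrA [RHS]mulrC; congr (_ * _ * _).
  apply: eq_bigr => i _; rewrite sqr_sqrtr// ltW//; exact: cauchy_weight_gt0.
rewrite E; congr (_ * _).
have := ensembleE1 (hp_fun_orthonormal s1 (N := N)); rewrite /ensembleE.
under eq_Rintegral do rewrite mul1r E.
have n0 : 0%:R < 2 * s + 1 by have s2 := s1; lra.
have [iW eW] := integral_power_monomials N s1 n0.
move: iW; under eq_fun do rewrite expr0 mul1r; move=> iW.
move: eW; under eq_Rintegral do rewrite expr0 mul1r; move=> eW.
rewrite RintegralZl// eW.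
have -> : \sum_(g : {ffun 'I_0 -> 'I_N}) moment_det s (fun k => k + content g k)%N = moment_det0 s N.
  rewrite (big_pred1 (ffun0 (card_ord 0))) => [|g]; last by apply/esym/eqP/ffunP => -[].
  rewrite /moment_det0; congr (\det _); apply/matrixP => i j; rewrite !mxE.
  congr (cauchy_moment _ _ (_ + _)); rewrite /content eq_card0 ?addn0// => k; case: k => //.
rewrite mulrCA mulKf ?pnatr_eq0 -?lt0n ?fact_gt0// => e.
have m0 := moment_det0_gt0 s1 N.
by apply: (mulIf (lt0r_neq0 m0)); rewrite e mulVf// gt_eqF.
Qed.

Lemma integral_hp_sfun N (f : R -> R) (a b : 'I_N.+1) : intg (fun x => f (x / N.+1%:R) * hp_fun s a x * hp_fun s b x) ->
  intg (fun x => f x * @hp_sfun R s N a x * @hp_sfun R s N b x) /\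
  \int[mu]_x (f x * @hp_sfun R s N a x * @hp_sfun R s N b x) =
  \int[mu]_x (f (x / N.+1%:R) * hp_fun s a x * hp_fun s b x).
Proof.
move=> h; have c0 : 0 < N.+1%:R :> R by [].
have E x : f x * @hp_sfun R s N a x * @hp_sfun R s N b x =
    N.+1%:R * (f (N.+1%:R * x / N.+1%:R) * hp_fun s a (N.+1%:R * x) * hp_fun s b (N.+1%:R * x)).
  rewrite /hp_sfun [N.+1%:R * x / _]mulrAC mulfV ?mul1r ?gt_eqF//.
  have aux (u v p q c : R) : u ^+ 2 = c -> v * (u * p) * (u * q) = c * (v * p * q) by move=> <-; ring.
  by apply: aux; rewrite sqr_sqrtr// ltW.
have [i1 e1] := integral_scale c0 h.
split; first by under eq_fun do rewrite E; exact: integrableZ_EFin.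
by under eq_Rintegral do rewrite E; rewrite (RintegralZl _ measurableT i1) e1 (mulVKf (lt0r_neq0 c0)).
Qed.

Lemma hp_sfun_orthonormal N a b : intg (fun x => @hp_sfun R s N a x * @hp_sfun R s N b x) /\
  \int[mu]_x (@hp_sfun R s N a x * @hp_sfun R s N b x) = (a == b)%:R.
Proof.
have [h1 h2] := hp_fun_orthonormal s1 a b.
have [] := @integral_hp_sfun N (cst 1) a b; first by under eq_fun do rewrite mul1r.
under eq_fun do rewrite mul1r; move=> ?.
under eq_Rintegral do rewrite mul1r.
by rewrite h2.
Qed.

Lemma normrM_le_sqr (p q : R) : `|p * q| <= p * p + q * q.
Proof.
rewrite normrM -[p * p]ger0_norm ?sqr_ge0// -[q * q]ger0_norm ?sqr_ge0// !normrM.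
have := sqr_ge0 (`|p| - `|q|); have := mulr_ge0 (normr_ge0 p) (normr_ge0 q); lra.
Qed.

Variables (h : nat).
Hypothesis hs : (2 * h)%:R < 2 * s + 1.

Lemma admissible_hp_fun N (f : R -> R) (B : R) : measurable_fun setT f -> 0 <= B ->
  (forall x, `|f x| <= B * (1 + x ^+ (2 * h))) -> admissible (@hp_fun R s N) f.
Proof.
move=> mf B0 hf a b.
have mphi c : measurable_fun setT (@hp_fun R s N c).
  apply: measurable_funM => //; apply: measurable_funM.
    by apply: continuous_measurable_fun; exact: continuous_horner.
  apply: continuous_measurable_fun => x.
  by apply: continuous_comp; [exact: continuous_cauchy_weight|exact: sqrt_continuous].
have I (c : 'I_N) : intg (fun x => B * ((1 + x ^+ (2 * h)) * (hp_fun s c x * hp_fun s c x))).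
  apply: integrableZ_EFin => //.
  rewrite (_ : (fun x => _) = (fun x => (Num.sqrt (hp_norm s N c) * Num.sqrt (hp_norm s N c))^-1 *
     (((1 + 'X^(2 * h)) * (hp_poly s N c * hp_poly s N c)).[x] * cauchy_weight (N%:R + s) x))); last first.
    by apply/funext => x; rewrite hp_funM [in RHS]hornerM hornerD hornerXn hornerC mulrCA !mulrA.
  apply: integrableZ_EFin => //; apply: integrable_poly_weight.
  have sz : (size ((1 + 'X^(2 * h)) * (hp_poly s N c * hp_poly s N c) : {poly R})%R < 2 * h + 2 * N)%N.
    rewrite (leq_ltn_trans (size_polyMleq _ _))//.
    have e1 : (size (1 + 'X^(2 * h) : {poly R})%R <= (2 * h).+1)%N.
      by rewrite (leq_trans (size_polyD _ _))// geq_max size_poly1 size_polyXn leqnn.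
    have e2 : (size (hp_poly s N c * hp_poly s N c)%R < c.+1 + c.+1)%N.
      by rewrite (leq_ltn_trans (size_polyMleq _ _))// !size_hp_poly.
    have aux (u v k : nat) : (u <= (2 * h).+1 -> v < k.+1 + k.+1 -> k < N -> (u + v).-1 < 2 * h + 2 * N)%N by lia.
    exact: aux e1 e2 (ltn_ord c).
  have : (size ((1 + 'X^(2 * h)) * (hp_poly s N c * hp_poly s N c))).+1%:R <= (2 * h + 2 * N)%:R :> R by rewrite ler_nat.
  have s2 := s1; have hs' := hs; rewrite -natr1 natrD !natrM in hs' *; lra.
have := integrableD_EFin measurableT (I a) (I b); apply: le_integrable_EFin => //.
  by apply: measurable_funM; [apply: measurable_funM; [exact: mf|exact: mphi]|exact: mphi].
move=> x _; rewrite -mulrA normrM -mulrDr -mulrDr [leRHS]mulrA.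
apply: ler_pM => //; exact: normrM_le_sqr.
Qed.

Lemma admissible_hp_sfun N (f : R -> R) (B : R) : measurable_fun setT f -> 0 <= B ->
  (forall x, `|f x| <= B * (1 + x ^+ (2 * h))) -> admissible (@hp_sfun R s N) f.
Proof.
move=> mf B0 hf a b.
have := @admissible_hp_fun N.+1 (fun x => f (x / N.+1%:R)) B.
case/(_ _ _ _ a b)/integral_hp_sfun => //.
- by apply: measurableT_comp => //; exact: measurable_funM.
- move=> x; rewrite (le_trans (hf _))// ler_wpM2l// lerD2l expr_div_n.
  rewrite ler_pdivrMr ?exprn_gt0// ler_peMr ?exprn_even_ge0 ?oddM//.
  by rewrite exprn_ege1// ler1n.
Qed.

(** The change of scale is made in the one-dimensional Gram integrals, which coincide for the
    rescaled and the original functions, rather than in the [N]-fold integral. *)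
Lemma ensembleE_hp_sfun_power N :
  (leb N.+1).-integrable setT (EFin \o (fun x => (\sum_i tnth x i) ^+ (2 * h) *
     \det (evalmx (@hp_sfun R s N) x) ^+ 2)) /\
  ensembleE (@hp_sfun R s N) (fun x => (\sum_i tnth x i) ^+ (2 * h)) =
  power_moment s (2 * h) N.+1 / N.+1%:R ^+ (2 * h).
Proof.
have le1 (x : R) e : (e <= 2 * h)%N -> `|x ^+ e| <= 1 * (1 + x ^+ (2 * h)).
  move=> e1; rewrite mul1r normrX -[x ^+ (2 * h)]ger0_norm ?exprn_even_ge0 ?oddM// normrX.
  have [x1|x1] := leP `|x| 1.
    by rewrite (@le_trans _ _ 1)// ?exprn_ile1// lerDl exprn_ge0.
  by rewrite (@le_trans _ _ (`|x| ^+ (2 * h)))// ?ler_weXn2l// ?lerDr// ltW.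
have a1 e : (e <= 2 * h)%N -> admissible (@hp_sfun R s N) (fun x => x ^+ e).
  move=> e1; apply: (@admissible_hp_sfun N _ 1) => //; last by move=> x; exact: le1.
have a2 e : (e <= 2 * h)%N -> admissible (@hp_fun R s N.+1) (fun x => (x / N.+1%:R) ^+ e).
  move=> e1; apply: (@admissible_hp_fun N.+1 _ 1) => //.
    by apply: measurable_funX; exact: measurable_funM.
  move=> x; rewrite expr_div_n normrM (@le_trans _ _ `|x ^+ e|)//; last exact: le1.
  rewrite ler_piMr// ger0_norm ?invr_ge0 ?exprn_ge0// invf_le1 ?exprn_gt0//.
  by rewrite exprn_ege1// ler1n.
have [i1 e1 _] := ensembleE_power_sum (@hp_sfun_orthonormal N) a1.
have [i2 e2 _] := ensembleE_power_sum (hp_fun_orthonormal s1 (N := N.+1)) a2.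
split=> //; rewrite e1.
transitivity (ensembleE (@hp_fun R s N.+1) (fun x => (\sum_i tnth x i / N.+1%:R) ^+ (2 * h))).
  rewrite e2 !big_seq; apply: eq_bigr => e he; apply: eq_bigr => a _.
  congr (\det _); apply/matrixP => i j; rewrite !mxE.
  by have [_ ->] := @integral_hp_sfun N (fun x => x ^+ nth 0%N e i) (a i) (a j)
    (a2 _ (patterns_le _ he) (a i) (a j)).
have n2 : (2 * h)%:R < 2 * s + 1 by [].
have [iW eW] := integral_power_monomials N.+1 s1 hs.
have E (x : N.+1.-tuple R) : (\sum_i tnth x i / N.+1%:R) ^+ (2 * h) * \det (evalmx (@hp_fun R s N.+1) x) ^+ 2 =
   (N.+1%:R ^- (2 * h) / moment_det0 s N.+1) * ((\sum_i tnth x i) ^+ (2 * h) *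
     (\prod_j cauchy_weight (N.+1%:R + s) (tnth x j) * \det (evalmx (monomials (fun k => k)) x) ^+ 2)).
  by rewrite -mulr_suml expr_div_n det_hp_fun [X in X * _]mulrC mulrACA.
rewrite /ensembleE; under eq_Rintegral do rewrite E.
rewrite RintegralZl// eW mulrCA mulKf ?pnatr_eq0 -?lt0n ?fact_gt0//.
by rewrite /power_moment -mulr_suml mulrC mulrA [LHS]mulrAC.
Qed.

End HuaPickrellEnsemble.

(** * Moments of sums over small and over large points *)

Section TruncatedMoments.
Context {R : realType}.
Notation mu := (@lebesgue_measure R).
Notation leb n := (@lebesgue_tuple R n).
Local Notation intg f := (mu.-integrable setT (EFin \o f)).

Definition trunc (A : set R) (x : R) : R := x * \1_A x.

Lemma trunc_in A x : A x -> trunc A x = x.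
Proof. by move=> Ax; rewrite /trunc indicE mem_set// mulr1. Qed.

Lemma trunc_out A x : ~ A x -> trunc A x = 0.
Proof. by move=> Ax; rewrite /trunc indicE memNset// mulr0. Qed.

Lemma norm_trunc A x : `|trunc A x| = `|x| * \1_A x.
Proof. by rewrite /trunc normrM indicE normr_nat. Qed.

Lemma norm_trunc_le A x : `|trunc A x| <= `|x|.
Proof. by rewrite norm_trunc indicE ler_piMr// lern1 leq_b1. Qed.

Lemma measurable_trunc A : measurable A -> measurable_fun setT (trunc A).
Proof. by move=> mA; apply: measurable_funM => //; exact: measurable_indic. Qed.

(** Both sides are compared after multiplication by [1 - u]: the left is then at most [1], and the
    right is [1 + u^2 (1 - 2u)]. *)
Lemma expR_le_quadratic (u : R) : `|u| <= 1 / 2 -> expR u <= 1 + u + 2 * u ^+ 2.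
Proof.
rewrite ler_norml => /andP[u1 u2]; have h1 : 0 < 1 - u by lra.
have e1 := expR_ge1Dx (- u).
have : (1 - u) * expR u <= 1.
  by rewrite -[leRHS](expRxMexpNx_1 u) mulrC ler_wpM2l// expR_ge0.
have e2 : 1 <= (1 - u) * (1 + u + 2 * u ^+ 2).
  have : 0 <= u ^+ 2 * (1 - 2 * u) by rewrite mulr_ge0 ?sqr_ge0//; lra.
  by move=> h; rewrite -subr_ge0; apply: le_trans h _; rewrite le_eqVlt; apply/orP; left; apply/eqP; ring.
by move=> e3; have := le_trans e3 e2; rewrite ler_pM2l.
Qed.

Lemma exprn_even_le_expR (u : R) h : (0 < h)%N ->
  u ^+ (2 * h) <= (2 * h)`!%:R * (expR u + expR (- u)).
Proof.
move=> h0; rewrite -ler_pdivrMl ?ltr0n ?fact_gt0//.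
have h2 : (2 * h = (2 * h).-1.+1)%N by rewrite prednK// muln_gt0.
have key (v : R) : 0 <= v -> (2 * h)`!%:R^-1 * v ^+ (2 * h) <= expR v.
  move=> v0; have := expR_ge1Dxn (2 * h).-1 v0; rewrite -h2 mulrC; apply: le_trans.
  by rewrite lerDr.
have [u0|u0] := leP 0 u; first by rewrite (le_trans (key _ u0))// lerDl expR_ge0.
have := key (- u); rewrite oppr_ge0 => /(_ (ltW u0)).
rewrite exprM sqrrN -exprM => /le_trans; apply.
by rewrite lerDr expR_ge0.
Qed.

Lemma normrX_le (h e : nat) (x : R) : (e <= 2 * h)%N -> `|x| ^+ e <= 1 + x ^+ (2 * h).
Proof.
move=> e1; rewrite -[x ^+ (2 * h)]ger0_norm ?exprn_even_ge0 ?oddM// normrX.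
have [x1|x1] := leP `|x| 1; first by rewrite (@le_trans _ _ 1)// ?exprn_ile1// lerDl exprn_ge0.
by rewrite (@le_trans _ _ (`|x| ^+ (2 * h)))// ?ler_weXn2l// ?lerDr// ltW.
Qed.

Lemma det_corr_kernel_le n (phi : 'I_n -> R -> R) l (z : 'I_l -> R) :
  `|\det (\matrix_(i, j) corr_kernel phi (z i) (z j))| <= \prod_i corr_kernel phi (z i) (z i).
Proof.
pose Phi : 'M[R]_(l, n) := \matrix_(i, a) phi a (z i).
have E : \matrix_(i, j) corr_kernel phi (z i) (z j) = Phi *m Phi^T.
  by apply/matrixP => i j; rewrite !mxE; apply: eq_bigr => a _; rewrite !mxE.
have /andP[d0 d1] := hadamard_psd (psd_gram_mx Phi).
rewrite E ger0_norm// (le_trans d1)// le_eqVlt; apply/orP; left; apply/eqP.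
by apply: eq_bigr => i _; rewrite -E mxE.
Qed.

Section GramTrace.
Variables (n : nat) (phi : 'I_n -> R -> R).

Lemma integral_mul_corr_kernel f : admissible phi f ->
  intg (fun x => f x * corr_kernel phi x x) /\
  \int[mu]_x (f x * corr_kernel phi x x) = \sum_a gram phi f a a.
Proof.
move=> af; have E x : f x * corr_kernel phi x x = \sum_a f x * phi a x * phi a x.
  by rewrite /corr_kernel mulr_sumr; apply: eq_bigr => a _; rewrite mulrA.
have i1 a : intg (fun x => f x * phi a x * phi a x) by exact: af.
split; first by under eq_fun do rewrite E; exact: integrable_sum_EFin.
under eq_Rintegral do rewrite E.
by rewrite Rintegral_sum//; apply: eq_bigr => a _; rewrite mxE.
Qed.

Lemma psd_gram G : admissible phi G -> (forall x, 0 <= G x) -> psd (gram phi G).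
Proof.
move=> aG G0; split.
  by apply/matrixP => a b; rewrite !mxE; apply: eq_Rintegral => x _; rewrite mulrAC.
move=> v.
have -> : (v *m gram phi G *m v^T) 0 0 = \int[mu]_x (\sum_a \sum_b (v 0 a * v 0 b) * (G x * phi a x * phi b x)).
  rewrite Rintegral_sum//; last by move=> a _; apply: integrable_sum_EFin => // b _; exact: integrableZ_EFin.
  rewrite mxE; under eq_bigr do rewrite !mxE mulr_suml.
  rewrite exchange_big/=; apply: eq_bigr => a _.
  rewrite Rintegral_sum//; last by move=> b _; exact: integrableZ_EFin.
  by apply: eq_bigr => b _; rewrite RintegralZl// !mxE mulrAC.
apply: Rintegral_ge0 => x _.
rewrite (_ : \sum_a _ = G x * (\sum_a v 0 a * phi a x) ^+ 2); first by rewrite mulr_ge0// sqr_ge0.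
rewrite expr2 mulr_suml mulr_sumr; apply: eq_bigr => a _; rewrite !mulr_sumr; apply: eq_bigr => b _; ring.
Qed.

End GramTrace.

Variables (s : R).
Hypothesis s1 : 1 < 2 * s.
Variables (h : nat).
Hypothesis (h0 : (0 < h)%N) (hs : (2 * h)%:R < 2 * s + 1).

Lemma admissible_power N (f : R -> R) e : measurable_fun setT f -> (forall x, `|f x| <= `|x|) ->
  (e <= 2 * h)%N -> admissible (@hp_sfun R s N) (fun x => f x ^+ e).
Proof.
move=> mf fx eh; apply: (@admissible_hp_sfun _ _ s1 h hs N _ 1) => //.
  exact: measurable_funX.
move=> x; rewrite mul1r normrX (le_trans _ (normrX_le x eh))//.
by apply: lerXn2r; rewrite ?nnegrE.
Qed.

Lemma admissible_trunc N A e : measurable A -> (e <= 2 * h)%N ->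
  admissible (@hp_sfun R s N) (fun x => trunc A x ^+ e).
Proof. by move=> mA; apply: admissible_power; [exact: measurable_trunc|exact: norm_trunc_le]. Qed.

Lemma hp_funN N (a : 'I_N) x : hp_fun s a (- x) = (-1) ^+ a * hp_fun s a x.
Proof. by rewrite /hp_fun /hp_poly romanovskiN cauchy_weightN -!mulrA. Qed.

Lemma hp_skernelN N x : hp_skernel s N (- x) (- x) = hp_skernel s N x x.
Proof.
apply: eq_bigr => a _; rewrite /hp_sfun mulrN hp_funN.
have aux (c e f : R) : e ^+ 2 = 1 -> c * (e * f) * (c * (e * f)) = c * f * (c * f).
  by move=> e1; rewrite -[RHS]mul1r -e1; ring.
by apply: aux; rewrite sqrr_sign.
Qed.

(* The exponential moment of a truncated sum is the determinant of a Gram matrix,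
   at most the product of its diagonal by Hadamard's inequality; the linear term
   of the trace vanishes because the kernel is even. *)
Lemma ensembleE_expR_le : exists2 K : R, 0 <= K & forall N (A : set R) (a t : R), measurable A ->
  (forall x, A x -> A (- x)) -> (forall x, A x -> `|x| <= a) -> t != 0 -> `|t| * a <= 1 / 2 ->
  (mu A <= (t ^- 2)%:E)%E ->
  (leb N.+1).-integrable setT (EFin \o (fun x : N.+1.-tuple R =>
    expR (t * \sum_i trunc A (tnth x i)) * \det (evalmx (@hp_sfun R s N) x) ^+ 2)) /\
  ensembleE (@hp_sfun R s N) (fun x => expR (t * \sum_i trunc A (tnth x i))) <= expR (2 * K).
Proof.
have [K K0 hK] := hp_skernel_le s1; exists K => // N A a t mA symA Aa t0 ta muA.
pose G x := expR (t * trunc A x).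
have tA x : `|t * trunc A x| <= 1 / 2.
  have [Ax|Ax] := pselect (A x); last by rewrite trunc_out// mulr0 normr0.
  by rewrite trunc_in// normrM (le_trans _ ta)// ler_wpM2l// Aa.
have mtr := measurable_trunc mA.
have aG : admissible (@hp_sfun R s N) G.
  apply: (@admissible_hp_sfun _ _ s1 h hs N _ (expR (1 / 2))); last 2 first.
  - exact: expR_ge0.
  - move=> x; rewrite ger0_norm ?expR_ge0// (@le_trans _ _ (expR (1 / 2)))//.
      by rewrite ler_expR (le_trans (ler_norm _))// tA.
    by rewrite ler_peMr ?expR_ge0// lerDl exprn_even_ge0// oddM.
  - apply: measurableT_comp; first exact: measurable_expR.
    exact: measurable_funM.
have [i1 e1] := ensembleE_prod aG.
have prodE (x : N.+1.-tuple R) : \prod_j G (tnth x j) = expR (t * \sum_i trunc A (tnth x i)).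
  by rewrite mulr_sumr expR_sum.
split; first by move: i1; under eq_fun do rewrite prodE.
rewrite (_ : (fun x => expR _) = (fun x => \prod_j G (tnth x j))); last by apply/funext => x; rewrite prodE.
rewrite e1.
have /andP[_ /le_trans->//] := hadamard_psd (psd_gram aG (fun x => expR_ge0 _)).
have on := @hp_sfun_orthonormal R s s1 N.
have a1 := admissible1 on.
(* By [x <= expR (x - 1)] and orthonormality, the product of the diagonal is at most the exponential
   of the trace of the Gram matrix of [G - 1]. *)
apply: (@le_trans _ _ (\prod_b expR (gram (@hp_sfun R s N) G b b - gram (@hp_sfun R s N) (cst 1) b b))).
  apply: ler_prod => b _; apply/andP; split.
    by rewrite mxE; apply: Rintegral_ge0 => x _; rewrite -mulrA -expr2 mulr_ge0 ?expR_ge0 ?sqr_ge0.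
  apply: le_trans (expR_ge1Dx _).
  have -> : gram (@hp_sfun R s N) (cst 1) b b = 1.
    by rewrite mxE; under eq_Rintegral do rewrite mul1r; have [_ ->] := on b b; rewrite eqxx.
  by rewrite addrC subrK.
rewrite -expR_sum ler_expR sumrB.
have [iG <-] := integral_mul_corr_kernel aG.
have [i0 <-] := integral_mul_corr_kernel a1.
have at1 : admissible (@hp_sfun R s N) (trunc A) by apply: (@admissible_trunc N A 1) => //; clear -h0; lia.
have at2 : admissible (@hp_sfun R s N) (fun x => trunc A x ^+ 2) by apply: admissible_trunc => //; clear -h0; lia.
have [j1 _] := integral_mul_corr_kernel at1; have [j2 _] := integral_mul_corr_kernel at2.
rewrite -/(hp_skernel s N) in iG i0 j1 j2 *.
pose k x := hp_skernel s N x x.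
have odd0 : \int[mu]_x (trunc A x * k x) = 0.
  have [_] := integral_opp j1.
  have oE x : trunc A (- x) * hp_skernel s N (- x) (- x) = - 1 * (trunc A x * hp_skernel s N x x).
    rewrite hp_skernelN mulrA; congr (_ * _); rewrite /trunc !indicE.
    have -> : (- x \in A) = (x \in A).
      by apply/idP/idP => /set_mem/symA; rewrite ?opprK => /mem_set.
    by rewrite !mulNr mul1r.
  under eq_Rintegral do rewrite oE.
  rewrite RintegralZl// mulN1r /k => e2.
  by have : \int[mu]_x (trunc A x * hp_skernel s N x x) = 0 by lra.
(* The kernel bound [K / x^2] cancels the square, which leaves [K] times the measure of [A]; hence
   the hypothesis relating that measure to [t]. *)
have sq : \int[mu]_x (trunc A x ^+ 2 * k x) <= K * t ^- 2.
  have muoo : (mu A < +oo)%E by exact: le_lt_trans muA (ltry _).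
  have iA : intg (\1_A : R -> R).
    apply/integrableP; split; first by apply/measurable_EFinP; exact: measurable_indic.
    under eq_integral => x _ do rewrite /= indicE normr_nat -indicE.
    by rewrite integral_indic// setIT.
  apply: (@le_trans _ _ (\int[mu]_x (K * \1_A x))).
    apply: Rintegral_ler => //; first exact: integrableZ_EFin.
    move=> x _; rewrite /trunc exprMn indicE.
    have [->|x0] := eqVneq x 0; first by rewrite expr0n/= !mul0r mulr_ge0.
    case: (x \in A); rewrite ?expr0n ?expr1n ?mulr0 ?mul0r ?mulr1//.
    by rewrite -ler_pdivlMl ?exprn_even_gt0// mulrC; exact: hK.
  rewrite RintegralZl// ler_wpM2l// /Rintegral integral_indic// setIT.
  by rewrite -lee_fin fineK// ge0_fin_numE.
have i12 : intg (fun x => t * (trunc A x * k x) + 2 * t ^+ 2 * (trunc A x ^+ 2 * k x)).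
  by apply: integrableD_EFin => //; exact: integrableZ_EFin.
rewrite -RintegralB//.
apply: (@le_trans _ _ (\int[mu]_x (t * (trunc A x * k x) + 2 * t ^+ 2 * (trunc A x ^+ 2 * k x)))).
  apply: Rintegral_ler => //; first exact: integrableB_EFin.
  move=> x _; rewrite -mulrBl /G /cst.
  have := expR_le_quadratic (tA x); rewrite exprMn => e2.
  have k0 := hp_skernel_ge0 s N x.
  have aux (E t' T k' : R) : 0 <= k' -> E <= 1 + t' * T + 2 * (t' ^+ 2 * T ^+ 2) ->
      (E - 1) * k' <= t' * (T * k') + 2 * t' ^+ 2 * (T ^+ 2 * k').
    move=> k1 hE; rewrite (_ : _ + _ = (t' * T + 2 * (t' ^+ 2 * T ^+ 2)) * k'); last by ring.
    by rewrite ler_wpM2r//; lra.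
  exact: aux.
rewrite RintegralD//; [|exact: integrableZ_EFin|exact: integrableZ_EFin].
rewrite !RintegralZl// odd0 mulr0 add0r -mulrA ler_wpM2l//.
by rewrite -ler_pdivlMl ?exprn_even_gt0// mulrC.
Qed.

(** An even power of [t S] is bounded by [expR (t S) + expR (- t S)] up to a factorial, and the
    exponential bound holds for both signs of [t]. *)
Lemma hp_small_moment : exists2 C : R, 0 <= C & forall N (A : set R) (a t : R), measurable A ->
  (forall x, A x -> A (- x)) -> (forall x, A x -> `|x| <= a) -> 0 < t -> t * a <= 1 / 2 ->
  (mu A <= (t ^- 2)%:E)%E ->
  t ^+ (2 * h) * ensembleE (@hp_sfun R s N) (fun x => (\sum_i trunc A (tnth x i)) ^+ (2 * h)) <= C.
Proof.
have [K K0 hK] := ensembleE_expR_le; exists ((2 * h)`!%:R * (2 * expR (2 * K))).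
  by rewrite !mulr_ge0// expR_ge0.
move=> N A a t mA symA Aa t0 ta muA.
have [|i1 e1] := hK N A a t mA symA Aa (lt0r_neq0 t0) _ muA; first by rewrite gtr0_norm.
have tN0 : - t != 0 by rewrite oppr_eq0 lt0r_neq0.
have [| |i2 e2] := hK N A a (- t) mA symA Aa tN0.
- by rewrite normrN gtr0_norm.
- by rewrite sqrrN.
have [i3 _ _] := ensembleE_power_sum (hp_sfun_orthonormal s1 (N := N)) (fun e he => @admissible_trunc N A e mA he).
have [i4 <-] := ensembleEZ (t ^+ (2 * h)) i3.
have [i5 e5] := ensembleED i1 i2; have [i6 e6] := ensembleEZ (2 * h)`!%:R i5.
apply: le_trans (ensembleE_le _ i4 i6) _.
  by move=> x; rewrite -exprMn mulNr; exact: exprn_even_le_expR.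
by rewrite e6 e5 ler_wpM2l// mulr2n mulrDl mul1r lerD.
Qed.

Lemma integral_norm_powR_tail (b c : R) : 0 < b -> 1 < c ->
  intg (fun x => `|x| `^ (- c) * \1_[set y | b <= `|y|] x) /\
  \int[mu]_x (`|x| `^ (- c) * \1_[set y | b <= `|y|] x) = 2 * (b `^ (1 - c) / (c - 1)).
Proof.
move=> b0 c1; pose g (x : R) := `|x| `^ (- c) * \1_[set y | b <= `|y|] x.
have g0 x : 0 <= g x by rewrite mulr_ge0// powR_ge0.
have mA : measurable [set y : R | b <= `|y|].
  rewrite -[X in measurable X]setTI; apply: measurable_fun_ler => //; exact: normr_measurable.
have mg : measurable_fun setT g.
  apply: measurable_funM; last exact: measurable_indic.
  apply: (@measurableT_comp _ _ _ _ _ _ (@powR R ^~ (- c))); first exact: measurable_powR.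
  exact: normr_measurable.
have mge : measurable_fun setT (EFin \o g) by exact/measurable_EFinP.
have gN x : g (- x) = g x.
  by rewrite /g normrN !indicE; congr (_ * (nat_of_bool _)%:R); apply/idP/idP; rewrite !inE/= normrN.
have half : (\int[mu]_(x in `[0%R, +oo[) (g x)%:E = (b `^ (1 - c) / (c - 1))%:E)%E.
  rewrite -[X in (_ = (X `^ _ / _)%:E)%E]add0r -integral_powR_shift ?add0r//.
  rewrite integral_mkcond [RHS]integral_mkcond; apply: eq_integral => x _.
  rewrite !patchE !mem_setE !in_itv/= !andbT /g indicE add0r.
  have [bx|xb] := leP b x.
    have x0 : 0 <= x by rewrite ltW// (lt_le_trans b0).
    by rewrite x0 mem_set ?mulr1 ?ger0_norm//= ger0_norm.
  case: ifPn => // x0; rewrite memNset ?mulr0//= ger0_norm//.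
  by apply/negP; rewrite -ltNge.
have tot : (\int[mu]_x (g x)%:E = (2 * (b `^ (1 - c) / (c - 1)))%:E)%E.
  rewrite -(setUv [set` `[(0 : R), +oo[ ]) ge0_integral_setU//=; last 4 first.
  - exact: measurableC.
  - by rewrite setUv.
  - by move=> x _; rewrite lee_fin.
  - exact/disj_setPCl.
  rewrite half setCitvr integral_itv_bndo_bndc; last exact: measurable_funTS.
  have := ge0_integration_by_substitution0 mge (fun x => g0 x).
  rewrite /= half; under [in X in _ = X -> _]eq_integral do rewrite gN.
  by move=> <-; rewrite -EFinD mulr2n mulrDl mul1r.
split; last by rewrite /Rintegral tot.
apply/integrableP; split=> //.
under eq_integral => x _ do rewrite /= ger0_norm//.
by rewrite tot ltry.
Qed.

(** Far points can be treated with absolute values. Hadamard bounds each kernel determinant by its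
    diagonal, so every block of a pattern contributes at most a constant times the integral of
    [|x|^(2h - 2s - 2)] over [|x| >= b]. For [b >= 1] this power of [b] is at most [1], so one block
    already gives the rate. *)
Lemma hp_tail_moment : exists2 C : R, 0 <= C & forall N (g : R -> R) (b : R), measurable_fun setT g -> 1 <= b ->
  (forall x, `|g x| <= `|x|) -> (forall x, g x != 0 -> b <= `|x|) ->
  ensembleE (@hp_sfun R s N) (fun x => (\sum_i g (tnth x i)) ^+ (2 * h)) <=
  C * b `^ (- (2 * s + 1 - (2 * h)%:R)).
Proof.
have [K K0 hK] := hp_skernel_far s1 (@ltr01 R).
have s2 := s1; have hs' := hs.
pose c := 2 * s + 2 - (2 * h)%:R; have c1 : 1 < c by rewrite /c; lra.
pose D := K * (2 / (c - 1)); have D0 : 0 <= D by rewrite /D mulr_ge0// divr_ge0//; lra.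
pose D1 := Num.max 1 D.
exists (\sum_(e <- patterns (2 * h)) D1 ^+ size e).
  by apply: sumr_ge0 => e _; rewrite exprn_ge0// le_max ler01.
move=> N f b mf b1 fx fb; have b0 : 0 < b by exact: lt_le_trans b1.
have cE : - (2 * s + 1 - (2 * h)%:R) = 1 - c by rewrite /c; ring.
rewrite cE; pose beta := b `^ (1 - c).
have beta1 : beta <= 1.
  by have : beta <= b `^ 0; [rewrite /beta ler_powR// subr_le0 ltW|rewrite powRr0].
have [ig eg] := integral_norm_powR_tail b0 c1.
have one e : (0 < e <= 2 * h)%N ->
    intg (fun x => `|f x| ^+ e * hp_skernel s N x x) /\
    \int[mu]_x (`|f x| ^+ e * hp_skernel s N x x) <= D * beta.
  move=> /andP[e0 eh].
  have ae : admissible (@hp_sfun R s N) (fun x => `|f x| ^+ e).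
    apply: (@admissible_hp_sfun _ _ s1 h hs N _ 1) => //.
      by apply: measurable_funX; exact: measurableT_comp.
    move=> x; rewrite mul1r normrX normr_id (le_trans _ (normrX_le x eh))//.
    by apply: lerXn2r; rewrite ?nnegrE.
  have [ia _] := integral_mul_corr_kernel ae; split => //.
  apply: (@le_trans _ _ (\int[mu]_x (K * (`|x| `^ (- c) * \1_[set y | b <= `|y|] x)))).
    apply: Rintegral_ler => //; first exact: integrableZ_EFin.
    move=> x _; have [f0|fx0] := eqVneq (f x) 0.
      by rewrite f0 normr0 expr0n -(prednK e0)/= mul0r !mulr_ge0// powR_ge0.
    rewrite indicE mem_set ?mulr1; last exact: fb.
    have x1 : 1 <= `|x| by rewrite (le_trans b1)// fb.
    have x0 : 0 < `|x| by exact: lt_le_trans x1.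
    apply: (@le_trans _ _ (`|x| ^+ e * hp_skernel s N x x)).
      by rewrite ler_wpM2r ?hp_skernel_ge0//; apply: lerXn2r; rewrite ?nnegrE.
    apply: le_trans (ler_wpM2l _ (hK N x x1)) _; first exact: exprn_ge0.
    rewrite mulrCA ler_wpM2l// -powR_mulrn// -powRD ?(gt_eqF x0) ?implybT//.
    by rewrite ler_powR// /c; have := eh; rewrite -(ler_nat R); lra.
  by rewrite RintegralZl// eg -/beta /D -!mulrA [(_ - _)^-1 * beta]mulrC.
have [_ _ ->] := ensembleE_power_sum (hp_sfun_orthonormal s1 (N := N)) (fun e he => @admissible_power N f e mf fx he).
rewrite mulr_suml !big_seq; apply: ler_sum => e he.
have pe (i : 'I_(size e)) : (0 < nth 0%N e i <= 2 * h)%N by rewrite (patterns_gt0 he)// (patterns_le _ he).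
have [ip ep] := @prod_tuple_integral R (size e) (fun i x => `|f x| ^+ nth 0%N e i * hp_skernel s N x x)
  (fun i => (one _ (pe i)).1).
apply: (@le_trans _ _ (\int[leb (size e)]_x \prod_i (`|f (tnth x i)| ^+ nth 0%N e i * hp_skernel s N (tnth x i) (tnth x i)))).
  apply: Rintegral_ler => //.
    have [] // := @integral_corr_kernel R N.+1 (@hp_sfun R s N) (size e) (fun i x => f x ^+ nth 0%N e i).
    by move=> i; apply: admissible_power => //; have /andP[] := pe i.
  move=> z _; rewrite (le_trans (ler_norm _))// normrM normr_prod big_split/=.
  apply: ler_pM => //; last exact: det_corr_kernel_le.
    by apply: prodr_ge0 => i _.
  by rewrite le_eqVlt; apply/orP; left; apply/eqP; apply: eq_bigr => i _; rewrite normrX.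
rewrite ep.
apply: (@le_trans _ _ (\prod_(i < size e) (D1 * beta))).
  apply: ler_prod => i _; apply/andP; split.
    by apply: Rintegral_ge0 => x _; rewrite mulr_ge0 ?exprn_ge0// hp_skernel_ge0.
  have [_ /le_trans] := one _ (pe i); apply.
  by rewrite ler_wpM2r ?powR_ge0// le_max lexx orbT.
rewrite prodr_const card_ord exprMn ler_wpM2l//.
  by rewrite exprn_ge0// le_max ler01.
have : (0 < size e)%N by move: he; rewrite (_ : (2 * h = (2 * h).-1.+1)%N); [exact: patterns_size|rewrite prednK// muln_gt0].
case: (size e) => // k _; rewrite exprS ler_piMr ?powR_ge0// exprn_ile1// powR_ge0//.
Qed.

End TruncatedMoments.

(** * Convergence of the moments of sums over an annulus *)

Section KernelLimit.
Context {R : realType}.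
Notation mu := (@lebesgue_measure R).
Notation leb n := (@lebesgue_tuple R n).
Local Notation intg f := (mu.-integrable setT (EFin \o f)).

Lemma det_conjugate l (e : 'I_l -> R) (M : 'I_l -> 'I_l -> R) :
  \det (\matrix_(i, j) (e i * e j * M i j)) = (\prod_i e i) ^+ 2 * \det (\matrix_(i, j) M i j).
Proof.
rewrite (_ : \matrix_(i, j) (e i * e j * M i j) =
  diag_mx (\row_i e i) *m (\matrix_(i, j) M i j) *m diag_mx (\row_i e i)).
  rewrite !det_mulmx det_diag mulrAC expr2; congr (_ * _ * _); apply: eq_bigr => i _; rewrite mxE//.
by apply/matrixP => i j; rewrite mul_mx_diag mxE mul_diag_mx !mxE mulrAC.
Qed.

Lemma det_cvg l (M : nat -> 'M[R]_l) (L : 'M[R]_l) :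
  (forall i j, M n i j @[n --> \oo] --> L i j) -> \det (M n) @[n --> \oo] --> \det L.
Proof.
move=> h; rewrite /determinant; apply: cvg_big => [|t _]; first exact: add_continuous.
apply: cvgMr; apply: cvg_big => [|i _]; [exact: mul_continuous|exact: h].
Qed.

Variables (s : R).
Hypothesis s1 : 1 < 2 * s.

Lemma det_hp_skernel_cvg l (z : 'I_l -> R) : (forall i, z i != 0) ->
  \det (\matrix_(i, j) hp_skernel s N (z i) (z j)) @[N --> \oo] -->
  \det (\matrix_(i, j) hp_kernel s (z i) (z j)).
Proof.
move=> z0.
have E N : \det (\matrix_(i, j) hp_skernel s N (z i) (z j)) =
    \det (\matrix_(i, j) (Num.sg (z i) ^+ N.+1 * Num.sg (z j) ^+ N.+1 * hp_skernel s N (z i) (z j))).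
  rewrite det_conjugate -prodrXl big1 ?mul1r// => i _.
  by rewrite -exprM mulnC exprM sqr_sg z0 expr1n.
rewrite (_ : (fun N => _) = (fun N => \det (\matrix_(i, j) (Num.sg (z i) ^+ N.+1 * Num.sg (z j) ^+ N.+1 * hp_skernel s N (z i) (z j))))); last by apply/funext.
apply: det_cvg => i j; rewrite mxE; under eq_fun do rewrite mxE -exprMn.
exact: hp_skernel_cvg.
Qed.

Variables (h : nat).
Hypothesis (h0 : (0 < h)%N) (hs : (2 * h)%:R < 2 * s + 1).

(** Dominated convergence: on the annulus the kernels are at most [K / a^2] on the diagonal, and
    Hadamard extends this bound to the determinants uniformly in [N]. *)
Lemma integral_hp_skernel_cvg l (f : 'I_l -> R -> R) (a b M : R) : 0 < a ->
  (forall i, measurable_fun setT (f i)) -> 0 <= M -> (forall i x, `|f i x| <= M) ->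
  (forall i x, f i x != 0 -> a <= `|x| <= b) ->
  (leb l).-integrable setT (EFin \o (fun z =>
     \prod_i f i (tnth z i) * \det (\matrix_(i, j) hp_kernel s (tnth z i) (tnth z j)))) /\
  \int[leb l]_z (\prod_i f i (tnth z i) * \det (\matrix_(i, j) hp_skernel s N (tnth z i) (tnth z j)))
    @[N --> \oo] -->
  \int[leb l]_z (\prod_i f i (tnth z i) * \det (\matrix_(i, j) hp_kernel s (tnth z i) (tnth z j))).
Proof.
move=> a0 mf M0 fM fab; have [K K0 hK] := hp_skernel_le s1.
pose A : set R := [set x | a <= `|x| <= b].
have mA : measurable A.
  rewrite (_ : A = [set x | a <= `|x|] `&` [set x | `|x| <= b]).
    by apply: measurableI; rewrite -[X in measurable X]setTI; apply: measurable_fun_ler => //; exact: normr_measurable.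
  by apply/seteqP; split => x /=; rewrite /A/= => /andP.
have Aoo : (mu A < +oo)%E.
  apply: (@le_lt_trans _ _ (mu `[- b, b])).
    apply: le_measure; rewrite ?inE//= => x /= /andP[_]; rewrite ler_norml => /andP[u v].
    by rewrite in_itv/= u v.
  by rewrite lebesgue_measure_itv/=; case: ifPn => // _; rewrite -EFinB ltry.
have iA : intg (\1_A : R -> R).
  apply/integrableP; split; first by apply/measurable_EFinP; exact: measurable_indic.
  under eq_integral => x _ do rewrite /= indicE normr_nat -indicE.
  by rewrite integral_indic// setIT.
have af N i : admissible (@hp_sfun R s N) (f i).
  apply: (@admissible_hp_sfun _ _ s1 h hs N _ M) => //.
  by move=> x; rewrite (le_trans (fM i x))// ler_peMr// lerDl exprn_even_ge0// oddM.
pose F N (z : l.-tuple R) := \prod_i f i (tnth z i) * \det (\matrix_(i, j) hp_skernel s N (tnth z i) (tnth z j)).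
pose G (z : l.-tuple R) := \prod_i f i (tnth z i) * \det (\matrix_(i, j) hp_kernel s (tnth z i) (tnth z j)).
have iF N : (leb l).-integrable setT (EFin \o F N).
  by have [] := @integral_corr_kernel R N.+1 (@hp_sfun R s N) l f (af N).
(* The kernels converge off the coordinate hyperplanes only; on these the product of the test
   functions is zero. *)
have FG z : F N z @[N --> \oo] --> G z.
  have [/forallP z0|] := boolP [forall i, tnth z i != 0]; first by apply: cvgMr; exact: det_hp_skernel_cvg.
  rewrite negb_forall => /existsP[i]; rewrite negbK => /eqP zi.
  have P0 : \prod_i f i (tnth z i) = 0.
    apply/eqP; rewrite prodf_seq_eq0; apply/hasP; exists i; rewrite ?mem_index_enum//=.
    apply/negPn/negP => /fab; rewrite zi normr0 => /andP[+ _]; by rewrite leNgt a0.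
  by rewrite /F /G P0 mul0r; under eq_fun do rewrite mul0r; exact: cvg_cst.
have [ig _] := @prod_tuple_integral R l (fun _ x => M * K * a ^- 2 * \1_A x) (fun i => integrableZ_EFin measurableT (M * K * a ^- 2) iA).
have dom N z : `|F N z| <= \prod_(i < l) (M * K * a ^- 2 * \1_A (tnth z i)).
  rewrite normrM normr_prod (le_trans (ler_wpM2l _ (det_corr_kernel_le (@hp_sfun R s N) (tnth z))))//.
    exact: prodr_ge0.
  rewrite -big_split/=; apply: ler_prod => i _; apply/andP; split.
    by rewrite mulr_ge0//; exact: hp_skernel_ge0.
  have [->|fn0] := eqVneq (f i (tnth z i)) 0.
    by rewrite normr0 mul0r mulr_ge0// !mulr_ge0// invr_ge0 sqr_ge0.
  have /andP[ax xb] := fab _ _ fn0.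
  rewrite indicE mem_set ?mulr1/=; last by rewrite /A/= ax.
  rewrite -mulrA; apply: ler_pM => //; first exact: hp_skernel_ge0.
  have x0 : tnth z i != 0 by rewrite -normr_gt0 (lt_le_trans a0).
  apply: le_trans (hK N _ x0) _; rewrite ler_wpM2l// lef_pV2 ?posrE ?exprn_even_gt0//= ?gt_eqF//.
  by rewrite -[leRHS]real_normK ?num_real// lerXn2r ?nnegrE// ltW.
(* Measurability of the integrand with the limit kernel is inherited from the finite kernels by
   pointwise convergence. *)
have mG : measurable_fun setT G.
  apply: measurable_fun_cvg (fun z _ => FG z) => N; exact: integrable_EFin_measurable (iF N).
have [] := @dominated_convergence _ _ _ (leb l) setT measurableT (fun N => EFin \o F N) (EFin \o G) _ _ _ _ ig _.
- by move=> N; apply/measurable_EFinP; exact: integrable_EFin_measurable (iF N).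
- exact/measurable_EFinP.
- apply: aeW => z _ /=; apply: cvg_EFin; first by near=> N.
  exact: FG.
- by apply: aeW => z N _ /=; rewrite lee_fin.
move=> iG _ c; split => //.
by apply: fine_cvg; rewrite EFin_Rintegral.
Unshelve. all: by end_near. Qed.

Definition limit_moment (g : R -> R) n : R :=
  \sum_(e <- patterns n) \int[leb (size e)]_z (\prod_i g (tnth z i) ^+ nth 0%N e i *
        \det (\matrix_(i, j) hp_kernel s (tnth z i) (tnth z j))).

Lemma ensembleE_power_cvg (g : R -> R) (a b : R) : 0 < a ->
  measurable_fun setT g -> (forall x, `|g x| <= `|x|) ->
  (forall x, g x != 0 -> a <= `|x| <= b) ->
  ensembleE (@hp_sfun R s N) (fun x => (\sum_i g (tnth x i)) ^+ (2 * h)) @[N --> \oo] -->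
  limit_moment g (2 * h).
Proof.
move=> a0 mg gx gab; pose M := 1 + b ^+ (2 * h).
have M0 : 0 <= M by rewrite addr_ge0// exprn_even_ge0// oddM.
have gM x e : (e <= 2 * h)%N -> (0 < e)%N -> `|g x ^+ e| <= M.
  move=> eh e0; have [->|gn0] := eqVneq (g x) 0; first by rewrite expr0n gtn_eqF//= normr0.
  have /andP[_ xb] := gab _ gn0.
  have b0 : 0 <= b by exact: le_trans xb.
  rewrite normrX; apply: (@le_trans _ _ (`|b| ^+ e)); last exact: normrX_le.
  by rewrite (ger0_norm b0); apply: lerXn2r; rewrite ?nnegrE// (le_trans (gx _)).
under eq_fun => N.
  have [_ _ ->] := ensembleE_power_sum (hp_sfun_orthonormal s1 (N := N)) (fun e he => @admissible_power R s s1 h hs N g e mg gx he).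
  rewrite big_seq; over.
rewrite /limit_moment big_seq; apply: cvg_big => [|e he]; first exact: add_continuous.
have pe (i : 'I_(size e)) : (0 < nth 0%N e i <= 2 * h)%N by rewrite (patterns_gt0 he)// (patterns_le _ he).
have [| | |_ //] := @integral_hp_skernel_cvg (size e) (fun i x => g x ^+ nth 0%N e i) a b M a0 _ M0.
- by move=> i; exact: measurable_funX.
- by move=> i x; have /andP[? ?] := pe i; exact: gM.
- move=> i x; have /andP[e0 _] := pe i; rewrite expf_eq0 e0/= => gn0; exact: gab.
Qed.

End KernelLimit.

(** * Passage to the point process *)

Import HBSimple.

Section PointProcessSums.
Context {R : realType}.
Notation leb n := (@lebesgue_tuple R n).
Context {d : measure_display} {T : measurableType d} (P : probability T R) (C : T -> set R).
Hypothesis C_process : point_process C.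

Implicit Types (g : R -> R) (a b : R) (w : T).

Definition annulus (a b : R) : set R := [set x | a <= `|x| <= b].

Lemma compact_annulus a b : compact (annulus a b).
Proof.
apply: (@subclosed_compact _ _ `[(- b)%R, b%R]).
- rewrite (_ : annulus a b = [set x : R | a <= `|x|] `&` [set x | `|x| <= b]); last first.
    by apply/seteqP; split => x /=; rewrite /annulus/= => /andP.
  have nc : continuous (fun x : R => `|x|) by exact: norm_continuous.
  apply: closedI.
    by rewrite (_ : [set x : R | a <= `|x|] = (fun x : R => `|x|) @^-1` [set y | a <= y])//; apply: closed_comp => [x _|]; [exact: nc|exact: closed_ge].
  by rewrite (_ : [set x : R | `|x| <= b] = (fun x : R => `|x|) @^-1` [set y | y <= b])//; apply: closed_comp => [x _|]; [exact: nc|exact: closed_le].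
- exact: segment_compact.
- by move=> x /andP[_]; rewrite ler_norml /= in_itv.
Qed.

Lemma measurable_annulus a b : measurable (annulus a b).
Proof.
rewrite (_ : annulus a b = [set x : R | a <= `|x|] `&` [set x | `|x| <= b]); last first.
  by apply/seteqP; split => x /=; rewrite /annulus/= => /andP.
by apply: measurableI; rewrite -[X in measurable X]setTI; apply: measurable_fun_ler => //; exact: normr_measurable.
Qed.

Lemma annulus_Rstar a b : 0 < a -> annulus a b `<=` @Rstar R.
Proof. by move=> a0 x /andP[ax _]; rewrite /Rstar/= -normr_gt0 (lt_le_trans a0). Qed.

Lemma finite_annulus a b w : 0 < a -> finite_set (C w `&` annulus a b).
Proof.
move=> a0; have [h _] := C_process; have [_ ] := h w; apply; first exact: compact_annulus.
exact: annulus_Rstar.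
Qed.

Definition points a b w : seq R := finmap.enum_fset (fset_set (C w `&` annulus a b)).

Lemma mem_points a b w x : 0 < a -> x \in points a b w <-> C w x /\ annulus a b x.
Proof.
move=> a0; rewrite /points; have := in_fset_set (finite_annulus b w a0) x.
by move=> ->; rewrite inE.
Qed.

Lemma uniq_points a b w : uniq (points a b w).
Proof. exact: finmap.fset_uniq. Qed.

Definition psum (g : R -> R) w : R := \sum_(x \in C w) g x.

Lemma psumE g a b w : 0 < a -> (forall x, g x != 0 -> a <= `|x| <= b) ->
  psum g w = \sum_(x <- points a b w) g x.
Proof.
move=> a0 gab; rewrite /psum (fsbigE (points a b w)); first last.
- move=> x Cx; apply: contraNeq => /gab xab; exact/mem_points.
- by move=> x /= /(mem_points _ _ _ a0)[].
- exact: uniq_points.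
rewrite big_seq_cond [RHS]big_seq_cond; apply: eq_bigl => x.
have [/(mem_points _ _ _ a0)[Cx _]|//] := boolP (x \in points a b w).
by rewrite mem_set.
Qed.

Lemma measurable_count (a b : R) (B : set R) : 0 < a -> measurable B ->
  measurable_fun setT (fun w => \sum_(x <- points a b w) \1_B x : R).
Proof.
move=> a0 mB; apply/measurable_EFinP.
rewrite (_ : EFin \o _ = (fun w => counting (C w `&` (annulus a b `&` B)) : \bar R)).
  have [_] := C_process; apply; apply: measurableI => //; exact: measurable_annulus.
apply/funext => w /=; rewrite /counting asboolT; last first.
  by rewrite setIA; apply: finite_setIl; exact: finite_annulus.
congr EFin; rewrite (eq_bigr (fun x => (x \in B)%:R)) => [|x _]; last by rewrite indicE.
rewrite -natr_sum; congr (_%:R); rewrite -big_mkcond/= sum1_count -size_filter.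
apply: perm_size; apply: uniq_perm; [by rewrite filter_uniq// uniq_points|exact: finmap.fset_uniq|].
have F2 : finite_set (C w `&` (annulus a b `&` B)).
  by rewrite setIA; apply: finite_setIl; exact: finite_annulus.
move=> x; rewrite mem_filter (in_fset_set F2).
apply/andP/idP; rewrite !inE; first by move=> [xB /(mem_points _ _ _ a0)[Cx xab]].
by move=> [Cx [xab xB]]; split => //; apply/mem_points.
Qed.

(** A point process provides measurable counts on Borel sets. Simple functions give finite
    combinations of counts, and [g] is a pointwise limit of these. *)
Lemma measurable_psum g a b : 0 < a -> measurable_fun setT g ->
  (forall x, g x != 0 -> a <= `|x| <= b) -> measurable_fun setT (psum g).
Proof.
move=> a0 mg gab.
have mge : measurable_fun [set: R] (EFin \o g) by exact/measurable_EFinP.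
have [G GE] := approximation_sfun measurableT mge.
have cG x : G n x @[n --> \oo] --> g x.
  by have := GE x I; move=> /fine_cvg.
apply: (@measurable_fun_cvg _ _ _ setT (fun n w => \sum_(x <- points a b w) G n x)); last first.
  move=> w _; rewrite (psumE w a0 gab); apply: cvg_big => [|x _]; [exact: add_continuous|exact: cG].
move=> n.
rewrite (_ : (fun w => _) = (fun w => \sum_(y <- finmap.enum_fset (fset_set (range (G n)))) y * \sum_(x <- points a b w) \1_(G n @^-1` [set y]) x)).
  apply: measurable_sum => y; apply: measurable_funM => //; apply: measurable_count => //.
apply/funext => w; under [RHS]eq_bigr do rewrite mulr_sumr.
rewrite exchange_big/=; apply: eq_bigr => x _.
by rewrite [LHS]fimfunE fsbig_finite//; exact: fimfunP.
Qed.

Definition dsum (g : R -> R) l (e : nat -> nat) w : R :=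
  \sum_(z \in @distinct_points R l (C w)) \prod_i g (tnth z i) ^+ e i.

Lemma dsumE g a b l e w : 0 < a -> (forall x, g x != 0 -> a <= `|x| <= b) ->
  (forall i, (0 < e i)%N) ->
  dsum g l e w = distinct_sum (fun i => g (tnth (in_tuple (points a b w)) i)) l e.
Proof.
move=> a0 gab e0; set t := in_tuple (points a b w).
have tI : injective (tnth t).
  by apply/tuple_uniqP; exact: uniq_points.
pose tup (u : {ffun 'I_l -> 'I_(size (points a b w))}) : l.-tuple R := [tuple tnth t (u i) | i < l].
have tupI : injective tup.
  move=> u v uv; apply/ffunP => i; apply: tI.
  by have := congr1 (fun z => tnth z i) uv; rewrite !tnth_mktuple.
pose r := [seq tup u | u <- enum [pred u : {ffun 'I_l -> 'I_(size (points a b w))} | injectiveb u]].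
have inr z : (z \in r) <-> distinct_points (C w) z /\ forall i, tnth z i \in points a b w.
  split.
    move=> /mapP[u]; rewrite mem_enum inE => /injectiveP uI ->; split; first split.
    - by apply/tuple_uniqP => i j; rewrite !tnth_mktuple => /tI/uI.
    - by move=> i; rewrite tnth_mktuple; have /(mem_points _ _ _ a0)[] := mem_tnth (u i) t.
    - by move=> i; rewrite tnth_mktuple; exact: mem_tnth.
  move=> [[zu Cz] zt].
  have K i : {j | tnth z i = tnth t j}.
    by have /tnthP/cid[j ->] : tnth z i \in t by []; exists j.
  have zE : z = tup [ffun i => sval (K i)].
    by apply: eq_from_tnth => i; rewrite tnth_mktuple ffunE; exact: (svalP (K i)).
  rewrite zE map_f// mem_enum inE; apply/injectiveP => i j ij.
  move/tuple_uniqP: zu; apply; rewrite zE !tnth_mktuple.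
  by rewrite ij.
rewrite /dsum (fsbigE r); first last.
- move=> z dz zr; apply/eqP; rewrite prodf_seq_eq0; apply: contraNT zr => /hasPn nz.
  apply/inr; split => // i; apply/(mem_points _ _ _ a0); split; first by have [_] := dz; apply.
  by apply: gab; have := nz i (mem_index_enum i); rewrite /= expf_eq0 e0.
- by move=> z /inr[].
- by rewrite map_inj_uniq ?enum_uniq.
rewrite big_seq_cond (eq_bigl (fun z => z \in r)); last first.
  by move=> z; case: (boolP (z \in r)) => //= /inr[dz _]; rewrite mem_set.
rewrite -big_seq big_map big_enum/= /distinct_sum; apply: eq_bigr => u _.
by apply: eq_bigr => i _; rewrite tnth_mktuple.
Qed.

Lemma psum_powerE g a b n w : 0 < a -> (forall x, g x != 0 -> a <= `|x| <= b) -> (0 < n)%N ->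
  psum (fun x => g x ^+ n) w = \sum_i g (tnth (in_tuple (points a b w)) i) ^+ n.
Proof.
move=> a0 gab n0; rewrite (@psumE _ a b)//; first by rewrite (big_tnth _ _ (points a b w)).
by move=> x; rewrite expf_eq0 n0/=; exact: gab.
Qed.

(** The recursion [sum_distinct_sum] is solved for the longest sum, which expresses it by a power
    sum and by shorter distinct sums. *)
Lemma measurable_dsum g a b l e : 0 < a -> measurable_fun setT g ->
  (forall x, g x != 0 -> a <= `|x| <= b) -> (forall i, (0 < e i)%N) ->
  measurable_fun setT (dsum g l e).
Proof.
move=> a0 mg gab; elim: l e => [|l IH] e e0.
  rewrite (_ : dsum g 0 e = cst 1); first exact: measurable_cst.
  apply/funext => w; rewrite (dsumE _ _ a0 gab e0) /distinct_sum (big_pred1 (ffun0 (card_ord 0))) ?big_ord0// => u.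
  have -> : u = ffun0 (card_ord 0) by apply/ffunP => -[].
  by rewrite /= eqxx; apply/injectiveP => -[].
pose e' i := e i.+1; have e'0 i : (0 < e' i)%N by exact: e0.
rewrite (_ : dsum g l.+1 e = (fun w => psum (fun x => g x ^+ e 0%N) w * dsum g l e' w -
   \sum_(j < l) dsum g l (fun i => e' i + (i == j) * e 0)%N w)); last first.
  apply/funext => w; rewrite (psum_powerE w a0 gab (e0 0%N)) !(dsumE _ _ a0 gab)//.
  rewrite sum_distinct_sum (_ : ncons_fun _ _ = e); last by apply/funext => -[].
  rewrite -[LHS]addr0 -addrA; congr (_ + _); apply/esym/eqP; rewrite subr_eq0; apply/eqP.
  by apply: eq_bigr => j _; rewrite (dsumE _ _ a0 gab)// => i; rewrite addn_gt0 e0.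
apply: measurable_funB.
  apply: measurable_funM; last exact: IH.
  apply: (@measurable_psum _ a b) => //; first exact: measurable_funX.
  by move=> x; rewrite expf_eq0 e0/=; exact: gab.
by apply: measurable_sum => j; apply: IH => i; rewrite addn_gt0 e0.
Qed.

Lemma dsum_norm_le g a b l e w : 0 < a -> (forall x, g x != 0 -> a <= `|x| <= b) ->
  (forall i, (0 < e i)%N) -> `|dsum g l e w| <= dsum (fun x => `|g x|) l e w.
Proof.
move=> a0 gab e0; rewrite !(@dsumE _ a b)//; last by move=> x; rewrite normr_eq0; exact: gab.
rewrite (le_trans (ler_norm_sum _ _ _))//; apply: ler_sum => u _.
by rewrite normr_prod le_eqVlt; apply/orP; left; apply/eqP; apply: eq_bigr => i _; rewrite normrX.
Qed.

End PointProcessSums.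

Section HuaPickrellProcess.
Context {R : realType}.
Notation leb n := (@lebesgue_tuple R n).
Context {d : measure_display} {T : measurableType d} (P : probability T R) (C : T -> set R).
Variables (s : R).
Hypothesis s1 : 1 < 2 * s.
Hypothesis hC : hp_process P s C.
Variables (h : nat).
Hypothesis (h0 : (0 < h)%N) (hs : (2 * h)%:R < 2 * s + 1).
Implicit Types (g : R -> R) (a b : R) (w : T).

Let C_process : point_process C := hC.1.

(** The determinantal formula is applied to [|g|] as well: its finite right-hand side is what proves
    integrability for [g]. *)
Lemma integral_dsum g a b (M : R) l e : 0 < a -> measurable_fun setT g ->
  (forall x, `|g x| <= M) -> (forall x, g x != 0 -> a <= `|x| <= b) ->
  (0 < l)%N -> (forall i, (0 < e i)%N) ->
  P.-integrable setT (EFin \o dsum C g l e) /\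
  \int[P]_w (dsum C g l e w) =
  \int[leb l]_z (\prod_i g (tnth z i) ^+ e i * \det (\matrix_(i, j) hp_kernel s (tnth z i) (tnth z j))).
Proof.
move=> a0 mg gM gab l0 e0.
have key (f : R -> R) : measurable_fun setT f -> (forall x, `|f x| <= M) -> (forall x, f x != 0 -> a <= `|x| <= b) ->
    (\int[P]_w (dsum C f l e w)%:E =
     (\int[leb l]_z (\prod_i f (tnth z i) ^+ e i * \det (\matrix_(i, j) hp_kernel s (tnth z i) (tnth z j))))%:E)%E.
  move=> mf fM fab; pose F (z : l.-tuple R) := \prod_i f (tnth z i) ^+ e i.
  have M0 : 0 <= M by exact: le_trans (fM 0).
  pose B := \sum_(i < l) M ^+ e i.
  have fB (i : 'I_l) x : `|f x ^+ e i| <= B.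
    rewrite normrX; apply: (@le_trans _ _ (M ^+ e i)); first by apply: lerXn2r; rewrite ?nnegrE.
    by rewrite /B (bigD1 i)//= lerDl sumr_ge0// => j _; exact: exprn_ge0.
  have B0 : 0 <= B by apply: sumr_ge0 => j _; exact: exprn_ge0.
  have fabe (i : 'I_l) x : f x ^+ e i != 0 -> a <= `|x| <= b by rewrite expf_eq0 e0/=; exact: fab.
  have F0 z i : ~ annulus a b (tnth z i) -> F z = 0.
    move=> nz; apply/eqP; rewrite prodf_seq_eq0; apply/hasP; exists i; rewrite ?mem_index_enum//=.
    by apply/negPn/negP => /fabe.
  have mF : measurable_fun setT F.
    apply: measurable_prod => i _; apply: measurable_funX.
    by apply: measurableT_comp => //; exact: measurable_tnth.
  have [iF _] := @integral_hp_skernel_cvg R s s1 h hs l (fun i x => f x ^+ e i) a b B a0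
    (fun i => measurable_funX (e i) mf) B0 fB fabe.
  rewrite EFin_Rintegral//.
  have [_ /(_ l F l0 mF) Hd] := hC.
  transitivity ('E_P[fun w => (\sum_(z \in distinct_points (C w)) F z)%R])%E.
    by rewrite unlock.
  rewrite Hd.
  - rewrite [LHS]integral_mkcond; apply: eq_integral => z _; rewrite patchE; case: ifPn => //.
    move=> /negP zR; rewrite -/(F z); have [i /F0 ->] : exists i, ~ annulus a b (tnth z i).
      apply: contrapT => na; apply: zR; apply/mem_set => i /=.
      by apply: (annulus_Rstar a0 (b := b)); apply: contrapT => nai; apply: na; exists i.
    by rewrite mul0r.
  - exists (B ^+ l) => z; rewrite normr_prod -[l in leRHS]card_ord -prodr_const.
    by apply: ler_prod => i _; rewrite normr_ge0 fB.
  - exists (annulus a b); split; [exact: compact_annulus|exact: annulus_Rstar|].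
    move=> z Fz i; apply: contrapT => /F0 Fz0; by rewrite Fz0 eqxx in Fz.
have mD (f : R -> R) : measurable_fun setT f -> (forall x, f x != 0 -> a <= `|x| <= b) ->
    measurable_fun setT (EFin \o dsum C f l e).
  by move=> mf fab; apply/measurable_EFinP; exact: (measurable_dsum C_process l a0 mf fab e0).
have nab x : `|g x| != 0 -> a <= `|x| <= b by rewrite normr_eq0; exact: gab.
have mn : measurable_fun setT (fun x => `|g x|) by exact: measurableT_comp.
have nM x : `| (`|g x|) | <= M by rewrite normr_id.
have kn := key (fun x => `|g x|) mn nM nab.
split; last by rewrite /Rintegral key.
apply/integrableP; split; first exact: mD.
apply: (@le_lt_trans _ _ (\int[P]_w (dsum C (fun x => `|g x|) l e w)%:E)%E); last by rewrite kn ltry.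
apply: ge0_le_integral => //.
- by apply: measurableT_comp => //; exact: mD.
- exact: mD.
- by move=> w _; rewrite /= lee_fin; exact: (dsum_norm_le C_process l w a0 gab e0).
Qed.

Lemma integral_psum_power g a b : 0 < a -> measurable_fun setT g ->
  (forall x, `|g x| <= `|x|) -> (forall x, g x != 0 -> a <= `|x| <= b) ->
  P.-integrable setT (EFin \o (fun w => psum C g w ^+ (2 * h))) /\
  \int[P]_w (psum C g w ^+ (2 * h)) = limit_moment s g (2 * h).
Proof.
move=> a0 mg gx gab.
have gb x : `|g x| <= `|b|.
  have [->|/gab/andP[_ xb]] := eqVneq (g x) 0; first by rewrite normr0.
  by rewrite (le_trans (gx x))// (le_trans xb)// ler_norm.
(* Exponents beyond the length of the pattern are set to [1], because [dsumE] and [integral_dsum]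
   ask for positive exponents at all indices. *)
pose e' (e : seq nat) i := if (i < size e)%N then nth 0%N e i else 1%N.
have e'0 e i : e \in patterns (2 * h) -> (0 < e' e i)%N.
  by move=> he; rewrite /e'; case: ifPn => // ie; rewrite (patterns_gt0 he).
have se e : e \in patterns (2 * h) -> (0 < size e)%N.
  by rewrite (_ : (2 * h = (2 * h).-1.+1)%N); [exact: patterns_size|rewrite prednK// muln_gt0].
have E w : psum C g w ^+ (2 * h) = \sum_(e <- patterns (2 * h) | e \in patterns (2 * h)) dsum C g (size e) (e' e) w.
  rewrite (psumE C_process w a0 gab) (big_tnth _ _ (points C a b w)) power_sum_distinct big_seq.
  apply: eq_bigr => e he; rewrite (dsumE C_process _ _ a0 gab) => [|i]; last exact: e'0.
  by apply: distinct_sum_ext => i ie; rewrite /e' ie.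
have D e (he : e \in patterns (2 * h)) := @integral_dsum g a b `|b| (size e) (e' e) a0 mg gb gab (se e he) (fun i => e'0 e i he).
split.
  under eq_fun do rewrite E.
  by apply: integrable_sum_EFin => // e he; have [] := D e he.
under eq_Rintegral do rewrite E.
rewrite Rintegral_sum//; last by move=> e he; have [] := D e he.
rewrite /limit_moment [RHS]big_seq; apply: eq_bigr => e he; have [_ ->] := D e he.
apply: eq_Rintegral => z _; congr (_ * _); apply: eq_bigr => i _.
by rewrite /e' ltn_ord.
Qed.

Lemma psum_moment_cvg g a b : 0 < a -> measurable_fun setT g ->
  (forall x, `|g x| <= `|x|) -> (forall x, g x != 0 -> a <= `|x| <= b) ->
  ensembleE (@hp_sfun R s N) (fun x => (\sum_i g (tnth x i)) ^+ (2 * h)) @[N --> \oo] -->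
  \int[P]_w (psum C g w ^+ (2 * h)).
Proof.
move=> a0 mg gx gab; have [_ ->] := integral_psum_power a0 mg gx gab.
exact: (ensembleE_power_cvg s1 hs a0 mg gx gab).
Qed.

End HuaPickrellProcess.

(** * The principal value *)

Section EvenPowers.
Context {R : realType}.
Implicit Types (a b eta : R).

(** With [M] the larger modulus, the left side is at most [n |a - b| M^(n-1)]. If [|a - b| <= eta M]
    this is absorbed by [eta M^n]; otherwise [M] is less than [|a - b| / eta]. *)
Lemma even_power_sub h a b eta : (0 < h)%N -> 0 < eta <= 1 ->
  `|a ^+ (2 * h) - b ^+ (2 * h)| <=
  (2 * h)%:R * (eta * (a ^+ (2 * h) + b ^+ (2 * h)) + eta ^- (2 * h).-1 * (a - b) ^+ (2 * h)).
Proof.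
move=> h0 /andP[e0 e1]; set n := (2 * h)%N.
have n0 : n = n.-1.+1 by rewrite prednK// muln_gt0.
have ev (x : R) : x ^+ n = `|x| ^+ n by rewrite -normrX ger0_norm// exprn_even_ge0// oddM.
pose M := Num.max `|a| `|b|.
have aM : `|a| <= M by rewrite le_max lexx.
have bM : `|b| <= M by rewrite le_max lexx orbT.
have M0 : 0 <= M by exact: le_trans aM.
have step : `|a ^+ n - b ^+ n| <= n%:R * (`|a - b| * M ^+ n.-1).
  rewrite subrXX normrM mulrCA; apply: ler_wpM2l => //.
  rewrite (le_trans (ler_norm_sum _ _ _))// mulr_natl -[n in _ *+ n]card_ord -sumr_const.
  apply: ler_sum => i _; rewrite normrM !normrX.
  have iE : (n.-1 = n.-1 - i + i)%N by have := ltn_ord i; lia.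
  by rewrite [in leRHS]iE exprD; apply: ler_pM; rewrite ?exprn_ge0//; apply: lerXn2r; rewrite ?nnegrE.
apply: le_trans step _; apply: ler_wpM2l => //.
have Mn : M ^+ n <= a ^+ n + b ^+ n.
  by rewrite [a ^+ n]ev [b ^+ n]ev /M maxEle; case: ifP => _; rewrite ?lerDl ?lerDr exprn_ge0.
have p1 : 0 <= a ^+ n + b ^+ n by apply: le_trans Mn; exact: exprn_ge0.
have p2 : 0 <= (a - b) ^+ n by rewrite ev exprn_ge0.
have [c1|c1] := leP `|a - b| (eta * M).
  apply: (@le_trans _ _ (eta * (a ^+ n + b ^+ n))); last first.
    by rewrite lerDl mulr_ge0// invr_ge0 exprn_ge0// ltW.
  apply: (@le_trans _ _ (eta * M * M ^+ n.-1)); first by rewrite ler_wpM2r// exprn_ge0.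
  by rewrite -mulrA -exprS -n0 ler_wpM2l// ltW.
apply: (@le_trans _ _ (eta ^- n.-1 * (a - b) ^+ n)); last first.
  by rewrite lerDr mulr_ge0// ltW.
rewrite [(a - b) ^+ n]ev n0 exprS mulrCA -n0 ler_wpM2l//.
rewrite ler_pdivlMl ?exprn_gt0// -exprMn; apply: lerXn2r; rewrite ?nnegrE// ?mulr_ge0// ltW//.
Qed.

Lemma even_power_add h a b : (a + b) ^+ (2 * h) <= 2 ^+ (2 * h) * (a ^+ (2 * h) + b ^+ (2 * h)).
Proof.
have ev (x : R) : x ^+ (2 * h) = `|x| ^+ (2 * h) by rewrite -normrX ger0_norm// exprn_even_ge0// oddM.
pose M := Num.max `|a| `|b|.
have M0 : 0 <= M by rewrite le_max normr_ge0.
apply: (@le_trans _ _ ((2 * M) ^+ (2 * h))).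
  rewrite ev; apply: lerXn2r; rewrite ?nnegrE ?mulr_ge0//.
  rewrite (le_trans (ler_normD _ _))// mulr2n mulrDl mul1r lerD//.
    by rewrite le_max lexx.
  by rewrite le_max lexx orbT.
rewrite exprMn ler_wpM2l ?exprn_ge0// [a ^+ _]ev [b ^+ _]ev /M maxEle.
by case: ifP => _; rewrite ?lerDl ?lerDr exprn_ge0.
Qed.

Lemma norm_le_even_power h a : (0 < h)%N -> `|a| <= 1 + a ^+ (2 * h).
Proof.
move=> h0; rewrite -[a ^+ _]ger0_norm ?exprn_even_ge0 ?oddM// normrX.
have [a1|a1] := leP `|a| 1; first by rewrite (le_trans a1)// lerDl exprn_ge0.
rewrite (@le_trans _ _ (`|a| ^+ (2 * h)))// ?lerDr//.
by rewrite -[leLHS]expr1 ler_weXn2l ?(ltW a1)// muln_gt0.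
Qed.

(** First [m] grows, then [eta] shrinks. The term [q m] on the right is moved to the left, which is
    possible once [c * eta <= 1/2]. *)
Lemma cvg_of_power_bound (L c : R) (q e : nat -> R) k : 0 <= L -> 0 <= c ->
  e n @[n --> \oo] --> (0 : R) ->
  (forall eta, 0 < eta <= 1 -> forall m, `|L - q m| <= c * (eta * (L + q m) + eta ^- k * e m)) ->
  q m @[m --> \oo] --> L.
Proof.
move=> L0 c0 e0 H; apply/cvgrPdist_le => eps eps0.
(* Chosen so that [eta = eps / D] satisfies [eta <= 1], [c * eta <= 1/2] and
   [c * L * eta <= eps / 8]. *)
pose D := 8 * (c + 1) * (L + 1) * (1 + eps); pose eta := eps / D.
have c1 : 0 < c + 1 by exact: ltr_wpDl.
have L1 : 0 < L + 1 by exact: ltr_wpDl.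
have s1 : 0 < 1 + eps by exact: addr_gt0.
have D0 : 0 < D by rewrite /D !mulr_gt0.
have eta0 : 0 < eta by exact: divr_gt0.
have cL : c <= (c + 1) * (L + 1) by nra.
have cL2 : c * L <= (c + 1) * (L + 1) by nra.
have DE : eta * (8 * ((c + 1) * (L + 1)) * (1 + eps)) = eps.
  by rewrite /eta (_ : 8 * _ * _ = D); [rewrite mulfVK// gt_eqF|rewrite /D; ring].
have P1 : 1 <= (c + 1) * (L + 1) by nra.
have eta1 : eta <= 1 by rewrite /eta ler_pdivrMr// mul1r /D; nra.
set X := (c + 1) * (L + 1) in cL cL2 DE P1.
have e1 : c * eta <= 1 / 2.
  have : eta * X * 8 * (1 + eps) = eps by rewrite -[RHS]DE; ring.
  have : 0 <= eta * X by rewrite mulr_ge0// ?ltW// (lt_le_trans ltr01).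
  have : c * eta <= eta * X by rewrite mulrC ler_wpM2l// ltW.
  move: (eta * X) (c * eta) => u v; nra.
have e2 : c * L * eta <= eps / 8.
  have : eta * X * 8 * (1 + eps) = eps by rewrite -[RHS]DE; ring.
  have : 0 <= eta * X by rewrite mulr_ge0// ?ltW// (lt_le_trans ltr01).
  have : c * L * eta <= eta * X by rewrite mulrC ler_wpM2l// ltW.
  move: (eta * X) (c * L * eta) => u v; nra.
pose K := c * eta ^- k.
have /cvgrPdist_le/(_ (eps / 4 / (K + 1))) : e n * 1 @[n --> \oo] --> (0 : R) by under eq_fun do rewrite mulr1.
have K0 : 0 <= K by rewrite /K mulr_ge0// invr_ge0 exprn_ge0// ltW.
have K1 : 0 < K + 1 by exact: ltr_wpDl.
move=> /(_ _)[]; first by rewrite !divr_gt0.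
move=> M _ HM; exists M => // m /HM /=; rewrite sub0r normrN mulr1 => em.
have := H eta _ m; rewrite eta0 eta1 => /(_ isT).
have KE : K * e m <= eps / 4.
  rewrite (@le_trans _ _ (K * (eps / 4 / (K + 1))))//.
    by rewrite ler_wpM2l// (le_trans (ler_norm _)).
  by rewrite mulrA ler_pdivrMr// mulrC ler_wpM2l// ?divr_ge0 ?(ltW eps0)// lerDl.
rewrite mulrDr [c * (eta ^- k * _)]mulrA -/K [c * (eta * _)]mulrA.
have := ler_norm (q m - L); rewrite distrC.
have := normr_ge0 (L - q m); move: KE; move: (K * e m) => w.
have : 0 <= c * eta by rewrite mulr_ge0// ltW.
have e2E : c * L * eta = (c * eta) * L by ring.
rewrite {}e2E in e2.
move: e1 e2; move: (c * eta) => v e1 e2 v0; move: `|L - q m| => u hw u0 uq hu.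
have : v * (L + q m) <= 2 * (v * L) + v * u by nra.
have : v * u <= u / 2 by nra.
lra.
Qed.

(* The scale [t] of the shell between [(m + 2)^-2] and [(m + 1)^-2] is small enough
   for the exponential moment bound, and [t^-1] telescopes. *)
Lemma shell_scale (m : nat) : exists2 t : R, 0 < t &
  [/\ t * m.+1%:R ^- 2 <= 1 / 2, 2 * (m.+1%:R ^- 2 - m.+2%:R ^- 2) <= t ^- 2 &
   t^-1 = 12 * ((Num.sqrt m.+1%:R)^-1 - (Num.sqrt m.+2%:R)^-1)].
Proof.
pose r : R := Num.sqrt m.+1%:R; pose q : R := Num.sqrt m.+2%:R.
have r2 : m.+1%:R = r ^+ 2 by rewrite sqr_sqrtr.
have q2 : m.+2%:R = q ^+ 2 by rewrite sqr_sqrtr.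
have qr : q ^+ 2 = r ^+ 2 + 1 by rewrite -r2 -q2 -[in LHS]natr1.
have r0 : 0 < r by rewrite sqrtr_gt0.
have q0 : 0 < q by rewrite sqrtr_gt0.
have r1 : 1 <= r.
  by rewrite -[leLHS]sqrtr1 ler_wsqrtr// ler1n.
have rq : r <= q by rewrite ler_wsqrtr// ler_nat.
have q2r : q <= 2 * r by nra.
rewrite -/r -/q r2 q2; clearbody r q.
(* Since [q^2 - r^2 = 1], the inverse of [r q (r + q)] is [1/r - 1/q]. The constant [12] makes the
   first bound follow from [q (r + q) <= 6 r^2]. *)
exists (r * q * (r + q) / 12); first by rewrite divr_gt0// !mulr_gt0// addr_gt0.
split.
- rewrite ler_pdivrMr ?exprn_gt0//.
  have h1 : q * (r + q) <= 6 * r ^+ 2 by nra.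
  have h2 : r * (q * (r + q)) <= r * (6 * r ^+ 2) by rewrite ler_wpM2l// ltW.
  have h3 : r ^+ 3 <= r ^+ 4 by rewrite ler_weXn2l.
  have -> : r ^+ 2 ^+ 2 = r ^+ 4 by ring.
  have h4 : r * (6 * r ^+ 2) = 6 * r ^+ 3 by ring.
  rewrite h4 in h2; lra.
- have p0 : 0 < r * q * (r + q) by rewrite !mulr_gt0// addr_gt0.
  have aux (x y : R) : 0 < x -> 0 < y -> y ^+ 2 = x ^+ 2 + 1 ->
      2 * (x ^+ 2 ^- 2 - y ^+ 2 ^- 2) * (x * y * (x + y) / 12) ^+ 2 =
      ((x + y) ^+ 2 * (x ^+ 2 + y ^+ 2)) / (72 * (x ^+ 2 * y ^+ 2)).
    move=> x0 y0 xy.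
    have -> : x ^+ 2 ^- 2 - y ^+ 2 ^- 2 = (y ^+ 2 - x ^+ 2) * (y ^+ 2 + x ^+ 2) / (x ^+ 4 * y ^+ 4).
      by field; rewrite !gt_eqF.
    by rewrite xy addrAC subrr add0r -xy; field; rewrite !gt_eqF.
  rewrite -[leRHS]mul1r ler_pdivlMr ?exprn_gt0 ?divr_gt0//.
  rewrite aux// ler_pdivrMr ?mulr_gt0 ?exprn_gt0// mul1r.
  have h1 : (r + q) ^+ 2 <= 2 * (r ^+ 2 + q ^+ 2) by have := sqr_ge0 (r - q); nra.
  have h2 : (r + q) ^+ 2 * (r ^+ 2 + q ^+ 2) <= 2 * (r ^+ 2 + q ^+ 2) * (r ^+ 2 + q ^+ 2).
    by rewrite ler_wpM2r// addr_ge0// sqr_ge0.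
  apply: le_trans h2 _.
  have : 1 <= r ^+ 2 by rewrite exprn_ege1.
  rewrite qr; move: (r ^+ 2) => u u1; nra.
- rewrite invf_div.
  have aux (x y : R) : 0 < x -> 0 < y -> y ^+ 2 = x ^+ 2 + 1 -> 12 / (x * y * (x + y)) = 12 * (x^-1 - y^-1).
    move=> x0 y0 xy; have n0 : x + y != 0 by rewrite gt_eqF// addr_gt0.
    apply: (mulIf (mulf_neq0 (mulf_neq0 (lt0r_neq0 x0) (lt0r_neq0 y0)) n0)).
    rewrite mulfVK; last by rewrite !mulf_neq0 ?(lt0r_neq0 x0) ?(lt0r_neq0 y0).
    have -> : 12 * (x^-1 - y^-1) * (x * y * (x + y)) = 12 * (y ^+ 2 - x ^+ 2) by field; rewrite !gt_eqF.
    by rewrite xy; ring.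
  exact: aux.
Qed.

End EvenPowers.

Section Shells.
Context {R : realType}.
Notation mu := (@lebesgue_measure R).
Implicit Types (a b c x : R).

Definition shell a b : set R := [set x | a < `|x| <= b].

Lemma measurable_shell a b : measurable (shell a b).
Proof.
rewrite (_ : shell a b = [set x : R | a < `|x|] `&` [set x | `|x| <= b]); last first.
  by apply/seteqP; split => x /=; rewrite /shell/= => /andP.
apply: measurableI; rewrite -[X in measurable X]setTI.
  by apply: measurable_fun_ltr => //; exact: normr_measurable.
by apply: measurable_fun_ler => //; exact: normr_measurable.
Qed.

Lemma shellN a b x : shell a b x -> shell a b (- x).
Proof. by rewrite /shell/= normrN. Qed.

Lemma lebesgue_shell_le a b : 0 <= a -> a <= b -> (mu (shell a b) <= (2 * (b - a))%:E)%E.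
Proof.
move=> a0 ab; apply: (@le_trans _ _ (mu (`]a, b] `|` `[- b, (- a)[))).
  apply: le_measure; rewrite ?inE; [exact: measurable_shell|exact: measurableU|].
  move=> x /andP[]; have [x0|x0] := leP 0 x.
    by rewrite ger0_norm// => ? ?; left; rewrite /= in_itv/=; apply/andP.
  by rewrite ltr0_norm// => ? ?; right; rewrite /= in_itv/=; apply/andP; split; lra.
rewrite (le_trans (measureU2 _ _ _))//= !lebesgue_measure_itv/= !lte_fin ltrN2.
case: ifP => [_|_]; last by rewrite adde0 lee_fin mulr_ge0// subr_ge0.
by rewrite -!EFinB -EFinD lee_fin opprK; lra.
Qed.

Lemma trunc_shell_supp a b x : trunc (shell a b) x != 0 -> a <= `|x| <= b.
Proof.
by apply: contraNT => h; rewrite trunc_out// => /andP[h1 h2]; move/negP: h; apply; rewrite (ltW h1).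
Qed.

Lemma trunc_shell_split a b c x : a <= b -> b <= c ->
  trunc (shell a c) x = trunc (shell a b) x + trunc (shell b c) x.
Proof.
move=> ab bc; rewrite /trunc -mulrDr !indicE; congr (_ * _).
rewrite -natrD; congr (_%:R).
have E u v : (x \in shell u v) = (u < `|x| <= v) by apply/idP/idP; rewrite inE.
by rewrite !E; case: (ltP b `|x|) => h1; case: (ltP a `|x|) => h2; case: (leP `|x| c) => h3 //=; exfalso; lra.
Qed.

End Shells.

Lemma cvg_le_const (R : realType) (u : nat -> R) (l c : R) : u n @[n --> \oo] --> l ->
  (forall n, u n <= c) -> l <= c.
Proof.
move=> ul uc; rewrite -(cvg_lim (@Rhausdorff R) ul); apply: limr_le; first exact: cvgP ul.
by near=> n.
Unshelve. all: by end_near. Qed.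

Lemma truncU (R : realType) (A B : set R) x : (forall y, A y -> ~ B y) ->
  trunc (A `|` B) x = trunc A x + trunc B x.
Proof.
move=> AB; have [Ax|Ax] := pselect (A x).
  by rewrite (trunc_in Ax) (trunc_out (AB _ Ax)) addr0 trunc_in//; left.
rewrite (trunc_out Ax) add0r; have [Bx|Bx] := pselect (B x).
  by rewrite !trunc_in//; right.
by rewrite !trunc_out// => -[].
Qed.

Lemma truncC (R : realType) (A : set R) x : trunc (~` A) x = x - trunc A x.
Proof.
have [Ax|Ax] := pselect (A x); first by rewrite (trunc_in Ax) trunc_out ?subrr.
by rewrite (trunc_out Ax) subr0 trunc_in.
Qed.

Section PrincipalValueMoments.
Context {R : realType}.
Notation mu := (@lebesgue_measure R).
Notation leb n := (@lebesgue_tuple R n).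
Context {d : measure_display} {T : measurableType d} (P : probability T R) (C : T -> set R).
Variables (s : R).
Hypothesis s1 : 1 < 2 * s.
Hypothesis hC : hp_process P s C.
Variables (h : nat).
Hypothesis (h0 : (0 < h)%N) (hs : (2 * h)%:R < 2 * s + 1).
Implicit Types (a b c : R) (w : T).
Local Notation intg f := (P.-integrable setT (EFin \o f)).
Local Notation n := (2 * h)%N.
Local Notation E_ N := (ensembleE (@hp_sfun R s N)).

Let C_process : point_process C := hC.1.

Definition shell_sum a b w : R := psum C (trunc (shell a b)) w.
Local Notation U := shell_sum.

Lemma measurable_shell_sum a b : 0 < a -> measurable_fun setT (U a b).
Proof.
move=> a0; apply: (measurable_psum C_process a0); last exact: trunc_shell_supp.
by apply: measurable_trunc; exact: measurable_shell.
Qed.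

Lemma shell_sum_split a b c w : 0 < a -> a <= b -> b <= c -> U a c w = U a b w + U b c w.
Proof.
move=> a0 ab bc; rewrite /U (psumE C_process w a0 (@trunc_shell_supp R a c)).
rewrite (psumE C_process w a0 (b := c) (g := trunc (shell a b))); last first.
  by move=> x /trunc_shell_supp/andP[-> /le_trans]; apply.
rewrite (psumE C_process w a0 (b := c) (g := trunc (shell b c))); last first.
  by move=> x /trunc_shell_supp/andP[/(le_trans ab)-> ->].
by rewrite -big_split/=; apply: eq_bigr => x _; exact: trunc_shell_split.
Qed.

Lemma shell_sum_integrable a b : 0 < a -> intg (fun w => U a b w ^+ n).
Proof.
move=> a0; have [] // := integral_psum_power s1 hC h0 hs a0 (measurable_trunc (measurable_shell a b)) (norm_trunc_le _) (@trunc_shell_supp R a b).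
Qed.

Lemma shell_sum_cvg a b : 0 < a ->
  E_ N (fun x => (\sum_i trunc (shell a b) (tnth x i)) ^+ n) @[N --> \oo] --> \int[P]_w (U a b w ^+ n).
Proof.
move=> a0; exact: (psum_moment_cvg s1 hC h0 hs a0 (measurable_trunc (measurable_shell a b)) (norm_trunc_le _) (@trunc_shell_supp R a b)).
Qed.

(** A shell with [0 < a] stays away from [0], so the bound on the ensembles passes to the limit
    process. *)
Lemma shell_sum_moment_small : exists2 K : R, 0 <= K & forall a b t, 0 < a -> a <= b -> 0 < t ->
  t * b <= 1 / 2 -> 2 * (b - a) <= t ^- 2 -> t ^+ n * \int[P]_w (U a b w ^+ n) <= K.
Proof.
have [K K0 hK] := hp_small_moment s1 h0 hs; exists K => // a b t a0 ab t0 tb tab.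
have c := cvgMr (a := t ^+ n) (@shell_sum_cvg a b a0).
apply: (cvg_le_const (c _)) => N; apply: (hK N _ b) => //.
- exact: measurable_shell.
- by move=> x; exact: shellN.
- by move=> x /andP[_].
- by rewrite (le_trans (lebesgue_shell_le (ltW a0) ab))// lee_fin.
Qed.

Lemma psum_moment_tail : exists2 K : R, 0 <= K & forall (g : R -> R) b b', measurable_fun setT g -> 1 <= b ->
  (forall x, `|g x| <= `|x|) -> (forall x, g x != 0 -> b <= `|x| <= b') ->
  \int[P]_w (psum C g w ^+ n) <= K * b `^ (- (2 * s + 1 - n%:R)).
Proof.
have [K K0 hK] := hp_tail_moment s1 h0 hs; exists K => // g b b' mg b1 gx gb.
have b0 : 0 < b by exact: lt_le_trans b1.
apply: (cvg_le_const (psum_moment_cvg s1 hC h0 hs b0 mg gx gb)) => N.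
by apply: hK => // x /gb/andP[].
Qed.

(** One bound covers both omitted ranges at once, uniformly in [N]: small points by the exponential
    moment estimate, large ones by the tail estimate. *)
Lemma near_far_moment : exists e : nat -> R, [/\ forall m, 0 <= e m, e m @[m --> \oo] --> (0 : R) &
  forall N m (A B : set R), measurable A -> measurable B -> (forall x, A x -> A (- x)) ->
    (forall x, A x -> `|x| <= m.+1%:R ^- 2) -> (forall x, B x -> m.+1%:R < `|x|) ->
    E_ N (fun x => (\sum_i trunc (A `|` B) (tnth x i)) ^+ n) <= e m].
Proof.
have [K K0 hK] := hp_small_moment s1 h0 hs; have [K' K'0 hK'] := hp_tail_moment s1 h0 hs.
have hs' := hs; pose e m : R := 2 ^+ n * (K * (2 * m.+1%:R^-1) ^+ n + K' * m.+1%:R `^ (- (2 * s + 1 - n%:R))).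
exists e; split.
- move=> m; rewrite /e mulr_ge0 ?exprn_ge0// addr_ge0 ?mulr_ge0 ?exprn_ge0 ?powR_ge0//.
- rewrite -[X in _ --> X](mulr0 (2 ^+ n)); apply: cvgMr.
  rewrite -[X in _ --> X](addr0 0); apply: cvgD.
    rewrite -[X in _ --> X](mulr0 K); apply: cvgMr.
    have -> : (0 : R) = 0 ^+ n by rewrite expr0n muln_eq0/= (gtn_eqF h0).
    have c2 : 2 * m.+1%:R^-1 @[m --> \oo] --> (0 : R).
      by rewrite -[X in _ --> X](mulr0 2); apply: cvgMr; exact: cvg_harmonic.
    apply: (cvg_comp (fun m => 2 * m.+1%:R^-1) (fun x : R => x ^+ n)); first exact: c2.
    exact: exprn_continuous.
  rewrite -[X in _ --> X](mulr0 K'); apply: cvgMr.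
  apply: (cvg_comp (fun m => m.+1%:R : R) (fun x : R => x `^ _)); last by apply: powRN_cvgy0; lra.
  by apply/cvgryPge => M; near=> m; rewrite (@le_trans _ _ m%:R) ?ler_nat//; near: m; exact: nbhs_infty_ger.
move=> N m A B mA mB symA Am Bm.
have m0 : 0 < m.+1%:R :> R by [].
have am1 : m.+1%:R ^- 2 <= 1 :> R by rewrite invf_le1 ?exprn_gt0// exprn_ege1// ler1n.
have AB x : trunc (A `|` B) x = trunc A x + trunc B x.
  by apply: truncU => y Ay /Bm; rewrite ltNge (le_trans (Am _ Ay))// (le_trans am1)// ler1n.
have on := @hp_sfun_orthonormal R s s1 N.
have I D (mD : measurable D) := ensembleE_power_sum on (fun e he => @admissible_trunc R s s1 h hs N D e mD he).
have [i1 _ _] := I _ mA; have [i2 _ _] := I _ mB; have [i3 _ _] := I _ (measurableU _ _ mA mB).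
have [i4 e4] := ensembleED i1 i2; have [i5 e5] := ensembleEZ (2 ^+ n) i4.
apply: le_trans (ensembleE_le _ i3 i5) _.
  move=> x; under eq_bigr do rewrite AB.
  by rewrite big_split; exact: even_power_add.
rewrite e5 e4 /e; apply: ler_wpM2l; first exact: exprn_ge0.
apply: lerD; last first.
  apply: hK'; [exact: measurable_trunc|by rewrite ler1n|exact: norm_trunc_le|].
  move=> x tx; have [/Bm/ltW//|nB] := pselect (B x).
  by rewrite trunc_out// eqxx in tx.
(* The scale is [t = (m + 1) / 2]: then [t] times the cutoff [(m + 1)^-2] is at most [1/2], and the
   measure [2 (m + 1)^-2] is below [t^-2]. *)
have t0 : 0 < m.+1%:R / 2 :> R by rewrite divr_gt0.
have m1 : 1 <= m.+1%:R :> R by rewrite ler1n.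
rewrite -[2 / _]invf_div exprVn ler_pdivlMr ?exprn_gt0// mulrC.
apply: (hK N A (m.+1%:R ^- 2)) => //.
  have -> : m.+1%:R / 2 / m.+1%:R ^+ 2 = 1 / 2 * m.+1%:R^-1 :> R by field; rewrite gt_eqF.
  by rewrite ler_piMr// invf_le1.
apply: (@le_trans _ _ (mu `[- m.+1%:R ^- 2, m.+1%:R ^- 2])).
  by apply: le_measure; rewrite ?inE//= => x /Am; rewrite ler_norml /= in_itv.
rewrite lebesgue_measure_itv/= lte_fin; case: ifP => _; last by rewrite lee_fin invr_ge0 exprn_ge0// ltW.
have -> : (m.+1%:R / 2) ^- 2 = 4 * m.+1%:R ^- 2 :> R by field; rewrite gt_eqF.
rewrite -EFinD lee_fin opprK.
have : 0 <= m.+1%:R ^- 2 :> R by rewrite invr_ge0 exprn_ge0// ltW.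
by move: (m.+1%:R ^- 2) => u u0; lra.
Unshelve. all: by end_near. Qed.

(** The upper cutoff keeps the summand supported in an annulus, as the determinantal formula
    requires. The index is shifted by one so that the cutoffs make sense for [m = 0]. *)
Definition pv_approx m w : R := U (m.+1%:R ^- 2) m.+1%:R w.
Local Notation V := pv_approx.

Let cutoff_gt0 m : 0 < m.+1%:R ^- 2 :> R. Proof. by rewrite invr_gt0 exprn_gt0. Qed.

Let cutoff_le1 m : m.+1%:R ^- 2 <= 1 :> R.
Proof. by rewrite invf_le1 ?exprn_gt0// exprn_ege1// ler1n. Qed.

Let cutoff_le m k : (m <= k)%N -> k.+1%:R ^- 2 <= m.+1%:R ^- 2 :> R.
Proof. by move=> mk; rewrite lef_pV2 ?posrE ?exprn_gt0// lerXn2r ?nnegrE// ler_nat. Qed.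

Lemma pv_approx_sub m k w : (m <= k)%N -> V k w - V m w =
  psum C (trunc (shell (k.+1%:R ^- 2) (m.+1%:R ^- 2) `|` shell m.+1%:R k.+1%:R)) w.
Proof.
move=> mk; have ckm := cutoff_le mk; have cm1 := cutoff_le1 m.
have m1 : 1 <= m.+1%:R :> R by rewrite ler1n.
have mk1 : m.+1%:R <= k.+1%:R :> R by rewrite ler_nat.
rewrite /pv_approx /U (psumE C_process w (cutoff_gt0 k) (@trunc_shell_supp R _ k.+1%:R)).
rewrite (psumE C_process w (cutoff_gt0 k) (b := k.+1%:R) (g := trunc (shell (m.+1%:R ^- 2) m.+1%:R))); last first.
  by move=> x /trunc_shell_supp/andP[/(le_trans ckm)-> /le_trans->].
rewrite (psumE C_process w (cutoff_gt0 k) (b := k.+1%:R) (g := trunc (_ `|` _))); last first.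
  move=> x; apply: contraNT => nx; rewrite trunc_out// => -[] /andP[x1 x2]; move/negP: nx; apply; apply/andP.
    by rewrite (ltW x1) (le_trans x2)// (le_trans cm1)// (le_trans m1).
  by rewrite (le_trans ckm)// (le_trans cm1)// (le_trans m1)// ltW.
rewrite -sumrB; apply: eq_bigr => x _; rewrite truncU; last first.
  by move=> y /andP[_ y1] /andP[y2 _]; have := lt_le_trans y2 (le_trans y1 cm1); rewrite ltNge m1.
rewrite (@trunc_shell_split _ (k.+1%:R ^- 2) (m.+1%:R ^- 2) k.+1%:R)//; last by rewrite (le_trans cm1)// (le_trans m1).
rewrite (@trunc_shell_split _ (m.+1%:R ^- 2) m.+1%:R k.+1%:R)// ?(le_trans cm1)//.
by rewrite addrA addrAC addrK addrC.
Qed.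

(** The same sequence [e] controls the increments for the limit process, through [N -> oo], and the
    truncation error of every finite ensemble. *)
Lemma pv_approx_moments : exists e : nat -> R, [/\ forall m, 0 <= e m, e m @[m --> \oo] --> (0 : R),
  forall m k, (m <= k)%N -> intg (fun w => (V k w - V m w) ^+ n) /\ \int[P]_w ((V k w - V m w) ^+ n) <= e m &
  forall N m, E_ N (fun x => (\sum_i trunc (~` shell (m.+1%:R ^- 2) m.+1%:R) (tnth x i)) ^+ n) <= e m].
Proof.
have [e [e0 ec eb]] := near_far_moment; exists e; split=> //.
- move=> m k mk; under eq_fun do rewrite (pv_approx_sub _ mk).
  set A := shell _ _; set B := shell m.+1%:R _.
  have mA : measurable A by exact: measurable_shell.
  have mB : measurable B by exact: measurable_shell.
  have ckm := cutoff_le mk; have cm1 := cutoff_le1 m.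
  have m1 : 1 <= m.+1%:R :> R by rewrite ler1n.
  have mk1 : m.+1%:R <= k.+1%:R :> R by rewrite ler_nat.
  have supp x : trunc (A `|` B) x != 0 -> k.+1%:R ^- 2 <= `|x| <= k.+1%:R.
    apply: contraNT => nx; rewrite trunc_out// => -[] /andP[x1 x2]; move/negP: nx; apply; apply/andP.
      by rewrite (ltW x1) (le_trans x2)// (le_trans cm1)// (le_trans m1).
    by rewrite (le_trans ckm)// (le_trans cm1)// (le_trans m1)// ltW.
  have mAB := measurable_trunc (measurableU _ _ mA mB).
  have [i1 _] := integral_psum_power s1 hC h0 hs (cutoff_gt0 k) mAB (norm_trunc_le _) supp.
  split; first exact: i1.
  apply: (cvg_le_const (psum_moment_cvg s1 hC h0 hs (cutoff_gt0 k) mAB (norm_trunc_le _) supp)) => N.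
  apply: eb => //.
  + by move=> x; exact: shellN.
  + by move=> x /andP[].
  + by move=> x /andP[].
- move=> N m.
  rewrite (_ : ~` shell _ _ = [set x | `|x| <= m.+1%:R ^- 2] `|` [set x | m.+1%:R < `|x|]).
    apply: eb => //.
    + by rewrite -[X in measurable X]setTI; apply: measurable_fun_ler => //; exact: normr_measurable.
    + by rewrite -[X in measurable X]setTI; apply: measurable_fun_ltr => //; exact: normr_measurable.
    + by move=> x /=; rewrite normrN.
  apply/seteqP; split => x /=; rewrite /shell/=.
    by move/negP; rewrite negb_and -!ltNge -leNgt => /orP.
  by move=> h1; apply/negP; rewrite negb_and -!ltNge -leNgt; apply/orP.
Qed.

(** Exchange of the limits in [N] and [m]. The full and the truncated moments of the ensemble are
    compared uniformly in [N], then [N] tends to infinity with [m] fixed, and [cvg_of_power_bound]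
    lets [m] tend to infinity. *)
Lemma pv_approx_moment_cvg (L : R) :
  power_moment s n N.+1 / N.+1%:R ^+ n @[N --> \oo] --> L ->
  0 <= L /\ \int[P]_w (V m w ^+ n) @[m --> \oo] --> L.
Proof.
move=> cL; have [e [e0 ec _ eb]] := pv_approx_moments.
have ESE N := ensembleE_hp_sfun_power s1 hs N.
have cE : E_ N (fun x => (\sum_i tnth x i) ^+ n) @[N --> \oo] --> L.
  rewrite (_ : (fun N => _) = (fun N => power_moment s n N.+1 / N.+1%:R ^+ n))//.
  by apply/funext => N; have [_ ->] := ESE N.
have ev (x : R) : 0 <= x ^+ n by rewrite exprn_even_ge0// oddM.
have L0 : 0 <= L.
  rewrite -oppr_le0; apply: (cvg_le_const (cvgN cE)) => N.
  by rewrite oppr_le0; apply: ensembleE_ge0.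
split=> //; apply: (@cvg_of_power_bound R L n%:R _ e n.-1) => // eta eta01 m.
have /andP[eta0 _] := eta01.
pose A : set R := shell (m.+1%:R ^- 2) m.+1%:R.
have mA : measurable A by exact: measurable_shell.
have cV := @shell_sum_cvg (m.+1%:R ^- 2) m.+1%:R (cutoff_gt0 m).
pose G (x y : R) := n%:R * (eta * (x + y) + eta ^- n.-1 * e m).
(* [even_power_sub] integrated over the ensemble; what truncation leaves out is the sum over the
   complement of the shell, with moment at most [e m]. *)
have key N : `|E_ N (fun x => (\sum_i tnth x i) ^+ n) - E_ N (fun x => (\sum_i trunc A (tnth x i)) ^+ n)| -
    G (E_ N (fun x => (\sum_i tnth x i) ^+ n)) (E_ N (fun x => (\sum_i trunc A (tnth x i)) ^+ n)) <= 0.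
  have on := @hp_sfun_orthonormal R s s1 N.
  have I D (mD : measurable D) := ensembleE_power_sum on (fun e he => @admissible_trunc R s s1 h hs N D e mD he).
  have [i1 _] := ESE N; have [i2 _ _] := I _ mA; have [i3 _ _] := I _ (measurableC mA).
  have [i4 e4] := ensembleED i1 i2; have [i5 e5] := ensembleEZ eta i4.
  have [i6 e6] := ensembleEZ (eta ^- n.-1) i3; have [i7 e7] := ensembleED i5 i6.
  have [i8 e8] := ensembleEZ n%:R i7.
  have [i9 e9] := ensembleED i1 i8; have [i10 e10] := ensembleED i2 i8.
  have D (x : N.+1.-tuple R) : \sum_i trunc (~` A) (tnth x i) = \sum_i tnth x i - \sum_i trunc A (tnth x i).
    by rewrite -sumrB; apply: eq_bigr => i _; exact: truncC.
  have B (x : N.+1.-tuple R) := even_power_sub (\sum_i tnth x i) (\sum_i trunc A (tnth x i)) h0 eta01.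
  have l1 := (fun H => ensembleE_le H i1 i10); have l2 := (fun H => ensembleE_le H i2 i9).
  rewrite e10 in l1; rewrite e9 in l2.
  have l3 : E_ N (fun x => n%:R * (eta * ((\sum_i tnth x i) ^+ n + (\sum_i trunc A (tnth x i)) ^+ n) +
      eta ^- n.-1 * (\sum_i trunc (~` A) (tnth x i)) ^+ n)) <=
      G (E_ N (fun x => (\sum_i tnth x i) ^+ n)) (E_ N (fun x => (\sum_i trunc A (tnth x i)) ^+ n)).
    rewrite e8 e7 e6 e5 e4 /G ler_wpM2l// lerD2l ler_wpM2l//; last exact: eb.
    by rewrite invr_ge0 exprn_ge0// ltW.
  rewrite subr_le0 ler_distl; apply/andP; split.
    rewrite lerBlDr (le_trans _ (lerD (lexx _) l3))//; apply: l2 => x.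
    by have := B x; rewrite -D ler_distl lerBlDr => /andP[].
  rewrite (le_trans _ (lerD (lexx _) l3))//; apply: l1 => x.
  by have := B x; rewrite -D ler_distl => /andP[].
rewrite -subr_le0; apply: (cvg_le_const _ key).
apply: cvgB; first by apply: cvg_norm; exact: cvgB.
apply: cvgMr; apply: cvgD; last exact: cvg_cst.
by apply: cvgMr; exact: cvgD.
Qed.

End PrincipalValueMoments.

Import HBNNSimple.

(** * Almost sure convergence of the truncated sums *)

Section AlmostSure.
Context {R : realType} {d : measure_display} {T : measurableType d}.

Lemma ae_bounded (mu : {measure set T -> \bar R}) (f : nat -> T -> R) (K : R) :
  (forall m, measurable_fun setT (f m)) -> (forall m w, 0 <= f m w) ->
  (forall w, {homo f ^~ w : m k / (m <= k)%N >-> m <= k}) ->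
  (forall m, \int[mu]_w (f m w)%:E <= K%:E)%E ->
  {ae mu, forall w, exists M : R, forall m, f m w <= M}.
Proof.
move=> mf f0 nd fK; pose F w := limn (fun m => (f m w)%:E).
have nde w : nondecreasing_seq (fun m => (f m w)%:E) by move=> m k mk; rewrite lee_fin nd.
have mF : measurable_fun setT F.
  apply: (emeasurable_fun_cvg (fun m w => (f m w)%:E)).
    by move=> m; apply/measurable_EFinP.
  by move=> w _; exact: ereal_nondecreasing_is_cvgn.
have F0 w : (0 <= F w)%E.
  by apply: lime_ge; [exact: ereal_nondecreasing_is_cvgn|apply: nearW => m; rewrite lee_fin].
have iF : mu.-integrable setT F.
  apply/integrableP; split => //.
  under eq_integral => w _ do rewrite gee0_abs//.
  apply: (@le_lt_trans _ _ K%:E); last exact: ltry.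
  have H1 m : measurable_fun setT (fun w => (f m w)%:E) by exact/measurable_EFinP.
  have H2 m w : setT w -> (0 <= (f m w)%:E)%E by rewrite lee_fin.
  rewrite (monotone_convergence mu measurableT H1 H2 (fun w _ => nde w)).
  apply: lime_le; last by apply: nearW => m; exact: fK.
  apply: ereal_nondecreasing_is_cvgn => m k mk; apply: ge0_le_integral => //; first exact: H2.
  by move=> w _; rewrite lee_fin nd.
have := integrable_ae measurableT iF; apply: filterS => w /(_ I) wF.
exists (fine (F w)) => m; rewrite -lee_fin fineK//.
apply: lime_ge; first exact: ereal_nondecreasing_is_cvgn.
by near=> k; apply: nde; near: k; exact: nbhs_infty_ge.
Unshelve. all: by end_near. Qed.

(* The integrals are suprema over simple functions, so no measurability of [f] and [g] is needed. *)
Lemma ge0_integral_eq_off_null (mu : {measure set T -> \bar R}) (N : set T) (f g : T -> \bar R) :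
  measurable N -> mu N = 0%E -> (forall w, 0 <= f w)%E -> (forall w, 0 <= g w)%E ->
  (forall w, ~ N w -> f w = g w) -> (\int[mu]_w f w = \int[mu]_w g w)%E.
Proof.
move=> mN N0.
suff key : forall f g : T -> \bar R, (forall w, 0 <= f w)%E -> (forall w, 0 <= g w)%E ->
    (forall w, ~ N w -> f w = g w) -> (\int[mu]_w f w <= \int[mu]_w g w)%E.
  by move=> f0 g0 fg; apply/eqP; rewrite eq_le !key// => w /fg ->.
move=> {}f {}g f0 g0 fg; rewrite !ge0_integralTE//.
apply: ge_ereal_sup => _ [u /= uf <-].
pose v : {nnsfun T >-> R} := proj_nnsfun u (measurableC mN).
have vE w : v w = u w * \1_(~` N) w by [].
have vg w : ((v w)%:E <= g w)%E.
  rewrite vE indicE; have [Nw|Nw] := pselect (N w).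
    by rewrite memNset ?mulr0//; exact.
  by rewrite mem_set// mulr1 -fg.
rewrite -[leLHS](integralT_nnsfun mu u) (_ : (\int[mu]_x (u x)%:E = \int[mu]_x (v x)%:E)%E); last first.
  apply: ae_eq_integral => //; try exact/measurable_EFinP.
  exists N; split => // w /=; apply: contra_notP => Nw _.
  have e : u w = v w by rewrite vE indicE mem_set// mulr1.
  exact: (congr1 EFin e).
by rewrite integralT_nnsfun; apply: ereal_sup_ubound; exists v.
Qed.

End AlmostSure.

Section PrincipalValueLimit.
Context {R : realType}.
Context {d : measure_display} {T : measurableType d} (P : probability T R) (C : T -> set R).
Variables (s : R).
Hypothesis s1 : 1 < 2 * s.
Hypothesis hC : hp_process P s C.
Variables (h : nat).
Hypothesis (h0 : (0 < h)%N) (hs : (2 * h)%:R < 2 * s + 1).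
Implicit Types (a b c : R) (w : T).
Local Notation intg f := (P.-integrable setT (EFin \o f)).
Local Notation n := (2 * h)%N.
Local Notation U := (shell_sum C).
Local Notation V := (pv_approx C).

Let C_process : point_process C := hC.1.

Let cutoff_gt0 m : 0 < m.+1%:R ^- 2 :> R. Proof. by rewrite invr_gt0 exprn_gt0. Qed.

Let cutoff_le1 m : m.+1%:R ^- 2 <= 1 :> R.
Proof. by rewrite invf_le1 ?exprn_gt0// exprn_ege1// ler1n. Qed.

Let cutoff_le m k : (m <= k)%N -> k.+1%:R ^- 2 <= m.+1%:R ^- 2 :> R.
Proof. by move=> mk; rewrite lef_pV2 ?posrE ?exprn_gt0// lerXn2r ?nnegrE// ler_nat. Qed.

Lemma Rintegral_cst1 : \int[P]_w (cst (1 : R) w) = 1.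
Proof. by rewrite Rintegral_cst// mul1r /= probability_setT. Qed.

Lemma integrable_cst1 : intg (cst (1 : R)).
Proof. exact: finite_measure_integrable_cst. Qed.

(** The sum of [|x|] over points with [1 < |x| <= m + 1] has bounded mean as [m] grows, hence is
    almost surely bounded, and it dominates each of its points. This makes the one-sided sums of
    [truncated_sum] finite, which matters because infinite ones are read as [0]. *)
Lemma ae_bounded_points : {ae P, forall w, exists M : R, forall x, C w x -> `|x| <= M}.
Proof.
have [K K0 hK] := psum_moment_tail s1 hC h0 hs.
pose g m (x : R) := `|trunc (shell 1 m.+1%:R) x|.
have gs m x : g m x != 0 -> 1 <= `|x| <= m.+1%:R by rewrite normr_eq0; exact: trunc_shell_supp.
have mg m : measurable_fun setT (g m).
  by apply: measurableT_comp => //; apply: measurable_trunc; exact: measurable_shell.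
have gx m x : `|g m x| <= `|x| by rewrite normr_id norm_trunc_le.
have gE m k w : (m <= k)%N -> psum C (g m) w = \sum_(x <- points C 1 k.+1%:R w) g m x.
  move=> mk; apply: psumE => // x /gs/andP[-> /le_trans->//]; by rewrite ler_nat.
have g0 m w : 0 <= psum C (g m) w by rewrite (gE m m)//; apply: sumr_ge0 => x _; exact: normr_ge0.
have mP m := measurable_psum C_process ltr01 (mg m) (gs m).
have aeb : {ae P, forall w, exists M : R, forall m, psum C (g m) w <= M}.
  apply: (@ae_bounded _ _ _ _ (fun m w => psum C (g m) w) (1 + K)) => //.
  - move=> w m k mk; rewrite (gE m k)// (gE k k)//; apply: ler_sum => x _.
    rewrite /g !norm_trunc ler_wpM2l// !indicE ler_nat.
    have [xm|//] := boolP (x \in shell 1 m.+1%:R); rewrite mem_set//.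
    by move: xm; rewrite inE /shell/= => /andP[-> /le_trans->//]; rewrite ler_nat.
  - move=> m; have [i _] := integral_psum_power s1 hC h0 hs ltr01 (mg m) (gx m) (gs m).
    have := hK _ _ _ (mg m) (lexx 1) (gx m) (gs m); rewrite powR1 mulr1 => b.
    have i2 := integrableD_EFin measurableT integrable_cst1 i.
    apply: (@le_trans _ _ (\int[P]_w (cst 1 w + psum C (g m) w ^+ n)%:E)%E).
      apply: ge0_le_integral => //.
      + by move=> w _; rewrite lee_fin.
      + by apply/measurable_EFinP; exact: mP.
      + by apply/measurable_EFinP; exact: integrable_EFin_measurable i2.
      + by move=> w _; rewrite lee_fin (le_trans (ler_norm _))// norm_le_even_power.
    by rewrite -EFin_Rintegral// RintegralD// ?Rintegral_cst1 ?lee_fin ?lerD2l//; exact: integrable_cst1.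
move: aeb; apply: filterS => w [M hM]; exists (Num.max 1 M) => x Cx.
have [x1|x1] := leP `|x| 1; first by rewrite le_max x1.
rewrite le_max; apply/orP; right.
have [m xm] : exists m : nat, `|x| <= m.+1%:R.
  have /archi_boundP := normr_ge0 x; set m := Num.bound _ => xm.
  by exists m; rewrite (le_trans (ltW xm))// ler_nat.
apply: le_trans (hM m); rewrite (gE m m)//.
have xin : x \in points C 1 m.+1%:R w by apply/(mem_points C_process) => //; split => //; rewrite /annulus/= (ltW x1).
rewrite (big_rem x)//= [X in _ <= X + _](_ : _ = `|x|); last by rewrite /g trunc_in// /shell/= x1.
by rewrite lerDl; apply: sumr_ge0 => y _; exact: normr_ge0.
Qed.

(** From [|t U| <= 1 + (t U)^(2h)], the mean of [|U|] on a shell is at most [(1 + K) / t], and for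
    the scales of [shell_scale] these bounds telescope. *)
Lemma ae_summable_shells : {ae P, forall w, exists M : R, forall m,
  \sum_(i < m) `|U (i.+2%:R ^- 2) (i.+1%:R ^- 2) w| <= M}.
Proof.
have [K K0 hK] := shell_sum_moment_small s1 hC h0 hs.
pose r (i : nat) : R := (Num.sqrt i.+1%:R)^-1.
have mU i : measurable_fun setT (fun w => `|U (i.+2%:R ^- 2) (i.+1%:R ^- 2) w|).
  by apply: measurableT_comp => //; exact: (measurable_shell_sum hC _ (cutoff_gt0 i.+1)).
have one i : (\int[P]_w `|U (i.+2%:R ^- 2) (i.+1%:R ^- 2) w|%:E <= (12 * (1 + K) * (r i - r i.+1))%:E)%E.
  have [t t0 [ta tb te]] := @shell_scale R i.
  have cle : i.+2%:R ^- 2 <= i.+1%:R ^- 2 :> R by exact: cutoff_le.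
  have b := hK _ _ t (cutoff_gt0 i.+1) cle t0 ta tb.
  have iU := shell_sum_integrable s1 hC h0 hs (i.+1%:R ^- 2) (cutoff_gt0 i.+1).
  have i1 := integrableZ_EFin measurableT (t ^+ n) iU.
  have i2 := integrableD_EFin measurableT integrable_cst1 i1.
  have i3 := integrableZ_EFin measurableT t^-1 i2.
  apply: (@le_trans _ _ (\int[P]_w (t^-1 * (cst 1 w + t ^+ n * U (i.+2%:R ^- 2) (i.+1%:R ^- 2) w ^+ n))%:E)%E).
    apply: ge0_le_integral => //.
    + by apply/measurable_EFinP.
    + by apply/measurable_EFinP; exact: integrable_EFin_measurable i3.
    + move=> w _; rewrite lee_fin ler_pdivlMl// -{1}(gtr0_norm t0) -normrM -exprMn.
      exact: norm_le_even_power.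
  rewrite -EFin_Rintegral// lee_fin RintegralZl// RintegralD//; last exact: integrable_cst1.
  rewrite Rintegral_cst1 RintegralZl// te -/(r i) -/(r i.+1) -mulrA [(1 + K) * _]mulrC mulrA.
  by rewrite ler_wpM2l ?lerD2l// -te invr_ge0 ltW.
apply: (@ae_bounded _ _ _ _ (fun m w => \sum_(i < m) `|U (i.+2%:R ^- 2) (i.+1%:R ^- 2) w|) (12 * (1 + K))).
- by move=> m; apply: measurable_sum => i; exact: mU.
- by move=> m w; exact: sumr_ge0.
- move=> w m k mk; rewrite -(subnKC mk) big_split_ord/= lerDl; exact: sumr_ge0.
- move=> m; under eq_integral do rewrite -sumEFin.
  rewrite ge0_integral_sum//; last by move=> i; apply/measurable_EFinP; exact: mU.
  apply: (@le_trans _ _ (\sum_(i < m) (12 * (1 + K) * (r i - r i.+1))%:E)%E).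
    by apply: lee_sum => i _; exact: one.
  rewrite sumEFin lee_fin -mulr_sumr ler_piMr ?mulr_ge0 ?addr_ge0//.
  have -> : \sum_(i < m) (r i - r i.+1) = r 0%N - r m.
    rewrite -opprB -(telescope_sumr r (leq0n m)) big_mkord -sumrN.
    by apply: eq_bigr => i _; rewrite opprB.
  by rewrite /r sqrtr1 invr1 lerBlDr lerDl invr_ge0 sqrtr_ge0.
Qed.

(** On a bounded configuration the upper cutoff is inactive once [M <= m + 1], and the two one-sided
    sums merge into the sum over the shell. *)
Lemma truncated_sumE w M m : (forall x, C w x -> `|x| <= M) -> M <= m.+1%:R ->
  truncated_sum (C w) m.+1 = V m w.
Proof.
move=> CM Mm; pose r := points C (m.+1%:R ^- 2) m.+1%:R w.
have E (p : pred R) (F : R -> R) (S : set R) : (forall x, S x <-> p x) -> (forall x, p x -> m.+1%:R ^- 2 < `|x|) ->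
    \sum_(x \in C w `&` S) F x = \sum_(x <- r | p x) F x.
  move=> Sp pm; rewrite (fsbigE [seq x <- r | p x]); first last.
  - move=> x [Cx /Sp px]; rewrite mem_filter px/= => /negP[]; apply/(mem_points C_process) => //.
    by split => //; rewrite /annulus/= (ltW (pm _ px)) (le_trans (CM _ Cx)).
  - by move=> x /=; rewrite mem_filter => /andP[px /(mem_points C_process _ _ _ (cutoff_gt0 m))[Cx _]]; split => //; exact/Sp.
  - by rewrite filter_uniq// uniq_points.
  rewrite big_filter_cond [LHS]big_seq_cond [RHS]big_seq_cond; apply: eq_bigl => x.
  have [/(mem_points C_process _ _ _ (cutoff_gt0 m))[Cx _]|//] := boolP (x \in r).
  by have [px|] := boolP (p x) => //=; rewrite mem_set//; split => //; exact/Sp.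
rewrite /truncated_sum (E (fun x => m.+1%:R ^- 2 < x)) ?(E (fun x => m.+1%:R ^- 2 < - x))//; last 2 first.
- by move=> x /lt_le_trans; apply; rewrite -normrN ler_norm.
- by move=> x /lt_le_trans; apply; rewrite ler_norm.
rewrite /pv_approx /shell_sum (psumE C_process w (cutoff_gt0 m) (@trunc_shell_supp R _ m.+1%:R)) -/r.
rewrite [X in X - _]big_mkcond [X in _ - X]big_mkcond -sumrB; apply: eq_big_seq => x.
move=> /(mem_points C_process _ _ _ (cutoff_gt0 m))[Cx _].
have xm : `|x| <= m.+1%:R by rewrite (le_trans (CM _ Cx)).
have c0 := cutoff_gt0 m.
have [h1|h1] := ltP (m.+1%:R ^- 2) x.
  have -> : (m.+1%:R ^- 2 < - x) = false.
    by apply/negbTE; rewrite -leNgt; move: c0 h1; move: (m.+1%:R ^- 2) => u; lra.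
  by rewrite subr0 trunc_in// /shell/= xm andbT (lt_le_trans h1)// ler_norm.
have [h2|h2] := ltP (m.+1%:R ^- 2) (- x).
  by rewrite trunc_in ?sub0r ?opprK// /shell/= xm andbT (lt_le_trans h2)// -normrN ler_norm.
rewrite subrr trunc_out// => /andP[+ _]; rewrite ltNge => /negP[].
by rewrite ler_norml h1 andbT lerNl.
Qed.

(** The contribution of [|x| > 1] is eventually constant, and that of [|x| <= 1] is a partial sum of
    an absolutely convergent series. *)
Lemma ae_pv_approx_cvg : {ae P, forall w, cvgn (V ^~ w) /\ pv_sum (C w) = limn (V ^~ w)}.
Proof.
move: ae_bounded_points ae_summable_shells; apply: filterS2 => w [M CM] [S hS].
have [m0 Mm0] : exists m : nat, M <= m.+1%:R.
  have /archi_boundP := normr_ge0 M; set m := Num.bound _ => xm.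
  by exists m; rewrite (le_trans (ler_norm _))// (le_trans (ltW xm))// ler_nat.
have far m : (m0 <= m)%N -> U 1 m.+1%:R w = U 1 m0.+1%:R w.
  move=> mm; rewrite (shell_sum_split hC w ltr01 (b := m0.+1%:R)) ?ler1n ?ler_nat//.
  rewrite [X in _ + X](_ : _ = 0) ?addr0// /shell_sum /psum fsbig1// => x Cx.
  by rewrite trunc_out// => /andP[+ _]; rewrite ltNge (le_trans (CM _ Cx)).
pose y i := U (i.+2%:R ^- 2) (i.+1%:R ^- 2) w.
have near m : U (m.+1%:R ^- 2) 1 w = series y m.
  elim: m => [|m IH].
    rewrite /series/= big_geq// /shell_sum /psum fsbig1// => x _.
    by rewrite trunc_out// expr1n invr1 => /andP[+ x1]; rewrite ltNge x1.
  rewrite (shell_sum_split hC w (cutoff_gt0 m.+1) (cutoff_le (leqnSn m)) (cutoff_le1 m)) IH.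
  by rewrite [RHS]/series/= big_nat_recr//= addrC.
have cy : cvgn (series y).
  apply: normed_cvg; apply: nondecreasing_is_cvgn.
    by apply: nondecreasing_series => i _ _; exact: normr_ge0.
  exists S => _ [m _ <-]; have := hS m.
  by rewrite -(big_mkord xpredT (fun i => `|U (i.+2%:R ^- 2) (i.+1%:R ^- 2) w|)).
have cV : V m w @[m --> \oo] --> limn (series y) + U 1 m0.+1%:R w.
  apply: cvg_trans (cvgD cy (cvg_cst (U 1 m0.+1%:R w))).
  apply: near_eq_cvg; near=> m.
  rewrite /pv_approx (shell_sum_split hC w (cutoff_gt0 m) (cutoff_le1 m)) ?ler1n//.
  by rewrite near far//; near: m; exact: nbhs_infty_ge.
split; first exact: cvgP cV.
rewrite (cvg_lim (@Rhausdorff R) cV); apply: (cvg_lim (@Rhausdorff R)).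
rewrite -cvg_shiftS; apply: cvg_trans cV; apply: near_eq_cvg; near=> m.
rewrite /= (truncated_sumE CM)// (le_trans Mm0)// ler_nat ltnS; near: m; exact: nbhs_infty_ge.
Unshelve. all: by end_near. Qed.

End PrincipalValueLimit.

Section PrincipalValueExpectation.
Context {R : realType}.
Context {d : measure_display} {T : measurableType d} (P : probability T R) (C : T -> set R).
Variables (s : R).
Hypothesis s1 : 1 < 2 * s.
Hypothesis hC : hp_process P s C.
Variables (h : nat).
Hypothesis (h0 : (0 < h)%N) (hs : (2 * h)%:R < 2 * s + 1).
Local Notation intg f := (P.-integrable setT (EFin \o f)).
Local Notation n := (2 * h)%N.
Local Notation V := (pv_approx C).

Let even_ge0 (x : R) : 0 <= x ^+ n.
Proof. by rewrite exprn_even_ge0// oddM. Qed.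

Lemma fatou_even_power (f : nat -> T -> R) (X : T -> R) (K : R) :
  (forall m, measurable_fun setT (f m)) -> (forall w, f m w @[m --> \oo] --> X w) ->
  (forall m, intg (fun w => f m w ^+ n) /\ \int[P]_w (f m w ^+ n) <= K) ->
  intg (fun w => X w ^+ n) /\ \int[P]_w (X w ^+ n) <= K.
Proof.
move=> mf fX fK; have mX : measurable_fun setT X by apply: measurable_fun_cvg (fun w _ => fX w).
have le : (\int[P]_w (X w ^+ n)%:E <= K%:E)%E.
  have H1 m : measurable_fun setT (fun w => (f m w ^+ n)%:E).
    by apply/measurable_EFinP; exact: measurable_funX.
  have H2 m w : setT w -> (0 <= (f m w ^+ n)%:E)%E by rewrite lee_fin.
  have := fatou P measurableT H1 H2.
  rewrite (_ : (fun w => limn_einf _) = (fun w => (X w ^+ n)%:E)); last first.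
    apply/funext => w.
    have c : (f m w ^+ n)%:E @[m --> \oo] --> (X w ^+ n)%:E.
      apply: cvg_EFin; first by near=> m.
      apply: (cvg_comp (f ^~ w) (fun x : R => x ^+ n)); [exact: fX|exact: exprn_continuous].
    by rewrite (is_cvg_limn_einfE (cvgP _ c)); apply/cvg_lim.
  move/le_trans; apply.
  rewrite limn_einf_lim; apply: lime_le; first exact: is_cvg_einfs.
  apply: nearW => m; apply: (@le_trans _ _ (\int[P]_w (f m w ^+ n)%:E)%E).
    by apply: ereal_inf_lbound; exists m => /=.
  by have [i b] := fK m; rewrite -EFin_Rintegral.
have i : intg (fun w => X w ^+ n).
  apply/integrableP; split; first by apply/measurable_EFinP; exact: measurable_funX.
  under eq_integral do rewrite /= ger0_norm//.
  exact: le_lt_trans le (ltry _).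
by split => //; rewrite -lee_fin EFin_Rintegral.
Unshelve. all: by end_near. Qed.

Lemma expectation_pv_sum (L : R) :
  power_moment s n N.+1 / N.+1%:R ^+ n @[N --> \oo] --> L ->
  (\int[P]_w (pv_sum (C w) ^+ n)%:E = L%:E)%E.
Proof.
move=> cL; have [N0 [mN0 N00 sub]] := ae_pv_approx_cvg s1 hC h0 hs.
have good w : ~ N0 w -> cvgn (V ^~ w) /\ pv_sum (C w) = limn (V ^~ w).
  by move=> nw; apply: contrapT => bad; apply: nw; exact: sub.
pose D : set T := ~` N0; have mD : measurable D by exact: measurableC.
(* Replacing [V m] by [0] on the null set gives a sequence converging everywhere, hence a measurable
   limit [X]; [pv_sum (C w)] equals [X w] off that set. *)
pose W m w : R := V m w * \1_D w; pose X w : R := limn (W ^~ w).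
have cX w : W m w @[m --> \oo] --> X w.
  suff : cvgn (W ^~ w) by [].
  rewrite /W indicE; have [Nw|Nw] := pselect (N0 w).
    by rewrite memNset ?mulr0; [under eq_fun do rewrite mulr0; exact: is_cvg_cst|exact].
  by rewrite mem_set//; under eq_fun do rewrite mulr1; have [] := good w Nw.
have c0 (m : nat) : 0 < m.+1%:R ^- 2 :> R by rewrite invr_gt0 exprn_gt0.
have mV m : measurable_fun setT (V m) by exact: (measurable_shell_sum hC _ (c0 m)).
have mW m : measurable_fun setT (W m) by apply: measurable_funM => //; exact: measurable_indic.
have mX : measurable_fun setT X by apply: measurable_fun_cvg (fun w _ => cX w).
have WE m w : ~ N0 w -> W m w = V m w by move=> nw; rewrite /W indicE mem_set// mulr1.
have WN m w : N0 w -> W m w = 0 by move=> nw; rewrite /W indicE memNset ?mulr0//; exact.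
have iV m : intg (fun w => V m w ^+ n) by exact: (shell_sum_integrable s1 hC h0 hs _ (c0 m)).
have [e [e0 ec eP _]] := pv_approx_moments s1 hC h0 hs.
have [L0 qL] := pv_approx_moment_cvg s1 hC h0 hs cL.
(* Fatou in [k] turns the bound on the increments from [m] to [k + m] into a bound on the distance
   to the limit. *)
have bW m : intg (fun w => (X w - W m w) ^+ n) /\ \int[P]_w ((X w - W m w) ^+ n) <= e m.
  apply: (@fatou_even_power (fun k w => W (k + m)%N w - W m w)).
  - by move=> k; exact: measurable_funB.
  - by move=> w; apply: cvgB; [by rewrite (cvg_shiftn m (W ^~ w)); exact: cX|exact: cvg_cst].
  - move=> k; have [i b] := eP m (k + m)%N (leq_addl _ _).
    have le w : (W (k + m)%N w - W m w) ^+ n <= (V (k + m)%N w - V m w) ^+ n.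
      have [Nw|Nw] := pselect (N0 w); last by rewrite !WE.
      by rewrite !WN// subrr expr0n muln_eq0 (gtn_eqF h0)/=.
    have i' : intg (fun w => (W (k + m)%N w - W m w) ^+ n).
      apply: le_integrable_EFin i => //; first by apply: measurable_funX; exact: measurable_funB.
      by move=> w _; rewrite ger0_norm.
    by split => //; apply: le_trans b; apply: Rintegral_ler.
have iW m : intg (fun w => W m w ^+ n).
  apply: le_integrable_EFin (iV m) => //; first exact: measurable_funX.
  move=> w _; rewrite ger0_norm//; have [Nw|Nw] := pselect (N0 w); last by rewrite !WE.
  by rewrite !WN// expr0n muln_eq0 (gtn_eqF h0)/=.
have WV m : \int[P]_w (W m w ^+ n) = \int[P]_w (V m w ^+ n).
  congr fine; apply: (ge0_integral_eq_off_null mN0 N00) => w; rewrite ?lee_fin//.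
  by move=> Nw; rewrite WE.
have iX : intg (fun w => X w ^+ n).
  have [i _] := bW 0%N.
  have := integrableZ_EFin measurableT (2 ^+ n) (integrableD_EFin measurableT i (iW 0%N)).
  apply: le_integrable_EFin => //; first exact: measurable_funX.
  by move=> w _; rewrite ger0_norm// -[X w in leLHS](subrK (W 0%N w)); exact: even_power_add.
(* The moments of [V m] tend to that of [X] as well as to [L], so uniqueness of limits identifies
   the two. *)
have qX : \int[P]_w (V m w ^+ n) @[m --> \oo] --> \int[P]_w (X w ^+ n).
  apply: (@cvg_of_power_bound R _ n%:R _ e n.-1) => //.
    by apply: Rintegral_ge0 => w _.
  move=> eta eta01 m; have /andP[eta0 _] := eta01; rewrite -WV.
  have [i b] := bW m.
  have i1 := integrableZ_EFin measurableT eta (integrableD_EFin measurableT iX (iW m)).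
  have i2 := integrableZ_EFin measurableT (eta ^- n.-1) i.
  have i3 := integrableD_EFin measurableT i1 i2.
  have i4 := integrableZ_EFin measurableT n%:R i3.
  rewrite -RintegralB//; apply: le_trans (le_normr_Rintegral _ _) _ => //.
    exact: integrableB_EFin.
  apply: (@le_trans _ _ (\int[P]_w (n%:R * (eta * (X w ^+ n + W m w ^+ n) + eta ^- n.-1 * (X w - W m w) ^+ n)))).
    apply: Rintegral_ler => //; last by move=> w _; exact: even_power_sub.
    by have := integrable_abse (integrableB_EFin measurableT iX (iW m)); apply: eq_integrable.
  rewrite RintegralZl// RintegralD// RintegralZl//; last exact: integrableD_EFin.
  rewrite RintegralD// RintegralZl// ler_wpM2l// lerD2l ler_wpM2l//.
  by rewrite invr_ge0 exprn_ge0// ltW.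
rewrite (cvg_unique (@Rhausdorff R) qL qX) EFin_Rintegral//.
apply: (ge0_integral_eq_off_null mN0 N00) => w; rewrite ?lee_fin//.
move=> Nw; have [_ ->] := good w Nw; congr ((_ ^+ _)%:E); rewrite /X; congr (limn _).
by apply/funext => m; rewrite WE.
Qed.

End PrincipalValueExpectation.

Theorem proposition1p4 (R : realType) (h : nat) (h_ge1 : (1 <= h)%N) :
  (forall s : R, h%:R - 1 / 2 < s ->
    forall (d : measure_display) (T : measurableType d) (P : probability T R)
      (C : T -> set R), hp_process P s C ->
    ('E_P[fun w => (pv_sum (C w) ^+ (2 * h))%R] =
      ((2 * h)`!%:R^-1)%:E *
      \sum_(1 <= k < (2 * h).+1)
        ((-1) ^+ (2 * h - k) * 'C(2 * h, k)%:R)%:E *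
        hua_pickrell_expectation s
          (fun x : k.-tuple R => ((\sum_(i < k) tnth x i) ^+ (2 * h))%R))%E) /\
  (forall N : nat, (1 <= N)%N ->
    exists p q : {poly R}, forall s : R, h%:R - 1 / 2 < s ->
      q.[s] != 0 /\
      hua_pickrell_expectation s
        (fun x : N.-tuple R => (\sum_(i < N) tnth x i) ^+ (2 * h)) =
      (p.[s] / q.[s])%:E).
Proof.
(* With [h >= 1], the assumption on [s] yields both standing hypotheses: [2h < 2s + 1] for the
   moments and [1 < 2s] for the kernel. *)
have hn (s : R) : h%:R - 1 / 2 < s -> (2 * h)%:R < 2 * s + 1 by rewrite natrM; lra.
have h1 : 1 <= h%:R :> R by rewrite ler1n.
have hs1 (s : R) : h%:R - 1 / 2 < s -> 1 < 2 * s by lra.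
have oh : ~~ odd (2 * h) by rewrite oddM.
split.
  move=> s hs d T P C hC; rewrite unlock.
  have s1 := hs1 s hs; have ns := hn s hs.
  have n0 : (0 < 2 * h)%N by rewrite muln_gt0.
  have c := power_moment_cvg s1 ns n0.
  (* The rescaled ensembles are indexed by [N + 1] points, so the limit is shifted accordingly. *)
  have cS : power_moment s (2 * h) N.+1 / N.+1%:R ^+ (2 * h) @[N --> \oo] --> (2 * h)`!%:R^-1 *
    \sum_(1 <= k < (2 * h).+1) (-1) ^+ (2 * h - k) * 'C(2 * h, k)%:R * power_moment s (2 * h) k.
    by move: c; rewrite -cvg_shiftS.
  rewrite (expectation_pv_sum s1 hC h_ge1 ns cS) EFinM; congr (_ * _)%E.
  rewrite -sumEFin; apply: eq_bigr => k _.
  by rewrite hua_pickrell_power_moment// EFinM.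
case=> // N _; have [p [q hpq]] := @power_moment_rational R N h h_ge1.
exists p, q => s hs; have [q0 e] := hpq s hs; split=> //.
by rewrite (hua_pickrell_power_moment _ (hs1 s hs) (hn s hs) oh) e.
Qed.
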